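(* Let $d_1,d_2$ be positive integers, let $F=(f,g)\in\Omega_2(d_1,d_2)$ be proper, and assume that $\{a,b\}$ is a generalized node of $F$. Then there is a Zariski open dense subset $W\subset\Omega_2(d_1,d_2)$ (of generic mappings) such that, if $U_a,U_b\subset\mathbb{C}^2$ are sufficiently small balls around $a$ and $b$ respectively, then for every $F'\in W$ sufficiently close to $F$ (in the natural topology of $\Omega_2(d_1,d_2)$) the number of pairs $(x,y)\in U_a\times U_b$ such that $\{x,y\}$ is a node of $F'$ equals $\nu(a,b)$.
   Context: $\Omega_2(d_1,d_2)$ is the set of polynomial mappings $(f,g):\mathbb{C}^2\to\mathbb{C}^2$ with $\deg f\le d_1$, $\deg g\le d_2$, identified with $\mathbb{C}^N$ via coefficients. $J(F)=f_xg_y-f_yg_x$ and $C(F)=\{J(F)=0\}$. For proper $F$, a generalized node of $F$ is an unordered pair $a,b\in C(F)$ with $F(a)=F(b)$ such that $(a,b)$ is an isolated zero of the map $C(F)\times C(F)\ni(x,y)\mapsto F(x)-F(y)\in\mathbb{C}^2$; its multiplicity is $\nu(a,b)=\dim_{\mathbb{C}}\mathcal{O}_{(a,b)}/(J(F)(x),J(F)(y),f(x)-f(y),g(x)-g(y))$, where $\mathcal{O}_{(a,b)}$ is the ring of holomorphic germs at $(a,b)\in\mathbb{C}^2\times\mathbb{C}^2$. A node of $F'$ is an unordered pair $\{x,y\}$ of distinct points with $F'(x)=F'(y)$ such that the bi-germ of $F'$ at $\{x,y\}$ is biholomorphically equivalent to the bi-germ of two transversal folds $(x_1,y_1)\mapsto(x_1^2,y_1)$,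 $(x_2,y_2)\mapsto(x_2,y_2^2)$. *)

(* Defs.v *)
From HB Require Import structures.
From mathcomp Require Import all_boot all_order all_algebra.
From mathcomp Require Import complex.
From mathcomp Require Import reals.

Set Implicit Arguments.
Unset Strict Implicit.
Unset Printing Implicit Defensive.

Import Order.TTheory GRing.Theory Num.Theory.
Local Open Scope ring_scope.

Section Defs.
Variable R : realType.
Local Notation C := (R[i]).

Definition cnorm (I : finType) (x : I -> C) : R :=
  Num.sqrt (\sum_(i : I) (Normc.normc (x i)) ^+ 2).

Definition vsub (I : finType) (x y : I -> C) : I -> C := fun i => x i - y i.
Definition vadd (I : finType) (x y : I -> C) : I -> C := fun i => x i + y i.

Definition peq (I : finType) (x y : I -> C) : Prop := forall i, x i = y i.

Definition copen (I : finType) (O : (I -> C) -> Prop) : Prop :=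
  forall x, O x -> exists2 r : R, 0 < r &
    forall y, cnorm (vsub y x) < r -> O y.

Definition ccompact (I : finType) (K : (I -> C) -> Prop) : Prop :=
  forall (J : Type) (O : J -> (I -> C) -> Prop),
    (forall j, copen (O j)) ->
    (forall x, K x -> exists j, O j x) ->
    exists (n : nat) (f : 'I_n -> J), forall x, K x -> exists i, O (f i) x.

Definition proper_map (I I' : finType) (G : (I -> C) -> (I' -> C)) : Prop :=
  forall K, ccompact K -> ccompact (fun x => K (G x)).

Definition holo_at (I : finType) (h : (I -> C) -> C) (z : I -> C) : Prop :=
  exists L : I -> C, forall eps : R, 0 < eps -> exists2 delta : R, 0 < delta &
    forall v : I -> C, cnorm v < delta ->
      Normc.normc (h (vadd z v) - h z - \sum_(i : I) L i * v i) <= eps * cnorm v.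

Definition holo_near (I : finType) (h : (I -> C) -> C) (p : I -> C) : Prop :=
  exists2 r : R, 0 < r & forall z, cnorm (vsub z p) < r -> holo_at h z.

Definition eq_near (I : finType) (T : Type) (h1 h2 : (I -> C) -> T) (p : I -> C) : Prop :=
  exists2 r : R, 0 < r & forall z, cnorm (vsub z p) < r -> h1 z = h2 z.

Definition in_germ_ideal (I : finType) (k : nat) (q : 'I_k -> (I -> C) -> C)
    (p : I -> C) (h : (I -> C) -> C) : Prop :=
  exists u : 'I_k -> (I -> C) -> C,
    (forall j, holo_near (u j) p) /\
    eq_near h (fun z => \sum_(j < k) u j z * q j z) p.

(* dim_C O_p / (q_0, ..., q_{k-1}) = n, where O_p is the ring of holomorphic germs at p:
   there are n holomorphic germs whose classes form a C-basis of the quotient. *)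
Definition local_dim (I : finType) (k : nat) (q : 'I_k -> (I -> C) -> C)
    (p : I -> C) (n : nat) : Prop :=
  exists e : 'I_n -> (I -> C) -> C,
    (forall i, holo_near (e i) p) /\
    (forall phi, holo_near phi p ->
       exists c : 'I_n -> C,
         in_germ_ideal q p (fun z => phi z - \sum_(i < n) c i * e i z)) /\
    (forall c : 'I_n -> C,
       in_germ_ideal q p (fun z => \sum_(i < n) c i * e i z) -> forall i, c i = 0).

(* exponents (i,j) of monomials x^i y^j of degree <= d *)
Definition mon (d : nat) := {m : 'I_d.+1 * 'I_d.+1 | (m.1 + m.2 <= d)%N}.

(* coordinates of Omega_2(d1,d2) = C^N : coefficients of f (inl) and of g (inr) *)
Definition Omega (d1 d2 : nat) := (mon d1 + mon d2)%type.

Definition xc (x : 'I_2 -> C) : C := x ord0.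
Definition yc (x : 'I_2 -> C) : C := x ord_max.

Definition peval (d : nat) (c : mon d -> C) (x : 'I_2 -> C) : C :=
  \sum_(m : mon d) c m * xc x ^+ (val m).1 * yc x ^+ (val m).2.

Definition pdx (d : nat) (c : mon d -> C) (x : 'I_2 -> C) : C :=
  \sum_(m : mon d) c m * ((val m).1 : nat)%:R * xc x ^+ (val m).1.-1 * yc x ^+ (val m).2.
Definition pdy (d : nat) (c : mon d -> C) (x : 'I_2 -> C) : C :=
  \sum_(m : mon d) c m * ((val m).2 : nat)%:R * xc x ^+ (val m).1 * yc x ^+ (val m).2.-1.

Definition fco (d1 d2 : nat) (c : Omega d1 d2 -> C) : mon d1 -> C := fun m => c (inl m).
Definition gco (d1 d2 : nat) (c : Omega d1 d2 -> C) : mon d2 -> C := fun m => c (inr m).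

Definition Fmap (d1 d2 : nat) (c : Omega d1 d2 -> C) (x : 'I_2 -> C) : 'I_2 -> C :=
  fun i => if i == ord0 then peval (fco c) x else peval (gco c) x.

Definition Jac (d1 d2 : nat) (c : Omega d1 d2 -> C) (x : 'I_2 -> C) : C :=
  pdx (fco c) x * pdy (gco c) x - pdy (fco c) x * pdx (gco c) x.

Definition crit (d1 d2 : nat) (c : Omega d1 d2 -> C) (x : 'I_2 -> C) : Prop :=
  Jac c x = 0.

Definition gen_node (d1 d2 : nat) (c : Omega d1 d2 -> C) (a b : 'I_2 -> C) : Prop :=
  crit c a /\ crit c b /\ peq (Fmap c a) (Fmap c b) /\
  (* (a,b) is an isolated zero of C(F) x C(F) -> C^2, (x,y) |-> F(x) - F(y) *)
  exists2 r : R, 0 < r & forall x y : 'I_2 -> C,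
    cnorm (vsub x a) < r -> cnorm (vsub y b) < r ->
    crit c x -> crit c y -> peq (Fmap c x) (Fmap c y) -> peq x a /\ peq y b.

Definition pt1 (z : ('I_2 + 'I_2)%type -> C) : 'I_2 -> C := fun i => z (inl i).
Definition pt2 (z : ('I_2 + 'I_2)%type -> C) : 'I_2 -> C := fun i => z (inr i).
Definition join2 (x y : 'I_2 -> C) : ('I_2 + 'I_2)%type -> C :=
  fun k => match k with inl i => x i | inr i => y i end.

Definition node_gens (d1 d2 : nat) (c : Omega d1 d2 -> C) :
    'I_4 -> (('I_2 + 'I_2)%type -> C) -> C :=
  fun j z => nth 0
    [:: Jac c (pt1 z); Jac c (pt2 z);
        peval (fco c) (pt1 z) - peval (fco c) (pt2 z);
        peval (gco c) (pt1 z) - peval (gco c) (pt2 z)] j.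

Definition node_mult (d1 d2 : nat) (c : Omega d1 d2 -> C) (a b : 'I_2 -> C) (n : nat) : Prop :=
  local_dim (node_gens c) (join2 a b) n.

Definition biholo_germ (phi : ('I_2 -> C) -> 'I_2 -> C) (s t : 'I_2 -> C) : Prop :=
  peq (phi s) t /\ (forall i, holo_near (fun z => phi z i) s) /\
  exists psi : ('I_2 -> C) -> 'I_2 -> C,
    peq (psi t) s /\ (forall i, holo_near (fun z => psi z i) t) /\
    (forall i, eq_near (fun z => psi (phi z) i) (fun z => z i) s) /\
    (forall i, eq_near (fun z => phi (psi z) i) (fun z => z i) t).

Definition zero2 : 'I_2 -> C := fun _ => 0.

Definition fold1 (u : 'I_2 -> C) : 'I_2 -> C :=
  fun i => if i == ord0 then xc u ^+ 2 else u i.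
Definition fold2 (u : 'I_2 -> C) : 'I_2 -> C :=
  fun i => if i == ord0 then u i else yc u ^+ 2.

(* the bi-germ of G at (x,y) is biholomorphically (A-)equivalent to the bi-germ of
   two transversal folds, fold1 at x and fold2 at y *)
Definition bigerm_folds (G : ('I_2 -> C) -> 'I_2 -> C) (x y : 'I_2 -> C) : Prop :=
  exists phi1 phi2 psi : ('I_2 -> C) -> 'I_2 -> C,
    biholo_germ phi1 zero2 x /\ biholo_germ phi2 zero2 y /\
    biholo_germ psi zero2 (G x) /\
    (forall i, eq_near (fun u => G (phi1 u) i) (fun u => psi (fold1 u) i) zero2) /\
    (forall i, eq_near (fun u => G (phi2 u) i) (fun u => psi (fold2 u) i) zero2).

(* {x,y} is a node of G (unordered pair: either assignment of the folds) *)
Definition is_node (G : ('I_2 -> C) -> 'I_2 -> C) (x y : 'I_2 -> C) : Prop :=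
  ~ peq x y /\ peq (G x) (G y) /\ (bigerm_folds G x y \/ bigerm_folds G y x).

Definition card_pairs (P : ('I_2 -> C) * ('I_2 -> C) -> Prop) (n : nat) : Prop :=
  exists e : 'I_n -> ('I_2 -> C) * ('I_2 -> C),
    (forall i j, peq (e i).1 (e j).1 -> peq (e i).2 (e j).2 -> i = j) /\
    (forall p, P p <-> exists i, peq (e i).1 p.1 /\ peq (e i).2 p.2).

Inductive polyfun (I : finType) : ((I -> C) -> C) -> Prop :=
  | polyfun_const (a : C) : polyfun (fun _ => a)
  | polyfun_coord (i : I) : polyfun (fun z => z i)
  | polyfun_add p q : polyfun p -> polyfun q -> polyfun (fun z => p z + q z)
  | polyfun_mul p q : polyfun p -> polyfun q -> polyfun (fun z => p z * q z).

Definition zariski_open (I : finType) (W : (I -> C) -> Prop) : Prop :=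
  exists S : ((I -> C) -> C) -> Prop,
    (forall p, S p -> polyfun p) /\
    (forall z, W z <-> exists2 p, S p & p z <> 0).

Definition zariski_dense (I : finType) (W : (I -> C) -> Prop) : Prop :=
  forall V, zariski_open V -> (exists z, V z) -> exists z, V z /\ W z.

End Defs.

(* Main.v *)
(** Near (a, b) the nodes are zeros of the square system G_c: J(x) = J(y) = 0, F(x) = F(y) in C^4,
    and a <> b because the zeros of J are not isolated.

    Genericity. If all zeros of G_c' off the diagonal are transversal then its zeros near (a, b) are
    exactly the nodes: the two branches of the critical curve are folds with transversal images.  An
    affine change of variables puts a degenerate pair at (0, 0), (1, 0), and the degenerate maps are
    then parametrised by fewer rational parameters than there are coefficients, so they lie in a
    hypersurface.

    Counting. The Pham system z_i^m + lam G_i has a finite free quotient algebra whose multiplication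
    matrices depend polynomially on the coefficients; their traces count zeros with multiplicity, so
    the number of zeros in a ball is constant along a segment of systems without zeros on the
    boundary.  For large lam this count equals the number of (simple) zeros of G_c', and it equals
    dim C[z]/(G_c + m^k) once these dimensions stabilise.  By Nakayama's lemma and Taylor expansion
    (from the division of a germ by a coordinate, a consequence of Cauchy's formula) this is the
    dimension of the analytic local algebra. *)
Require Import Defs.
From HB Require Import structures.
From mathcomp Require Import all_boot all_order all_algebra.
From mathcomp Require Import complex.
From mathcomp Require Import reals.
From mathcomp Require Import boolp.
From mathcomp Require Import mpoly ssrcomplements bigenough.
From mathcomp Require Import ring lra zify.
From mathcomp Require ftc.
Import Order.TTheory GRing.Theory Num.Theory BigEnough.
Local Open Scope ring_scope.

Set Implicit Arguments.
Unset Strict Implicit.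
Unset Printing Implicit Defensive.

(** * Norms, limits and continuity *)

Section Norms.
Variable R : realType.
Local Notation C := (R[i]).
Implicit Types (x y : C).

(** A germ is only known to be complex differentiable at each point of a ball. Power series are
    therefore replaced throughout by finite Taylor expansions with a remainder of order K. The
    powers [z_i^m], with [m] above all degrees, keep zeros from escaping to infinity: the monomials
    with all exponents below [m] form a basis of the quotient algebra, so its rank is [m^n] for all
    coefficients. The Pham system links the two sides of the equality. Its zeros in the ball deform
    into those of the generic map, and its ideal agrees with that of [G_c] modulo [m^k] for small
    [k]. The number [nu] first appears as the number of zeros of one generic map near [c]; being the
    largest size of a family independent modulo [(G_c) + m^K], it is the same for every other one.
    In the genericity part the four parameters of the affine change have to be paid for: a
    degenerate pair in normal position must determine more coefficients than there are parameters.
    In low degree the coefficients to be solved for are missing, and degenerate pairs are shown to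
    come in larger families, for instance filling a whole line. *)

Definition nc (x : C) : R := Normc.normc x.

Lemma nc_ge0 x : 0 <= nc x.
Proof. by case: x => a b; rewrite /nc /= sqrtr_ge0. Qed.

Lemma nc0 : nc 0 = 0. Proof. exact: Normc.normc0. Qed.
Lemma nc1 : nc 1 = 1. Proof. exact: Normc.normc1. Qed.
Lemma ncD x y : nc (x + y) <= nc x + nc y. Proof. exact: le_normcD. Qed.
Lemma ncM x y : nc (x * y) = nc x * nc y. Proof. exact: Normc.normcM. Qed.
Lemma ncN x : nc (- x) = nc x. Proof. exact: normcN. Qed.
Lemma ncV x : nc x^-1 = (nc x)^-1. Proof. exact: Normc.normcV. Qed.
Lemma ncB x y : nc (x - y) <= nc x + nc y.
Proof. by rewrite -(ncN y) ncD. Qed.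
Lemma nc_distC x y : nc (x - y) = nc (y - x).
Proof. by rewrite -ncN opprB. Qed.
Lemma nc_eq0 x : nc x = 0 -> x = 0. Proof. exact: Normc.eq0_normc. Qed.
Lemma nc_gt0 x : x != 0 -> 0 < nc x.
Proof.
move=> x0; rewrite lt_def nc_ge0 andbT; apply: contra_neq x0; exact: nc_eq0.
Qed.
Lemma nc_tri y x z : nc (x - z) <= nc (x - y) + nc (y - z).
Proof. by apply: le_trans (ncD _ _); rewrite addrA subrK. Qed.
Lemma ncX x n : nc (x ^+ n) = nc x ^+ n.
Proof. by elim: n => [|n IH]; rewrite ?expr0 ?nc1 // !exprS ncM IH. Qed.
Lemma nc_ge_sub x y : nc x - nc y <= nc (x + y).
Proof.
rewrite lerBlDr; have -> : x = (x + y) - y by rewrite addrK.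
by apply: le_trans (ncB _ _) _; rewrite subrK.
Qed.

Lemma nc_real (a : R) : nc (real_complex R a) = `|a|.
Proof. by rewrite /nc /= expr0n /= addr0 sqrtr_sqr. Qed.
Lemma nc_nat n : nc (n%:R : C) = n%:R.
Proof.
have -> : n%:R = real_complex R n%:R :> C by rewrite rmorph_nat.
by rewrite nc_real normr_nat.
Qed.

Lemma nc_sum (I : Type) (r : seq I) (P : pred I) (F : I -> C) :
  nc (\sum_(i <- r | P i) F i) <= \sum_(i <- r | P i) nc (F i).
Proof.
elim/big_ind2: _ => [|a b c d h1 h2|//]; first by rewrite nc0.
by apply: le_trans (ncD _ _) _; rewrite lerD.
Qed.

Lemma nc_Re x : `|complex.Re x| <= nc x.
Proof.
case: x => a b; rewrite /nc /= -sqrtr_sqr ler_wsqrtr // lerDl sqr_ge0 //.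
Qed.
Lemma nc_Im x : `|complex.Im x| <= nc x.
Proof.
case: x => a b; rewrite /nc /= -sqrtr_sqr ler_wsqrtr // lerDr sqr_ge0 //.
Qed.
Lemma nc_ReIm x : nc x <= `|complex.Re x| + `|complex.Im x|.
Proof.
case: x => a b; rewrite [complex.Re _]/= [complex.Im _]/=.
have -> : Complex a b = real_complex R a + Complex 0 1 * real_complex R b.
  by apply/eqP; rewrite eq_complex /= !(mul0r, mul1r, mulr0, subr0, addr0, add0r) !eqxx.
apply: le_trans (ncD _ _) _; rewrite ncM !nc_real.
have -> : nc (Complex 0 1) = 1 by rewrite /nc /= expr0n /= expr1n add0r sqrtr1.
by rewrite mul1r.
Qed.

(* The sum norm; it is equivalent to [cnorm] and its triangle inequality is immediate. *)
Definition n1 (I : finType) (x : I -> C) : R := \sum_i nc (x i).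

Section N1.
Variable I : finType.
Implicit Types (u v w : I -> C).

Lemma n1_ge0 u : 0 <= n1 u.
Proof. by apply: sumr_ge0 => i _; exact: nc_ge0. Qed.

Lemma le_n1 u i : nc (u i) <= n1 u.
Proof. by rewrite /n1 (bigD1 i) //= lerDl sumr_ge0 // => j _; exact: nc_ge0. Qed.

Lemma n1D u v : n1 (vadd u v) <= n1 u + n1 v.
Proof. by rewrite /n1 -big_split /= ler_sum // => i _; exact: ncD. Qed.

Lemma n1_tri v u w : n1 (vsub u w) <= n1 (vsub u v) + n1 (vsub v w).
Proof. by rewrite /n1 -big_split /= ler_sum // => i _; exact: nc_tri. Qed.

Lemma n1_sub_sym u v : n1 (vsub u v) = n1 (vsub v u).
Proof. by apply: eq_bigr => i _; exact: nc_distC. Qed.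

Lemma n1_subxx u : n1 (vsub u u) = 0.
Proof. by rewrite /n1 big1 // => i _; rewrite /vsub subrr nc0. Qed.

Lemma n1_eq0 u v : n1 (vsub u v) = 0 -> u = v.
Proof.
move=> h; apply: funext => i; apply/eqP; rewrite -subr_eq0; apply/eqP/nc_eq0.
by apply/eqP; rewrite eq_le nc_ge0 andbT -h; exact: (le_n1 (vsub u v)).
Qed.

Lemma n1Z (a : C) u : n1 (fun i => a * u i) = nc a * n1 u.
Proof. by rewrite /n1 mulr_sumr; apply: eq_bigr => i _; rewrite ncM. Qed.

Lemma vaddK z v : vsub (vadd z v) z = v.
Proof. by apply: funext => i; rewrite /vsub /vadd addrC addKr. Qed.
Lemma vsubK z w : vadd z (vsub w z) = w.
Proof. by apply: funext => i; rewrite /vsub /vadd addrC subrK. Qed.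

Lemma peqP u v : peq u v <-> u = v.
Proof. by split=> [h|->//]; apply: funext. Qed.

Lemma cnorm_ge0 u : 0 <= cnorm u. Proof. exact: sqrtr_ge0. Qed.

Lemma nc_le_cnorm u i : nc (u i) <= cnorm u.
Proof.
rewrite -(ger0_norm (nc_ge0 _)) -sqrtr_sqr ler_wsqrtr // (bigD1 i) //= lerDl.
by apply: sumr_ge0 => j _; exact: sqr_ge0.
Qed.

Lemma cnorm_le_n1 u : cnorm u <= n1 u.
Proof.
rewrite -(ger0_norm (n1_ge0 _)) -sqrtr_sqr ler_wsqrtr //.
rewrite /n1 expr2 mulr_suml ler_sum // => i _.
by rewrite expr2 ler_wpM2l ?nc_ge0 // le_n1.
Qed.

Lemma n1_le_cnorm u : n1 u <= #|I|%:R * cnorm u.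
Proof.
rewrite mulr_natl -sumr_const ler_sum // => i _; exact: nc_le_cnorm.
Qed.

Definition near (p : I -> C) (P : (I -> C) -> Prop) : Prop :=
  exists2 r : R, 0 < r & forall z, n1 (vsub z p) < r -> P z.

Lemma nearE p P :
  (exists2 r : R, 0 < r & forall z, cnorm (vsub z p) < r -> P z) <-> near p P.
Proof.
split=> [[r r0 h]|[r r0 h]].
  by exists r => // z hz; apply: h; apply: le_lt_trans (cnorm_le_n1 _) hz.
exists (r / (#|I|%:R + 1)); first by rewrite divr_gt0 // ltr_wpDl // ler0n.
move=> z hz; apply: h; apply: le_lt_trans (n1_le_cnorm _) _.
have k0 : 0 < #|I|%:R + 1 :> R by rewrite ltr_wpDl // ler0n.
rewrite ltr_pdivlMr // in hz; apply: le_lt_trans hz.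
by rewrite mulrC ler_wpM2l ?cnorm_ge0 // lerDl ler01.
Qed.

Lemma near_imp p (P Q : (I -> C) -> Prop) :
  near p P -> (forall z, P z -> Q z) -> near p Q.
Proof. by case=> r r0 h hPQ; exists r => // z /h /hPQ. Qed.

Lemma near_and p (P Q : (I -> C) -> Prop) :
  near p P -> near p Q -> near p (fun z => P z /\ Q z).
Proof.
case=> r r0 h [s s0 k]; exists (Num.min r s); first by rewrite lt_min r0.
by move=> z; rewrite lt_min => /andP[/h ? /k].
Qed.

Lemma near_all (J : finType) p (P : J -> (I -> C) -> Prop) :
  (forall j, near p (P j)) -> near p (fun z => forall j, P j z).
Proof.
move=> h.
have H (s : seq J) : near p (fun z => forall j, j \in s -> P j z).
  elim: s => [|j s IH]; first by exists 1.
  apply: near_imp (near_and (h j) IH) _ => z [h1 h2] k.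
  by rewrite inE => /orP[/eqP->//|/h2].
by apply: near_imp (H (enum J)) _ => z hz j; apply: hz; rewrite mem_enum.
Qed.

Lemma near_self p (P : (I -> C) -> Prop) : near p P -> P p.
Proof. by case=> r r0; apply; rewrite n1_subxx. Qed.

Lemma near_near p (P : (I -> C) -> Prop) : near p P -> near p (fun q => near q P).
Proof.
case=> r r0 h; exists (r / 2); first by rewrite divr_gt0.
move=> q hq; exists (r / 2); first by rewrite divr_gt0.
move=> z hz; apply: h; apply: le_lt_trans (n1_tri q _ _) _; lra.
Qed.

Lemma near_ball p r : 0 < r -> near p (fun z => n1 (vsub z p) < r).
Proof. by move=> r0; exists r. Qed.

Lemma near_true p (P : (I -> C) -> Prop) : (forall z, P z) -> near p P.
Proof. by move=> h; exists 1. Qed.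

Definition ctsat (h : (I -> C) -> C) p :=
  forall e : R, 0 < e -> near p (fun z => nc (h z - h p) < e).

Lemma ctsat_const a p : ctsat (fun _ => a) p.
Proof. by move=> e e0; apply: near_true => z; rewrite subrr nc0. Qed.

Lemma ctsat_coord i p : ctsat (fun z => z i) p.
Proof.
move=> e e0; exists e => // z hz; apply: le_lt_trans hz; exact: (le_n1 (vsub z p)).
Qed.

Lemma ctsat_add f g p : ctsat f p -> ctsat g p -> ctsat (fun z => f z + g z) p.
Proof.
move=> hf hg e e0; have e2 : 0 < e / 2 by rewrite divr_gt0.
apply: near_imp (near_and (hf _ e2) (hg _ e2)) _ => z [h1 h2].
rewrite opprD addrACA; apply: le_lt_trans (ncD _ _) _; lra.
Qed.

Lemma ctsat_bnd f p : ctsat f p -> near p (fun z => nc (f z) < nc (f p) + 1).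
Proof.
move/(_ 1 ltr01) => h; apply: near_imp h _ => z hz.
have := ncD (f z - f p) (f p); rewrite subrK; lra.
Qed.

Lemma ctsat_mul f g p : ctsat f p -> ctsat g p -> ctsat (fun z => f z * g z) p.
Proof.
move=> hf hg e e0.
set B := nc (f p) + nc (g p) + 2.
have B0 : 0 < B by rewrite /B; have := nc_ge0 (f p); have := nc_ge0 (g p); lra.
have e2 : 0 < e / B by rewrite divr_gt0.
have e3 : 0 < e / B / 2 by rewrite divr_gt0.
apply: near_imp (near_and (near_and (hf _ e3) (hg _ e3)) (ctsat_bnd hf)) _ => z [[h1 h2] h3].
have -> : f z * g z - f p * g p = f z * (g z - g p) + (f z - f p) * g p by ring.
apply: le_lt_trans (ncD _ _) _; rewrite !ncM.
have h4 : nc (f z) * nc (g z - g p) <= B * (e / B / 2).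
  apply: ler_pM; rewrite ?nc_ge0 //; last exact: ltW.
  rewrite /B; have := nc_ge0 (g p); lra.
have h5 : nc (f z - f p) * nc (g p) <= (e / B / 2) * (B - 1).
  apply: ler_pM; rewrite ?nc_ge0 //; first exact: ltW.
  rewrite /B; have := nc_ge0 (f p); lra.
apply: le_lt_trans (lerD h4 h5) _.
have -> : B * (e / B / 2) + e / B / 2 * (B - 1) = e - e / B / 2.
  by field; rewrite gt_eqF.
by rewrite ltrBlDr ltrDl.
Qed.

Lemma ctsat_sum (J : Type) (s : seq J) (F : J -> (I -> C) -> C) p :
  (forall j, ctsat (F j) p) -> ctsat (fun z => \sum_(j <- s) F j z) p.
Proof.
move=> h; elim: s => [|j s IH].
  have -> : (fun z => \sum_(j <- [::]) F j z) = (fun _ => 0).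
    by apply: funext => z; rewrite big_nil.
  exact: ctsat_const.
have -> : (fun z => \sum_(k <- j :: s) F k z) = (fun z => F j z + \sum_(k <- s) F k z).
  by apply: funext => z; rewrite big_cons.
exact: ctsat_add.
Qed.

Lemma ctsat_neq0 h p : ctsat h p -> h p != 0 ->
  near p (fun z => nc (h p) / 2 < nc (h z)).
Proof.
move=> hc h0; have e0 : 0 < nc (h p) / 2 by rewrite divr_gt0 // nc_gt0.
apply: near_imp (hc _ e0) _ => z hz.
have := ncB (h z) (h z - h p); rewrite opprB addrC subrK; lra.
Qed.

Lemma polyfun_cts h p : polyfun h -> ctsat h p.
Proof.
elim=> [a|i|f g _ hf _ hg|f g _ hf _ hg].
- exact: ctsat_const.
- exact: ctsat_coord.
- exact: ctsat_add.
- exact: ctsat_mul.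
Qed.
End N1.
End Norms.

(** * Cauchy's formula on squares *)

Section Cube.
Variable R : realType.

Lemma archi_pow2 (a e : R) : 0 < e -> exists n : nat, a / 2 ^+ n < e.
Proof.
move=> e0; have [n hn] : exists n : nat, a / e < n%:R.
  by exists (Num.bound `|a / e|); apply: le_lt_trans (ler_norm _) (archi_boundP (normr_ge0 _)).
exists n; have p2 : n%:R < 2 ^+ n :> R by rewrite -natrX ltr_nat ltn_expl.
rewrite ltr_pdivrMr ?exprn_gt0 // mulrC -ltr_pdivrMr //.
exact: lt_trans p2.
Qed.

(* Cousin's lemma on cubes [x, x + h]^K: a property that passes from the 2^K half cubes to
   the cube and holds for all small cubes around each point holds for every cube. *)
Lemma cube_ind (K : finType) (P : (K -> R) -> R -> Prop) (x0 : K -> R) (h0 : R) :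
  0 < h0 ->
  (forall x h, 0 < h ->
     (forall b : K -> bool, P (fun k => x k + (if b k then h / 2 else 0)) (h / 2)) -> P x h) ->
  (forall y, (forall k, x0 k <= y k <= x0 k + h0) ->
     exists2 d : R, 0 < d & forall x h, 0 < h -> h < d ->
       (forall k, x k <= y k <= x k + h) ->
       (forall k, x0 k <= x k /\ x k + h <= x0 k + h0) -> P x h) ->
  P x0 h0.
Proof.
move=> h00 hsplit hloc; apply: contrapT => nP.
(* Bisection: every cube on which [P] fails has a half cube on which it fails; [st] records which
   half is taken in each coordinate. *)
have /choice[st hst] : forall s : (K -> R) * R, exists b : K -> bool, 0 < s.2 -> ~ P s.1 s.2 ->
    ~ P (fun k => s.1 k + (if b k then s.2 / 2 else 0)) (s.2 / 2).
  move=> [x h]; case: (pselect (0 < h)) => [hh|]; last by exists (fun _ => true).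
  case: (pselect (P x h)) => [|np]; first by exists (fun _ => true).
  have : ~ forall b : K -> bool, P (fun k => x k + (if b k then h / 2 else 0)) (h / 2).
    by move=> H; apply: np; apply: hsplit.
  by move/existsNP => [b hb]; exists b.
pose nxt (s : (K -> R) * R) : (K -> R) * R :=
  (fun k => s.1 k + (if st s k then s.2 / 2 else 0), s.2 / 2).
pose sq n := iter n nxt (x0, h0).
have sqh n : (sq n).2 = h0 / 2 ^+ n.
  elim: n => [|n IH]; first by rewrite expr0 divr1.
  by rewrite /sq iterS /= -/(sq n) IH exprS invfM mulrCA mulrC mulrA.
have sqh0 n : 0 < (sq n).2 by rewrite sqh divr_gt0 // exprn_gt0.
have sqP n : ~ P (sq n).1 (sq n).2.
  elim: n => [//|n IH]; rewrite /sq iterS -/(sq n); exact: hst.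
have nest n k : (sq n).1 k <= (sq n.+1).1 k /\
    (sq n.+1).1 k + (sq n.+1).2 <= (sq n).1 k + (sq n).2.
  rewrite /sq iterS -/(sq n) /=; have := sqh0 n; case: (st _ _) => /=; lra.
have mono n j k : (sq n).1 k <= (sq (j + n)%N).1 k /\
    (sq (j + n)%N).1 k + (sq (j + n)%N).2 <= (sq n).1 k + (sq n).2.
  elim: j => [|j IH]; first by rewrite add0n.
  by rewrite addSn; have := nest (j + n)%N k; lra.
have cmp n m k : (sq n).1 k <= (sq m).1 k + (sq m).2.
  case: (leqP n m) => h.
    have := mono n (m - n)%N k; rewrite subnK //; have := sqh0 m; lra.
  have := mono m (n - m)%N k; rewrite subnK ?(ltnW h) //; have := sqh0 n; lra.
(* In each coordinate the left ends increase and stay below every right end, so their suprema form a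
   point that lies in all the cubes. *)
pose E k : classical_sets.set R := fun r => exists n, r = (sq n).1 k.
pose y k := sup (E k).
have E0 k : classical_sets.has_sup (E k).
  split; first by exists (x0 k); exists 0%N.
  by exists (x0 k + h0) => r [n ->]; have := cmp n 0%N k.
have ylo n k : (sq n).1 k <= y k by apply: sup_upper_bound => //; exists n.
have yhi n k : y k <= (sq n).1 k + (sq n).2.
  by apply: ge_sup; [case: (E0 k)|move=> r [j ->]].
have [|d d0 hd] := hloc y.
  by move=> k; apply/andP; split; [exact: (ylo 0%N)|exact: (yhi 0%N)].
have [n hn] := archi_pow2 h0 d0.
apply: (sqP n); apply: hd => //; first by rewrite sqh.
  by move=> k; rewrite ylo yhi.
by move=> k; have := mono 0%N n k; rewrite addn0.
Qed.
End Cube.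

(** * Primitives of continuous functions *)

Section Primitive.
Variable R : realType.
Import classical_sets filter topology normedtype derive lebesgue_integral.
Import measure lebesgue_measure numFieldNormedType.Exports.
Local Open Scope classical_set_scope.

Lemma real_primitive (f : R -> R) (a b : R) : a <= b ->
  (forall x e : R, 0 < e -> exists2 d : R, 0 < d & forall y, `|y - x| < d -> `|f y - f x| < e) ->
  exists F : R -> R, forall x, a <= x <= b -> forall e : R, 0 < e ->
    exists2 d : R, 0 < d & forall y, `|y - x| < d ->
      `|F y - F x - f x * (y - x)| <= e * `|y - x|.
Proof.
move=> ab hf.
have cf : continuous f.
  move=> x; apply/cvgrPdist_lt => e /(hf x)[d d0 hd].
  near=> y; rewrite distrC; apply: hd; near: y.
  by exists d => // y /=; rewrite distrC.
(* The margins [a - 1] and [b + 1] make every point of [a, b] interior, so the fundamental theorem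
   of calculus yields a two-sided derivative at the ends as well. *)
exists (fun x => Rintegral lebesgue_measure (`[a - 1, x]%classic : set R) f) => x /andP[ax xb] e e0.
have xu : x < b + 1 by lra.
have int_f : lebesgue_measure.-integrable (`[a - 1, b + 1]%classic : set R) (constructive_ereal.EFin \o f).
  apply: continuous_compact_integrable; first exact: segment_compact.
  by apply: continuous_subspaceT.
have /= := @ftc.continuous_FTC1 _ f (BLeft (a - 1)) x (b + 1) xu int_f _ (cf x).
case; first by rewrite /= constructive_ereal.lte_fin; lra.
set F := (fun _ => _) => dF F'.
have /cvgrPdist_le /(_ e e0) : (fun h => h^-1 *: ((F \o shift x) (h *: (1 : R)) - F x)) @ 0^' --> f x.
  rewrite -F' derive1E; exact: dF.
case=> d /= d0 hd; exists d => // y hy.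
have [->|yx] := eqVneq y x; first by rewrite !subrr mulr0 subrr normr0 mulr0.
have hyx : y - x != 0 by rewrite subr_eq0.
have := hd (y - x); rewrite /ball_ /= sub0r normrN => /(_ hy hyx).
rewrite /GRing.scale /= mulr1 subrK => h.
have -> : F y - F x - f x * (y - x) = - ((f x - (y - x)^-1 * (F y - F x)) * (y - x)).
  by rewrite mulrBl mulrAC mulVf // mul1r opprB.
by rewrite normrN normrM ler_wpM2r.
Unshelve. all: by end_near.
Qed.
End Primitive.

(** * Integrals of complex functions of a real variable *)

Section PathIntegral.
Variable R : realType.
Local Notation C := (R[i]).
Local Notation rc := (real_complex R).
Implicit Types (a b : R) (phi psi Phi Psi : R -> C).

Definition icts phi a b := forall x, a <= x <= b -> forall e : R, 0 < e ->
  exists2 d : R, 0 < d & forall y, a <= y <= b -> `|y - x| < d -> nc (phi y - phi x) < e.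

Definition ider Phi phi a b := forall x, a <= x <= b -> forall e : R, 0 < e ->
  exists2 d : R, 0 < d & forall y, a <= y <= b -> `|y - x| < d ->
    nc (Phi y - Phi x - phi x * rc (y - x)) <= e * `|y - x|.

Lemma ider_sub a b c d Phi phi : a <= c -> d <= b -> ider Phi phi a b -> ider Phi phi c d.
Proof.
move=> ac db h x hx e e0; have [|r r0 hr] := h x _ e e0; first lra.
by exists r => // y hy; apply: hr; lra.
Qed.

Lemma iderD Phi phi Psi psi a b : ider Phi phi a b -> ider Psi psi a b ->
  ider (fun x => Phi x + Psi x) (fun x => phi x + psi x) a b.
Proof.
move=> h1 h2 x hx e e0; have e2 : 0 < e / 2 by rewrite divr_gt0.
have [r r0 hr] := h1 x hx _ e2; have [s s0 hs] := h2 x hx _ e2.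
exists (Num.min r s); first by rewrite lt_min r0.
move=> y hy; rewrite lt_min => /andP[/(hr _ hy) k1 /(hs _ hy) k2].
have -> : Phi y + Psi y - (Phi x + Psi x) - (phi x + psi x) * rc (y - x) =
  (Phi y - Phi x - phi x * rc (y - x)) + (Psi y - Psi x - psi x * rc (y - x)) by ring.
by apply: le_trans (ncD _ _) _; lra.
Qed.

Lemma iderZ (k : C) Phi phi a b : ider Phi phi a b ->
  ider (fun x => k * Phi x) (fun x => k * phi x) a b.
Proof.
move=> h x hx e e0; have K0 := nc_ge0 k.
have e2 : 0 < e / (nc k + 1) by rewrite divr_gt0 // ltr_wpDl.
have [r r0 hr] := h x hx _ e2; exists r => // y hy /(hr _ hy) k1.
have -> : k * Phi y - k * Phi x - k * phi x * rc (y - x) =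
  k * (Phi y - Phi x - phi x * rc (y - x)) by ring.
rewrite ncM; apply: le_trans (ler_wpM2l K0 k1) _.
rewrite mulrA ler_wpM2r //; rewrite mulrCA ler_piMr ?ltW //.
by rewrite ltr_pdivrMr ?ltr_wpDl //; lra.
Qed.

Lemma ider_lin (k l : C) a b : ider (fun x => l + k * rc x) (fun _ => k) a b.
Proof.
move=> x hx e e0; exists 1 => // y _ _.
have -> : l + k * rc y - (l + k * rc x) - k * rc (y - x) = 0 by ring.
by rewrite nc0 mulr_ge0 // ltW.
Qed.

(** The mean value theorem fails for complex values. With [B + e] in place of [B] the estimate holds
    on short intervals around each point and adds up over two adjacent intervals, so Cousin's lemma
    applies. *)
Lemma mvt_bound Phi phi a b B : a <= b -> ider Phi phi a b ->
  (forall x, a <= x <= b -> nc (phi x) <= B) -> nc (Phi b - Phi a) <= B * (b - a).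
Proof.
move=> ab hd hB; case: (eqVneq a b) => [->|nab]; first by rewrite !subrr nc0 mulr0.
have ltab : 0 < b - a by rewrite subr_gt0 lt_neqAle nab.
suff H e : 0 < e -> nc (Phi b - Phi a) <= (B + e) * (b - a).
  apply/ler_addgt0Pr => e e0; have := H (e / (b - a)) (divr_gt0 e0 ltab).
  by rewrite mulrDl divfK // gt_eqF.
move=> e0; pose P (x : unit -> R) h := nc (Phi (x tt + h) - Phi (x tt)) <= (B + e) * h.
have : P (fun _ => a) (b - a).
  apply: (@cube_ind R unit P) => //.
    move=> x h h0 H; rewrite /P; have H1 := H (fun _ => true); have H2 := H (fun _ => false).
    rewrite /P addr0 in H2; rewrite /P -addrA -splitr in H1.
    have := ncD (Phi (x tt + h) - Phi (x tt + h / 2)) (Phi (x tt + h / 2) - Phi (x tt)).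
    rewrite addrA subrK; lra.
  move=> y /(_ tt) hy; have hy' : a <= y tt <= b by lra.
  have [d d0 hd'] := hd _ hy' _ e0; exists d => // x h h0 hlt /(_ tt) hx /(_ tt) hs.
  rewrite /P.
  have k1 := hd' (x tt + h) ltac:(lra) ltac:(rewrite ger0_norm; lra).
  have k2 := hd' (x tt) ltac:(lra) ltac:(rewrite ler0_norm; lra).
  rewrite ger0_norm in k1; last lra.
  rewrite ler0_norm in k2; last lra.
  have -> : Phi (x tt + h) - Phi (x tt) =
     (Phi (x tt + h) - Phi (y tt) - phi (y tt) * rc (x tt + h - y tt))
     - (Phi (x tt) - Phi (y tt) - phi (y tt) * rc (x tt - y tt)) + phi (y tt) * rc h by ring.
  apply: le_trans (ncD _ _) _; rewrite ncM nc_real (gtr0_norm h0).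
  have k3 := ler_wpM2r (ltW h0) (hB _ hy').
  apply: le_trans (lerD (ncB _ _) k3) _; lra.
by rewrite /P (_ : a + (b - a) = b) //; ring.
Qed.

Lemma ider_unique Phi Psi phi a b : a <= b -> ider Phi phi a b -> ider Psi phi a b ->
  Phi b - Phi a = Psi b - Psi a.
Proof.
move=> ab h1 h2.
have h3 := iderD h1 (iderZ (- 1) h2).
have := mvt_bound (B := 0) ab h3.
rewrite mul0r => H; apply/eqP; rewrite -subr_eq0; apply/eqP/nc_eq0/eqP.
rewrite eq_le nc_ge0 andbT.
have -> : Phi b - Phi a - (Psi b - Psi a) = Phi b + -1 * Psi b - (Phi a + -1 * Psi a) by ring.
by apply: H => x _; rewrite mulN1r subrr nc0.
Qed.

Lemma icts_prim phi a b : a <= b -> icts phi a b -> exists Phi, ider Phi phi a b.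
Proof.
(* Composition with the clamp [cl], a contraction onto [a, b], extends [phi] continuously to the
   line; the primitive is then found separately for the real and the imaginary part. *)
move=> ab hc; pose cl x : R := Num.min (Num.max x a) b.
have clE x : (x <= a /\ cl x = a) \/ (a <= x <= b /\ cl x = x) \/ (b <= x /\ cl x = b).
  rewrite /cl; case: (leP x a) => h; first by left; split=> //; case: (leP a b) => //; lra.
  case: (leP x b) => h'; right; [left|right]; split=> //; lra.
have clb x : a <= cl x <= b by case: (clE x) => [[? ->]|[[? ->]|[? ->]]]; lra.
have cl_id x : a <= x <= b -> cl x = x by case: (clE x) => [[? ->]|[[? ->]|[? ->]]]; lra.
have cl_lip x y : `|cl y - cl x| <= `|y - x|.
  rewrite ler_norml; have := ler_norm (y - x); have := ler_norm (x - y); rewrite (distrC x).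
  case: (clE x) => [[? ->]|[[? ->]|[? ->]]]; case: (clE y) => [[? ->]|[[? ->]|[? ->]]]; lra.
have K (p : C -> R) : (forall u v, `|p u - p v| <= nc (u - v)) ->
   exists F : R -> R, forall x, a <= x <= b -> forall e : R, 0 < e ->
    exists2 d : R, 0 < d & forall y, `|y - x| < d ->
      `|F y - F x - p (phi (cl x)) * (y - x)| <= e * `|y - x|.
  move=> hp; apply: (@real_primitive R (fun x => p (phi (cl x))) a b ab) => x e e0.
  have [d d0 hd] := hc _ (clb x) e e0; exists d => // y hy.
  apply: le_lt_trans (hp _ _) _; apply: hd => //; exact: le_lt_trans (cl_lip _ _) hy.
have [u v|F hF] := K (@complex.Re R); first by rewrite -raddfB nc_Re.
have [u v|G hG] := K (@complex.Im R); first by rewrite -raddfB nc_Im.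
exists (fun x => Complex (F x) (G x)) => x hx e e0.
have e2 : 0 < e / 2 by rewrite divr_gt0.
have [r r0 hr] := hF x hx _ e2; have [s s0 hs] := hG x hx _ e2.
exists (Num.min r s); first by rewrite lt_min r0.
move=> y hy; rewrite lt_min => /andP[/hr k1 /hs k2]; rewrite cl_id // in k1 k2.
apply: le_trans (nc_ReIm _) _.
have -> : complex.Re (Complex (F y) (G y) - Complex (F x) (G x) - phi x * rc (y - x))
  = F y - F x - complex.Re (phi x) * (y - x) by case: (phi x) => p q /=; ring.
have -> : complex.Im (Complex (F y) (G y) - Complex (F x) (G x) - phi x * rc (y - x))
  = G y - G x - complex.Im (phi x) * (y - x) by case: (phi x) => p q /=; ring.
lra.
Qed.

Lemma icts_const (k : C) a b : icts (fun _ => k) a b.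
Proof. by move=> x _ e e0; exists 1 => // y _ _; rewrite subrr nc0. Qed.

Lemma icts_rc a b : icts (fun x => rc x) a b.
Proof. by move=> x _ e e0; exists e => // y _ h; rewrite -rmorphB nc_real. Qed.

Lemma icts_comp (f : C -> C) phi a b : icts phi a b ->
  (forall x, a <= x <= b -> forall e : R, 0 < e -> exists2 d : R, 0 < d &
     forall v, nc (v - phi x) < d -> nc (f v - f (phi x)) < e) ->
  icts (fun x => f (phi x)) a b.
Proof.
move=> h hf x hx e e0; have [d d0 hd] := hf x hx e e0.
by have [r r0 hr] := h x hx d d0; exists r => // y hy /(hr _ hy)/hd.
Qed.

Lemma icts_pair (op : C -> C -> C) phi psi a b :
  (forall u v : C, forall e : R, 0 < e -> exists2 d : R, 0 < d &
     forall u' v', nc (u' - u) < d -> nc (v' - v) < d -> nc (op u' v' - op u v) < e) ->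
  icts phi a b -> icts psi a b -> icts (fun x => op (phi x) (psi x)) a b.
Proof.
move=> hop h1 h2 x hx e e0; have [d d0 hd] := hop (phi x) (psi x) e e0.
have [r r0 hr] := h1 x hx d d0; have [s s0 hs] := h2 x hx d d0.
exists (Num.min r s); first by rewrite lt_min r0.
by move=> y hy; rewrite lt_min => /andP[/(hr _ hy) ? /(hs _ hy) ?]; apply: hd.
Qed.

Lemma icts_add phi psi a b : icts phi a b -> icts psi a b ->
  icts (fun x => phi x + psi x) a b.
Proof.
apply: icts_pair => u v e e0; exists (e / 2); first by rewrite divr_gt0.
by move=> u' v' h1 h2; rewrite opprD addrACA; apply: le_lt_trans (ncD _ _) _; lra.
Qed.

Lemma icts_mul phi psi a b : icts phi a b -> icts psi a b ->
  icts (fun x => phi x * psi x) a b.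
Proof.
apply: icts_pair => u v e e0.
have H1 : ctsat (fun p : bool -> C => p true * p false) (fun t => if t then u else v).
  by apply: ctsat_mul; exact: ctsat_coord.
have [d d0 hd] := H1 _ e0; exists (d / 2); first by rewrite divr_gt0.
move=> u' v' h1 h2; apply: (hd (fun t => if t then u' else v')).
by rewrite /n1 big_bool /= /vsub; lra.
Qed.

Lemma inv_cts (u : C) : u != 0 -> forall e : R, 0 < e -> exists2 d : R, 0 < d &
  forall v, nc (v - u) < d -> nc (v^-1 - u^-1) < e.
Proof.
move=> u0 e e0; have U0 := nc_gt0 u0.
exists (Num.min (nc u / 2) (e * (nc u * nc u) / 4)).
  by rewrite lt_min !divr_gt0 // !mulr_gt0.
move=> v; rewrite lt_min => /andP[h1 h2].
have hv : nc u / 2 < nc v.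
  by have := ncB v (v - u); rewrite opprB addrC subrK; lra.
have v0 : v != 0 by apply: contraTneq hv => ->; rewrite nc0 -leNgt divr_ge0 // ltW.
have -> : v^-1 - u^-1 = - ((v - u) / (v * u)) by field; rewrite v0 u0.
rewrite ncN ncM ncV ltr_pdivrMr ?nc_gt0 ?mulf_neq0 // ncM.
apply: lt_le_trans h2 _; rewrite -mulrA ler_pM2l //.
have : nc u * nc u / 2 <= nc v * nc u by rewrite mulrAC ler_pM2r // ltW.
have := mulr_gt0 U0 U0; lra.
Qed.

Lemma icts_inv phi a b : icts phi a b -> (forall x, a <= x <= b -> phi x != 0) ->
  icts (fun x => (phi x)^-1) a b.
Proof.
move=> h h0; apply: (icts_comp (f := fun v => v^-1) h) => x hx; apply: inv_cts; exact: h0.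
Qed.

Definition prim a b phi : R -> C :=
  if pselect (exists Phi, ider Phi phi a b) is left h then projT1 (cid h) else (fun _ => 0).

Lemma prim_ider a b phi : (exists Phi, ider Phi phi a b) -> ider (prim a b phi) phi a b.
Proof. by move=> h; rewrite /prim; case: pselect => // h'; exact: projT2 (cid h'). Qed.

(* Junk value 0 when [phi] has no primitive on [0, 1]. *)
Definition Int01 phi : C := prim 0 1 phi 1 - prim 0 1 phi 0.

Lemma Int01_ider Phi phi : ider Phi phi 0 1 -> Int01 phi = Phi 1 - Phi 0.
Proof.
move=> h; apply: (ider_unique (phi := phi)) => //.
by apply: prim_ider; exists Phi.
Qed.

Lemma Int01_prim phi : icts phi 0 1 -> ider (prim 0 1 phi) phi 0 1.
Proof. by move=> h; apply: prim_ider; apply: icts_prim. Qed.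

Lemma Int01D phi psi : icts phi 0 1 -> icts psi 0 1 ->
  Int01 (fun x => phi x + psi x) = Int01 phi + Int01 psi.
Proof.
move=> h1 h2; rewrite (Int01_ider (iderD (Int01_prim h1) (Int01_prim h2))) /Int01; ring.
Qed.

Lemma Int01Z k phi : icts phi 0 1 -> Int01 (fun x => k * phi x) = k * Int01 phi.
Proof. by move=> h1; rewrite (Int01_ider (iderZ k (Int01_prim h1))) /Int01; ring. Qed.

Lemma Int01_const k : Int01 (fun _ => k) = k.
Proof. by rewrite (Int01_ider (@ider_lin k 0 0 1)) rmorph0 rmorph1; ring. Qed.

Lemma Int01_bound phi B : icts phi 0 1 -> (forall x, 0 <= x <= 1 -> nc (phi x) <= B) ->
  nc (Int01 phi) <= B.
Proof.
move=> h hB; have := mvt_bound ler01 (Int01_prim h) hB.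
by rewrite subr0 mulr1.
Qed.

Lemma Int01_ext phi psi : icts phi 0 1 -> (forall x, 0 <= x <= 1 -> phi x = psi x) ->
  Int01 phi = Int01 psi.
Proof.
move=> h e; symmetry; apply: Int01_ider => x hx; rewrite -e //.
exact: Int01_prim.
Qed.
End PathIntegral.

(** * Goursat's argument for a contraction of a segment *)

Section Goursat.
Variable R : realType.
Local Notation C := (R[i]).
Local Notation rc := (real_complex R).

Definition cdiff (f : C -> C) (z f' : C) := forall e : R, 0 < e ->
  exists2 d : R, 0 < d & forall v, nc (v - z) < d ->
    nc (f v - f z - f' * (v - z)) <= e * nc (v - z).

Lemma cdiff_cts f z f' : cdiff f z f' -> forall e : R, 0 < e ->
  exists2 d : R, 0 < d & forall v, nc (v - z) < d -> nc (f v - f z) < e.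
Proof.
move=> h e e0; have [d d0 hd] := h 1 ltr01; have F0 := nc_ge0 f'.
have s0 : 0 < e / (nc f' + 2) by rewrite divr_gt0 //; lra.
exists (Num.min d (e / (nc f' + 2))); first by rewrite lt_min d0.
move=> v; rewrite lt_min => /andP[/hd h1 h2].
rewrite ltr_pdivlMr in h2; last lra.
have -> : f v - f z = (f v - f z - f' * (v - z)) + f' * (v - z) by ring.
apply: le_lt_trans (ncD _ _) _; rewrite ncM; apply: le_lt_trans _ h2.
by have := nc_ge0 (v - z); lra.
Qed.

(** [D] contracts the segment from [w0] to [w1] towards [z], and [a1], [a2] are the logarithmic
    derivatives of [D - z] in [t] and in [s]. The four integrals are thus those of
    [f(v) dv / (v - z)] over the sides of the image of the unit square, and the identity is Cauchy's
    theorem for it. Since [l0 > 0] the image stays away from [z]. As [a1] depends only on [t] and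
    [a2] only on [s], each has a single primitive that serves on all parallel sides. *)
Lemma homotopy_side (f : C -> C) (z w0 w1 : C) (l0 m0 : R) :
  let w t := w0 + rc t * (w1 - w0) in
  let lam t := rc (l0 + (1 - l0) * t) in
  let D s t := z + lam s * (w t - z) in
  let a1 t := (w1 - w0) / (w t - z) in
  let a2 s := rc (1 - l0) / lam s in
  0 < l0 < 1 -> 0 < m0 -> (forall t, 0 <= t <= 1 -> m0 <= nc (w t - z)) ->
  (forall s t, 0 <= s <= 1 -> 0 <= t <= 1 -> exists f', cdiff f (D s t) f') ->
  Int01 (fun t => f (D 1 t) * a1 t) - Int01 (fun t => f (D 0 t) * a1 t) =
  Int01 (fun s => f (D s 1) * a2 s) - Int01 (fun s => f (D s 0) * a2 s).
Proof.
move=> w lam D a1 a2 hl m00 hm hf.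
have wz t : 0 <= t <= 1 -> w t - z != 0.
  by move=> ht; apply: contraTneq (hm t ht) => ->; rewrite nc0 -ltNge.
have lam_gt s : 0 <= s <= 1 -> l0 <= l0 + (1 - l0) * s <= 1.
  by move=> hs; have : 0 <= (1 - l0) * s <= 1 - l0 by [rewrite mulr_ge0 /= ?ler_piMr //; lra]; lra.
have lam0 s : 0 <= s <= 1 -> lam s != 0.
  move=> /lam_gt hs; apply/eqP => /(congr1 (@nc R)); rewrite nc_real nc0 ger0_norm; lra.
have icD1 s : 0 <= s <= 1 -> icts (fun t => D s t) 0 1.
  move=> hs; apply: icts_add; first exact: icts_const.
  apply: icts_mul; first exact: icts_const.
  apply: icts_add; last exact: icts_const.
  apply: icts_add; first exact: icts_const.
  by apply: icts_mul; [exact: icts_rc|exact: icts_const].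
have iclam : icts lam 0 1.
  have := icts_add (@icts_const R (rc l0) 0 1) (icts_mul (@icts_const R (rc (1 - l0)) 0 1) (@icts_rc R 0 1)).
  by move=> h; have -> : lam = (fun x => rc l0 + rc (1 - l0) * rc x) by apply: funext => x; rewrite /lam rmorphD rmorphM.
have icD2 t : icts (fun s => D s t) 0 1.
  apply: icts_add; first exact: icts_const.
  by apply: icts_mul => //; exact: icts_const.
have ica1 : icts a1 0 1.
  apply: icts_mul; first exact: icts_const.
  apply: icts_inv => //; apply: icts_add; last exact: icts_const.
  apply: icts_add; first exact: icts_const.
  by apply: icts_mul; [exact: icts_rc|exact: icts_const].
have ica2 : icts a2 0 1.
  by apply: icts_mul; [exact: icts_const|exact: icts_inv].
have icf1 s : 0 <= s <= 1 -> icts (fun t => f (D s t) * a1 t) 0 1.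
  move=> hs; apply: icts_mul => //; apply: icts_comp; first exact: icD1.
  by move=> t ht; have [f' /cdiff_cts] := hf s t hs ht.
have icf2 t : 0 <= t <= 1 -> icts (fun s => f (D s t) * a2 s) 0 1.
  move=> ht; apply: icts_mul => //; apply: icts_comp; first exact: icD2.
  by move=> s hs; have [f' /cdiff_cts] := hf s t hs ht.
(* Primitives turn integrals over subintervals into differences, which makes the boundary integral
   additive under subdivision by [ring] alone. *)
pose TH s := prim 0 1 (fun t => f (D s t) * a1 t).
pose LA t := prim 0 1 (fun s => f (D s t) * a2 s).
have dTH s : 0 <= s <= 1 -> ider (TH s) (fun t => f (D s t) * a1 t) 0 1.
  by move=> hs; apply: Int01_prim; exact: icf1.
have dLA t : 0 <= t <= 1 -> ider (LA t) (fun s => f (D s t) * a2 s) 0 1.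
  by move=> ht; apply: Int01_prim; exact: icf2.
have dL := Int01_prim ica1; have dl := Int01_prim ica2.
set L := prim 0 1 a1 in dL; set l := prim 0 1 a2 in dl.
(* The boundary integral over the square with corner (x, y) and side [h]. Goursat's estimate bounds
   it by [e * h^2] on small squares, and this bound is preserved by subdivision. *)
pose Q x y h := (TH (x + h) (y + h) - TH (x + h) y) - (TH x (y + h) - TH x y)
   - (LA (y + h) (x + h) - LA (y + h) x) + (LA y (x + h) - LA y x).
suff Q0 e : 0 < e -> nc (Q 0 0 1) <= e * (1 * 1).
  have : nc (Q 0 0 1) = 0.
    apply/eqP; rewrite eq_le nc_ge0 andbT; apply/ler_addgt0Pr => e e0.
    by have := Q0 e e0; rewrite !mulr1 add0r.
  rewrite /Q /Int01 -/(TH 1) -/(TH 0) -/(LA 1) -/(LA 0) !add0r => /nc_eq0 H.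
  by apply/eqP; rewrite -subr_eq0 -[X in _ == X]H; apply/eqP; ring.
move=> e0; pose P (x : bool -> R) h := nc (Q (x true) (x false) h) <= e * (h * h).
apply: (@cube_ind R bool P (fun _ => 0) 1) => // [x h h0 H|y hy].
  have H1 b1 b2 := H (fun k => if k then b1 else b2).
  have := H1 true true; have := H1 true false; have := H1 false true; have := H1 false false.
  rewrite /P /= !addr0 /Q -!addrA -!splitr !addrA => k1 k2 k3 k4.
  set X := x true in k1 k2 k3 k4 *; set Y := x false in k1 k2 k3 k4 *.
  set X2 := X + h / 2 in k1 k2 k3 k4 *; set Y2 := Y + h / 2 in k1 k2 k3 k4 *.
  set A1 := (X in nc X <= _) in k1; set A2 := (X in nc X <= _) in k2.
  set A3 := (X in nc X <= _) in k3; set A4 := (X in nc X <= _) in k4.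
  have -> : TH (X + h) (Y + h) - TH (X + h) Y - (TH X (Y + h) - TH X Y) -
      (LA (Y + h) (X + h) - LA (Y + h) X) + LA Y (X + h) - LA Y X = (A1 + A2) + (A3 + A4).
    by rewrite /A1 /A2 /A3 /A4; ring.
  apply: le_trans (ncD _ _) _.
  have := ncD A1 A2; have := ncD A3 A4; lra.
set S := y true; set T := y false.
have hS : 0 <= S <= 1 by have := hy true; rewrite /= -/S; lra.
have hT : 0 <= T <= 1 by have := hy false; rewrite /= -/T; lra.
have [f' df] := hf S T hS hT; set zs := D S T in df.
(* [M] bounds the Lipschitz constant of [D], while [A] and [l0^-1] bound [a1] and [a2]; with [e']
   the four sides of a square add up to exactly [e * h^2]. *)
pose M := nc (w0 - z) + nc (w1 - w0) *+ 2 + 1.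
have n0 := nc_ge0 (w0 - z); have n1' := nc_ge0 (w1 - w0).
have M0 : 0 < M by rewrite /M; lra.
pose A := nc (w1 - w0) / m0.
have A0 : 0 <= A by rewrite divr_ge0 // ltW.
have A20 : 0 < l0^-1 by rewrite invr_gt0; lra.
have MS0 : 0 < 2 * M * (A + l0^-1) by rewrite !mulr_gt0 //; lra.
pose e' := e / (2 * M * (A + l0^-1)).
have e'0 : 0 < e' by rewrite divr_gt0.
have [d d0 hd] := df _ e'0; exists (d / M); first by rewrite divr_gt0.
move=> x h h0 hdM hx hsub; rewrite /P.
rewrite ltr_pdivlMr // in hdM.
set X := x true; set Y := x false.
have := hx true; have := hx false; have /= := hsub true; have /= := hsub false.
rewrite -/X -/Y -/S -/T => bY bX sY sX; clear hx hsub; clearbody X Y S T.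
have sub01 a s : 0 <= a /\ a + h <= 1 -> a <= s <= a + h -> 0 <= s <= 1 by clear; lra.
have leh a : a <= a <= a + h /\ a <= a + h <= a + h by move: h0; clear; lra.
have {}bX : 0 <= X /\ X + h <= 1 by move: bX => /=; clear; lra.
have {}bY : 0 <= Y /\ Y + h <= 1 by move: bY => /=; clear; lra.
have dst a b c : b <= a <= b + h -> b <= c <= b + h -> `|a - c| <= h.
  by rewrite ler_norml; move: h0; clear; lra.
pose E s t := f (D s t) - f zs - f' * (D s t - zs).
have EB s t : X <= s <= X + h -> Y <= t <= Y + h -> nc (E s t) <= e' * M * h.
  move=> hs ht; have dist : nc (D s t - zs) <= M * h.
    have -> : D s t - zs = rc ((1 - l0) * (s - S)) * ((w0 - z) + rc t * (w1 - w0))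
       + lam S * (rc (t - T) * (w1 - w0)) by rewrite /zs /D /lam /w; ring.
    apply: le_trans (ncD _ _) _; rewrite !ncM !nc_real.
    have k1 : nc (w0 - z + rc t * (w1 - w0)) <= nc (w0 - z) + nc (w1 - w0).
      apply: le_trans (ncD _ _) _; rewrite ncM nc_real lerD // ler_piMl // ger0_norm; move: (sub01 _ _ bY ht); clear; lra.
    have k2 : `|(1 - l0) * (s - S)| <= h.
      rewrite normrM (ger0_norm (_ : 0 <= 1 - l0)); last by move: hl; clear; lra.
      have h3 : `|s - S| <= h by exact: dst hs sX.
      by apply: le_trans h3; rewrite ler_piMl //; move: hl; clear; lra.
    have k3 : `|l0 + (1 - l0) * S| <= 1 by rewrite ger0_norm; move: hl (lam_gt S hS); clear; lra.
    have k4 : `|t - T| <= h by exact: dst ht sY.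
    have k5 := ler_pM (normr_ge0 _) (nc_ge0 _) k2 k1.
    have k6 : `|l0 + (1 - l0) * S| * (`|t - T| * nc (w1 - w0)) <= 1 * (h * nc (w1 - w0)).
      by rewrite ler_pM ?mulr_ge0 // ler_wpM2r.
    rewrite /M; apply: le_trans (lerD k5 k6) _; rewrite mulrDl mulrDl mulr2n; lra.
  have hMd : M * h < d by rewrite mulrC.
  apply: le_trans (hd _ (le_lt_trans dist hMd)) _.
  by rewrite -mulrA ler_wpM2l // ltW.
(* The affine part of [f] at [zs], multiplied by [a1] or [a2], has an explicit primitive: [k1] times
   [L] or [l] plus a linear function. These contributions cancel around the square and leave only
   the remainder [E]. *)
pose k1 := f zs - f' * (zs - z).
have bTH s : X <= s <= X + h ->
  nc (TH s (Y + h) - TH s Y - k1 * (L (Y + h) - L Y) - f' * lam s * (w1 - w0) * rc h)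
   <= e' * M * h * A * h.
  move=> hs; have hs' := sub01 _ _ bX hs.
  have := iderD (dTH s hs') (iderZ (-1) (iderD (iderZ k1 dL)
     (@ider_lin R (f' * lam s * (w1 - w0)) 0 0 1))).
  move/(@ider_sub R 0 1 Y (Y + h)) => /(_ bY.1 bY.2) dd.
  have := mvt_bound (B := e' * M * h * A) (elimT andP (leh Y).2).1 dd.
  rewrite (_ : Y + h - Y = h); last ring.
  set u := (X in nc X <= _) => H; set v := (X in nc X <= _).
  have -> : v = u by rewrite /u /v; ring.
  apply: H => t ht; have ht' := sub01 _ _ bY ht.
  have -> : f (D s t) * a1 t + -1 * (k1 * a1 t + f' * lam s * (w1 - w0)) = E s t * a1 t.
    by rewrite /E /k1 /a1 /D; field; exact: wz.
  rewrite ncM ler_pM ?nc_ge0 ?EB // /a1 ncM ncV /A ler_wpM2l // lef_pV2 ?posrE ?hm //.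
  by apply: lt_le_trans (hm t ht').
have bLA t : Y <= t <= Y + h ->
  nc (LA t (X + h) - LA t X - k1 * (l (X + h) - l X) - f' * (w t - z) * rc (1 - l0) * rc h)
   <= e' * M * h * l0^-1 * h.
  move=> ht; have ht' := sub01 _ _ bY ht.
  have := iderD (dLA t ht') (iderZ (-1) (iderD (iderZ k1 dl)
     (@ider_lin R (f' * (w t - z) * rc (1 - l0)) 0 0 1))).
  move/(@ider_sub R 0 1 X (X + h)) => /(_ bX.1 bX.2) dd.
  have := mvt_bound (B := e' * M * h * l0^-1) (elimT andP (leh X).2).1 dd.
  rewrite (_ : X + h - X = h); last ring.
  set u := (X in nc X <= _) => H; set v := (X in nc X <= _).
  have -> : v = u by rewrite /u /v; ring.
  apply: H => s hs; have hs' := sub01 _ _ bX hs.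
  have -> : f (D s t) * a2 s + -1 * (k1 * a2 s + f' * (w t - z) * rc (1 - l0)) = E s t * a2 s.
    by rewrite /E /k1 /a2 /D; move: (lam s) (lam0 s hs') => ls ls0; field.
  rewrite ncM ler_pM ?nc_ge0 ?EB // /a2 ncM ncV !nc_real.
  have hls := lam_gt s hs'; move: hl hls; clear => hl hls.
  rewrite !ger0_norm; [|lra|lra].
  rewrite ler_pdivrMr; last lra.
  apply: (@le_trans _ _ 1); first lra.
  by rewrite mulrC ler_pdivlMr ?mul1r; lra.
have b1 := bTH (X + h) (leh X).2; have b2 := bTH X (leh X).1.
have b3 := bLA (Y + h) (leh Y).2; have b4 := bLA Y (leh Y).1.
set u1 := (X in nc X <= _) in b1; set u2 := (X in nc X <= _) in b2.
set u3 := (X in nc X <= _) in b3; set u4 := (X in nc X <= _) in b4.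
have -> : Q X Y h = (u1 - u2) + (u4 - u3).
  by rewrite /Q /u1 /u2 /u3 /u4 /lam /w; ring.
apply: le_trans (ncD _ _) _.
have k2 := ncB u1 u2; have k3 := ncB u4 u3.
have -> : e * (h * h) = e' * M * h * A * h * 2 + e' * M * h * l0^-1 * h * 2.
  rewrite /e'; have -> : e' * M * h * A * h * 2 + e' * M * h * l0^-1 * h * 2 = e' * (2 * M * (A + l0^-1)) * (h * h) by ring.
  by rewrite /e' divfK // gt_eqF.
lra.
Qed.
End Goursat.

(** * The square contour and Cauchy's formula *)

Section SquareContour.
Variable R : realType.
Local Notation C := (R[i]).
Local Notation rc := (real_complex R).

Definition ii : C := Complex 0 1.

Lemma ii_sqr : ii * ii = -1.
Proof. by rewrite /ii; simpc. Qed.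

Lemma nc_sqr (x : C) : nc x ^+ 2 = complex.Re x ^+ 2 + complex.Im x ^+ 2.
Proof. by case: x => a b; rewrite /nc /= sqr_sqrtr // addr_ge0 ?sqr_ge0. Qed.

Lemma nc_le_sqr (x : C) (B : R) : 0 <= B -> (nc x <= B) = (nc x ^+ 2 <= B ^+ 2).
Proof. by move=> B0; rewrite ler_sqr ?nnegrE // nc_ge0. Qed.

Lemma nc_ge_sqr (x : C) (B : R) : 0 <= B -> (B <= nc x) = (B ^+ 2 <= nc x ^+ 2).
Proof. by move=> B0; rewrite ler_sqr ?nnegrE // nc_ge0. Qed.

Lemma nc_ii : nc ii = 1.
Proof. by apply/eqP; rewrite eq_le nc_le_sqr // nc_ge_sqr // nc_sqr /=; lra. Qed.

(** The square with centre 0 and half side [rho], traversed counterclockwise: every side is the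
    previous one multiplied by [ii], so one computation serves for all four. *)
Definition corner (rho : R) (s : nat) : C := rc rho * (1 - ii) * ii ^+ s.
Definition side rho s (t : R) : C := corner rho s + rc t * (corner rho s.+1 - corner rho s).

Lemma corner4 rho : corner rho 4 = corner rho 0.
Proof.
have e : ii ^+ 4 = (ii * ii) * (ii * ii) by ring.
by rewrite /corner e ii_sqr; ring.
Qed.

Lemma nc_side (rho : R) s (t : R) : 0 < rho -> 0 <= t <= 1 -> rho <= nc (side rho s t) <= 2 * rho.
Proof.
move=> r0 ht.
have -> : side rho s t = ii ^+ s * rc rho * ((1 - ii) * (1 + rc t * (ii - 1))).
  by rewrite /side /corner exprS; ring.
rewrite !ncM ncX nc_ii expr1n mul1r nc_real (gtr0_norm r0) -!ncM.
set v := (1 - ii) * _.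
have v2 : nc v ^+ 2 = 2 * ((1 - t) ^+ 2 + t ^+ 2).
  by rewrite nc_sqr /v /ii /=; ring.
have h1 : 1 <= nc v by rewrite nc_ge_sqr // v2; have := sqr_ge0 (2 * t - 1); lra.
have h2 : nc v <= 2 by rewrite nc_le_sqr // v2; have : 0 <= t * (1 - t) by [apply: mulr_ge0; lra]; lra.
rewrite ler_peMr //=; last lra.
by rewrite mulrC ler_wpM2r // ltW.
Qed.

Lemma nc_cornerB rho s : 0 < rho -> nc (corner rho s.+1 - corner rho s) = 2 * rho.
Proof.
move=> r0; have -> : corner rho s.+1 - corner rho s = rc rho * ii ^+ s * ((1 - ii) * (ii - 1)).
  by rewrite /corner exprS; ring.
rewrite ncM ncM ncX nc_ii expr1n mulr1 nc_real (gtr0_norm r0).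
have -> : (1 - ii) * (ii - 1) = 2 * ii - ii * ii - 1 by ring.
have -> : 2 * ii - ii * ii - 1 = 2 * ii by rewrite ii_sqr; ring.
by rewrite ncM nc_ii nc_nat mulr1 mulrC.
Qed.

(** Continuity is required on an annulus that contains the square, so that it can be checked without
    mentioning the parametrisation of the sides. *)
Definition acts rho (phi : C -> C) := forall w, rho <= nc w <= 2 * rho ->
  forall e : R, 0 < e -> exists2 d : R, 0 < d & forall v, nc (v - w) < d -> nc (phi v - phi w) < e.

Definition CI rho (phi : C -> C) : C :=
  \sum_(s < 4) Int01 (fun t => phi (side rho s t) * (corner rho s.+1 - corner rho s)).

Lemma icts_side rho s : icts (side rho s) 0 1.
Proof.
apply: icts_add; first exact: icts_const.
by apply: icts_mul; [exact: icts_rc|exact: icts_const].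
Qed.

Lemma acts_icts rho phi s : 0 < rho -> acts rho phi ->
  icts (fun t => phi (side rho s t) * (corner rho s.+1 - corner rho s)) 0 1.
Proof.
move=> r0 h; apply: icts_mul; last exact: icts_const.
by apply: icts_comp; [exact: icts_side|move=> t ht; apply: h; exact: nc_side].
Qed.

Lemma CI_add rho phi psi : 0 < rho -> acts rho phi -> acts rho psi ->
  CI rho (fun w => phi w + psi w) = CI rho phi + CI rho psi.
Proof.
move=> r0 h1 h2; rewrite /CI -big_split; apply: eq_bigr => s _ /=.
rewrite -Int01D; try exact: acts_icts.
by congr Int01; apply: funext => t; rewrite mulrDl.
Qed.

Lemma CI_Z rho k phi : 0 < rho -> acts rho phi -> CI rho (fun w => k * phi w) = k * CI rho phi.
Proof.
move=> r0 h1; rewrite /CI mulr_sumr; apply: eq_bigr => s _ /=.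
rewrite -Int01Z; last exact: acts_icts.
by congr Int01; apply: funext => t; rewrite mulrA.
Qed.

Lemma CI_bound rho phi B : 0 < rho -> acts rho phi ->
  (forall w, rho <= nc w <= 2 * rho -> nc (phi w) <= B) -> nc (CI rho phi) <= 8 * rho * B.
Proof.
move=> r0 h hB; apply: le_trans (nc_sum _ _ _) _.
have -> : 8 * rho * B = \sum_(s < 4) 2 * rho * B by rewrite sumr_const card_ord; ring.
apply: ler_sum => s _; apply: Int01_bound; first exact: acts_icts.
move=> t ht; rewrite ncM nc_cornerB // [leRHS]mulrC ler_wpM2r //; first lra.
by apply: hB; exact: nc_side.
Qed.

Lemma CI_ext rho phi psi : 0 < rho -> acts rho phi ->
  (forall w, rho <= nc w <= 2 * rho -> phi w = psi w) -> CI rho phi = CI rho psi.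
Proof.
move=> r0 h e; apply: eq_bigr => s _; apply: Int01_ext; first exact: acts_icts.
by move=> t ht; rewrite e //; exact: nc_side.
Qed.

Lemma acts_const rho k : acts rho (fun _ => k).
Proof. by move=> w _ e e0; exists 1 => // v _; rewrite subrr nc0. Qed.

Lemma acts_id rho : acts rho (fun w => w).
Proof. by move=> w _ e e0; exists e. Qed.

Lemma acts_add rho phi psi : acts rho phi -> acts rho psi -> acts rho (fun w => phi w + psi w).
Proof.
move=> h1 h2 w hw e e0; have e2 : 0 < e / 2 by rewrite divr_gt0.
have [r r0 hr] := h1 w hw _ e2; have [s s0 hs] := h2 w hw _ e2.
exists (Num.min r s); first by rewrite lt_min r0.
move=> v; rewrite lt_min => /andP[/hr k1 /hs k2].
by rewrite opprD addrACA; apply: le_lt_trans (ncD _ _) _; lra.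
Qed.

Lemma acts_mul rho phi psi : acts rho phi -> acts rho psi -> acts rho (fun w => phi w * psi w).
Proof.
move=> h1 h2 w hw e e0.
have H1 : ctsat (fun p : bool -> C => p true * p false) (fun t => if t then phi w else psi w).
  by apply: ctsat_mul; exact: ctsat_coord.
have [d d0 hd] := H1 _ e0; have d2 : 0 < d / 2 by rewrite divr_gt0.
have [r r0 hr] := h1 w hw _ d2; have [s s0 hs] := h2 w hw _ d2.
exists (Num.min r s); first by rewrite lt_min r0.
move=> v; rewrite lt_min => /andP[/hr k1 /hs k2].
apply: (hd (fun t => if t then phi v else psi v)).
by rewrite /n1 big_bool /= /vsub; lra.
Qed.

Lemma acts_inv rho phi : acts rho phi -> (forall w, rho <= nc w <= 2 * rho -> phi w != 0) ->
  acts rho (fun w => (phi w)^-1).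
Proof.
move=> h h0 w hw e e0; have [d d0 hd] := inv_cts (h0 w hw) e0.
by have [r r0 hr] := h w hw d d0; exists r => // v /hr/hd.
Qed.

Lemma far_neq0 rho (z w : C) : nc z <= rho / 2 -> 0 < rho -> rho <= nc w -> rho / 2 <= nc (w - z).
Proof. by move=> hz r0 hw; have := nc_ge_sub w (- z); rewrite ncN; lra. Qed.

Lemma nc_neq0 (z : C) (a : R) : 0 < a -> a <= nc z -> z != 0.
Proof. by move=> a0 h; apply: contraTneq h => ->; rewrite nc0 -ltNge. Qed.

Lemma acts_kernel rho z : 0 < rho -> nc z <= rho / 2 -> acts rho (fun w => (w - z)^-1).
Proof.
move=> r0 hz; apply: acts_inv.
  by apply: acts_add; [exact: acts_id|exact: acts_const].
move=> w /andP[hw _]; apply: (@nc_neq0 _ (rho / 2)); first by rewrite divr_gt0.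
exact: far_neq0.
Qed.

Definition holo1 (f : C -> C) (r : R) := forall z, nc z < r -> exists f', cdiff f z f'.

Lemma holo1_acts f rho : 0 < rho -> holo1 f (3 * rho) -> acts rho f.
Proof.
by move=> r0 h w hw; have [|f' /cdiff_cts //] := h w; lra.
Qed.

(** Each side is contracted towards [z] with final factor [l0]. By [homotopy_side] the integral
    changes by terms attached to the corners, which telescope around the square. On the contracted
    square [f] differs from [f z] by at most [e], and the form [dv / (v - z)] is invariant under the
    contraction. *)
Lemma cauchy_square f rho z : 0 < rho -> holo1 f (3 * rho) -> nc z <= rho / 2 ->
  CI rho (fun w => f w * (w - z)^-1) = f z * CI rho (fun w => (w - z)^-1).
Proof.
move=> r0 hf hz.
have [f' dfz] : exists f', cdiff f z f' by apply: hf; lra.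
suff H e : 0 < e -> nc (CI rho (fun w => f w * (w - z)^-1) - f z * CI rho (fun w => (w - z)^-1)) <= 16 * e.
  apply/eqP; rewrite -subr_eq0; apply/eqP/nc_eq0/eqP; rewrite eq_le nc_ge0 andbT.
  by apply/ler_addgt0Pr => e e0; have e16 : 0 < e / 16 by [lra]; have := H _ e16; lra.
move=> e0; have [d d0 hd] := cdiff_cts dfz e0.
(* A point of a side has distance at most [5/2 * rho] from [z], so [l0 * (6 * rho) <= d] puts the
   contracted side inside the disc where [f] is within [e] of [f z]. *)
pose l0 := Num.min (1 / 2) (d / (6 * rho)).
have hl : 0 < l0 < 1.
  have k : 0 < d / (6 * rho) by rewrite divr_gt0 // mulr_gt0.
  by rewrite lt_min k andbT gt_min; lra.
have hl2 : l0 * (6 * rho) <= d by rewrite -ler_pdivlMr ?mulr_gt0 // ge_min lexx orbT.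
have hl3 : l0 <= 1 / 2 by rewrite ge_min lexx.
clearbody l0.
pose G (k : C) := Int01 (fun s => f (z + rc (l0 + (1 - l0) * s) * (k - z)) * (rc (1 - l0) / rc (l0 + (1 - l0) * s))).
pose K s := Int01 (fun t => f (z + rc l0 * (side rho s t - z)) * ((corner rho s.+1 - corner rho s) / (side rho s t - z))).
have sideH s : Int01 (fun t => f (side rho s t) * (side rho s t - z)^-1 * (corner rho s.+1 - corner rho s)) - K s = G (corner rho s.+1) - G (corner rho s).
  have := @homotopy_side R f z (corner rho s) (corner rho s.+1) l0 (rho / 2) hl.
  move=> /(_ (divr_gt0 r0 (ltr0Sn _ 1))) H.
  rewrite /G /K.
  have E1 : (fun t => f (side rho s t) * (side rho s t - z)^-1 * (corner rho s.+1 - corner rho s)) =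
    (fun t => f (z + rc (l0 + (1 - l0) * 1) * (side rho s t - z)) * ((corner rho s.+1 - corner rho s) / (side rho s t - z))).
    apply: funext => t; rewrite (_ : l0 + (1 - l0) * 1 = 1); last by ring.
    rewrite rmorph1 mul1r subrKC; ring.
  have E2 : rc l0 = rc (l0 + (1 - l0) * 0) by rewrite mulr0 addr0.
  rewrite E1 E2 {}H.
  - congr (_ - _); congr Int01; apply: funext => t.
      by rewrite rmorph1 mul1r subrKC.
    by rewrite rmorph0 mul0r addr0.
  - by move=> t /(nc_side s r0)/andP[h _]; exact: far_neq0.
  move=> u t hu ht; apply: hf.
  rewrite -/(side rho s t); have /andP[_ hs] := nc_side s r0 ht.
  have -> : z + rc (l0 + (1 - l0) * u) * (side rho s t - z) =
     rc (1 - (l0 + (1 - l0) * u)) * z + rc (l0 + (1 - l0) * u) * side rho s t by ring.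
  have hla : 0 <= l0 + (1 - l0) * u <= 1.
    have a1 : 0 <= (1 - l0) * u by apply: mulr_ge0; lra.
    have a2 : (1 - l0) * u <= 1 - l0 by rewrite ler_piMr; lra.
    lra.
  move: (l0 + _) hla => la hla.
  apply: le_lt_trans (ncD _ _) _; rewrite !ncM !nc_real !ger0_norm; try lra.
  have k1 : (1 - la) * nc z <= nc z by rewrite ler_piMl ?nc_ge0 //; lra.
  have k2 : la * nc (side rho s t) <= nc (side rho s t) by rewrite ler_piMl ?nc_ge0 //; lra.
  lra.
have tele : CI rho (fun w => f w * (w - z)^-1) = \sum_(s < 4) K s.
  apply/eqP; rewrite -subr_eq0 /CI -sumrB; under eq_bigr do rewrite sideH.
  by rewrite !big_ord_recr big_ord0 /= corner4; apply/eqP; ring.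
rewrite tele /CI mulr_sumr -sumrB; apply: le_trans (nc_sum _ _ _) _.
have -> : 16 * e = \sum_(s < 4) 4 * e by rewrite sumr_const card_ord; ring.
apply: ler_sum => s _.
have ia := acts_icts s r0 (acts_kernel r0 hz).
have ib : icts (fun t => f (z + rc l0 * (side rho s t - z)) * ((corner rho s.+1 - corner rho s) / (side rho s t - z))) 0 1.
  apply: icts_mul; last first.
    by move: ia; congr icts; apply: funext => t; rewrite mulrC.
  apply: icts_comp.
    apply: icts_add; first exact: icts_const.
    apply: icts_mul; first exact: icts_const.
    by apply: icts_add; [exact: icts_side|exact: icts_const].
  move=> t /(nc_side s r0)/andP[_ hs].
  have [|g' /cdiff_cts //] := hf (z + rc l0 * (side rho s t - z)).
  apply: le_lt_trans (ncD _ _) _; rewrite ncM nc_real ger0_norm; last lra.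
  have := ncB (side rho s t) z => k.
  have : l0 * nc (side rho s t - z) <= 1 / 2 * (5 / 2 * rho).
    by apply: ler_pM; rewrite ?nc_ge0 //; lra.
  lra.
rewrite /K -Int01Z // -[X in _ - X]opprK -[X in - - X]mulN1r -Int01Z; last first.
  by apply: icts_mul; [exact: icts_const|].
rewrite opprK -Int01D //; last by do 2! (apply: icts_mul; first exact: icts_const).
apply: Int01_bound; first by apply: icts_add => //; do 2! (apply: icts_mul; first exact: icts_const).
move=> t ht; have /andP[s1 s2] := nc_side s r0 ht.
have hfar := far_neq0 hz r0 s1.
have -> : f (z + rc l0 * (side rho s t - z)) * ((corner rho s.+1 - corner rho s) / (side rho s t - z)) +
   -1 * (f z * ((side rho s t - z)^-1 * (corner rho s.+1 - corner rho s))) =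
   (f (z + rc l0 * (side rho s t - z)) - f z) * ((corner rho s.+1 - corner rho s) / (side rho s t - z)) by ring.
rewrite ncM mulrC ler_pM ?nc_ge0 //.
  rewrite ncM nc_cornerB // ncV ler_pdivrMr; last by apply: lt_le_trans hfar; rewrite divr_gt0.
  lra.
apply/ltW/hd; rewrite addrC addKr ncM nc_real ger0_norm; last lra.
have := ncB (side rho s t) z => k; apply: lt_le_trans hl2.
by rewrite ltr_pM2l; lra.
Qed.
End SquareContour.

(** * Taylor estimates of first and second order in one variable *)

Section CauchyEstimates.
Variable R : realType.
Local Notation C := (R[i]).
Local Notation rc := (real_complex R).

(** The classical value is 2 pi i. Cauchy's formula is divided by this factor, for which the lower
    bound of [Lam_ge] is the relevant information. *)
Definition Lam rho z : C := CI rho (fun w => (w - z)^-1).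

(** By rotation all four sides give the same integral of [phi]. The values of [phi] lie on the
    circle of radius 1 around [i] and have imaginary part between 1 and 2, hence within 6/5 of
    [3/2 * i]. This leaves a modulus of at least 3/10 per side. *)
Lemma Lam0_ge (rho : R) : 0 < rho -> 6 / 5 <= nc (Lam rho 0).
Proof.
move=> r0; pose phi (t : R) := (ii R - 1) / (1 + rc t * (ii R - 1)).
have nz t : 0 <= t <= 1 -> 1 + rc t * (ii R - 1) != 0.
  move=> ht; apply/eqP => /(congr1 (fun u => nc u ^+ 2)).
  rewrite nc0 nc_sqr /ii /= => H.
  have : (1 - t) ^+ 2 + t ^+ 2 = 0 by rewrite -[RHS](expr0n _ 2) -{}H; ring.
  by have := sqr_ge0 (1 - t); have := sqr_ge0 t; have := sqr_ge0 (2 * t - 1); lra.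
have cphi : icts phi 0 1.
  apply: icts_mul; first exact: icts_const.
  apply: icts_inv => //; apply: icts_add; first exact: icts_const.
  by apply: icts_mul; [exact: icts_rc|exact: icts_const].
have cr0 : rc rho != 0 by apply/eqP => /(congr1 (@nc R)); rewrite nc_real nc0 gtr0_norm //; lra.
have i1 : 1 - ii R != 0.
  by apply/eqP => /(congr1 (@complex.Re R)) /=; rewrite subr0 => /eqP; rewrite oner_eq0.
have i0 : ii R != 0.
  by apply/eqP => /(congr1 (@complex.Im R)) /=; move/eqP; rewrite oner_eq0.
have E : Lam rho 0 = 4 * Int01 phi.
  rewrite /Lam /CI; transitivity (\sum_(s < 4) Int01 phi); last first.
    by rewrite sumr_const card_ord mulr_natl.
  apply: eq_bigr => s _; symmetry; apply: Int01_ext => // t ht.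
  have aux (K D x : C) : K != 0 -> D != 0 -> x / D = (K * D)^-1 * (K * x).
    by move=> K0 D0; field; rewrite K0 D0.
  rewrite /phi (aux (rc rho * (1 - ii R) * ii R ^+ s)) ?nz ?mulf_neq0 ?expf_neq0 //.
  by rewrite /side /corner exprS; congr (_^-1 * _); ring.
have B : nc (Int01 phi - rc (3 / 2) * ii R) <= 6 / 5.
  have -> : Int01 phi - rc (3 / 2) * ii R = Int01 (fun t => phi t + - (rc (3 / 2) * ii R)).
    by rewrite Int01D ?Int01_const //; exact: icts_const.
  apply: Int01_bound; first by apply: icts_add => //; exact: icts_const.
  move=> t ht; pose q := (1 - t) ^+ 2 + t ^+ 2.
  have q1 : 1 / 2 <= q by rewrite /q; have := sqr_ge0 (2 * t - 1); lra.
  have q2 : q <= 1 by rewrite /q; have : 0 <= t * (1 - t) by [apply: mulr_ge0; lra]; lra.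
  have -> : phi t = Complex ((2 * t - 1) / q) (1 / q).
    rewrite /phi; apply: (mulIf (nz t ht)); rewrite divfK; last exact: nz.
    apply/eqP; rewrite eq_complex /ii /=; apply/andP; split; apply/eqP; rewrite /q; field;
    by rewrite gt_eqF //; rewrite -/q; lra.
  rewrite nc_le_sqr; last lra.
  rewrite nc_sqr /ii /=.
  rewrite !(mulr0, mul0r, subr0, mulr1, addr0).
  have X1 : 2 * q = 1 + (2 * t - 1) ^+ 2 by rewrite /q; ring.
  have X2 : 1 <= 1 / q by rewrite ler_pdivlMr; lra.
  have -> : ((2 * t - 1) / q) ^+ 2 = 2 * (1 / q) - (1 / q) ^+ 2.
    have -> : (2 * t - 1) / q = (2 * t - 1) * (1 / q) by rewrite mul1r.
    rewrite exprMn (_ : (2 * t - 1) ^+ 2 = 2 * q - 1); last lra.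
    have : q * (1 / q) = 1 by rewrite mul1r mulfV // gt_eqF //; lra.
    move: (1 / q) => y hy; have -> : (2 * q - 1) * y ^+ 2 = 2 * (q * y) * y - y ^+ 2 by ring.
    by rewrite hy; ring.
  move: (1 / q) X2 => y X2.
  nra.
rewrite E ncM nc_nat.
have := nc_ge_sub (rc (3 / 2) * ii R) (Int01 phi - rc (3 / 2) * ii R); rewrite subrKC ncM nc_ii.
rewrite nc_real ger0_norm; last lra.
lra.
Qed.

Lemma Lam_ge (rho : R) z : 0 < rho -> nc z <= rho / 32 -> 3 / 5 <= nc (Lam rho z).
Proof.
move=> r0 hz.
have az := acts_kernel r0 (ltac:(lra) : nc z <= rho / 2).
have a0 := acts_kernel r0 (ltac:(rewrite nc0; lra) : nc (0 : C) <= rho / 2).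
have am : acts rho (fun w : C => -1 * (w - 0)^-1) by apply: acts_mul => //; exact: acts_const.
have K : nc (Lam rho z - Lam rho 0) <= 8 * rho * (nc z * 2 / rho / rho).
  have -> : Lam rho z - Lam rho 0 = CI rho (fun w => (w - z)^-1 + -1 * (w - 0)^-1).
    by rewrite CI_add // CI_Z // mulN1r.
  apply: CI_bound => //; first exact: acts_add.
  move=> w /andP[hw _].
  have hf := far_neq0 (ltac:(lra) : nc z <= rho / 2) r0 hw.
  have n1 : w - z != 0 by apply: nc_neq0 hf; rewrite divr_gt0.
  have n2 : w != 0 by apply: nc_neq0 hw.
  have -> : (w - z)^-1 + -1 * (w - 0)^-1 = z / (w - z) / w by field; rewrite n1 n2.
  rewrite !ncM !ncV -!mulrA ler_wpM2l ?nc_ge0 //.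
  rewrite mulrA ler_pM ?invr_ge0 ?nc_ge0 //.
    by rewrite -[leRHS]invrK lef_pV2 ?posrE ?invr_gt0 ?divr_gt0 ?(lt_le_trans _ hf) ?divr_gt0 // invfM invrK mulrC.
  by rewrite lef_pV2 ?posrE // (lt_le_trans r0).
have := Lam0_ge r0; have := nc_ge_sub (Lam rho 0) (Lam rho z - Lam rho 0); rewrite subrKC.
have : 8 * rho * (nc z * 2 / rho / rho) <= 1 / 2.
  rewrite (_ : _ * _ = 16 * (nc z / rho)); last by field; rewrite gt_eqF.
  have : nc z / rho <= 1 / 32 by rewrite ler_pdivrMr //; lra.
  lra.
lra.
Qed.

Lemma holo1_sub (f : C -> C) r (k : C) : holo1 f r -> holo1 (fun w => f w - k) r.
Proof.
move=> h z /h[f' hf]; exists f' => e /hf[d d0 hd]; exists d => // v /hd.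
by rewrite (_ : f v - k - (f z - k) = f v - f z) //; ring.
Qed.

(** Cauchy's formula for [f - f 0] is taken at [z] and at 0, where the integral vanishes; the two
    kernels differ by [z / (w * (w - z))]. *)
Lemma division1 (f : C -> C) (rho : R) z : 0 < rho -> holo1 f (3 * rho) -> nc z <= rho / 2 ->
  (f z - f 0) * Lam rho z = z * CI rho (fun w => (f w - f 0) * (w^-1 * (w - z)^-1)).
Proof.
move=> r0 hf hz; have hg := holo1_sub (f 0) hf.
have := cauchy_square r0 hg hz; rewrite -/(Lam rho z) => <-.
have h0 : nc (0 : C) <= rho / 2 by rewrite nc0 divr_ge0 // ltW.
have := cauchy_square r0 hg h0; rewrite subrr mul0r => C0.
have ag := holo1_acts r0 hg.
have a1 : acts rho (fun w => (f w - f 0) * (w^-1 * (w - z)^-1)).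
  apply: acts_mul => //; apply: acts_mul; last exact: acts_kernel.
  by have := acts_kernel r0 h0; congr acts; apply: funext => w; rewrite subr0.
rewrite -CI_Z // -[RHS]add0r -[X in _ = X + _]C0 -CI_add //; first last.
- by apply: acts_mul => //; exact: acts_const.
- by apply: acts_mul => //; exact: acts_kernel.
apply: CI_ext => //; first by apply: acts_mul => //; exact: acts_kernel.
move=> w /andP[hw _].
have n1 : w - z != 0 by apply: nc_neq0 (far_neq0 hz r0 hw); rewrite divr_gt0.
have n2 : w != 0 by apply: nc_neq0 hw.
rewrite subr0; field; by rewrite n1 n2.
Qed.

Lemma CI_kernel_bound (g : C -> C) (rho : R) z (G : R) : 0 < rho -> acts rho g -> nc z <= rho / 2 ->
  (forall w, rho <= nc w <= 2 * rho -> nc (g w) <= G) ->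
  nc (CI rho (fun w => g w * (w^-1 * (w - z)^-1))) <= 16 * G / rho.
Proof.
move=> r0 ag hz hG.
have h0 : nc (0 : C) <= rho / 2 by rewrite nc0 divr_ge0 // ltW.
have a1 : acts rho (fun w => g w * (w^-1 * (w - z)^-1)).
  apply: acts_mul => //; apply: acts_mul; last exact: acts_kernel.
  by have := acts_kernel r0 h0; congr acts; apply: funext => w; rewrite subr0.
have := @CI_bound R rho _ (G * (rho^-1 * (2 / rho))) r0 a1.
rewrite (_ : 8 * rho * (G * (rho^-1 * (2 / rho))) = 16 * G / rho); last by field; rewrite gt_eqF.
apply=> w hwr; have /andP[hw _] := hwr.
rewrite !ncM !ncV ler_pM ?mulr_ge0 ?invr_ge0 ?nc_ge0 ?hG //.
rewrite ler_pM ?invr_ge0 ?nc_ge0 //; first by rewrite lef_pV2 ?posrE // (lt_le_trans r0).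
have hf := far_neq0 hz r0 hw.
rewrite -[leRHS]invrK lef_pV2 ?posrE ?invr_gt0 ?divr_gt0 ?(lt_le_trans _ hf) ?divr_gt0 //.
by rewrite invfM invrK mulrC.
Qed.

Lemma cauchy_est1 (f : C -> C) (rho B : R) z : 0 < rho -> holo1 f (3 * rho) ->
  (forall w, nc w < 3 * rho -> nc (f w) <= B) -> nc z <= rho / 32 ->
  nc (f z - f 0) <= 64 * B * nc z / rho.
Proof.
move=> r0 hf hB hz; have hz2 : nc z <= rho / 2 by lra.
have := congr1 (@nc R) (division1 r0 hf hz2); rewrite !ncM => E.
have B0 : 0 <= B by apply: le_trans (nc_ge0 (f 0)) (hB _ _); rewrite nc0 mulr_gt0.
have K : nc (CI rho (fun w => (f w - f 0) * (w^-1 * (w - z)^-1))) <= 16 * (2 * B) / rho.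
  apply: CI_kernel_bound => //; first exact: holo1_acts (holo1_sub _ hf).
  move=> w hw; have h1 := hB w ltac:(lra).
  have h2 : nc (f 0) <= B by apply: hB; rewrite nc0 mulr_gt0.
  by have := ncB (f w) (f 0); lra.
have L := Lam_ge r0 hz.
have h3 : nc (f z - f 0) * (3 / 5) <= nc z * (16 * (2 * B) / rho).
  apply: (@le_trans _ _ (nc (f z - f 0) * nc (Lam rho z))); first by rewrite ler_wpM2l ?nc_ge0.
  by rewrite E ler_wpM2l ?nc_ge0.
have -> : 64 * B * nc z / rho = 2 * (nc z * (16 * (2 * B) / rho)) by field; rewrite gt_eqF.
have : 0 <= nc z * (16 * (2 * B) / rho) by apply: le_trans h3; apply: mulr_ge0; [exact: nc_ge0|lra].
lra.
Qed.

Lemma cdiff_bound (f : C -> C) (M d : R) f' : 0 < d -> cdiff f 0 f' ->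
  (forall z, nc z < d -> nc (f z - f 0) <= M * nc z) -> nc f' <= M.
Proof.
move=> d0 hf hM; apply/ler_addgt0Pr => e e0; have [s s0 hs] := hf e e0.
pose t := Num.min (d / 2) (s / 2).
have t0 : 0 < t by rewrite lt_min !divr_gt0.
have td : t < d by rewrite gt_min; lra.
have ts : t < s by rewrite gt_min; lra.
clearbody t.
have nt : nc (rc t) = t by rewrite nc_real gtr0_norm.
have := hs (rc t); have := hM (rc t); rewrite subr0 nt => /(_ td) h1 /(_ ts) h2.
have := ncB (f (rc t) - f 0) (f (rc t) - f 0 - f' * rc t).
rewrite opprB addrC subrK ncM nt => h3.
by rewrite -(ler_pM2r t0); lra.
Qed.

(** For the remainder [g] of the affine part, [division1] is split once more by
    [1/(w - u) = 1/w + u/(w * (w - u))]. This gives [key], whose term of first order has the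
    coefficient [c2], a multiple of the derivative of [g] at 0. *)
Lemma cauchy_est2 (f : C -> C) (rho B : R) f' z : 0 < rho -> holo1 f (3 * rho) ->
  (forall w, nc w < 3 * rho -> nc (f w) <= B) -> cdiff f 0 f' -> nc z <= rho / 32 ->
  nc (f z - f 0 - f' * z) <= 4000 * B * nc z ^+ 2 / rho ^+ 2.
Proof.
move=> r0 hf hB df hz.
have B0 : 0 <= B by apply: le_trans (nc_ge0 (f 0)) (hB _ _); rewrite nc0 mulr_gt0.
have F' : nc f' <= 64 * B / rho.
  have d0 : 0 < rho / 32 by rewrite divr_gt0.
  apply: (cdiff_bound d0 df) => u hu.
  have := cauchy_est1 r0 hf hB (ltW hu); rewrite (_ : 64 * B / rho * nc u = 64 * B * nc u / rho) //; ring.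
pose g w := f w - f 0 - f' * w.
have hg : holo1 g (3 * rho).
  move=> w /hf[g' hg']; exists (g' - f') => e /hg'[d d0 hd]; exists d => // v /hd.
  by rewrite /g (_ : f v - f 0 - f' * v - (f w - f 0 - f' * w) - (g' - f') * (v - w) = f v - f w - g' * (v - w)) //; ring.
have g0 : g 0 = 0 by rewrite /g subrr mulr0 subrr.
have ag := holo1_acts r0 hg.
have gB w : rho <= nc w <= 2 * rho -> nc (g w) <= 130 * B.
  move=> hw; have h1 := hB w ltac:(lra).
  have h2 : nc (f 0) <= B by apply: hB; rewrite nc0 mulr_gt0.
  have h3 : nc f' * nc w <= 64 * B / rho * (2 * rho) by apply: ler_pM; rewrite ?nc_ge0 //; lra.
  rewrite (_ : _ * (2 * rho) = 128 * B) in h3; last by field; rewrite gt_eqF.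
  rewrite -ncM in h3.
  by have := ncB (f w) (f 0); have := ncB (f w - f 0) (f' * w); rewrite -/(g w); lra.
have h0 : nc (0 : C) <= rho / 2 by rewrite nc0 divr_ge0 // ltW.
have aV : acts rho (fun w => w^-1).
  by have := acts_kernel r0 h0; congr acts; apply: funext => w; rewrite subr0.
pose g2 w := g w * w^-1.
have ag2 : acts rho g2 by exact: acts_mul.
have g2B w : rho <= nc w <= 2 * rho -> nc (g2 w) <= 130 * B / rho.
  move=> hw; rewrite ncM ncV ler_pM ?invr_ge0 ?nc_ge0 ?gB // lef_pV2 ?posrE //; first lra.
  by apply: lt_le_trans r0 _; lra.
pose T u := CI rho (fun w => g2 w * (w^-1 * (w - u)^-1)).
have TB u : nc u <= rho / 2 -> nc (T u) <= 16 * (130 * B / rho) / rho.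
  by move=> hu; exact: CI_kernel_bound.
pose c2 := CI rho (fun w => g2 w * w^-1).
have key u : nc u <= rho / 32 -> g u * Lam rho u = u * c2 + u * (u * T u).
  move=> hu; have hu2 : nc u <= rho / 2 by lra.
  have := division1 r0 hg hu2; rewrite g0 subr0 => ->.
  have au := acts_kernel r0 hu2.
  rewrite -mulrDr; congr (u * _).
  rewrite /T /c2 -CI_Z; [|by []|by apply: acts_mul => //; exact: acts_mul].
  rewrite -CI_add //; [|exact: acts_mul|].
    apply: CI_ext => //; first by do ![apply: acts_mul => //]; apply: acts_add => //; exact: acts_const.
    move=> w /andP[hw _].
    have n1 : w - u != 0 by apply: nc_neq0 (far_neq0 hu2 r0 hw); rewrite divr_gt0.
    have n2 : w != 0 by apply: nc_neq0 hw.
    by rewrite /g2 subr0; field; rewrite n1 n2.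
  by apply: acts_mul; [exact: acts_const|apply: acts_mul => //; exact: acts_mul].
have dg : cdiff g 0 0.
  move=> e /df[d d0 hd]; exists d => // v /hd.
  by rewrite !subr0 mul0r subr0 g0 subr0.
pose LB := 8 * rho * (2 / rho).
have LamB u : nc u <= rho / 2 -> nc (Lam rho u) <= 16.
  move=> hu; have -> : 16 = 8 * rho * (2 / rho) by field; rewrite gt_eqF.
  apply: CI_bound => //; first exact: acts_kernel.
  move=> w /andP[hw _]; have hf2 := far_neq0 hu r0 hw.
  by rewrite ncV -[leRHS]invrK lef_pV2 ?posrE ?invr_gt0 ?divr_gt0 ?(lt_le_trans _ hf2) ?divr_gt0 // invfM invrK mulrC.
(* Since [g] is o(u) and the last term of [key] is O(u^2), dividing by [u = t] and letting [t] tend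
   to 0 leaves only [c2]. *)
have c20 : c2 = 0.
  apply: nc_eq0; apply/eqP; rewrite eq_le nc_ge0 andbT; apply/ler_addgt0Pr => e e0.
  have e1 : 0 < e / 32 by rewrite divr_gt0.
  have [d d0 hd] := dg _ e1.
  pose M := 16 * (130 * B / rho) / rho.
  have M0 : 0 <= M by apply: le_trans (nc_ge0 (T 0)) (TB _ h0).
  pose t := Num.min (d / 2) (Num.min (rho / 32) (e / 2 / (M + 1))).
  have t0 : 0 < t by rewrite !lt_min !divr_gt0 // ltr_wpDl.
  have td : t < d by rewrite gt_min; lra.
  have tr : t <= rho / 32 by rewrite !ge_min lexx orbT.
  have tM : t * M <= e / 2.
    have : t * (M + 1) <= e / 2 by rewrite -ler_pdivlMr ?ltr_wpDl // !ge_min lexx !orbT.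
    by apply: le_trans; rewrite ler_pM2l //; lra.
  clearbody t; have nt : nc (rc t) = t by rewrite nc_real gtr0_norm.
  have tn : rc t != 0 by apply: (@nc_neq0 _ _ t) => //; rewrite nt.
  have := key (rc t); rewrite nt => /(_ tr) E.
  have h1 := hd (rc t); rewrite subr0 nt mul0r g0 !subr0 in h1; have h2 := h1 td.
  have h3 : nc (g (rc t) * Lam rho (rc t)) <= e / 32 * t * 16.
    by rewrite ncM ler_pM ?nc_ge0 // LamB // nt; lra.
  have h4 : nc (rc t * (rc t * T (rc t))) <= t * (t * M).
    by rewrite !ncM nt !ler_pM2l // TB // nt; lra.
  have h5 : nc (rc t * c2) <= e / 32 * t * 16 + t * (t * M).
    have -> : rc t * c2 = g (rc t) * Lam rho (rc t) - rc t * (rc t * T (rc t)) by rewrite E; ring.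
    by apply: le_trans (ncB _ _) _; lra.
  rewrite ncM nt in h5; rewrite -(ler_pM2l t0).
  have : t * (t * M) <= t * (e / 2) by rewrite ler_pM2l.
  lra.
have := congr1 (@nc R) (key z hz); rewrite c20 mulr0 add0r !ncM => E.
have L := Lam_ge r0 hz; have TBz := TB z ltac:(lra).
have h3 : nc (g z) * (3 / 5) <= nc z * (nc z * (16 * (130 * B / rho) / rho)).
  apply: (@le_trans _ _ (nc (g z) * nc (Lam rho z))); first by rewrite ler_wpM2l ?nc_ge0.
  by rewrite E !ler_wpM2l ?nc_ge0.
rewrite -/(g z).
have -> : 4000 * B * nc z ^+ 2 / rho ^+ 2 = 4000 / 2080 * (nc z * (nc z * (16 * (130 * B / rho) / rho))).
  by field; rewrite gt_eqF.
have : 0 <= nc z * (nc z * (16 * (130 * B / rho) / rho)) by apply: le_trans h3; apply: mulr_ge0; [exact: nc_ge0|lra].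
lra.
Qed.
End CauchyEstimates.

(** * Holomorphic functions of several variables *)

Section Holo.
Variable R : realType.
Local Notation C := (R[i]).
Local Notation rc := (real_complex R).

Definition hat (I : finType) (h : (I -> C) -> C) (z : I -> C) (L : I -> C) :=
  forall e : R, 0 < e -> exists2 d : R, 0 < d & forall x, n1 (vsub x z) < d ->
    nc (h x - h z - \sum_i L i * (x i - z i)) <= e * n1 (vsub x z).

Lemma holo_atE (I : finType) (h : (I -> C) -> C) z : holo_at h z <-> exists L, hat h z L.
Proof.
split=> [[L hL]|[L hL]]; exists L => e e0.
  have [d d0 hd] := hL e e0; exists d => // x hx.
  have := hd (vsub x z) (le_lt_trans (cnorm_le_n1 _) hx); rewrite vsubK => /le_trans; apply.
  by rewrite ler_wpM2l ?cnorm_le_n1 // ltW.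
have K0 : 0 < #|I|%:R + 1 :> R by rewrite ltr_wpDl // ler0n.
have [d d0 hd] := hL (e / (#|I|%:R + 1)) (divr_gt0 e0 K0).
exists (d / (#|I|%:R + 1)); first by rewrite divr_gt0.
move=> v; rewrite ltr_pdivlMr // => hv.
have cv := cnorm_ge0 v; have nv := n1_le_cnorm v.
have kk : #|I|%:R * cnorm v <= cnorm v * (#|I|%:R + 1) by rewrite mulrC ler_wpM2l //; lra.
have := hd (vadd z v); rewrite vaddK => /(_ (le_lt_trans nv (le_lt_trans kk hv))) h1.
have -> : \sum_i L i * v i = \sum_i L i * (vadd z v i - z i).
  by apply: eq_bigr => i _; rewrite /vadd addrC addKr.
apply: le_trans h1 _; rewrite -mulrA ler_pM2l // mulrC ler_pdivrMr //.
exact: le_trans nv kk.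
Qed.

Lemma holo_nearE (I : finType) (h : (I -> C) -> C) p :
  holo_near h p <-> near p (fun z => exists L, hat h z L).
Proof.
rewrite /holo_near; split=> [/nearE hn|hn].
  by apply: near_imp hn _ => z /holo_atE.
by apply/nearE; apply: near_imp hn _ => z /holo_atE.
Qed.

Lemma eq_nearE (I : finType) T (h1 h2 : (I -> C) -> T) p :
  eq_near h1 h2 p <-> near p (fun z => h1 z = h2 z).
Proof. exact: nearE. Qed.

Lemma hat_ext (I : finType) (h g : (I -> C) -> C) z L :
  near z (fun x => h x = g x) -> hat h z L -> hat g z L.
Proof.
move=> hn H e e0; have [d d0 hd] := H e e0; have [r r0 hr] := hn.
exists (Num.min d r); first by rewrite lt_min d0.
move=> x; rewrite lt_min => /andP[/hd k /hr <-]; by rewrite -(near_self hn).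
Qed.

Lemma hat_lip (I : finType) (h : (I -> C) -> C) z L : hat h z L ->
  near z (fun x => nc (h x - h z) <= (n1 L + 1) * n1 (vsub x z)).
Proof.
move=> H; have [d d0 hd] := H 1 ltr01; exists d => // x /hd k.
have -> : h x - h z = (h x - h z - \sum_i L i * (x i - z i)) + \sum_i L i * (x i - z i) by ring.
apply: le_trans (ncD _ _) _; rewrite mulrDl addrC lerD //.
apply: le_trans (nc_sum _ _ _) _; rewrite /n1 mulr_suml ler_sum // => i _.
rewrite ncM ler_wpM2l ?nc_ge0 //; exact: (le_n1 (vsub x z)).
Qed.

Lemma hat_cts (I : finType) (h : (I -> C) -> C) z L : hat h z L -> ctsat h z.
Proof.
move=> /hat_lip H e e0; have L0 := n1_ge0 L.
have k0 : 0 < e / (n1 L + 2) by rewrite divr_gt0 //; lra.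
apply: near_imp (near_and H (near_ball z k0)) _ => x [h1].
rewrite ltr_pdivlMr; last lra.
move=> h2; apply: le_lt_trans h1 _; apply: le_lt_trans h2.
by rewrite mulrC ler_wpM2l ?n1_ge0 //; lra.
Qed.

Lemma hat_comp (I J : finType) (h : (J -> C) -> C) (phi : (I -> C) -> J -> C) z L M :
  hat h (phi z) L -> (forall j, hat (fun x => phi x j) z (M j)) ->
  hat (fun x => h (phi x)) z (fun i => \sum_j L j * M j i).
Proof.
move=> hL hM e e0.
pose N := \sum_j (n1 (M j) + 1).
have N0 : 0 <= N by apply: sumr_ge0 => j _; rewrite addr_ge0 // n1_ge0.
have lipN : near z (fun x => n1 (vsub (phi x) (phi z)) <= N * n1 (vsub x z)).
  have := near_all (fun j => hat_lip (hM j)); move/near_imp; apply=> x hx.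
  by rewrite /N mulr_suml {1}/n1; apply: ler_sum => j _; exact: hx.
have L0 := n1_ge0 L.
pose e1 := e / 2 / (N + 1); pose e2 := e / 2 / (n1 L + 1).
have e10 : 0 < e1 by rewrite !divr_gt0 //; lra.
have e20 : 0 < e2 by rewrite !divr_gt0 //; lra.
have [d1 d10 hd1] := hL e1 e10.
have K := near_all (fun j => (hM j) e2 e20 : near z _).
have [d d0 hd] : near z (fun x => nc (h (phi x) - h (phi z) - \sum_i (\sum_j L j * M j i) * (x i - z i)) <= e * n1 (vsub x z)); last by exists d.
have s0 : 0 < d1 / (N + 1) by rewrite divr_gt0 //; lra.
apply: near_imp (near_and (near_and lipN K) (near_ball z s0)) _ => x [[h1 h2] h3].
rewrite ltr_pdivlMr in h3; last lra.
have nx := n1_ge0 (vsub x z).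
have h4 : n1 (vsub (phi x) (phi z)) < d1.
  by apply: le_lt_trans h1 _; apply: le_lt_trans h3; rewrite mulrC ler_wpM2l //; lra.
have h5 := hd1 _ h4.
have E : \sum_i (\sum_j L j * M j i) * (x i - z i) = \sum_j L j * (\sum_i M j i * (x i - z i)).
  under [RHS]eq_bigr do rewrite mulr_sumr.
  rewrite exchange_big /=; apply: eq_bigr => i _; rewrite mulr_suml.
  by apply: eq_bigr => j _; rewrite mulrA.
have -> : h (phi x) - h (phi z) - \sum_i (\sum_j L j * M j i) * (x i - z i) =
  (h (phi x) - h (phi z) - \sum_j L j * (phi x j - phi z j)) +
  \sum_j L j * (phi x j - phi z j - \sum_i M j i * (x i - z i)).
  rewrite E; have -> : \sum_j L j * (phi x j - phi z j - \sum_i M j i * (x i - z i)) =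
    \sum_j L j * (phi x j - phi z j) - \sum_j L j * (\sum_i M j i * (x i - z i)).
    by rewrite -sumrB; apply: eq_bigr => j _; rewrite mulrBr.
  by ring.
apply: le_trans (ncD _ _) _.
have k1 : e1 * n1 (vsub (phi x) (phi z)) <= e / 2 * n1 (vsub x z).
  apply: le_trans (ler_wpM2l (ltW e10) h1) _; rewrite mulrA ler_wpM2r //.
  rewrite /e1 mulrAC ler_pdivrMr; last lra.
  by rewrite ler_pM2l ?divr_gt0 //; lra.
have k2 : nc (\sum_j L j * (phi x j - phi z j - \sum_i M j i * (x i - z i))) <= e / 2 * n1 (vsub x z).
  apply: le_trans (nc_sum _ _ _) _.
  apply: (@le_trans _ _ (n1 L * (e2 * n1 (vsub x z)))).
    by rewrite /n1 mulr_suml ler_sum // => j _; rewrite ncM ler_wpM2l ?nc_ge0 ?h2.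
  rewrite mulrA ler_wpM2r // /e2 mulrCA ler_piMr ?divr_ge0 ?ltW //.
  by rewrite ltr_pdivrMr; lra.
lra.
Qed.

Lemma hat_const (I : finType) (k : C) (z : I -> C) : hat (fun _ => k) z (fun _ => 0).
Proof.
move=> e e0; exists 1 => // x _; rewrite subrr sub0r ncN big1 ?nc0.
  by rewrite mulr_ge0 ?n1_ge0 // ltW.
by move=> i _; rewrite mul0r.
Qed.

Lemma hat_coord (I : finType) (j : I) (z : I -> C) : hat (fun x => x j) z (fun i => (i == j)%:R).
Proof.
move=> e e0; exists 1 => // x _; rewrite (bigD1 j) //= eqxx mul1r big1 => [|i /negPf->].
  by rewrite addr0 subrr nc0 mulr_ge0 ?n1_ge0 // ltW.
by rewrite mul0r.
Qed.

(** Addition and multiplication are treated as functions on [bool -> C], so that the sum and product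
    rules become instances of the chain rule [hat_comp]. *)
Lemma hat_addb (u : bool -> C) : hat (fun u : bool -> C => u true + u false) u (fun _ => 1).
Proof.
move=> e e0; exists 1 => // x _; rewrite big_bool /= !mul1r.
by rewrite (_ : _ - _ - _ = 0) ?nc0 ?mulr_ge0 ?n1_ge0 ?ltW //; ring.
Qed.

Lemma hat_mulb (u : bool -> C) :
  hat (fun u : bool -> C => u true * u false) u (fun b => if b then u false else u true).
Proof.
move=> e e0; exists e => // x hx; rewrite big_bool /=.
rewrite (_ : _ - _ - _ = (x true - u true) * (x false - u false)); last by ring.
rewrite ncM ler_pM ?nc_ge0 //; last exact: (le_n1 (vsub x u)).
exact: le_trans (le_n1 (vsub x u) true) (ltW hx).
Qed.

Lemma hat_add (I : finType) (f g : (I -> C) -> C) z L M : hat f z L -> hat g z M ->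
  hat (fun x => f x + g x) z (fun i => L i + M i).
Proof.
move=> hf hg; have := @hat_comp I bool _ (fun x b => if b then f x else g x) z _ (fun b => if b then L else M) (hat_addb _).
have -> : (fun i => \sum_j 1 * (if j then L else M) i) = (fun i => L i + M i).
  by apply: funext => i; rewrite big_bool /= !mul1r.
by apply; case.
Qed.

Lemma hat_mul (I : finType) (f g : (I -> C) -> C) z L M : hat f z L -> hat g z M ->
  hat (fun x => f x * g x) z (fun i => g z * L i + f z * M i).
Proof.
move=> hf hg; have := @hat_comp I bool _ (fun x b => if b then f x else g x) z _ (fun b => if b then L else M) (hat_mulb _).
set F := (fun i => \sum_j _).
have -> : F = (fun i => g z * L i + f z * M i) by apply: funext => i; rewrite /F big_bool.
by apply; case.
Qed.

Lemma hat_scale (I : finType) (k : C) (f : (I -> C) -> C) z L : hat f z L ->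
  hat (fun x => k * f x) z (fun i => k * L i).
Proof.
move=> hf; have := hat_mul (hat_const k z) hf; congr hat.
by apply: funext => i; rewrite mulr0 add0r.
Qed.

Lemma hat_sum (I : finType) (J : Type) (s : seq J) (F : J -> (I -> C) -> C) z L :
  (forall j, hat (F j) z (L j)) ->
  hat (fun x => \sum_(j <- s) F j x) z (fun i => \sum_(j <- s) L j i).
Proof.
move=> h; elim: s => [|j s IH].
  have := hat_const 0 z; congr hat; apply: funext => i; by rewrite big_nil.
have := hat_add (h j) IH; congr hat; apply: funext => i; by rewrite big_cons.
Qed.

Lemma hat_cdiff (I : finType) (f : C -> C) (h : (I -> C) -> C) z L f' :
  cdiff f (h z) f' -> hat h z L -> hat (fun x => f (h x)) z (fun i => f' * L i).
Proof.
move=> hf hh.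
have hu : hat (fun u : unit -> C => f (u tt)) (fun _ => h z) (fun _ => f').
  move=> e /hf[d d0 hd]; exists d => // x; rewrite /n1 (bigD1 tt) //= big1 ?addr0; last by case.
  by rewrite (bigD1 tt) //= big1 ?addr0; [exact: hd|case].
have := @hat_comp I unit _ (fun x _ => h x) z _ (fun _ => L) hu (fun _ => hh).
congr hat; apply: funext => i; by rewrite (bigD1 tt) //= big1 ?addr0 //; case.
Qed.

Lemma cdiff_inv (u : C) : u != 0 -> cdiff (fun x => x^-1) u (- (u * u)^-1).
Proof.
move=> u0 e e0; have nu := nc_gt0 u0; have nu2 : 0 < nc u ^+ 2 by rewrite exprn_gt0.
have e1 : 0 < e * nc u by rewrite mulr_gt0.
have [d d0 hd] := inv_cts u0 e1.
exists (Num.min d (nc u / 2)); first by rewrite lt_min d0 divr_gt0.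
move=> v; rewrite lt_min => /andP[/hd h1 h2].
have v0 : v != 0.
  apply: contraTneq h2 => ->; rewrite sub0r ncN -leNgt; lra.
have -> : v^-1 - u^-1 - - (u * u)^-1 * (v - u) = - (v^-1 - u^-1) * u^-1 * (v - u).
  by field; rewrite u0 v0.
rewrite !ncM ncN ncV ler_wpM2r ?nc_ge0 // ler_pdivrMr //; exact: ltW.
Qed.

Lemma hat_inv (I : finType) (h : (I -> C) -> C) z L : hat h z L -> h z != 0 ->
  hat (fun x => (h x)^-1) z (fun i => - (h z * h z)^-1 * L i).
Proof. by move=> hh h0; apply: hat_cdiff hh; exact: cdiff_inv. Qed.

Lemma cdiff_line (I : finType) (h : (I -> C) -> C) (p v : I -> C) l0 L :
  hat h (fun i => p i + l0 * v i) L ->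
  cdiff (fun l => h (fun i => p i + l * v i)) l0 (\sum_i L i * v i).
Proof.
move=> H e e0; have v0 := n1_ge0 v.
have e1 : 0 < e / (n1 v + 1) by rewrite divr_gt0 //; lra.
have [d d0 hd] := H _ e1; exists (d / (n1 v + 1)); first by rewrite divr_gt0 //; lra.
move=> l; rewrite ltr_pdivlMr; last lra.
move=> hl; have E : n1 (vsub (fun i => p i + l * v i) (fun i => p i + l0 * v i)) = nc (l - l0) * n1 v.
  rewrite -n1Z; apply: eq_bigr => i _; congr nc; rewrite /vsub; ring.
have := hd (fun i => p i + l * v i); rewrite E => /(_ _) h1.
have -> : (\sum_i L i * v i) * (l - l0) = \sum_i L i * (p i + l * v i - (p i + l0 * v i)).
  by rewrite mulr_suml; apply: eq_bigr => i _; ring.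
have nl := nc_ge0 (l - l0).
apply: le_trans (h1 _) _; first by apply: le_lt_trans hl; rewrite ler_wpM2l //; lra.
rewrite mulrCA mulrC ler_wpM2r // mulrAC ler_pdivrMr; last lra.
by rewrite ler_pM2l //; lra.
Qed.

Section OnBall.
Variables (I : finType) (h : (I -> C) -> C) (p : I -> C) (r B : R).
Hypothesis r0 : 0 < r.
Hypothesis hB : forall z, n1 (vsub z p) < r -> (exists L, hat h z L) /\ nc (h z) <= B.

(** Restriction to the complex line through [p] in direction [v] reduces the estimates to one
    variable; the radius [r / n1 v] on the line corresponds to the ball of radius [r]. *)
Lemma line_setup (v : I -> C) : 0 < n1 v ->
  let f l := h (fun i => p i + l * v i) in
  holo1 f (3 * (r / (3 * n1 v))) /\ (forall w, nc w < 3 * (r / (3 * n1 v)) -> nc (f w) <= B).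
Proof.
move=> v0 f; have -> : 3 * (r / (3 * n1 v)) = r / n1 v by field; rewrite gt_eqF.
have K w : nc w < r / n1 v -> n1 (vsub (fun i => p i + w * v i) p) < r.
  rewrite ltr_pdivlMr // -n1Z; congr (_ < _); apply: eq_bigr => i _; congr nc; rewrite /vsub; ring.
split=> w /K /hB[[L hL] hb] //; exists (\sum_i L i * v i); exact: cdiff_line hL.
Qed.

Lemma holo_est1 x : n1 (vsub x p) <= r / 96 -> nc (h x - h p) <= 192 * B / r * n1 (vsub x p).
Proof.
set v := vsub x p => hv; have := n1_ge0 v; rewrite le_eqVlt => /orP[/eqP v0|v0].
  have -> : x = p by apply: n1_eq0; rewrite -/v.
  by rewrite subrr nc0 -v0 mulr0.
have [hf fB] := line_setup v0; set f := (fun l => _) in hf fB.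
have rho0 : 0 < r / (3 * n1 v) by rewrite divr_gt0 // mulr_gt0.
have z1 : nc (1 : C) <= r / (3 * n1 v) / 32.
  by rewrite nc1 ler_pdivlMr // ler_pdivlMr ?mulr_gt0 //; lra.
have := cauchy_est1 rho0 hf fB z1; rewrite nc1.
have -> : f 1 = h x by congr h; apply: funext => i; rewrite /v /vsub mul1r subrKC.
have -> : f 0 = h p by congr h; apply: funext => i; rewrite mul0r addr0.
by rewrite (_ : _ / (r / _) = 192 * B / r * n1 v) //; field; rewrite !gt_eqF.
Qed.

Lemma holo_est2 L x : hat h p L -> n1 (vsub x p) <= r / 96 ->
  nc (h x - h p - \sum_i L i * (x i - p i)) <= (36 * 1000) * B / r ^+ 2 * n1 (vsub x p) ^+ 2.
Proof.
move=> hL; set v := vsub x p => hv; have := n1_ge0 v; rewrite le_eqVlt => /orP[/eqP v0|v0].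
  have -> : x = p by apply: n1_eq0; rewrite -/v.
  rewrite subrr big1 ?subrr ?nc0 -?v0 ?expr0n ?mulr0 // => i _; by rewrite subrr mulr0.
have [hf fB] := line_setup v0; set f := (fun l => _) in hf fB.
have rho0 : 0 < r / (3 * n1 v) by rewrite divr_gt0 // mulr_gt0.
have z1 : nc (1 : C) <= r / (3 * n1 v) / 32.
  by rewrite nc1 ler_pdivlMr // ler_pdivlMr ?mulr_gt0 //; lra.
have df : cdiff f 0 (\sum_i L i * v i).
  by apply: cdiff_line; move: hL; congr hat; apply: funext => i; rewrite mul0r addr0.
have := cauchy_est2 rho0 hf fB df z1; rewrite nc1.
have -> : f 1 = h x by congr h; apply: funext => i; rewrite /v /vsub mul1r subrKC.
have -> : f 0 = h p by congr h; apply: funext => i; rewrite mul0r addr0.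
rewrite mulr1 expr1n mulr1.
by rewrite (_ : _ / (r / _) ^+ 2 = (36 * 1000) * B / r ^+ 2 * n1 v ^+ 2) //; field; rewrite !gt_eqF.
Qed.
End OnBall.

Lemma holo_bnd (I : finType) (h : (I -> C) -> C) p : near p (fun z => exists L, hat h z L) ->
  exists r B : R, [/\ 0 < r, 0 <= B & forall z, n1 (vsub z p) < r ->
    (exists L, hat h z L) /\ nc (h z) <= B].
Proof.
move=> hn; have [L hL] := near_self hn.
have [r r0 hr] := near_and hn (ctsat_bnd (hat_cts hL)).
exists r, (nc (h p) + 1); split=> // [|z /hr[h1 /ltW h2] //].
by rewrite addr_ge0 // nc_ge0.
Qed.

(** Strict differentiability is what the inverse function theorem needs. The remainder [k] is
    quadratically small near [p], so Cauchy's estimate on a ball of radius [s] around [y] makes it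
    Lipschitz with a constant of order [s]; for points farther apart than [s / 96] the size of [k]
    itself is enough. *)
Lemma strict_diff (I : finType) (h : (I -> C) -> C) p L :
  near p (fun z => exists L, hat h z L) -> hat h p L -> forall e : R, 0 < e ->
  exists2 s : R, 0 < s & forall x y, n1 (vsub x p) < s -> n1 (vsub y p) < s ->
    nc (h x - h y - \sum_i L i * (x i - y i)) <= e * n1 (vsub x y).
Proof.
move=> hn hL e e0; have [r [B [r0 B0 hB]]] := holo_bnd hn.
pose k z := h z - h p - \sum_i L i * (z i - p i).
pose C0 := (36 * 1000) * B / r ^+ 2.
have C00 : 0 <= C0 by rewrite divr_ge0 ?sqr_ge0 // !mulr_ge0.
have kB z : n1 (vsub z p) <= r / 96 -> nc (k z) <= C0 * n1 (vsub z p) ^+ 2.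
  exact: (holo_est2 r0 hB hL).
have kH z : n1 (vsub z p) < r -> exists M, hat k z M.
  move=> /hB[[M hM] _]; eexists.
  apply: hat_add.
    by apply: hat_add; [exact: hM|exact: (hat_const (- h p))].
  have := @hat_scale I (-1) (fun z => \sum_i L i * (z i - p i)) z _
    (hat_sum (index_enum I) (fun i => hat_scale (L i) (hat_add (hat_coord i z) (hat_const (- p i) z)))).
  apply: hat_ext; apply: near_true => x; by rewrite mulN1r.
(* On the ball around [y], [k] is at most [C0 * (2 * s)^2], so [holo_est1] gives the Lipschitz
   constant [192 * 4 * C0 * s = 768 * C0 * s], which has to be at most [e]. The bound [r / 200]
   keeps [2 * s] below [r / 96]. *)
pose s := Num.min (r / 200) (e / (768 * (C0 + 1))).
have s0 : 0 < s.
  by rewrite lt_min !divr_gt0 // mulr_gt0 // ltr_wpDl.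
have sr : s <= r / 200 by rewrite ge_min lexx.
have se : 768 * C0 * s <= e.
  have c1 : 0 < 768 * (C0 + 1) by rewrite mulr_gt0 ?ltr0n // ltr_wpDl.
  have : s * (768 * (C0 + 1)) <= e by rewrite -(ler_pdivlMr _ _ c1) ge_min lexx orbT.
  lra.
clearbody s; exists s => // x y hx hy.
have -> : h x - h y - \sum_i L i * (x i - y i) = k x - k y.
  rewrite /k (_ : \sum_i L i * (x i - y i) = \sum_i L i * (x i - p i) - \sum_i L i * (y i - p i)).
    ring.
  by rewrite -sumrB; apply: eq_bigr => i _; ring.
have nxy := n1_ge0 (vsub x y).
case: (leP (n1 (vsub x y)) (s / 96)) => hxy.
  have hb z : n1 (vsub z y) < s -> (exists M, hat k z M) /\ nc (k z) <= C0 * (2 * s) ^+ 2.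
    move=> hz; have zp : n1 (vsub z p) < 2 * s by have := n1_tri y z p; lra.
    split; first by apply: kH; lra.
    apply: le_trans (kB z _) _; first lra.
    by rewrite ler_wpM2l // ler_sqr ?nnegrE ?n1_ge0 //; lra.
  apply: le_trans (holo_est1 s0 hb hxy) _; rewrite ler_wpM2r //.
  rewrite (_ : _ / s = 768 * C0 * s) //; by field; rewrite gt_eqF.
have b1 : nc (k x) <= C0 * s ^+ 2.
  apply: le_trans (kB x _) _; first lra.
  by rewrite ler_wpM2l // ler_sqr ?nnegrE ?n1_ge0 //; lra.
have b2 : nc (k y) <= C0 * s ^+ 2.
  apply: le_trans (kB y _) _; first lra.
  by rewrite ler_wpM2l // ler_sqr ?nnegrE ?n1_ge0 //; lra.
apply: le_trans (ncB _ _) _.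
have b3 : 768 * C0 * s * n1 (vsub x y) <= e * n1 (vsub x y) by rewrite ler_wpM2r.
have b4 : C0 * s * (s / 96) <= C0 * s * n1 (vsub x y) by apply: ler_wpM2l; [apply: mulr_ge0 => //; exact: ltW|exact: ltW].
have b5 : 0 <= C0 * s ^+ 2 by rewrite mulr_ge0 // sqr_ge0.
have b6 : C0 * s ^+ 2 = 96 * (C0 * s * (s / 96)) by field.
rewrite b6 in b1 b2 b5; lra.
Qed.
End Holo.

(** * Compactness of balls and geometric limits *)

Section Compactness.
Variable R : realType.
Local Notation C := (R[i]).

(** The Heine-Borel theorem as an induction on sets: [Q] is local, hereditary and stable under
    unions. Real and imaginary parts of the coordinates place the ball in a real cube, to which
    [cube_ind] applies. *)
Lemma compact_ball (I : finType) (Q : ((I -> C) -> Prop) -> Prop) (p : I -> C) (r : R) :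
  0 < r -> (forall A B : (I -> C) -> Prop, (forall z, A z -> B z) -> Q B -> Q A) ->
  Q (fun _ => False) -> (forall A B, Q A -> Q B -> Q (fun z => A z \/ B z)) ->
  (forall y, exists2 d : R, 0 < d & Q (fun z => n1 (vsub z y) < d)) ->
  Q (fun z => n1 (vsub z p) <= r).
Proof.
move=> r0 Qsub Q0 QU Qloc.
pose co (z : I -> C) (k : I * bool) := if k.2 then complex.Re (z k.1) else complex.Im (z k.1).
pose P (x : I * bool -> R) h := Q (fun z => forall k, x k <= co z k <= x k + h).
have QF (s : seq (I * bool -> bool)) (A : (I * bool -> bool) -> (I -> C) -> Prop) :
    (forall b, Q (A b)) -> Q (fun z => exists2 b, List.In b s & A b z).
  move=> hA; elim: s => [|b s IH]; first by apply: Qsub Q0 => z [].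
  apply: Qsub (QU _ _ (hA b) IH) => z [c /= [<-|hc] hz]; first by left.
  by right; exists c.
have : P (fun k => co p k - r) (2 * r).
  apply: (@cube_ind R _ P); first lra.
    move=> x h h0 H; rewrite /P.
    have := QF (map (fun f : {ffun I * bool -> bool} => (fun k => f k)) (enum {ffun I * bool -> bool})) _ H.
    apply: Qsub => z hz.
    exists (fun k => [ffun k => x k + h / 2 < co z k] k).
      have : [ffun k => x k + h / 2 < co z k] \in enum {ffun I * bool -> bool} by rewrite mem_enum.
      elim: (enum _) => [//|f s IH]; rewrite inE => /orP[/eqP <-|/IH]; first by left.
      by right.
    by move=> k; have := hz k; rewrite ffunE; case: ltP => ? /=; lra.
  move=> y hy; pose yz i : C := Complex (y (i, true)) (y (i, false)).
  have [d d0 hd] := Qloc yz; have K0 : 0 < #|I|%:R * 2 + 1 :> R by rewrite ltr_wpDl // mulr_ge0 // ler0n.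
  exists (d / (#|I|%:R * 2 + 1)); first by rewrite divr_gt0.
  move=> x h h0 hh hx _; rewrite ltr_pdivlMr // in hh.
  apply: Qsub hd => z hz; apply: (@le_lt_trans _ _ (\sum_(i : I) 2 * h)).
    apply: ler_sum => i _; apply: le_trans (nc_ReIm _) _; rewrite /vsub !raddfB /=.
    have := hz (i, true); have := hz (i, false); have := hx (i, true); have := hx (i, false).
    rewrite /co /= => a1 a2 a3 a4.
    have : `|complex.Re (z i) - y (i, true)| <= h by rewrite ler_norml; lra.
    have : `|complex.Im (z i) - y (i, false)| <= h by rewrite ler_norml; lra.
    lra.
  rewrite sumr_const -mulr_natl; lra.
apply: Qsub => z hz [i b]; have := le_trans (le_n1 (vsub z p) i) hz; rewrite /vsub /co /=.
case: b => /=.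
  by move=> /(le_trans (nc_Re _)); rewrite raddfB ler_norml; lra.
by move=> /(le_trans (nc_Im _)); rewrite raddfB ler_norml; lra.
Qed.

(** The intervals with centre [u n] and radius [2 * K / 2^n] are nested, and the supremum of their
    left ends lies in all of them. *)
Lemma geom_limit (u : nat -> R) (K : R) : (forall n, `|u n.+1 - u n| <= K / 2 ^+ n) ->
  exists l, forall n, `|u n - l| <= 2 * K / 2 ^+ n.
Proof.
move=> hu; pose e n := 2 * K / 2 ^+ n.
have eS n : e n = 2 * e n.+1 by rewrite /e exprS invfM; lra.
have eK n : K / 2 ^+ n = e n.+1 by rewrite /e exprS invfM; lra.
have e0 n : 0 <= e n.+1 by rewrite -eK; apply: le_trans (hu n).
have mono n j : u n - e n <= u (j + n)%N - e (j + n)%N /\ u (j + n)%N + e (j + n)%N <= u n + e n.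
  elim: j => [|j IH]; first by rewrite add0n.
  have := hu (j + n)%N; rewrite eK ler_norml -addSn => h; have := eS (j + n)%N; lra.
have e0' n : 0 <= e n by rewrite eS mulr_ge0.
have cmp n m : u n - e n <= u m + e m.
  case: (leqP n m) => h.
    have := mono n (m - n)%N; rewrite subnK //; have := e0' m; lra.
  have := mono m (n - m)%N; rewrite subnK ?(ltnW h) //; have := e0' n; lra.
pose E : classical_sets.set R := fun r => exists n, r = u n - e n.
have E0 : classical_sets.has_sup E.
  split; first by exists (u 0%N - e 0%N); exists 0%N.
  by exists (u 0%N + e 0%N) => r [n ->]; exact: cmp.
exists (sup E) => n.
have h1 : u n - e n <= sup E by apply: sup_upper_bound => //; exists n.
have h2 : sup E <= u n + e n by apply: ge_sup; [case: E0|move=> r [j ->]].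
by rewrite -/(e n) ler_norml; lra.
Qed.
End Compactness.

(** * Local inversion by a contraction *)

Section InverseFunction.
Variable R : realType.
Local Notation C := (R[i]).
Variables (I : finType) (F : (I -> C) -> I -> C).

Definition mxinv (M N : I -> I -> C) :=
  (forall i k, \sum_j N i j * M j k = (i == k)%:R) /\
  (forall i k, \sum_j M i j * N j k = (i == k)%:R).

Lemma sum_delta (v : I -> C) i : \sum_k (i == k)%:R * v k = v i.
Proof.
rewrite (bigD1 i) //= eqxx mul1r big1 ?addr0 // => k; rewrite eq_sym => /negPf->.
by rewrite mul0r.
Qed.

Lemma mxinv_apply (A B : I -> I -> C) (v : I -> C) i :
  (forall i k, \sum_j A i j * B j k = (i == k)%:R) ->
  \sum_j A i j * (\sum_k B j k * v k) = v i.
Proof.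
move=> h; under eq_bigr do rewrite mulr_sumr.
rewrite exchange_big -[RHS]sum_delta; apply: eq_bigr => k _ /=; rewrite -h mulr_suml.
by apply: eq_bigr => j _; rewrite mulrA.
Qed.

Variable p : I -> C.
Variables (M N : I -> I -> C).
Hypothesis hF : forall i, near p (fun z => exists L, hat (fun x => F x i) z L).
Hypothesis hM : forall i, hat (fun x => F x i) p (M i).
Hypothesis hMN : mxinv M N.

Definition opn (A : I -> I -> C) : R := \sum_i \sum_j nc (A i j).

Lemma opn_ge0 A : 0 <= opn A.
Proof. by apply: sumr_ge0 => i _; apply: sumr_ge0 => j _; exact: nc_ge0. Qed.

Lemma opnP A (v : I -> C) (B : R) : (forall j, nc (v j) <= B) ->
  n1 (fun i => \sum_j A i j * v j) <= opn A * B.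
Proof.
move=> hv; rewrite /n1 /opn mulr_suml ler_sum // => i _.
apply: le_trans (nc_sum _ _ _) _; rewrite mulr_suml ler_sum // => j _.
by rewrite ncM ler_wpM2l ?nc_ge0.
Qed.

(** By strict differentiability [x - N (F x)] is a contraction with factor 1/2 near [p]. This yields
    both the Lipschitz bound for the inverse and the convergence of the iteration that solves
    [F x = y]. *)
Lemma ift_core : exists rho sg K : R, [/\ 0 < rho, 0 < sg, 0 < K,
  (forall x x', n1 (vsub x p) < rho -> n1 (vsub x' p) < rho ->
     n1 (vsub x x') <= K * n1 (vsub (F x) (F x'))) &
  forall y, n1 (vsub y (F p)) < sg -> exists2 x, n1 (vsub x p) < rho & F x = y].
Proof.
have oN := opn_ge0 N.
pose e := ((opn N + 1) * 2)^-1.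
have e0 : 0 < e by rewrite invr_gt0 mulr_gt0 // ltr_wpDl.
have eN : opn N * e <= 1 / 2.
  rewrite /e ler_pdivrMr; first lra.
  by rewrite mulr_gt0 // ltr_wpDl.
have [s s0 hs] : exists2 s : R, 0 < s & forall j x y, n1 (vsub x p) < s -> n1 (vsub y p) < s ->
    nc (F x j - F y j - \sum_i M j i * (x i - y i)) <= e * n1 (vsub x y).
  have K j := strict_diff (hF j) (hM j) e0.
  have H (t : seq I) : exists2 s : R, 0 < s & forall j, j \in t -> forall x y, n1 (vsub x p) < s -> n1 (vsub y p) < s ->
    nc (F x j - F y j - \sum_i M j i * (x i - y i)) <= e * n1 (vsub x y).
    elim: t => [|j t [s s0 hs]]; first by exists 1.
    have [r r0 hr] := K j; exists (Num.min r s); first by rewrite lt_min r0.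
    move=> k; rewrite inE => /orP[/eqP->|kt] x y; rewrite !lt_min => /andP[? ?] /andP[? ?]; first exact: hr.
    exact: hs.
  have [s s0 hs] := H (enum I); exists s => // j; apply: hs; exact: mem_enum.
pose A (v : I -> C) i := \sum_j N i j * v j.
have contr x x' : n1 (vsub x p) < s -> n1 (vsub x' p) < s ->
   n1 (vsub (vsub x x') (A (vsub (F x) (F x')))) <= 1 / 2 * n1 (vsub x x').
  move=> hx hx'.
  have := opnP N (fun j => hs j x x' hx hx').
  have -> : (fun i => \sum_j N i j * (F x j - F x' j - \sum_i0 M j i0 * (x i0 - x' i0))) =
    vsub (A (vsub (F x) (F x'))) (vsub x x').
    apply: funext => i; rewrite /vsub /A.
    under eq_bigr do rewrite mulrBr; rewrite sumrB; congr (_ - _).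
    exact: (mxinv_apply (fun k => x k - x' k) i hMN.1).
  rewrite n1_sub_sym => /le_trans; apply; rewrite mulrA ler_wpM2r ?n1_ge0 //.
have AB v : n1 (A v) <= opn N * n1 v by apply: opnP => j; exact: le_n1.
exists s, (s / (4 * (opn N + 1))), (2 * (opn N + 1)); split=> //.
- by rewrite divr_gt0 // mulr_gt0 // ltr_wpDl.
- by rewrite mulr_gt0 // ltr_wpDl.
- move=> x x' hx hx'; have h1 := contr x x' hx hx'; have h2 := AB (vsub (F x) (F x')).
  have h3 := n1D (vsub (vsub x x') (A (vsub (F x) (F x')))) (A (vsub (F x) (F x'))).
  have h4 : vadd (vsub (vsub x x') (A (vsub (F x) (F x')))) (A (vsub (F x) (F x'))) = vsub x x'.
    by apply: funext => i; rewrite /vadd {1}/vsub subrK.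
  rewrite h4 in h3; have := n1_ge0 (vsub (F x) (F x')); lra.
move=> y; rewrite ltr_pdivlMr ?mulr_gt0 ?ltr_wpDl // => hy.
(* Newton's iteration with the fixed matrix [N]. The first step has length at most [s / 4] and each
   later one at most half of the preceding, so the iterates stay within [s / 2] of [p]. *)
pose T x := vadd x (A (vsub y (F x))).
have Tc x x' : n1 (vsub x p) < s -> n1 (vsub x' p) < s -> n1 (vsub (T x) (T x')) <= 1 / 2 * n1 (vsub x x').
  move=> hx hx'; have := contr x x' hx hx'; congr (_ <= _); apply: eq_bigr => i _; congr nc.
  rewrite /T /vadd /vsub /A; rewrite (_ : \sum_j N i j * (F x j - F x' j) = \sum_j N i j * (y j - F x' j) - \sum_j N i j * (y j - F x j)); first ring.
  by rewrite -sumrB; apply: eq_bigr => j _; ring.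
have Tp : n1 (vsub (T p) p) <= s / 4.
  rewrite /T vaddK; apply: le_trans (AB _) _.
  have := n1_ge0 (vsub y (F p)); nra.
pose x_ n := iter n T p.
have step n : n1 (vsub (x_ n) p) <= s / 2 * (1 - (2 ^+ n)^-1) /\ n1 (vsub (x_ n.+1) (x_ n)) <= s / 4 / 2 ^+ n.
  elim: n => [|n [IH1 IH2]].
    by rewrite expr0 invr1 subrr mulr0 n1_subxx mulr1; split=> //; exact: Tp.
  have e2 : 0 < (2 ^+ n)^-1 :> R by rewrite invr_gt0 exprn_gt0.
  have eS : (2 ^+ n.+1)^-1 = (2 ^+ n)^-1 / 2 :> R by rewrite exprS invfM mulrC.
  have h1 : n1 (vsub (x_ n.+1) p) <= s / 2 * (1 - (2 ^+ n.+1)^-1).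
    have := n1_tri (x_ n) (x_ n.+1) p; rewrite eS; lra.
  split=> //; have k1 : n1 (vsub (x_ n) p) < s by have := mulr_gt0 s0 e2; lra.
  have k2 : n1 (vsub (x_ n.+1) p) < s.
    by rewrite eS in h1; have := mulr_gt0 s0 e2; lra.
  have := Tc _ _ k2 k1; rewrite -/(x_ n.+2) eS; lra.
have lims i : exists l : C, forall n, nc (x_ n i - l) <= s / 2 ^+ n.
  have K1 n : nc (x_ n.+1 i - x_ n i) <= s / 4 / 2 ^+ n.
    apply: le_trans (step n).2; exact: (le_n1 (vsub (x_ n.+1) (x_ n))).
  have [n|a ha] := @geom_limit R (fun n => complex.Re (x_ n i)) (s / 4).
    by apply: le_trans (K1 n); rewrite -raddfB; exact: nc_Re.
  have [n|b hb] := @geom_limit R (fun n => complex.Im (x_ n i)) (s / 4).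
    by apply: le_trans (K1 n); rewrite -raddfB; exact: nc_Im.
  exists (Complex a b) => n; apply: le_trans (nc_ReIm _) _; rewrite !raddfB /=.
  have := ha n; have := hb n; have : 2 * (s / 4) / 2 ^+ n = s / 2 ^+ n / 2 by lra.
  lra.
have /choice[x hx] := lims.
have hxn n : n1 (vsub (x_ n) x) <= #|I|%:R * s / 2 ^+ n.
  rewrite -mulrA mulr_natl -sumr_const ler_sum // => i _; exact: hx.
have xs : n1 (vsub x p) <= s / 2.
  apply/ler_addgt0Pr => d d0; have [n hn] := archi_pow2 (#|I|%:R * s) d0.
  have := n1_tri (x_ n) x p; have := hxn n; rewrite n1_sub_sym; have := (step n).1.
  have : 0 < (2 ^+ n)^-1 :> R by rewrite invr_gt0 exprn_gt0.
  move=> e2; have := mulr_gt0 s0 e2; lra.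
have xs' : n1 (vsub x p) < s by lra.
have fix_x : T x = x.
  apply: n1_eq0; apply/eqP; rewrite eq_le n1_ge0 andbT; apply/ler_addgt0Pr => d d0; rewrite add0r.
  have d2 : 0 < d / 2 by rewrite divr_gt0.
  have [n hn] := archi_pow2 (#|I|%:R * s) d2.
  have e2 : 0 < (2 ^+ n)^-1 :> R by rewrite invr_gt0 exprn_gt0.
  have k1 : n1 (vsub (x_ n) p) < s by have := (step n).1; have := mulr_gt0 s0 e2; lra.
  have h1 := Tc _ _ xs' k1; rewrite -/(x_ n.+1) in h1.
  have h2 := hxn n.+1; have h3 := hxn n.
  have eS : (2 ^+ n.+1)^-1 = (2 ^+ n)^-1 / 2 :> R by rewrite exprS invfM mulrC.
  rewrite eS in h2; rewrite n1_sub_sym in h3.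
  have := n1_tri (x_ n.+1) (T x) x; lra.
exists x => //; apply: funext => i.
have A0 j : A (vsub y (F x)) j = 0.
  by have /(congr1 (fun f => f j - x j)) := fix_x; rewrite /T /vadd addrC addKr subrr.
have := mxinv_apply (vsub y (F x)) i hMN.2; rewrite big1 => [|j _].
  by rewrite /vsub => /esym/eqP; rewrite subr_eq0 => /eqP.
by rewrite -/(A (vsub y (F x)) j) A0 mulr0.
Qed.
End InverseFunction.

(** * Parameter integrals and division by a coordinate *)

Section Division.
Variable R : realType.
Local Notation C := (R[i]).
Local Notation rc := (real_complex R).
Variable I : finType.

(** An open set around the annulus of [acts]: to prove that the derivative in the parameters is
    continuous in [w], it must also be estimated at points near the contour. *)
Definition wreg (rho : R) (w : C) := rho / 2 < nc w < 3 * rho.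

Lemma wreg_open (rho : R) w v : 0 < rho -> rho <= nc w <= 2 * rho -> nc (v - w) < rho / 2 -> wreg rho v.
Proof.
move=> r0 hw hv; rewrite /wreg; have := nc_ge_sub w (v - w); have := ncD w (v - w).
rewrite subrKC; lra.
Qed.

Lemma wreg_annulus (rho : R) w : 0 < rho -> rho <= nc w <= 2 * rho -> wreg rho w.
Proof. by move=> r0 h; rewrite /wreg; lra. Qed.

(** Differentiation under the integral. [holo_est2] bounds the remainder quadratically and uniformly
    in [w], and the same bound shows that the derivative [L w] is continuous in [w] and can be
    integrated. *)
Lemma CI_hat (Phi : C -> (I -> C) -> C) (p : I -> C) (r B rho : R) :
  0 < r -> 0 < rho ->
  (forall w, wreg rho w -> forall z, n1 (vsub z p) < r ->
     (exists L, hat (Phi w) z L) /\ nc (Phi w z) <= B) ->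
  (forall z, n1 (vsub z p) < r -> acts rho (fun w => Phi w z)) ->
  exists L, hat (fun z => CI rho (fun w => Phi w z)) p L.
Proof.
move=> r0 rho0 hPhi hcts.
have /choice[L hL] : forall w, exists L, wreg rho w -> hat (Phi w) p L.
  move=> w; case: (pselect (wreg rho w)) => [h|]; last by exists (fun _ => 0).
  have pr : n1 (vsub p p) < r by rewrite n1_subxx.
  by have [[L hL] _] := hPhi w h p pr; exists L.
pose C0 := 36 * 1000 * B / r ^+ 2.
have est w x : wreg rho w -> n1 (vsub x p) <= r / 96 ->
    nc (Phi w x - Phi w p - \sum_i L w i * (x i - p i)) <= C0 * n1 (vsub x p) ^+ 2.
  by move=> hw; exact: (holo_est2 r0 (hPhi w hw) (hL w hw)).
have B0 : 0 <= B.
  have hw : wreg rho (rc rho) by rewrite /wreg nc_real gtr0_norm //; lra.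
  have pr : n1 (vsub p p) < r by rewrite n1_subxx.
  by have [_] := hPhi _ hw p pr; apply: le_trans; exact: nc_ge0.
have C00 : 0 <= C0 by rewrite divr_ge0 ?sqr_ge0 // !mulr_ge0.
have actL i : acts rho (fun w => L w i).
  move=> w hw e e0.
  pose s := Num.min (r / 96) (e / (4 * (C0 + 1))).
  have s0 : 0 < s by rewrite lt_min !divr_gt0 // mulr_gt0 // ltr_wpDl.
  have sr : s <= r / 96 by rewrite ge_min lexx.
  have se : C0 * s <= e / 4.
    have : s * (4 * (C0 + 1)) <= e by rewrite -ler_pdivlMr ?mulr_gt0 ?ltr_wpDl // ge_min lexx orbT.
    lra.
  clearbody s.
  (* A step of length [s] in direction [i]: the difference quotient approximates [L v i] uniformly
     in [v], and for fixed [s] it is continuous in [v]. *)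
  pose x k := p k + (if k == i then rc s else 0).
  have nx : n1 (vsub x p) = s.
    rewrite /n1 (bigD1 i) //= big1 => [|k /negPf hk]; rewrite /vsub /x.
      by rewrite eqxx addr0 addrC addKr nc_real gtr0_norm.
    by rewrite hk addr0 subrr nc0.
  have sx v : \sum_k L v k * (x k - p k) = L v i * rc s.
    rewrite (bigD1 i) //= big1 => [|k /negPf hk]; rewrite /x.
      by rewrite eqxx addr0 addrC addKr.
    by rewrite hk addr0 subrr mulr0.
  have s8 : 0 < s * e / 8 by rewrite divr_gt0 // mulr_gt0.
  have xr : n1 (vsub x p) < r by rewrite nx; lra.
  have pr : n1 (vsub p p) < r by rewrite n1_subxx.
  have [d1 d10 h1] := hcts x xr w hw _ s8.
  have [d2 d20 h2] := hcts p pr w hw _ s8.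
  exists (Num.min (rho / 2) (Num.min d1 d2)); first by rewrite !lt_min d10 d20 divr_gt0.
  move=> v; rewrite !lt_min => /and3P[v0 /h1 v1 /h2 v2].
  have wv := wreg_open rho0 hw v0.
  have ev := est v x wv; have ew := est w x (wreg_annulus rho0 hw).
  rewrite nx !sx in ev ew; have := ev sr; have := ew sr => {}ew {}ev.
  rewrite -(ltr_pM2r s0).
  have -> : nc (L v i - L w i) * s = nc ((L v i - L w i) * rc s) by rewrite ncM nc_real gtr0_norm.
  have -> : (L v i - L w i) * rc s = (Phi w x - Phi w p - L w i * rc s) - (Phi v x - Phi v p - L v i * rc s)
     + ((Phi v x - Phi w x) - (Phi v p - Phi w p)) by ring.
  have k1 := ncD (Phi w x - Phi w p - L w i * rc s - (Phi v x - Phi v p - L v i * rc s)) (Phi v x - Phi w x - (Phi v p - Phi w p)).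
  have k2 := ncB (Phi w x - Phi w p - L w i * rc s) (Phi v x - Phi v p - L v i * rc s).
  have k3 := ncB (Phi v x - Phi w x) (Phi v p - Phi w p).
  have k4 : C0 * s ^+ 2 <= e / 4 * s by rewrite expr2 mulrA ler_pM2r.
  have k5 := mulr_gt0 s0 e0; lra.
exists (fun i => CI rho (fun w => L w i)) => e e0.
pose K := 8 * rho * C0.
have K0 : 0 <= K by apply: mulr_ge0 => //; apply: mulr_ge0 => //; exact: ltW.
have e1 : 0 < e / (K + 1) by rewrite divr_gt0 // ltr_wpDl.
exists (Num.min (r / 96) (e / (K + 1))); first by rewrite lt_min divr_gt0.
move=> x; rewrite lt_min => /andP[x1 x2].
have ax : acts rho (fun w => Phi w x) by apply: hcts; lra.
have ap : acts rho (fun w => Phi w p) by apply: hcts; rewrite n1_subxx.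
have aS (s : seq I) : acts rho (fun w => \sum_(i <- s) L w i * (x i - p i)).
  elim: s => [|i s IH].
    by rewrite (_ : (fun w => _) = (fun _ => 0)); [exact: acts_const|apply: funext => w; rewrite big_nil].
  rewrite (_ : (fun w => _) = (fun w => L w i * (x i - p i) + \sum_(i <- s) L w i * (x i - p i))); last by apply: funext => w; rewrite big_cons.
  by apply: acts_add => //; apply: acts_mul => //; exact: acts_const.
have CS (s : seq I) : CI rho (fun w => \sum_(i <- s) L w i * (x i - p i)) = \sum_(i <- s) CI rho (fun w => L w i) * (x i - p i).
  elim: s => [|i s IH].
    rewrite big_nil (_ : (fun w => _) = (fun _ => 0 * 0)); last by apply: funext => w; rewrite big_nil mul0r.
    by rewrite CI_Z ?mul0r //; exact: acts_const.
  rewrite big_cons (_ : (fun w => _) = (fun w => (x i - p i) * L w i + \sum_(i <- s) L w i * (x i - p i))); last by apply: funext => w; rewrite big_cons mulrC.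
  rewrite CI_add // ?CI_Z ?IH // 1?mulrC //.
  by apply: acts_mul => //; exact: acts_const.
have am f : acts rho f -> acts rho (fun w => -1 * f w) by move=> h; apply: acts_mul => //; exact: acts_const.
have -> : CI rho (fun w => Phi w x) - CI rho (fun w => Phi w p) - \sum_i CI rho (fun w => L w i) * (x i - p i)
  = CI rho (fun w => Phi w x + -1 * Phi w p + -1 * \sum_i L w i * (x i - p i)).
  rewrite CI_add //; [|by apply: acts_add => //; exact: am|exact: am].
  by rewrite CI_add ?CI_Z ?CS ?mulN1r //; exact: am.
apply: (@le_trans _ _ (8 * rho * (C0 * n1 (vsub x p) ^+ 2))).
  apply: CI_bound => //; first by do ![apply: acts_add => //]; exact: am.
  by move=> w hw; rewrite !mulN1r; apply: est; [exact: wreg_annulus|exact: ltW].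
rewrite mulrA expr2 mulrA ler_wpM2r ?n1_ge0 //.
rewrite ltr_pdivlMr ?ltr_wpDl // in x2; rewrite -/K.
by have := n1_ge0 (vsub x p); lra.
Qed.

Lemma CI_holo (Phi : C -> (I -> C) -> C) (p : I -> C) (r B rho : R) :
  0 < r -> 0 < rho ->
  (forall w, wreg rho w -> forall z, n1 (vsub z p) < r ->
     (exists L, hat (Phi w) z L) /\ nc (Phi w z) <= B) ->
  (forall z, n1 (vsub z p) < r -> acts rho (fun w => Phi w z)) ->
  near p (fun q => exists L, hat (fun z => CI rho (fun w => Phi w z)) q L).
Proof.
move=> r0 rho0 h1 h2; exists (r / 2); first by rewrite divr_gt0.
move=> q hq; have tri z : n1 (vsub z q) < r / 2 -> n1 (vsub z p) < r.
  by move=> hz; have := n1_tri q z p; lra.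
have r2 : 0 < r / 2 by rewrite divr_gt0.
apply: (@CI_hat Phi q (r / 2) B rho) => // [w hw z /tri|z /tri]; [exact: h1|exact: h2].
Qed.

Definition upd (z : I -> C) (i : I) (c : C) : I -> C := fun j => if j == i then c else z j.

Lemma upd_id z i : upd z i (z i) = z.
Proof. by apply: funext => j; rewrite /upd; case: eqP => // ->. Qed.

Lemma hat_upd (h : (I -> C) -> C) (i : I) (c : (I -> C) -> C) z M L :
  hat c z M -> hat h (upd z i (c z)) L ->
  exists L', hat (fun x => h (upd x i (c x))) z L'.
Proof.
move=> hc hL; eexists.
apply: (@hat_comp _ I I h (fun x => upd x i (c x)) z L
  (fun j => if j == i then M else (fun k => (k == j)%:R))) => // j; rewrite /upd.
by case: (j == i) => //; exact: hat_coord.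
Qed.

Lemma n1_upd (z p : I -> C) i c : n1 (vsub (upd z i c) p) <= n1 (vsub z p) + nc (c - p i).
Proof.
rewrite /n1 (bigD1 i) //= [X in _ <= X + _](bigD1 i) //= {1}/vsub /upd eqxx.
rewrite (eq_bigr (fun j => nc (vsub z p j))); last by move=> j /negPf hj; rewrite /vsub hj.
by have := nc_ge0 (vsub z p i); lra.
Qed.

(* The quotient is written as a Cauchy integral over the square contour, so it is
   holomorphic across z_i = p_i as well. *)
Lemma division (h : (I -> C) -> C) (p : I -> C) (i : I) :
  near p (fun z => exists L, hat h z L) ->
  exists2 k : (I -> C) -> C, near p (fun z => exists L, hat k z L) &
    near p (fun z => h z = h (upd z i (p i)) + (z i - p i) * k z).
Proof.
move=> hn; have [r [B [r0 B0 hB]]] := holo_bnd hn.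
pose rho := r / 8; have rho0 : 0 < rho by rewrite divr_gt0.
pose g z := h (upd z i (p i)).
pose Phi w z := (h (upd z i (p i + w)) - g z) * (w^-1 * (w - (z i - p i))^-1).
pose Psi (w : C) (z : I -> C) := (w - (z i - p i))^-1.
pose s := rho / 64.
have s0 : 0 < s by rewrite divr_gt0.
have zi z : n1 (vsub z p) < s -> nc (z i - p i) < s.
  by apply: le_lt_trans; exact: (le_n1 (vsub z p)).
have inball z w : n1 (vsub z p) < s -> nc w < 3 * rho -> n1 (vsub (upd z i (p i + w)) p) < r.
  move=> hz hw; apply: le_lt_trans (n1_upd _ _ _ _) _; rewrite (addrAC (p i)) subrr add0r.
  by rewrite /s /rho in hz hw; lra.
have inball0 z : n1 (vsub z p) < s -> n1 (vsub (upd z i (p i)) p) < r.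
  by move=> hz; have := inball z 0 hz; rewrite addr0; apply; rewrite nc0; lra.
have far w z : wreg rho w -> n1 (vsub z p) < s -> rho / 4 <= nc (w - (z i - p i)).
  move=> hw /zi hz; have := nc_ge_sub w (- (z i - p i)); rewrite ncN.
  by move: hw hz; rewrite /wreg /s; lra.
have farn w z : wreg rho w -> n1 (vsub z p) < s -> w - (z i - p i) != 0.
  by move=> hw hz; apply: nc_neq0 (far w z hw hz); rewrite divr_gt0.
have wn w : wreg rho w -> w != 0.
  by move=> hw; apply: (@nc_neq0 _ _ (rho / 2)); [rewrite divr_gt0|move: hw; rewrite /wreg; lra].
have hlin w z : exists L, hat (fun z : I -> C => w - (z i - p i)) z L.
  eexists; apply: hat_add; first exact: hat_const.
  have := hat_scale (-1) (hat_add (hat_coord i z) (hat_const (- p i) z)).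
  by apply: hat_ext; apply: near_true => x; rewrite mulN1r.
have hPsi w : wreg rho w -> forall z, n1 (vsub z p) < s ->
    (exists L, hat (Psi w) z L) /\ nc (Psi w z) <= 4 / rho.
  move=> hw z hz; split.
    have [L hL] := hlin w z; eexists; apply: hat_inv hL _; exact: farn.
  have := far w z hw hz => hf; rewrite ncV -[leRHS]invrK lef_pV2 ?posrE ?invr_gt0 ?divr_gt0 //.
    by rewrite invfM invrK mulrC.
  by apply: lt_le_trans hf; rewrite divr_gt0.
have actPsi z : n1 (vsub z p) < s -> acts rho (fun w => Psi w z).
  by move=> /zi hz; apply: acts_kernel => //; rewrite /s in hz; lra.
have hPhi w : wreg rho w -> forall z, n1 (vsub z p) < s ->
    (exists L, hat (Phi w) z L) /\ nc (Phi w z) <= (2 * B) * (2 / rho * (4 / rho)).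
  move=> hw z hz; have hw3 : nc w < 3 * rho by move: hw; rewrite /wreg; lra.
  have [[L1 hL1] b1] := hB _ (inball z w hz hw3).
  have [[L2 hL2] b2] := hB _ (inball0 z hz).
  have [[L3 hL3] b3] := hPsi w hw z hz.
  split.
    have [L1' hL1'] := hat_upd (hat_const (p i + w) z) hL1.
    have [L2' hL2'] := hat_upd (hat_const (p i) z) hL2.
    eexists; apply: hat_mul.
      apply: hat_add; first exact: hL1'.
      have := hat_scale (-1) hL2'; apply: hat_ext; apply: near_true => x; by rewrite mulN1r.
    by apply: hat_mul; [exact: hat_const|exact: hL3].
  rewrite /Phi !ncM; apply: ler_pM; rewrite ?mulr_ge0 ?nc_ge0 //.
    by apply: le_trans (ncB _ _) _; rewrite /g; lra.
  rewrite -/(Psi w z) ler_pM ?nc_ge0 // ncV -[leRHS]invrK lef_pV2 ?posrE ?invr_gt0 ?divr_gt0 //.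
    by rewrite invfM invrK mulrC; move: hw; rewrite /wreg; lra.
  by apply: nc_gt0; exact: wn.
have actPhi z : n1 (vsub z p) < s -> acts rho (fun w => Phi w z).
  move=> hz; apply: acts_mul.
    apply: acts_add; last exact: acts_const.
    move=> w hw e e0; have hw3 : nc w < 3 * rho by lra.
    have [[L hL] _] := hB _ (inball z w hz hw3).
    have [d d0 hd] := hat_cts hL e0.
    exists d => // v hv; apply: hd; apply: le_lt_trans hv.
    rewrite /n1 (bigD1 i) //= big1 => [|j /negPf hj]; rewrite /vsub /upd.
      by rewrite eqxx addr0 opprD addrACA subrr add0r.
    by rewrite hj subrr nc0.
  apply: acts_mul; last exact: actPsi.
  by apply: acts_inv; [exact: acts_id|move=> w hw; apply: wn; exact: wreg_annulus].
have H1 := CI_holo s0 rho0 hPhi actPhi; have H2 := CI_holo s0 rho0 hPsi actPsi.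
have H3 : near p (fun z => CI rho (fun w => Psi w z) != 0).
  exists s => // z /zi hz; have := @Lam_ge R rho (z i - p i) rho0.
  rewrite /Lam => /(_ _)/nc_neq0 -> //; rewrite /s in hz; lra.
exists (fun z => CI rho (fun w => Phi w z) * (CI rho (fun w => Psi w z))^-1).
  apply: near_imp (near_and (near_and H1 H2) H3) _ => z [[[L1 h1] [L2 h2]] h3].
  by eexists; apply: hat_mul; [exact: h1|apply: hat_inv; [exact: h2|]].
apply: near_imp (near_and H3 (near_ball p s0)) _ => z [h3 hz].
have hf : holo1 (fun u => h (upd z i (p i + u))) (3 * rho).
  move=> u hu; have [[L hL] _] := hB _ (inball z u hz hu).
  pose v j : C := (j == i)%:R.
  have E u' : (fun j => upd z i (p i) j + u' * v j) = upd z i (p i + u').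
    by apply: funext => j; rewrite /upd /v; case: eqP => _; rewrite ?mulr1 // mulr0 addr0.
  exists (\sum_j L j * v j); have := @cdiff_line R I h (upd z i (p i)) v u L.
  by rewrite E => /(_ hL); congr cdiff; apply: funext => u'; rewrite E.
have hu : nc (z i - p i) <= rho / 2 by have := zi z hz; rewrite /s; lra.
have := division1 rho0 hf hu; rewrite /= addr0 subrKC upd_id -/(g z) => E.
rewrite mulrA -E mulfK; last exact: h3.
by rewrite subrKC.
Qed.
End Division.

(** * The holomorphic inverse function theorem *)

Section InverseFunctionHolo.
Variable R : realType.
Local Notation C := (R[i]).
Variable I : finType.

(** An increment of [h] along a coordinate axis is compared with the derivative at [x] by
    differentiability and with the one at [p] by strict differentiability. *)
Lemma deriv_cts (h : (I -> C) -> C) p L (e : R) :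
  near p (fun z => exists L, hat h z L) -> hat h p L -> 0 < e ->
  near p (fun x => forall M, hat h x M -> forall i, nc (M i - L i) < e).
Proof.
move=> hn hL e0; have e4 : 0 < e / 4 by rewrite divr_gt0.
have [s s0 hs] := strict_diff hn hL e4.
exists s => // x hx M hM i; have [d d0 hd] := hM _ e4.
have [t t0 [td ts]] : exists2 t : R, 0 < t & t < d /\ n1 (vsub x p) + t < s.
  exists (Num.min (d / 2) ((s - n1 (vsub x p)) / 2)).
    by rewrite lt_min !divr_gt0 // subr_gt0.
  split; first by rewrite gt_min; lra.
  by rewrite -ltrBrDl gt_min; apply/orP; right; lra.
pose y k := x k + (if k == i then real_complex R t else 0).
have ny : n1 (vsub y x) = t.
  rewrite /n1 (bigD1 i) //= big1 => [|k /negPf hk]; rewrite /vsub /y.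
    by rewrite eqxx addr0 addrC addKr nc_real gtr0_norm.
  by rewrite hk addr0 subrr nc0.
have sy (N : I -> C) : \sum_k N k * (y k - x k) = N i * real_complex R t.
  rewrite (bigD1 i) //= big1 => [|k /negPf hk]; rewrite /y.
    by rewrite eqxx addr0 addrC addKr.
  by rewrite hk addr0 subrr mulr0.
have h1 := hd y; rewrite ny sy in h1; have {}h1 := h1 td.
have h2 := hs y x; rewrite ny sy in h2.
have {}h2 := h2 (ltac:(by have := n1_tri x y p; rewrite ny; lra)) hx.
rewrite -(ltr_pM2r t0).
have -> : nc (M i - L i) * t = nc ((M i - L i) * real_complex R t) by rewrite ncM nc_real gtr0_norm.
have -> : (M i - L i) * real_complex R t = (h y - h x - L i * real_complex R t) - (h y - h x - M i * real_complex R t) by ring.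
apply: le_lt_trans (ncB _ _) _; have := mulr_gt0 e0 t0; lra.
Qed.

(** An inverse matrix is assumed at all points near [p], because [G] has to be differentiable in a
    whole neighbourhood of [F p]; its derivative at [F x] is the inverse matrix at [x]. *)
Lemma ift (F : (I -> C) -> I -> C) (p : I -> C) :
  (forall i, near p (fun z => exists L, hat (fun x => F x i) z L)) ->
  near p (fun z => exists M N : I -> I -> C, (forall i, hat (fun x => F x i) z (M i)) /\ mxinv M N) ->
  exists G : (I -> C) -> I -> C, [/\ G (F p) = p,
    forall i, near (F p) (fun y => exists L, hat (fun y => G y i) y L),
    near p (fun x => G (F x) = x), near (F p) (fun y => F (G y) = y) &
    forall e : R, 0 < e -> near (F p) (fun y => n1 (vsub (G y) p) < e)].
Proof.
move=> hF hn; have [M [N [hM hMN]]] := near_self hn.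
have [rh1 hrh1 hn'] := hn.
have [rho [sg [K [rho0 sg0 K0 lip sur]]]] := ift_core hF hM hMN.
have /choice[G hG] : forall y, exists x, n1 (vsub y (F p)) < sg -> n1 (vsub x p) < rho /\ F x = y.
  move=> y; case: (pselect (n1 (vsub y (F p)) < sg)) => [/sur[x h1 h2]|]; last by exists p.
  by exists x.
have inj x x' : n1 (vsub x p) < rho -> n1 (vsub x' p) < rho -> F x = F x' -> x = x'.
  move=> h1 h2 e; apply: n1_eq0; apply/eqP; rewrite eq_le n1_ge0 andbT.
  by have := lip x x' h1 h2; rewrite e n1_subxx mulr0.
have pp : n1 (vsub p p) < rho by rewrite n1_subxx.
have FG0 : n1 (vsub (F p) (F p)) < sg by rewrite n1_subxx.
have G0 : G (F p) = p by have [h1 h2] := hG _ FG0; exact: inj.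
have Gc e : 0 < e -> near (F p) (fun y => n1 (vsub (G y) p) < e).
  move=> e0; have s0 : 0 < e / K by rewrite divr_gt0.
  apply: near_imp (near_and (near_ball (F p) sg0) (near_ball (F p) s0)) _ => y [h1].
  rewrite ltr_pdivlMr // => h2; have [h3 h4] := hG y h1.
  by have := lip _ _ h3 pp; rewrite h4 => H; apply: le_lt_trans H _; rewrite mulrC.
exists G; split=> //.
- move=> i; apply: near_imp (near_and (near_ball (F p) sg0) (Gc _ hrh1)) _ => y0 [hy0 hg0].
  have [h3 h4] := hG y0 hy0; have [M' [N' [hM' [hN' _]]]] := hn' _ hg0.
  exists (N' i) => e e0; have oN := opn_ge0 N'.
  pose e1 := e / (K * (opn N' + 1)).
  have kk : 0 < K * (opn N' + 1) by rewrite mulr_gt0 // ltr_wpDl.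
  have e10 : 0 < e1 by rewrite divr_gt0.
  have [d d0 hd] := near_all (fun j => (hM' j) e1 e10 : near (G y0) _).
  have [t t0 ht] : exists2 t : R, 0 < t & forall y, n1 (vsub y y0) < t -> n1 (vsub y (F p)) < sg /\ K * n1 (vsub y y0) < d.
    exists (Num.min (sg - n1 (vsub y0 (F p))) (d / K)); first by rewrite lt_min subr_gt0 hy0 divr_gt0.
    move=> y; rewrite lt_min => /andP[k1]; rewrite ltr_pdivlMr // mulrC => k2; split=> //.
    by have := n1_tri y0 y (F p); lra.
  exists t => // y /ht[k1 k2]; have [h5 h6] := hG y k1.
  have kl := lip _ _ h5 h3; rewrite h4 h6 in kl.
  have := hd (G y) (le_lt_trans kl k2) => hj.
  have key := opnP N' hj.
  have := le_trans (le_n1 _ i) key; rewrite h4 h6.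
  have -> : \sum_j N' i j * (y j - y0 j - \sum_i0 M' j i0 * (G y i0 - G y0 i0)) =
     - (G y i - G y0 i - \sum_j N' i j * (y j - y0 j)).
    under eq_bigr do rewrite mulrBr; rewrite sumrB.
    by rewrite (mxinv_apply (fun k => G y k - G y0 k) i hN'); ring.
  rewrite ncN => /le_trans; apply.
  have k3 : opn N' * (e1 * n1 (vsub (G y) (G y0))) <= opn N' * (e1 * (K * n1 (vsub y y0))).
    by rewrite ler_wpM2l // ler_wpM2l // ltW.
  apply: le_trans k3 _; rewrite !mulrA ler_wpM2r ?n1_ge0 // /e1.
  rewrite [opn N' * _]mulrC -!mulrA ler_piMr ?ltW // mulrCA.
  by rewrite mulrC ltr_pdivrMr // mul1r mulrC ltr_pM2l //; lra.
- have hc : near p (fun x => n1 (vsub (F x) (F p)) < sg).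
    have k0 : 0 < sg / (#|I|%:R + 1) by rewrite divr_gt0 // ltr_wpDl // ler0n.
    apply: near_imp (near_all (fun j => hat_cts (hM j) k0)) _ => x hx.
    apply: (@le_lt_trans _ _ (\sum_(j : I) sg / (#|I|%:R + 1))).
      by apply: ler_sum => j _; apply: ltW; exact: hx.
    rewrite sumr_const -[X in X < _]mulr_natl mulrA ltr_pdivrMr ?ltr_wpDl ?ler0n //.
    by rewrite mulrC ltr_pM2l // ltrDl.
  apply: near_imp (near_and hc (near_ball p rho0)) _ => x [h1 h2].
  by have [h3 h4] := hG _ h1; exact: inj.
- by exists sg => // y /hG[].
Qed.
End InverseFunctionHolo.

(** * Germs of holomorphic functions and maps of the plane *)

Section HoloNear.
Variable R : realType.
Local Notation C := (R[i]).

Definition hnear (I : finType) (h : (I -> C) -> C) (p : I -> C) := near p (fun z => exists L, hat h z L).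

Lemma hat_unique (I : finType) (h : (I -> C) -> C) p L M : hat h p L -> hat h p M -> L = M.
Proof.
move=> h1 h2; apply: funext => i; apply/eqP; rewrite -subr_eq0; apply/eqP/nc_eq0/eqP.
rewrite eq_le nc_ge0 andbT; apply/ler_addgt0Pr => e e0; rewrite add0r.
have e2 : 0 < e / 2 by rewrite divr_gt0.
have [d d0 hd] := h1 _ e2; have [s s0 hs] := h2 _ e2.
have [t t0 [td ts]] : exists2 t : R, 0 < t & t < d /\ t < s.
  exists (Num.min (d / 2) (s / 2)); first by rewrite lt_min !divr_gt0.
  by rewrite !gt_min; split; apply/orP; [left|right]; lra.
pose y k := p k + (if k == i then real_complex R t else 0).
have ny : n1 (vsub y p) = t.
  rewrite /n1 (bigD1 i) //= big1 => [|k /negPf hk]; rewrite /vsub /y.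
    by rewrite eqxx addr0 addrC addKr nc_real gtr0_norm.
  by rewrite hk addr0 subrr nc0.
have sy (N : I -> C) : \sum_k N k * (y k - p k) = N i * real_complex R t.
  rewrite (bigD1 i) //= big1 => [|k /negPf hk]; rewrite /y.
    by rewrite eqxx addr0 addrC addKr.
  by rewrite hk addr0 subrr mulr0.
have k1 := hd y; rewrite ny sy in k1; have {}k1 := k1 td.
have k2 := hs y; rewrite ny sy in k2; have {}k2 := k2 ts.
rewrite -(ler_pM2r t0).
have -> : nc (L i - M i) * t = nc ((L i - M i) * real_complex R t) by rewrite ncM nc_real gtr0_norm.
have -> : (L i - M i) * real_complex R t = (h y - h p - M i * real_complex R t) - (h y - h p - L i * real_complex R t) by ring.
apply: le_trans (ncB _ _) _; lra.
Qed.

Lemma near_comp (I J : finType) (phi : (I -> C) -> J -> C) p (P : (J -> C) -> Prop) :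
  (forall j, ctsat (fun x => phi x j) p) -> near (phi p) P -> near p (fun x => P (phi x)).
Proof.
move=> hc [r r0 hr]; have k0 : 0 < #|J|%:R + 1 :> R by rewrite ltr_wpDl // ler0n.
have s0 : 0 < r / (#|J|%:R + 1) by rewrite divr_gt0.
apply: near_imp (near_all (fun j => hc j _ s0)) _ => x hx; apply: hr.
apply: (@le_lt_trans _ _ (\sum_(j : J) r / (#|J|%:R + 1))).
  by apply: ler_sum => j _; apply: ltW; exact: hx.
by rewrite sumr_const -[X in X < _]mulr_natl mulrA ltr_pdivrMr // mulrC ltr_pM2l // ltrDl.
Qed.

Lemma hnear_cts (I : finType) (h : (I -> C) -> C) p : hnear h p -> ctsat h p.
Proof. by move=> /near_self[L] /hat_cts. Qed.

Lemma hnear_comp (I J : finType) (h : (J -> C) -> C) (phi : (I -> C) -> J -> C) p :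
  (forall j, hnear (fun x => phi x j) p) -> hnear h (phi p) -> hnear (fun x => h (phi x)) p.
Proof.
move=> hp hh; have cp j := hnear_cts (hp j).
apply: near_imp (near_and (near_all hp) (near_comp cp hh)) _ => x [h1 [L hL]].
have /choice[M hM] := h1; eexists; exact: (hat_comp hL hM).
Qed.

Lemma hnear_const (I : finType) (k : C) (p : I -> C) : hnear (fun _ => k) p.
Proof. by apply: near_true => z; eexists; exact: hat_const. Qed.
Lemma hnear_coord (I : finType) i (p : I -> C) : hnear (fun x => x i) p.
Proof. by apply: near_true => z; eexists; exact: hat_coord. Qed.

Lemma hnear_add (I : finType) (f g : (I -> C) -> C) p : hnear f p -> hnear g p ->
  hnear (fun x => f x + g x) p.
Proof.
move=> hf hg; apply: near_imp (near_and hf hg) _ => z [[L hL] [M hM]].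
by eexists; exact: (hat_add hL hM).
Qed.
Lemma hnear_mul (I : finType) (f g : (I -> C) -> C) p : hnear f p -> hnear g p ->
  hnear (fun x => f x * g x) p.
Proof.
move=> hf hg; apply: near_imp (near_and hf hg) _ => z [[L hL] [M hM]].
by eexists; exact: (hat_mul hL hM).
Qed.
Lemma hnear_sub (I : finType) (f g : (I -> C) -> C) p : hnear f p -> hnear g p ->
  hnear (fun x => f x - g x) p.
Proof.
move=> hf hg; have := hnear_add hf (hnear_mul (hnear_const (-1) p) hg).
by congr hnear; apply: funext => x; rewrite mulN1r.
Qed.
Lemma hat_sub (I : finType) (f g : (I -> C) -> C) z L M : hat f z L -> hat g z M ->
  hat (fun x => f x - g x) z (fun i => L i - M i).
Proof.
move=> hf hg; have := hat_add hf (hat_scale (-1) hg).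
by congr hat; apply: funext => x; rewrite mulN1r.
Qed.
Lemma hnear_ext (I : finType) (f g : (I -> C) -> C) p :
  near p (fun x => f x = g x) -> hnear f p -> hnear g p.
Proof.
move=> e hf; apply: near_imp (near_and (near_near e) hf) _ => z [h1 [L hL]].
by exists L; exact: hat_ext h1 hL.
Qed.

Definition vec2 (a b : C) : 'I_2 -> C := fun i => if i == ord0 then a else b.

Lemma sum2 (V : nmodType) (E : 'I_2 -> V) : \sum_i E i = E ord0 + E ord_max.
Proof. by rewrite big_ord_recr big_ord_recr big_ord0 /= add0r; congr (E _ + E _); apply: val_inj. Qed.

Lemma I2P (P : 'I_2 -> Prop) : P ord0 -> P ord_max -> forall i, P i.
Proof.
move=> h0 h1 i; case: i => [[|[|//]] hi].
  by rewrite (_ : Ordinal hi = ord0) //; apply: val_inj.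
by rewrite (_ : Ordinal hi = ord_max) //; apply: val_inj.
Qed.

Lemma vec2_eta (x : 'I_2 -> C) : vec2 (x ord0) (x ord_max) = x.
Proof. by apply: funext; apply: I2P. Qed.

Lemma hat_vec2 (f g : ('I_2 -> C) -> C) z L M : hat f z L -> hat g z M ->
  forall i, hat (fun x => vec2 (f x) (g x) i) z (if i == ord0 then L else M).
Proof. by move=> h1 h2; apply: I2P. Qed.

Lemma mxinv2 (M : 'I_2 -> 'I_2 -> C) :
  M ord0 ord0 * M ord_max ord_max - M ord0 ord_max * M ord_max ord0 != 0 ->
  exists N, mxinv M N.
Proof.
set d := _ - _ => d0.
exists (fun i j => (if i == ord0 then (if j == ord0 then M ord_max ord_max else - M ord0 ord_max)
   else (if j == ord0 then - M ord_max ord0 else M ord0 ord0)) / d).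
rewrite /d in d0 *.
by split; apply: I2P; apply: I2P; rewrite sum2 /=; field; exact: d0.
Qed.

(** The determinant is continuous by [deriv_cts], hence nonzero near [p], which supplies the
    invertibility that [ift] asks for. *)
Lemma ift2 (F : ('I_2 -> C) -> 'I_2 -> C) p (M : 'I_2 -> 'I_2 -> C) :
  (forall i, hnear (fun x => F x i) p) -> (forall i, hat (fun x => F x i) p (M i)) ->
  M ord0 ord0 * M ord_max ord_max - M ord0 ord_max * M ord_max ord0 != 0 ->
  exists G : ('I_2 -> C) -> 'I_2 -> C, [/\ G (F p) = p, forall i, hnear (fun y => G y i) (F p),
    near p (fun x => G (F x) = x) & near (F p) (fun y => F (G y) = y)].
Proof.
move=> hF hM hd.
have [|G [h1 h2 h3 h4 _]] := ift hF; last by exists G.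
have /choice[D hD] : forall x, exists D : 'I_2 -> 'I_2 -> C, forall i, (exists L, hat (fun x => F x i) x L) -> hat (fun x => F x i) x (D i).
  move=> x; have : forall i, exists L, (exists L, hat (fun x => F x i) x L) -> hat (fun x => F x i) x L.
    by move=> i; case: (pselect (exists L, hat (fun x => F x i) x L)) => [[L hL]|]; [exists L|exists (fun _ => 0)].
  by move=> /choice[D hD]; exists D.
have cD i j : ctsat (fun x => D x i j) p.
  move=> e e0; have Dp : D p i = M i by apply: hat_unique (hD p i _) (hM i); exists (M i).
  apply: near_imp (near_and (hF i) (deriv_cts (hF i) (hM i) e0)) _ => x [hx hd'].
  by rewrite Dp; apply: hd'; exact: hD.
have cd : ctsat (fun x => D x ord0 ord0 * D x ord_max ord_max + - 1 * (D x ord0 ord_max * D x ord_max ord0)) p.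
  by apply: ctsat_add; [|apply: ctsat_mul; [exact: ctsat_const|]]; apply: ctsat_mul.
have Dp : D p = M by apply: funext => i; apply: hat_unique (hD p i _) (hM i); exists (M i).
have := ctsat_neq0 cd; rewrite Dp mulN1r => /(_ hd) K.
apply: near_imp (near_and (near_all hF) K) _ => x [hx hk].
have [|N hN] := @mxinv2 (D x); last by exists (D x), N; split=> // i; exact: hD.
by apply: contraTneq hk => e; rewrite mulN1r e nc0 -leNgt divr_ge0 // nc_ge0.
Qed.

Lemma hat_comp2 (I : finType) (h : ('I_2 -> C) -> C) (phi : (I -> C) -> 'I_2 -> C) z L M :
  hat h (phi z) L -> (forall j, hat (fun x => phi x j) z (M j)) ->
  hat (fun x => h (phi x)) z (fun i => L ord0 * M ord0 i + L ord_max * M ord_max i).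
Proof. by move=> hL hM; have := hat_comp hL hM; congr hat; apply: funext => i; rewrite sum2. Qed.

(** A branch of the square root near [k] is the local inverse of squaring, obtained from [ift] over
    the index type [unit]. *)
Lemma csqrt_near (k : C) : k != 0 -> exists (c : C) (g : C -> C), [/\ c != 0, g k = c &
  exists2 d : R, 0 < d & forall t, nc (t - k) < d -> g t ^+ 2 = t /\ exists g', cdiff g t g'].
Proof.
move=> k0; pose c := sqrtC k; have c2 : c ^+ 2 = k by rewrite sqrtCK.
have c0 : c != 0 by apply: contraNneq k0 => e; rewrite -c2 e expr0n.
pose F (x : unit -> C) (_ : unit) := x tt * x tt.
have dF (z : unit -> C) (i : unit) : hat (fun x => F x i) z (fun _ => 2 * z tt).
  have := hat_mul (hat_coord tt z) (hat_coord tt z); congr hat.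
  by apply: funext => -[] /=; rewrite mulr1; ring.
have hF i : hnear (fun x => F x i) (fun _ => c) by apply: near_true => z; eexists; exact: dF.
have [|G [h1 h2 h3 h4 _]] := ift hF.
  have := ctsat_neq0 (ctsat_coord tt (fun _ : unit => c)) c0; move/near_imp; apply=> z hz.
  have z0 : z tt != 0 by apply: contraTneq hz => ->; rewrite nc0 -leNgt divr_ge0 // nc_ge0.
  exists (fun _ _ => 2 * z tt), (fun _ _ => (2 * z tt)^-1); split; first exact: dF.
  have z2 : 2 * z tt != 0 by rewrite mulf_neq0 // pnatr_eq0.
  by split=> -[] []; rewrite (bigD1 tt) //= big1 ?addr0 ?mulVf ?mulfV //; case.
have Fk : F (fun _ => c) = (fun _ => k) by apply: funext => -[]; rewrite /F -expr2.
rewrite Fk in h1 h2 h4.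
exists c, (fun t => G (fun _ => t) tt); split=> //; first by rewrite h1.
have [d d0 hd] := near_and h4 (h2 tt); exists d => // t ht.
have [|e [L hL]] := hd (fun _ => t).
  by rewrite /n1 (bigD1 tt) //= big1 ?addr0 //; case.
split; first by have /(congr1 (fun f => f tt)) := e; rewrite /F -expr2.
exists (\sum_i L i * 1); have := @cdiff_line R unit (fun y => G y tt) (fun _ => 0) (fun _ => 1) t L.
have E u : (fun _ : unit => 0 + u * 1) = (fun _ => u) :> (unit -> C) by apply: funext => _; rewrite add0r mulr1.
by rewrite E => /(_ hL); congr cdiff; apply: funext => u; rewrite E.
Qed.
End HoloNear.

(** * Transversal folds *)

Arguments nc : simpl never.

Section FoldCurve.
Variable R : realType.
Local Notation C := (R[i]).
Local Notation pt := ('I_2 -> C).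
Local Notation o0 := (@ord0 1).
Local Notation o1 := (@ord_max 1).

Definition wedge (A B : pt) : C := A o0 * B o1 - A o1 * B o0.

Variables (u v J : pt -> C) (Du Dv DJ : pt -> pt).
Hypothesis hu : forall x, hat u x (Du x).
Hypothesis hv : forall x, hat v x (Dv x).
Hypothesis hJ : forall x, hat J x (DJ x).
Hypothesis cDu : forall i x, ctsat (fun x => Du x i) x.
Hypothesis cDJ : forall i x, ctsat (fun x => DJ x i) x.
Hypothesis Jdef : forall x, J x = wedge (Du x) (Dv x).

(** Whitney's normal form of a fold. The hypothesis makes [(J, u)] local coordinates, in which
    [J = wedge Du Dv] turns the derivative of [v] in the first coordinate into [-J / W]. Hence [v]
    minus its restriction to the curve [J = 0] is [J^2] times a unit, and the unit has a square
    root. The image of the critical curve is the graph of [gam] over [u]. *)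
Lemma fold_curve (p : pt) : J p = 0 -> wedge (DJ p) (Du p) != 0 ->
  exists (gam : C -> C) (w : pt -> C) (c : C),
  [/\ gam (u p) = v p,
      exists2 d : R, 0 < d & forall t, nc (t - u p) < d -> exists g', cdiff gam t g',
      cdiff gam (u p) (wedge (DJ p) (Dv p) / wedge (DJ p) (Du p)),
      [/\ hnear w p, hat w p (fun i => c * DJ p i), c != 0 & w p = 0] &
      near p (fun x => v x - gam (u x) = w x ^+ 2)].
Proof.
move=> Jp Wp; pose W x := wedge (DJ x) (Du x).
pose Phi x := vec2 (J x) (u x).
have nu x : hnear u x by apply: near_true => z; eexists; exact: hu.
have nv x : hnear v x by apply: near_true => z; eexists; exact: hv.
have nJ x : hnear J x by apply: near_true => z; eexists; exact: hJ.
have hPhi i : hnear (fun x => Phi x i) p by move: i; apply: I2P.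
have dPhi x := hat_vec2 (hJ x) (hu x).
have [|Psi [P1 P2 P3 P4]] := ift2 hPhi (dPhi p); first by rewrite /= mulrC [X in _ - X]mulrC mulrC [X in _ - X]mulrC.
pose yp := Phi p; rewrite -/yp in P1 P2 P4.
have yp0 : yp o0 = 0 by rewrite /yp /Phi /vec2 eqxx Jp.
have cPsi i := hnear_cts (P2 i).
have cW x : ctsat W x.
  have := ctsat_add (ctsat_mul (cDJ o0 x) (cDu o1 x)) (ctsat_mul (ctsat_const (-1) x) (ctsat_mul (cDJ o1 x) (cDu o0 x))).
  by congr ctsat; apply: funext => z; rewrite mulN1r.
(* The value of [v] at the point of the critical curve where [u = t]. *)
pose gam t := v (Psi (vec2 0 t)).
pose vP y := v (Psi y).
have nvP : hnear vP yp by apply: hnear_comp => //; rewrite P1.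
pose sl (y : pt) := vec2 0 (y o1).
have slyp : sl yp = yp by rewrite /sl -[in RHS](vec2_eta yp) yp0.
have csl i y : ctsat (fun y => sl y i) y.
  by move: i; apply: I2P; [exact: ctsat_const|exact: ctsat_coord].
have hsl i : hnear (fun y => sl y i) yp.
  by move: i; apply: I2P; [exact: hnear_const|exact: hnear_coord].
pose H y := vP y - vP (sl y).
have nH : hnear H yp by apply: hnear_sub => //; apply: hnear_comp => //; rewrite slyp.
(* [M] and [M1] are the rows of the derivative of [Psi]; the four equations say that it is inverse
   to the matrix with rows [DJ] and [Du]. *)
have chain : near yp (fun y => exists M : pt, exists M1 : pt, [/\ hat vP y (vec2 (Dv (Psi y) o0 * M o0 + Dv (Psi y) o1 * M1 o0) (Dv (Psi y) o0 * M o1 + Dv (Psi y) o1 * M1 o1)),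
     DJ (Psi y) o0 * M o0 + DJ (Psi y) o1 * M1 o0 = 1, DJ (Psi y) o0 * M o1 + DJ (Psi y) o1 * M1 o1 = 0,
     Du (Psi y) o0 * M o0 + Du (Psi y) o1 * M1 o0 = 0 & Du (Psi y) o0 * M o1 + Du (Psi y) o1 * M1 o1 = 1]).
  apply: near_imp (near_and (near_all P2) (near_near P4)) _ => y [/choice[M hM] hy].
  have HJ := hat_comp2 (hJ (Psi y)) hM; have Hu := hat_comp2 (hu (Psi y)) hM.
  have Hv := hat_comp2 (hv (Psi y)) hM.
  have EJ : near y (fun z => J (Psi z) = z o0).
    by apply: near_imp hy _ => z /(congr1 (fun f => f o0)).
  have Eu : near y (fun z => u (Psi z) = z o1).
    by apply: near_imp hy _ => z /(congr1 (fun f => f o1)).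
  have e1 := hat_unique (hat_ext EJ HJ) (hat_coord o0 y).
  have e2 := hat_unique (hat_ext Eu Hu) (hat_coord o1 y).
  exists (M o0), (M o1); split.
  - by move: Hv; congr hat; apply: funext; apply: I2P.
  - by have := congr1 (fun f => f o0) e1.
  - by have := congr1 (fun f => f o1) e1.
  - by have := congr1 (fun f => f o0) e2.
  - by have := congr1 (fun f => f o1) e2.
have cWP : ctsat (fun y => W (Psi y)) yp.
  move=> e e0; have := cW (Psi yp) e e0 => h; exact: (near_comp cPsi h).
have WPn : W (Psi yp) != 0 by rewrite P1.
have Wn := ctsat_neq0 cWP WPn.
have Wn0 : near yp (fun y => W (Psi y) != 0).
  apply: near_imp Wn _ => y hy; apply: contraTneq hy => ->.
  by rewrite nc0 -leNgt divr_ge0 // nc_ge0.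
(* Cramer's rule in the equations of [chain] gives the derivative of [v] in the coordinate [J]; the
   part [vP (sl y)] of [H] is constant in this direction. *)
have form : near yp (fun y => forall L, hat H y L -> L o0 = - y o0 / W (Psi y)).
  have chain2 : near yp (fun y => exists A, hat vP (sl y) A).
    by apply: (@near_comp _ _ _ sl yp (fun z => exists A, hat vP z A) (fun i => csl i yp)); rewrite slyp.
  apply: near_imp (near_and (near_and chain chain2) (near_and Wn0 P4)) _ => y [[[M [M1 [k1 k2 k3 k4 k5]]] [A hA]] [w0 e]] L hL.
  have dsl i : hat (fun y => sl y i) y (if i == o0 then (fun _ => 0) else (fun k => (k == o1)%:R)).
    by move: i; apply: I2P; [exact: hat_const|exact: hat_coord].
  have := hat_sub k1 (hat_comp2 hA dsl); move/(hat_unique hL) => ->.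
  rewrite /= !mulr0 addr0 subr0.
  have Jy : y o0 = wedge (Du (Psi y)) (Dv (Psi y)) by rewrite -Jdef -[in LHS]e.
  rewrite Jy; apply: (mulIf w0); rewrite divfK // /W /wedge.
  have m0 : M o0 * W (Psi y) = Du (Psi y) o1.
    by rewrite -[RHS]mulr1 -k2 -[RHS](subr0) -[X in _ = _ - X](mulr0 (DJ (Psi y) o1)) -k4 /W /wedge; ring.
  have m1 : M1 o0 * W (Psi y) = - Du (Psi y) o0.
    by rewrite -[RHS]mulr1 -k2 -[RHS]addr0 -[X in _ = _ + X](mulr0 (DJ (Psi y) o0)) -k4 /W /wedge; ring.
  rewrite /W /wedge in m0 m1.
  by rewrite mulrDl -!mulrA m0 m1; ring.
have updE (y : pt) : upd y o0 0 = sl y.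
  by apply: funext; apply: I2P.
have [k1 nk1 ek1] := division o0 nH; rewrite yp0 in ek1.
have Hk1 : near yp (fun y => H y = y o0 * k1 y).
  apply: near_imp ek1 _ => y ->; rewrite updE subr0 /H.
  by rewrite (_ : sl (sl y) = sl y) ?subrr ?add0r //.
have k1z : near yp (fun y => k1 (sl y) = 0).
  (* Differentiating [H = J * k1] at a point with [J = 0] gives [k1] there, and [form] says that
     this derivative is 0. So [k1] can be divided by [J] again. *)
  have K : near yp (fun y => y o0 = 0 -> k1 y = 0).
    apply: near_imp (near_and (near_and form (near_near Hk1)) nk1) _ => y [[h1 h2] [L hL]] y0.
    have := hat_mul (hat_coord o0 y) hL => h3.
    have h4 : near y (fun x => x o0 * k1 x = H x) by apply: near_imp h2 _ => x ->.
    have := h1 _ (hat_ext h4 h3); rewrite y0 eqxx mulr1 mul0r addr0 => ->.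
    by rewrite oppr0 mul0r.
  have := @near_comp _ _ _ sl yp _ (fun i => csl i yp); rewrite slyp => /(_ _ K).
  by move/near_imp; apply=> y; apply; rewrite /sl /vec2 eqxx.
have [k2 nk2 ek2] := division o0 nk1; rewrite yp0 in ek2.
have Hk2 : near yp (fun y => H y = y o0 * (y o0 * k2 y)).
  apply: near_imp (near_and (near_and Hk1 k1z) ek2) _ => y [[-> h1] h2].
  by rewrite h2 updE h1 add0r subr0.
(* At the point with first coordinate [t], [form] and the derivative of [J^2 * k2] combine to
   [W * (2 * k2 + t * L) = -1]. If [k2] vanished at [yp], the left side would have modulus at most
   1/2 for small [t]. *)
have k2n : k2 yp != 0.
  apply/eqP => k20; have [K hK] := near_self nk2.
  pose B := nc (W p) + 1.
  have B0 : 0 < B by rewrite /B; have := nc_ge0 (W p); lra.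
  have iB0 : 0 < B^-1 by rewrite invr_gt0.
  have Kn := nc_ge0 (K o0).
  have e0 : 0 < B^-1 / 8 by rewrite divr_gt0.
  have b1 := hnear_cts nk2 e0; have b2 := deriv_cts nk2 hK ltr01.
  have b3 := ctsat_bnd cWP; rewrite P1 -/B in b3.
  have [r r0 hr] := near_and (near_and (near_and b1 b2) (near_and b3 form)) (near_and (near_and (near_near Hk2) nk2) Wn0).
  pose t := Num.min (r / 2) (B^-1 / (4 * (nc (K o0) + 1))).
  have t0 : 0 < t by rewrite lt_min !divr_gt0 // mulr_gt0 // ltr_wpDl.
  have tr : t < r by rewrite gt_min; lra.
  have tB : t * (4 * (nc (K o0) + 1)) <= B^-1.
    by rewrite -ler_pdivlMr ?ge_min ?lexx ?orbT // mulr_gt0 // ltr_wpDl.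
  clearbody t; pose y := vec2 (real_complex R t) (yp o1).
  have ny : n1 (vsub y yp) < r.
    rewrite /n1 sum2 /vsub /y /vec2 /= yp0 subr0 subrr nc0 addr0 nc_real gtr0_norm //.
  have [[[a1 a2] [a3 a4]] [[a5 [L hL]] a6]] := hr y ny.
  have d1 := hat_mul (hat_coord o0 y) (hat_mul (hat_coord o0 y) hL).
  have h4 : near y (fun x => x o0 * (x o0 * k2 x) = H x) by apply: near_imp a5 _ => x ->.
  have := a4 _ (hat_ext h4 d1); rewrite eqxx !mulr1.
  have y0 : y o0 = real_complex R t by rewrite /y /vec2 eqxx.
  rewrite y0 => E.
  have tn : real_complex R t != 0 by apply: (@nc_neq0 _ _ t) => //; rewrite nc_real gtr0_norm.
  have E2 : W (Psi y) * (2 * k2 y + real_complex R t * L o0) = -1.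
    apply: (mulIf tn); rewrite mulN1r.
    have := congr1 (fun q => q * W (Psi y)) E; rewrite divfK // => <-; ring.
  have := congr1 (@nc R) E2; rewrite ncN nc1 ncM => E3.
  have := a2 L hL o0 => a2'.
  have c1 : nc (2 * k2 y + real_complex R t * L o0) <= B^-1 / 2.
    apply: le_trans (ncD _ _) _; rewrite !ncM nc_nat nc_real gtr0_norm //.
    rewrite k20 subr0 in a1.
    have c2 : nc (L o0) <= nc (K o0) + 1 by have := ncD (L o0 - K o0) (K o0); rewrite subrK; lra.
    have c3 : t * nc (L o0) <= t * (nc (K o0) + 1) by rewrite ler_pM2l.
    lra.
  have c4 : nc (W (Psi y)) * nc (2 * k2 y + real_complex R t * L o0) <= B * (B^-1 / 2).
    by apply: ler_pM; rewrite ?nc_ge0 // ltW.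
  rewrite E3 mulrA mulfV ?gt_eqF // in c4.
  by move: c4; rewrite leNgt => /negP; apply; lra.
have [c [g [c0 gk [d d0 hd]]]] := csqrt_near k2n.
have cPhi i : ctsat (fun x => Phi x i) p := hnear_cts (hPhi i).
pose rt x := g (k2 (Phi x)).
have nk : hnear (fun x => k2 (Phi x)) p by apply: hnear_comp.
have kcl : near p (fun x => nc (k2 (Phi x) - k2 yp) < d) by exact: (hnear_cts nk) d0.
have nrt : hnear rt p.
  apply: near_imp (near_and nk kcl) _ => x [[L hL] h1].
  by have [_ [g' hg']] := hd _ h1; eexists; exact: (hat_cdiff hg' hL).
exists gam, (fun x => J x * rt x), c.
have gamE t : gam t = vP (fun i => vec2 0 0 i + t * vec2 0 1 i).
  congr (v (Psi _)); apply: funext; apply: I2P; rewrite /vec2 /=.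
    by rewrite mulr0 addr0.
  by rewrite mulr1 add0r.
have gE : gam = (fun t => vP (fun i => vec2 0 0 i + t * vec2 0 1 i)) by apply: funext.
have lineE t : (fun i => vec2 0 0 i + t * vec2 0 1 i) = vec2 0 t :> pt.
  by apply: funext; apply: I2P; rewrite /vec2 /= ?mulr0 ?addr0 // mulr1 add0r.
have ypE : vec2 0 (u p) = yp by rewrite /yp /Phi Jp.
split.
- by rewrite /gam ypE P1.
- have [r r0 hr] := nvP; exists r => // t ht.
  have [|L hL] := hr (vec2 0 t).
    by rewrite /n1 sum2 /vsub yp0 /vec2 /= subr0 nc0 add0r.
  exists (\sum_i L i * vec2 0 1 i); rewrite gE; apply: cdiff_line.
  by rewrite lineE.
- have [M [M1 [m1 m2 m3 m4 m5]]] := near_self chain; rewrite P1 in m1 m2 m3 m4 m5.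
  rewrite -ypE -lineE in m1.
  have := cdiff_line m1; rewrite -gE; congr cdiff.
  rewrite sum2 /vec2 /= mulr0 add0r mulr1.
  apply: (mulIf Wp); rewrite divfK // /wedge.
  have q0 : M o1 * W p = - DJ p o1.
    by rewrite -[RHS]mulr1 -m5 -[RHS]addr0 -[X in _ = _ + X](mulr0 (Du p o1)) -m3 /W /wedge; ring.
  have q1 : M1 o1 * W p = DJ p o0.
    by rewrite -[RHS]mulr1 -m5 -[RHS]subr0 -[X in _ = _ - X](mulr0 (Du p o0)) -m3 /W /wedge; ring.
  rewrite /W /wedge in q0 q1.
  by rewrite mulrDl -!mulrA q0 q1; ring.
- split=> //; first exact: hnear_mul.
    have [L hL] := near_self nrt; have := hat_mul (hJ p) hL; congr hat.
    by apply: funext => i; rewrite Jp mul0r addr0 /rt -/yp gk.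
  by rewrite Jp mul0r.
have := near_comp cPhi Hk2 => HkP.
apply: near_imp (near_and (near_and P3 HkP) kcl) _ => x [[e1 e2] e3].
have [e4 _] := hd _ e3; rewrite exprMn /rt e4.
have <- : H (Phi x) = v x - gam (u x) by rewrite /H /vP e1.
by rewrite e2 /Phi /vec2 eqxx; ring.
Qed.
End FoldCurve.

(** * Bi-germs of two folds *)

Section TwoFolds.
Variable R : realType.
Local Notation C := (R[i]).
Local Notation pt := ('I_2 -> C).
Local Notation o0 := (@ord0 1).
Local Notation o1 := (@ord_max 1).

Lemma ift2_germ (F : pt -> pt) p (M : 'I_2 -> 'I_2 -> C) :
  (forall i, hnear (fun x => F x i) p) -> (forall i, hat (fun x => F x i) p (M i)) ->
  wedge (M o0) (M o1) != 0 ->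
  exists G : pt -> pt, [/\ biholo_germ G (F p) p, near p (fun x => G (F x) = x),
    near (F p) (fun y => F (G y) = y) & forall i, hnear (fun y => G y i) (F p)].
Proof.
move=> h1 h2 h3; have [G [g1 g2 g3 g4]] := ift2 h1 h2 h3; exists G; split=> //.
split; first by apply/peqP.
split; first by move=> i; apply/holo_nearE; exact: g2.
exists F; split; first by apply/peqP.
split; first by move=> i; apply/holo_nearE; exact: h1.
by split=> i; apply/eq_nearE; [apply: near_imp g4 _|apply: near_imp g3 _] => z ->.
Qed.

Lemma hat_c1 (gam : C -> C) (y : pt) i g' : cdiff gam (y i) g' ->
  hat (fun y => gam (y i)) y (fun k => g' * (k == i)%:R).
Proof. by move=> h; apply: hat_cdiff h (hat_coord i y). Qed.

Lemma hnear_c1 (gam : C -> C) (y : pt) (f : pt -> C) :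
  (exists2 d : R, 0 < d & forall t, nc (t - f y) < d -> exists g', cdiff gam t g') ->
  hnear f y -> hnear (fun x => gam (f x)) y.
Proof.
move=> [d d0 hd] hf; apply: near_imp (near_and hf (hnear_cts hf d0)) _ => x [[L hL] /hd[g' hg']].
by eexists; exact: (hat_cdiff hg' hL).
Qed.

(** By [fold_curve] the two critical images are graphs of [g1] and [g2] over [u], with different
    slopes by transversality. The target coordinates [v - g1(u)] and [v - g2(u)] straighten both
    graphs. At [p] the first one is the square [w1^2] while the second one together with [w1] gives
    source coordinates, and symmetrically at [q]. *)
Lemma two_folds (u v J : pt -> C) (Du Dv DJ : pt -> pt) (p q : pt) :
  (forall x, hat u x (Du x)) -> (forall x, hat v x (Dv x)) -> (forall x, hat J x (DJ x)) ->
  (forall i x, ctsat (fun x => Du x i) x) -> (forall i x, ctsat (fun x => DJ x i) x) ->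
  (forall x, J x = wedge (Du x) (Dv x)) ->
  J p = 0 -> J q = 0 -> u p = u q -> v p = v q ->
  wedge (DJ p) (Du p) != 0 -> wedge (DJ q) (Du q) != 0 ->
  wedge (DJ p) (Du p) * wedge (DJ q) (Dv q) != wedge (DJ p) (Dv p) * wedge (DJ q) (Du q) ->
  bigerm_folds (fun x => vec2 (u x) (v x)) p q.
Proof.
move=> hu hv hJ cDu cDJ Jdef Jp Jq upq vpq Up Uq UV.
have [g1 [w1 [c1 [a1 a2 a3 [a4 a5 a6 a7] a8]]]] := fold_curve hu hv hJ cDu cDJ Jdef Jp Up.
have [g2 [w2 [c2 [b1 b2 b3 [b4 b5 b6 b7] b8]]]] := fold_curve hu hv hJ cDu cDJ Jdef Jq Uq.
set k1 := _ / _ in a3; set k2 := _ / _ in b3.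
have k12 : k1 - k2 != 0.
  rewrite subr_eq0; apply: contra UV; rewrite /k1 /k2 eqr_div // => /eqP e.
  by rewrite mulrC -e.
have nu x : hnear u x by apply: near_true => z; eexists; exact: hu.
have nv x : hnear v x by apply: near_true => z; eexists; exact: hv.
pose G x := vec2 (u x) (v x); pose y0 := G p.
have Gq : G q = y0 by rewrite /y0 /G upq vpq.
(* The straightening of the target; the normal form uses its local inverse [psi], just as [ph1] and
   [ph2] are the local inverses of [X1] and [X2]. *)
pose S (y : pt) := vec2 (y o1 - g1 (y o0)) (y o1 - g2 (y o0)).
have y00 : y0 o0 = u p by []. have y01 : y0 o1 = v p by [].
have dS : forall i, hat (fun y => S y i) y0 (if i == o0 then vec2 (- k1) 1 else vec2 (- k2) 1).
  have e1 := hat_sub (hat_coord o1 y0) (@hat_c1 g1 y0 o0 k1 a3).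
  rewrite -upq in b3; have e2 := hat_sub (hat_coord o1 y0) (@hat_c1 g2 y0 o0 k2 b3).
  apply: I2P; [move: e1|move: e2]; congr hat; apply: funext; apply: I2P;
    by rewrite /vec2 /= ?(mulr1, mulr0, sub0r, subr0).
have nS i : hnear (fun y => S y i) y0.
  move: i; apply: I2P; apply: hnear_sub; try exact: hnear_coord;
  apply: hnear_c1 => //; try exact: hnear_coord.
  by rewrite /= y00 upq.
have [|psi [s1 s2 s3 s4]] := ift2_germ nS dS.
  by rewrite /wedge /vec2 /= mulr1 mul1r opprK addrC -oppr_eq0 opprB.
have Sy0 : S y0 = @zero2 R.
  by apply: funext; apply: I2P; rewrite /S /vec2 /= y00 y01 ?a1 ?subrr // upq vpq b1 subrr.
pose X1 x := vec2 (w1 x) (v x - g2 (u x)).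
pose X2 x := vec2 (v x - g1 (u x)) (w2 x).
have cG z i : ctsat (fun x => G x i) z.
  by move: i; apply: I2P; apply: hnear_cts.
have n1' : forall i, hnear (fun x => X1 x i) p.
  apply: I2P => //; apply: hnear_sub => //; apply: hnear_c1 => //; by rewrite upq.
have n2' : forall i, hnear (fun x => X2 x i) q.
  apply: I2P => //; apply: hnear_sub => //; apply: hnear_c1 => //; by rewrite -upq.
have d1 : forall i, hat (fun x => X1 x i) p (if i == o0 then (fun i => c1 * DJ p i) else (fun i => Dv p i - k2 * Du p i)).
  apply: I2P => //; apply: hat_sub => //; apply: hat_cdiff => //; by rewrite upq.
have d2 : forall i, hat (fun x => X2 x i) q (if i == o0 then (fun i => Dv q i - k1 * Du q i) else (fun i => c2 * DJ q i)).
  apply: I2P => //; apply: hat_sub => //; apply: hat_cdiff => //; by rewrite -upq.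
have [|ph1 [p1 p2 p3 p4]] := ift2_germ n1' d1.
  rewrite /wedge /=.
  have -> : c1 * DJ p o0 * (Dv p o1 - k2 * Du p o1) - c1 * DJ p o1 * (Dv p o0 - k2 * Du p o0)
    = c1 * (wedge (DJ p) (Dv p) - k2 * wedge (DJ p) (Du p)) by rewrite /wedge; ring.
  rewrite mulf_neq0 // -(divfK Up (wedge (DJ p) (Dv p))) -mulrBl mulf_neq0 //.
have [|ph2 [q1 q2 q3 q4]] := ift2_germ n2' d2.
  rewrite /wedge /=.
  have -> : (Dv q o0 - k1 * Du q o0) * (c2 * DJ q o1) - (Dv q o1 - k1 * Du q o1) * (c2 * DJ q o0)
    = c2 * (k1 * wedge (DJ q) (Du q) - wedge (DJ q) (Dv q)) by rewrite /wedge; ring.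
  rewrite mulf_neq0 // -(divfK Uq (wedge (DJ q) (Dv q))) -mulrBl mulf_neq0 //.
have X1p : X1 p = @zero2 R.
  by apply: funext; apply: I2P; rewrite /X1 /vec2 /= ?a7 // upq vpq b1 subrr.
have X2q : X2 q = @zero2 R.
  by apply: funext; apply: I2P; rewrite /X2 /vec2 /= ?b7 // -upq -vpq a1 subrr.
rewrite X1p in p1 p3 p4; rewrite X2q in q1 q3 q4; rewrite Sy0 in s1.
have pz : ph1 (@zero2 R) = p by case: p1 => /peqP.
have qz : ph2 (@zero2 R) = q by case: q1 => /peqP.
exists ph1, ph2, psi; split=> //; split=> //; split=> //.
have cp1 i := hnear_cts (p4 i); have cp2 i := hnear_cts (q4 i).
split=> i; apply/eq_nearE.
  have A1 : near p (fun x => psi (S (G x)) = G x) by exact: (near_comp (cG p) s2).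
  have A2 : near (@zero2 R) (fun z => psi (S (G (ph1 z))) = G (ph1 z) /\ v (ph1 z) - g1 (u (ph1 z)) = w1 (ph1 z) ^+ 2).
    apply: (@near_comp _ _ _ ph1 (@zero2 R) (fun x => psi (S (G x)) = G x /\ v x - g1 (u x) = w1 x ^+ 2)) => //.
    by rewrite pz; exact: near_and.
  apply: near_imp (near_and A2 p3) _ => z [[e1 e2] e3].
  rewrite -[LHS](congr1 (fun f => f i) e1); congr (psi _ i).
  have f0 : w1 (ph1 z) = z o0 by rewrite -[in RHS]e3.
  have f1 : v (ph1 z) - g2 (u (ph1 z)) = z o1 by rewrite -[in RHS]e3.
  by apply: funext; apply: I2P; rewrite /S /fold1 /vec2 /= /xc ?e2 ?f0 ?f1.
have A1 : near q (fun x => psi (S (G x)) = G x).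
  by apply: (@near_comp _ _ _ G q (fun y => psi (S y) = y)) => //; rewrite Gq.
have A2 : near (@zero2 R) (fun z => psi (S (G (ph2 z))) = G (ph2 z) /\ v (ph2 z) - g2 (u (ph2 z)) = w2 (ph2 z) ^+ 2).
  apply: (@near_comp _ _ _ ph2 (@zero2 R) (fun x => psi (S (G x)) = G x /\ v x - g2 (u x) = w2 x ^+ 2)) => //.
  by rewrite qz; exact: near_and.
apply: near_imp (near_and A2 q3) _ => z [[e1 e2] e3].
rewrite -[LHS](congr1 (fun f => f i) e1); congr (psi _ i).
have f0 : w2 (ph2 z) = z o1 by rewrite -[in RHS]e3.
have f1 : v (ph2 z) - g1 (u (ph2 z)) = z o0 by rewrite -[in RHS]e3.
by apply: funext; apply: I2P; rewrite /S /fold2 /vec2 /= /yc ?e2 ?f0 ?f1.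
Qed.

(** Exchanging the target coordinates covers critical images that are graphs over the second
    coordinate instead of the first. *)
Lemma bigerm_swap (G : pt -> pt) p q :
  bigerm_folds (fun x => vec2 (G x o1) (G x o0)) p q -> bigerm_folds G p q.
Proof.
move=> [ph1 [ph2 [psi [h1 [h2 [[s1 [s2 [ps [s3 [s4 [s5 s6]]]]]] [h4 h5]]]]]]].
pose sw (y : pt) := vec2 (y o1) (y o0).
have swsw y : sw (sw y) = y by rewrite /sw /vec2 /= -[RHS]vec2_eta.
have csw i y : ctsat (fun y => sw y i) y by move: i; apply: I2P; exact: ctsat_coord.
have nsw i y : hnear (fun y => sw y i) y by move: i; apply: I2P; exact: hnear_coord.
exists ph1, ph2, (fun z => sw (psi z)); split=> //; split=> //; split.
  split; first by apply/peqP; move/peqP: s1 => ->; exact: (swsw (G p)).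
  split.
    move=> i; apply/holo_nearE; move: i; apply: I2P;
    [exact/holo_nearE/(s2 o1)|exact/holo_nearE/(s2 o0)].
  exists (fun y => ps (sw y)); split; first exact: s3.
  split.
    move=> i; apply/holo_nearE; apply: (@hnear_comp _ _ _ (fun y => ps y i) sw) => //.
    by apply/holo_nearE; exact: s4.
  split=> i; apply/eq_nearE.
    have /eq_nearE := s5 i; move/near_imp; apply=> z; by rewrite swsw.
  have K : near (sw (G p)) (fun z => psi (ps z) = z).
    have := near_all (fun i => (eq_nearE _ _ _).1 (s6 i)); move/near_imp; apply=> z hz.
    by apply: funext.
  have := near_comp (fun i => csw i (G p)) K; move/near_imp; apply=> z ->; by rewrite swsw.
split=> i; apply/eq_nearE.
  have := near_all (fun i => (eq_nearE _ _ _).1 (h4 i)); move/near_imp; apply=> z hz.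
  by move: i; apply: I2P; rewrite /sw /vec2 /= -?(hz o1) -?(hz o0).
have := near_all (fun i => (eq_nearE _ _ _).1 (h5 i)); move/near_imp; apply=> z hz.
by move: i; apply: I2P; rewrite /sw /vec2 /= -?(hz o1) -?(hz o0).
Qed.

(** The fold annihilates the direction [k], and [ph] carries it to a kernel vector of the derivative
    of [G]. This vector is nonzero because [ph] has a left inverse. *)
Lemma fold_singular (G : pt -> pt) (D : 'I_2 -> pt) (ph psi fo : pt -> pt) (x y : pt) (k : 'I_2)
    (P : 'I_2 -> pt) :
  (forall i, hat (fun x => G x i) x (D i)) -> biholo_germ ph (@zero2 R) x ->
  biholo_germ psi (@zero2 R) y ->
  fo (@zero2 R) = @zero2 R -> (forall i, hat (fun z => fo z i) (@zero2 R) (P i)) ->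
  (forall i, P i k = 0) ->
  (forall i, eq_near (fun u => G (ph u) i) (fun u => psi (fo u) i) (@zero2 R)) ->
  wedge (D o0) (D o1) = 0.
Proof.
move=> hD [/peqP px [nph [ph' [px' [nph' [inv _]]]]]] [_ [npsi _]] f0 hP Pk e.
have /choice[M hM] : forall i, exists L, hat (fun z => ph z i) (@zero2 R) L.
  by move=> i; have /holo_nearE/near_self := nph i.
have /choice[N hN] : forall i, exists L, hat (fun z => ph' z i) x L.
  by move=> i; have /holo_nearE/near_self := nph' i.
have /choice[Q hQ] : forall i, exists L, hat (fun z => psi z i) (@zero2 R) L.
  by move=> i; have /holo_nearE/near_self := npsi i.
rewrite -px in hN hD.
have E1 i : D i o0 * M o0 k + D i o1 * M o1 k = 0.
  have /eq_nearE ee := e i.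
  have h1 := hat_ext ee (hat_comp2 (hD i) hM).
  rewrite -f0 in hQ; have h2 := hat_comp2 (hQ i) hP.
  by have := congr1 (fun f => f k) (hat_unique h1 h2); rewrite /= !Pk !mulr0 addr0.
have E2 : N k o0 * M o0 k + N k o1 * M o1 k = 1.
  have /eq_nearE ee := inv k.
  have h1 := hat_ext ee (hat_comp2 (hN k) hM).
  by have := congr1 (fun f => f k) (hat_unique h1 (hat_coord k _)); rewrite /= eqxx.
rewrite /wedge -[LHS]mulr1 -E2.
have -> : (D o0 o0 * D o1 o1 - D o0 o1 * D o1 o0) * (N k o0 * M o0 k + N k o1 * M o1 k) =
  N k o0 * (D o1 o1 * (D o0 o0 * M o0 k + D o0 o1 * M o1 k) - D o0 o1 * (D o1 o0 * M o0 k + D o1 o1 * M o1 k))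
  + N k o1 * (D o0 o0 * (D o1 o0 * M o0 k + D o1 o1 * M o1 k) - D o1 o0 * (D o0 o0 * M o0 k + D o0 o1 * M o1 k)) by ring.
by rewrite !E1; ring.
Qed.

Lemma bigerm_singular (G : pt -> pt) (D D' : 'I_2 -> pt) p q :
  (forall i, hat (fun x => G x i) p (D i)) -> (forall i, hat (fun x => G x i) q (D' i)) ->
  bigerm_folds G p q -> wedge (D o0) (D o1) = 0 /\ wedge (D' o0) (D' o1) = 0.
Proof.
move=> hD hD' [ph1 [ph2 [psi [h1 [h2 [h3 [h4 h5]]]]]]].
have sq (i : 'I_2) : hat (fun z : pt => z i ^+ 2) (@zero2 R) (fun _ => 0).
  have := hat_mul (hat_coord i (@zero2 R)) (hat_coord i (@zero2 R)); congr hat.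
  by apply: funext => k; rewrite /zero2 !mul0r addr0.
split.
  apply: (@fold_singular G D ph1 psi (@fold1 R) p (G p) o0 (fun i => if i == o0 then (fun _ => 0) else (fun k => (k == o1)%:R))) => //.
  - by apply: funext; apply: I2P; rewrite /fold1 /= /xc /zero2 ?expr0n.
  - by apply: I2P; [exact: (sq o0)|exact: hat_coord].
  - exact: I2P.
apply: (@fold_singular G D' ph2 psi (@fold2 R) q (G p) o1 (fun i => if i == o0 then (fun k => (k == o0)%:R) else (fun _ => 0))) => //.
- by apply: funext; apply: I2P; rewrite /fold2 /= /yc /zero2 ?expr0n.
- by apply: I2P; [exact: hat_coord|exact: (sq o1)].
- exact: I2P.
Qed.
End TwoFolds.

(** * Polynomial maps, their critical curves and nodes *)

Section PolynomialMaps.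
Variable R : realType.
Local Notation C := (R[i]).
Local Notation pt := ('I_2 -> C).
Local Notation o0 := (@ord0 1).
Local Notation o1 := (@ord_max 1).

Lemma hat_exp (I : finType) (i : I) n (z : I -> C) :
  hat (fun x => x i ^+ n) z (fun k => n%:R * z i ^+ n.-1 * (k == i)%:R).
Proof.
elim: n => [|n IH].
  by have := hat_const 1 z; congr hat; apply: funext => k; rewrite !mul0r.
have := hat_mul (hat_coord i z) IH; congr hat.
  by apply: funext => x; rewrite exprS.
apply: funext => k /=; case: n {IH} => [|n] /=; first by rewrite expr0; ring.
by rewrite exprS -[n.+2%:R]natr1; ring.
Qed.

Lemma hat_monomials (T : finType) (k : T -> C) (A B : T -> nat) (x : pt) :
  hat (fun x => \sum_(m : T) k m * xc x ^+ A m * yc x ^+ B m) x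
    (vec2 (\sum_(m : T) k m * (A m)%:R * xc x ^+ (A m).-1 * yc x ^+ B m)
          (\sum_(m : T) k m * (B m)%:R * xc x ^+ A m * yc x ^+ (B m).-1)).
Proof.
have H m := hat_mul (hat_scale (k m) (hat_exp o0 (A m) x)) (hat_exp o1 (B m) x).
have := hat_sum (index_enum T) H; congr hat.
apply: funext; apply: I2P; rewrite /vec2 /=; apply: eq_bigr => m _; rewrite /xc /yc /=; ring.
Qed.

Section Coeffs.
Variables (d : nat) (c : mon d -> C).

Definition pdxx (x : pt) : C := \sum_(m : mon d)
  c m * ((val m).1 : nat)%:R * ((val m).1.-1)%:R * xc x ^+ (val m).1.-2 * yc x ^+ (val m).2.
Definition pdxy (x : pt) : C := \sum_(m : mon d)
  c m * ((val m).1 : nat)%:R * ((val m).2 : nat)%:R * xc x ^+ (val m).1.-1 * yc x ^+ (val m).2.-1.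
Definition pdyy (x : pt) : C := \sum_(m : mon d)
  c m * ((val m).2 : nat)%:R * ((val m).2.-1)%:R * xc x ^+ (val m).1 * yc x ^+ (val m).2.-2.

Lemma hat_peval x : hat (peval c) x (vec2 (pdx c x) (pdy c x)).
Proof. exact: (hat_monomials c (fun m => (val m).1) (fun m => (val m).2)). Qed.

Lemma hat_pdx x : hat (pdx c) x (vec2 (pdxx x) (pdxy x)).
Proof.
exact: (hat_monomials (fun m => c m * ((val m).1 : nat)%:R) (fun m => (val m).1.-1) (fun m => (val m).2)).
Qed.

Lemma hat_pdy x : hat (pdy c) x (vec2 (pdxy x) (pdyy x)).
Proof.
have := hat_monomials (fun m => c m * ((val m).2 : nat)%:R) (fun m => (val m).1) (fun m => (val m).2.-1) x.
by congr hat; congr vec2; apply: eq_bigr => m _; rewrite -!mulrA; congr (_ * _); rewrite mulrCA.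
Qed.

Lemma polyfun_sum (I J : finType) (F : J -> (I -> C) -> C) :
  (forall j, polyfun (F j)) -> polyfun (fun z => \sum_j F j z).
Proof.
move=> h; have H (s : seq J) : polyfun (fun z => \sum_(j <- s) F j z).
  elim: s => [|j s IH].
    by rewrite (_ : (fun z => _) = (fun _ => 0)); [exact: polyfun_const|apply: funext => z; rewrite big_nil].
  rewrite (_ : (fun z => _) = (fun z => F j z + \sum_(j <- s) F j z)); last by apply: funext => z; rewrite big_cons.
  exact: polyfun_add.
exact: H.
Qed.

Lemma polyfun_exp (I : finType) (f : (I -> C) -> C) n : polyfun f -> polyfun (fun z => f z ^+ n).
Proof.
move=> hf; elim: n => [|n IH]; first exact: (polyfun_const _ 1).
by rewrite (_ : (fun z => _) = (fun z => f z * f z ^+ n)); [exact: polyfun_mul|apply: funext => z; rewrite exprS].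
Qed.

Lemma polyfun_monomials (I T : finType) (k : T -> (I -> C) -> C) (A B : T -> nat) (f g : (I -> C) -> C) :
  (forall m, polyfun (k m)) -> polyfun f -> polyfun g ->
  polyfun (fun z => \sum_(m : T) k m z * f z ^+ A m * g z ^+ B m).
Proof.
move=> hk hf hg; apply: polyfun_sum => m.
by apply: polyfun_mul; [apply: polyfun_mul => //|]; exact: polyfun_exp.
Qed.
End Coeffs.

Section Jacobian.
Variables (d1 d2 : nat) (c : Omega d1 d2 -> C).
Local Notation f := (fco c).
Local Notation g := (gco c).

Definition Df (x : pt) : pt := vec2 (pdx f x) (pdy f x).
Definition Dg (x : pt) : pt := vec2 (pdx g x) (pdy g x).
Definition DJ (x : pt) : pt :=
  vec2 (pdxx f x * pdy g x + pdx f x * pdxy g x - (pdxy f x * pdx g x + pdy f x * pdxx g x))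
       (pdxy f x * pdy g x + pdx f x * pdyy g x - (pdyy f x * pdx g x + pdy f x * pdxy g x)).

Lemma hat_Jac x : hat (Jac c) x (DJ x).
Proof.
have := hat_sub (hat_mul (hat_pdx f x) (hat_pdy g x)) (hat_mul (hat_pdy f x) (hat_pdx g x)).
by congr hat; apply: funext; apply: I2P; rewrite /DJ /vec2 /=; ring.
Qed.

Lemma JacE x : Jac c x = wedge (Df x) (Dg x).
Proof. by []. Qed.

Lemma hat_Fmap x i : hat (fun y => Fmap c y i) x (if i == o0 then Df x else Dg x).
Proof. by move: i; apply: I2P; exact: hat_peval. Qed.

Lemma cts_Df i x : ctsat (fun x => Df x i) x.
Proof. by move: i; apply: I2P; [exact: hat_cts (hat_pdx f x)|exact: hat_cts (hat_pdy f x)]. Qed.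
Lemma cts_Dg i x : ctsat (fun x => Dg x i) x.
Proof. by move: i; apply: I2P; [exact: hat_cts (hat_pdx g x)|exact: hat_cts (hat_pdy g x)]. Qed.

Lemma polyfun_peval_at d (e : mon d -> C) : [/\ polyfun (peval e), polyfun (pdx e), polyfun (pdy e) &
  [/\ polyfun (pdxx e), polyfun (pdxy e) & polyfun (pdyy e)]].
Proof.
split; [| | |split]; apply: polyfun_sum => m;
do ![apply: polyfun_mul]; try exact: polyfun_const;
by apply: polyfun_exp; exact: polyfun_coord.
Qed.

Lemma cts_DJ i x : ctsat (fun x => DJ x i) x.
Proof.
have [_ a1 a2 [a3 a4 a5]] := polyfun_peval_at f; have [_ b1 b2 [b3 b4 b5]] := polyfun_peval_at g.
move: i; apply: I2P; apply: polyfun_cts; rewrite /DJ /vec2 /=; apply: polyfun_add;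
 first [by apply: polyfun_add; exact: polyfun_mul | idtac].
  rewrite (_ : (fun z => _) = (fun z => -1 * (pdxy f z * pdx g z + pdy f z * pdxx g z))); last by apply: funext => z; rewrite mulN1r.
  by apply: polyfun_mul; [exact: polyfun_const|apply: polyfun_add; exact: polyfun_mul].
rewrite (_ : (fun z => _) = (fun z => -1 * (pdyy f z * pdx g z + pdy f z * pdxy g z))); last by apply: funext => z; rewrite mulN1r.
by apply: polyfun_mul; [exact: polyfun_const|apply: polyfun_add; exact: polyfun_mul].
Qed.

Definition zero_pair (p q : pt) := [/\ Jac c p = 0, Jac c q = 0 & Fmap c p = Fmap c q].

(** [wedge (DJ p) (Df p)] is the derivative of [f] along the tangent vector [(-J_y, J_x)] of the
    critical curve, and likewise for [g]. The inequality says that the images of the two branches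
    have independent tangent vectors. *)
Definition transv (p q : pt) :=
  wedge (DJ p) (Df p) * wedge (DJ q) (Dg q) != wedge (DJ p) (Dg p) * wedge (DJ q) (Df q).

(** Beyond transversality, one and the same component has to be regular along both branches, so that
    both images are graphs over a common axis. *)
Definition good_pair (p q : pt) := transv p q /\
  ((wedge (DJ p) (Df p) != 0 /\ wedge (DJ q) (Df q) != 0) \/
   (wedge (DJ p) (Dg p) != 0 /\ wedge (DJ q) (Dg q) != 0)).

Lemma node_zero p q : is_node (Fmap c) p q -> zero_pair p q.
Proof.
move=> [_ [/peqP e h]].
have [h1 h2] : Jac c p = 0 /\ Jac c q = 0; last by split.
case: h => h; first by have := bigerm_singular (hat_Fmap p) (hat_Fmap q) h.
by have [] := bigerm_singular (hat_Fmap q) (hat_Fmap p) h.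
Qed.

Lemma good_node p q : p <> q -> zero_pair p q -> good_pair p q -> is_node (Fmap c) p q.
Proof.
move=> pq [Jp Jq e] [UV h]; split; first by move/peqP.
split; first exact/peqP.
have e0 : peval f p = peval f q by have := congr1 (fun u => u o0) e.
have e1 : peval g p = peval g q by have := congr1 (fun u => u o1) e.
left; case: h => -[h1 h2].
  exact: (two_folds (hat_peval f) (hat_peval g) hat_Jac cts_Df cts_DJ JacE).
apply: bigerm_swap.
have hJ' x : hat (fun x => - Jac c x) x (fun i => - DJ x i).
  have := hat_scale (-1) (hat_Jac x); congr hat; apply: funext => i; by rewrite mulN1r.
have cJ' i x : ctsat (fun x => - DJ x i) x.
  have := ctsat_mul (ctsat_const (-1) x) (cts_DJ i x); congr ctsat; apply: funext => z; by rewrite mulN1r.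
have wN A B : wedge (fun i => - A i) B = - wedge A B :> C by rewrite /wedge; ring.
apply: (two_folds (hat_peval g) (hat_peval f) hJ' cts_Dg cJ'); rewrite ?wN ?oppr_eq0 ?Jp ?Jq ?oppr0 //.
  by move=> x; rewrite JacE /wedge /Df /Dg /vec2 /=; ring.
by rewrite !mulrNN eq_sym.
Qed.
End Jacobian.
End PolynomialMaps.

(** * Pham systems and multiplicities *)

Section LinearExtension.
Variables (A : comNzRingType) (n : nat) (V : lmodType A) (N : 'X_{1..n} -> V).

Definition lx (p : {mpoly A[n]}) : V := \sum_(b <- msupp p) p@_b *: N b.

Lemma lxw k p : (msize p <= k)%N -> lx p = \sum_(b : 'X_{1..n < k}) p@_b *: N b.
Proof.
move=> le_pi; set I : subFinType _ := 'X_{1..n < k}.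
rewrite /lx (big_mksub I) ?msupp_uniq //=; first last.
  by move=> x /msize_mdeg_lt /leq_trans; apply.
by rewrite big_rmcond //= => j /memN_msupp_eq0 ->; rewrite scale0r.
Qed.

Lemma lx_linear : linear lx.
Proof.
move=> a p q; pose_big_enough k.
  rewrite !(@lxw k) // scaler_sumr -big_split; apply: eq_bigr => b _ /=.
  by rewrite mcoeffD mcoeffZ scalerDl scalerA.
by close.
Qed.

HB.instance Definition _ := GRing.isLinear.Build A {mpoly A[n]} V _ lx lx_linear.

Lemma lxX b : lx 'X_[b] = N b.
Proof. by rewrite /lx msuppX big_seq1 mcoeffX eqxx scale1r. Qed.

Lemma lx_mulX b k p : (msize p <= k)%N ->
  lx ('X_[b] * p) = \sum_(c : 'X_{1..n < k}) p@_c *: N (b + c)%MM.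
Proof.
move=> h; rewrite {1}(mpolywE h) mulr_sumr linear_sum; apply: eq_bigr => c _.
by rewrite -scalerAr linearZ /= -mpolyXD lxX.
Qed.
End LinearExtension.

Section Ideal.
Variables (A : comNzRingType) (n k : nat) (h : 'I_k -> {mpoly A[n]}).

Definition inid (p : {mpoly A[n]}) := exists q : 'I_k -> {mpoly A[n]}, p = \sum_i q i * h i.

Lemma inid0 : inid 0.
Proof. by exists (fun _ => 0); rewrite big1 // => i _; rewrite mul0r. Qed.
Lemma inidD p q : inid p -> inid q -> inid (p + q).
Proof.
move=> [a ->] [b ->]; exists (fun i => a i + b i); rewrite -big_split.
by apply: eq_bigr => i _; rewrite mulrDl.
Qed.
Lemma inidM p q : inid q -> inid (p * q).
Proof.
by move=> [a ->]; exists (fun i => p * a i); rewrite mulr_sumr; apply: eq_bigr => i _; rewrite mulrA.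
Qed.
Lemma inidZ c q : inid q -> inid (c *: q).
Proof. by rewrite -mul_mpolyC; exact: inidM. Qed.
Lemma inidN q : inid q -> inid (- q).
Proof. by rewrite -mulN1r; exact: inidM. Qed.
Lemma inid_gen i : inid (h i).
Proof.
exists (fun j => (i == j)%:R); rewrite (bigD1 i) //= eqxx mul1r big1 ?addr0 // => j.
by rewrite eq_sym => /negPf->; rewrite mul0r.
Qed.
Lemma inid_sum (T : Type) (s : seq T) (F : T -> {mpoly A[n]}) :
  (forall t, inid (F t)) -> inid (\sum_(t <- s) F t).
Proof.
by move=> hF; elim: s => [|t s IH]; rewrite ?big_nil ?big_cons; [exact: inid0|exact: inidD].
Qed.
End Ideal.

(** * Normal forms in the algebra of a Pham system *)

Section Pham.
Variables (n m' : nat).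
Local Notation m := m'.+1.
Local Notation rd := {ffun 'I_n -> 'I_m}.
Local Notation D := #|{: rd}|.

Definition mr (r : rd) : 'X_{1..n} := [multinom (r i : nat) | i < n].
Definition rm (b : 'X_{1..n}) : rd := [ffun i => inord (b i)].

Lemma rmK (b : 'X_{1..n}) : (forall i, (b i < m)%N) -> mr (rm b) = b.
Proof. by move=> h; apply/mnmP => i; rewrite mnmE ffunE inordK. Qed.
Lemma mrK r : rm (mr r) = r.
Proof. by apply/ffunP => i; rewrite ffunE mnmE inord_val. Qed.

(** The leading variable of a monomial is the smallest one whose exponent reaches [m]. Fixing this
    choice makes the reduction deterministic; independence of it is the content of [N_kill]. *)
Definition fi (b : 'X_{1..n}) : option 'I_n :=
  if [pick i : 'I_n | (m <= b i)%N] is Some i0 then Some [arg min_(i < i0 | (m <= b i)%N) (i : nat)] else None.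

Variant fi_spec (b : 'X_{1..n}) : option 'I_n -> Type :=
| FiNone of (forall i, (b i < m)%N) : fi_spec b None
| FiSome i of (m <= b i)%N & (forall j, (m <= b j)%N -> (i <= j)%N) : fi_spec b (Some i).

Lemma fiP b : fi_spec b (fi b).
Proof.
rewrite /fi; case: pickP => [i0 h0|h]; last by constructor => i; rewrite ltnNge h.
by case: arg_minnP => // i h1 h2; constructor.
Qed.

Section Ring.
Variables (A : comNzRingType) (G : 'I_n -> {mpoly A[n]}).
Definition H i := 'X_i ^+ m + G i.

(** The normal form of a monomial as a vector over the reduced monomials, obtained by replacing the
    [m]-th power of the leading variable by [- G i]. The argument [k] is fuel: each replacement
    lowers the degree, as only terms of degree below [m] are inserted. *)
Fixpoint Nf (k : nat) (b : 'X_{1..n}) : 'rV[A]_D :=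
  if k is k'.+1 then
    if fi b is Some i then - \sum_(c : 'X_{1..n < m}) (G i)@_c *: Nf k' (b - U_(i) *+ m + c)%MM
    else delta_mx 0 (enum_rank (rm b))
  else 0.

Lemma subU_deg (b : 'X_{1..n}) i : (m <= b i)%N -> (mdeg (b - U_(i) *+ m) + m)%N = mdeg b.
Proof.
move=> h; rewrite -[in RHS](@submK _ (U_(i) *+ m) b); last first.
  by apply/mnm_lepP => j; rewrite mulmnE mnm1E; case: eqP => [<-|]; rewrite ?mul1n ?mul0n.
by rewrite mdegD mdegMn mdeg1 mul1n.
Qed.

Lemma Nf_fuel k l b : (mdeg b < k)%N -> (mdeg b < l)%N -> Nf k b = Nf l b.
Proof.
elim: k l b => [//|k IH] [//|l] b hk hl /=; case: fiP => // i hi _.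
congr (- _); apply: eq_bigr => c _; congr (_ *: _).
have hc : (mdeg (b - U_(i) *+ m + c) < mdeg b)%N.
  by rewrite mdegD -(subU_deg hi) ltn_add2l; case: c.
by apply: IH; [exact: leq_trans hc hk|exact: leq_trans hc hl].
Qed.

Definition N b := Nf (mdeg b).+1 b.

Lemma N_red (b : 'X_{1..n}) : (forall i, (b i < m)%N) -> N b = delta_mx 0 (enum_rank (rm b)).
Proof. by move=> h; rewrite /N /=; case: fiP => // i; rewrite leqNgt h. Qed.

Lemma N_fi (b : 'X_{1..n}) (i : 'I_n) : (m <= b i)%N -> (forall j, (m <= b j)%N -> (i <= j)%N) ->
  N b = - \sum_(c : 'X_{1..n < m}) (G i)@_c *: N (b - U_(i) *+ m + c)%MM.
Proof.
move=> hi hmin; rewrite {1}/N [Nf _.+1 _]/=; case: fiP => [h|j hj hm]; first by move: hi; rewrite leqNgt h.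
have -> : j = i by apply/val_inj/eqP; rewrite eqn_leq hm ?hmin.
congr (- _); apply: eq_bigr => c _; congr (_ *: _); apply: Nf_fuel => //.
by rewrite mdegD -(subU_deg hi) ltn_add2l; case: c.
Qed.

Definition NP : {mpoly A[n]} -> 'rV[A]_D := lx N.

Hypothesis hG : forall i, (msize (G i) <= m)%N.

Lemma kill_eq b i : NP ('X_[b] * H i) = N (b + U_(i) *+ m)%MM + \sum_(c : 'X_{1..n < m}) (G i)@_c *: N (b + c)%MM.
Proof. by rewrite /NP /H mulrDr linearD /= mpolyXn -mpolyXD lxX (lx_mulX _ _ (hG i)). Qed.

(* When the leading variable of b is j < i, expanding both X_j^m and X_i^m once gives the
   same double sum with opposite signs (the Koszul syzygy), so induction on the degree suffices. *)
Lemma N_kill b i : NP ('X_[b] * H i) = 0.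
Proof.
have [k] := ubnP (mdeg b); elim: k b i => [//|k IH] b i hb.
rewrite kill_eq; case E: (fi (b + U_(i) *+ m)%MM) => [j|]; last first.
  move: E; case: fiP => // h _; have := h i.
  by rewrite mnmDE mulmnE mnm1E eqxx mul1n ltnNge leq_addl.
move: E; case: fiP => // l hj hmin [E]; rewrite {}E in hj hmin => {l}.
case: (eqVneq j i) => [ji|ji].
  rewrite (N_fi hj hmin) ji; apply/eqP; rewrite addrC subr_eq0; apply/eqP.
  apply: eq_bigr => c _; congr (_ *: N (_ + _)%MM); by rewrite addmK.
have hbj : (m <= b j)%N by move: hj; rewrite mnmDE mulmnE mnm1E eq_sym (negPf ji) mul0n addn0.
have Ub : (U_(j) *+ m <= b)%MM.
  by apply/mnm_lepP => l; rewrite mulmnE mnm1E; case: eqP => [<-|]; rewrite ?mul1n ?mul0n.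
pose b' := (b - U_(j) *+ m)%MM.
have db c : (mdeg c < m)%N -> (mdeg (b' + c) < k)%N.
  by move=> hc; rewrite -ltnS; apply: leq_trans hb; rewrite ltnS mdegD -(subU_deg hbj) ltn_add2l.
have T c l : (mdeg c < m)%N -> N (b' + c + U_(l) *+ m)%MM = - \sum_(e : 'X_{1..n < m}) (G l)@_e *: N (b' + c + e)%MM.
  by move=> hc; have := IH _ l (db c hc); rewrite kill_eq => /eqP; rewrite addr_eq0 => /eqP.
have -> : N (b + U_(i) *+ m)%MM = \sum_(c : 'X_{1..n < m}) \sum_(e : 'X_{1..n < m}) ((G j)@_c * (G i)@_e) *: N (b' + c + e)%MM.
  rewrite (N_fi hj hmin) -sumrN; apply: eq_bigr => c _.
  have -> : (b + U_(i) *+ m - U_(j) *+ m + c = b' + c + U_(i) *+ m)%MM.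
    apply/mnmP => l; rewrite !(mnmDE, mnmBE, mulmnE, mnm1E).
    by have /mnm_lepP/(_ l) := Ub; rewrite mulmnE mnm1E; lia.
  rewrite T; last by case: c.
  by rewrite scalerN opprK scaler_sumr; apply: eq_bigr => e _; rewrite scalerA.
have -> : \sum_(c : 'X_{1..n < m}) (G i)@_c *: N (b + c)%MM = - \sum_(c : 'X_{1..n < m}) \sum_(e : 'X_{1..n < m}) ((G j)@_e * (G i)@_c) *: N (b' + e + c)%MM.
  rewrite -sumrN; apply: eq_bigr => c _.
  have -> : (b + c = b' + c + U_(j) *+ m)%MM.
    apply/mnmP => l; rewrite !(mnmDE, mnmBE, mulmnE, mnm1E).
    by have /mnm_lepP/(_ l) := Ub; rewrite mulmnE mnm1E; lia.
  rewrite T; last by case: c.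
  rewrite scalerN scaler_sumr; congr (- _); apply: eq_bigr => e _.
  by rewrite scalerA mulrC -!addmA [(_ + bmnm e)%MM]addmC.
by rewrite [X in _ - X]exchange_big /= subrr.
Qed.

Lemma NP_ideal p : inid H p -> NP p = 0.
Proof.
move=> [q ->]; rewrite /NP linear_sum big1 // => i _.
rewrite [q i]mpolyE mulr_suml linear_sum big1 // => b _.
by rewrite -scalerAl linearZ /= -/(NP _) N_kill scaler0.
Qed.

Definition sec (v : 'rV[A]_D) : {mpoly A[n]} := \sum_(r : rd) v 0 (enum_rank r) *: 'X_[mr r].

Lemma sec_linear : linear sec.
Proof.
move=> a u v; rewrite /sec scaler_sumr -big_split; apply: eq_bigr => r _.
by rewrite !mxE scalerDl scalerA.
Qed.
HB.instance Definition _ := GRing.isLinear.Build A 'rV[A]_D {mpoly A[n]} _ sec sec_linear.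

Lemma sec_delta r : sec (delta_mx 0 (enum_rank r)) = 'X_[mr r].
Proof.
rewrite /sec (bigD1 r) //= big1 => [|r' /negPf h]; rewrite mxE !eqxx ?scale1r ?addr0 //=.
by rewrite (inj_eq enum_rank_inj) h scale0r.
Qed.

Lemma N_mr r : N (mr r) = delta_mx 0 (enum_rank r).
Proof. by rewrite N_red ?mrK // => i; rewrite mnmE. Qed.

Lemma NP_sec v : NP (sec v) = v.
Proof.
rewrite /sec /NP linear_sum /=; apply/rowP => j; rewrite summxE.
rewrite (bigD1 (enum_val j)) //= big1 => [|r /negPf h].
  by rewrite linearZ /= lxX N_mr enum_valK !mxE !eqxx mulr1 addr0.
rewrite linearZ /= lxX N_mr !mxE eqxx /= (_ : (j == enum_rank r) = false) ?mulr0 //.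
by apply: contraFF h => /eqP ->; rewrite enum_rankK.
Qed.

(** Together with [NP_ideal] and [NP_sec] this identifies the quotient by [H] with the free module
    on the reduced monomials, over an arbitrary commutative ring of coefficients. *)
Lemma sec_NP p : inid H (p - sec (NP p)).
Proof.
have K b : inid H ('X_[b] - sec (N b)).
  have [k] := ubnP (mdeg b); elim: k b => [//|k IH] b hb.
  case: (fiP b) => [h|j hj hmin].
    by rewrite (N_red h) sec_delta rmK // subrr; exact: inid0.
  rewrite (N_fi hj hmin) linearN /= opprK linear_sum /=.
  have Ub : (U_(j) *+ m <= b)%MM.
    by apply/mnm_lepP => l; rewrite mulmnE mnm1E; case: eqP => [<-|]; rewrite ?mul1n ?mul0n.
  have -> : 'X_[b] = 'X_[b - U_(j) *+ m] * H j - \sum_(c : 'X_{1..n < m}) (G j)@_c *: 'X_[b - U_(j) *+ m + c].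
    rewrite /H mulrDr mpolyXn -mpolyXD submK // {1}(mpolywE (hG j)) mulr_sumr.
    rewrite (eq_bigr (fun c : 'X_{1..n < m} => (G j)@_c *: 'X_[b - U_(j) *+ m + c])) ?addrK // => c _.
    by rewrite -scalerAr mpolyXD.
  rewrite -addrA; apply: inidD; first by apply: inidM; exact: inid_gen.
  rewrite addrC -sumrB; apply: inid_sum => c; rewrite linearZ /= -scalerBr; apply: inidZ.
  rewrite -opprB; apply: inidN; apply: IH.
  by rewrite -ltnS; apply: leq_trans hb; rewrite ltnS mdegD -(subU_deg hj) ltn_add2l; case: c.
have -> : p - sec (NP p) = \sum_(b <- msupp p) p@_b *: ('X_[b] - sec (N b)).
  under eq_bigr do rewrite scalerBr; rewrite sumrB -mpolyE; congr (_ - _).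
  by rewrite /NP /lx linear_sum; apply: eq_bigr => b _; rewrite linearZ.
by apply: inid_sum => b; apply: inidZ.
Qed.

Definition M (p : {mpoly A[n]}) : 'M[A]_D := \matrix_(r, j) NP (p * 'X_[mr (enum_val r)]) 0 j.

Lemma mulM v p : v *m M p = NP (p * sec v).
Proof.
apply/rowP => j; rewrite !mxE /sec mulr_sumr /NP linear_sum /= summxE.
rewrite (reindex (@enum_rank rd)) /=; last first.
  by exists enum_val => r _; rewrite ?enum_rankK ?enum_valK.
by apply: eq_bigr => r _; rewrite !mxE enum_rankK -scalerAr linearZ !mxE.
Qed.

Lemma NP_M p q : NP p *m M q = NP (q * p).
Proof.
rewrite mulM; apply/eqP; rewrite eq_sym -subr_eq0 -linearB /= -mulrBr; apply/eqP.
by apply: NP_ideal; apply: inidM; exact: sec_NP.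
Qed.

Lemma MM p q : M p *m M q = M (q * p).
Proof.
apply/row_matrixP => r; rewrite row_mul; have E s : row r (M s) = NP (s * 'X_[mr (enum_val r)]).
  by apply/rowP => j; rewrite !mxE.
by rewrite !E NP_M mulrA.
Qed.

Lemma M1 : M 1 = 1%:M.
Proof.
apply/row_matrixP => r; apply/rowP => j.
by rewrite !mxE mul1r /NP lxX N_mr enum_valK mxE eqxx /= eq_sym.
Qed.

Lemma M_is_linear : linear M.
Proof.
move=> a p q; apply/matrixP => r j; rewrite !mxE mulrDl /NP linearD /= mxE -scalerAl linearZ.
by rewrite !mxE.
Qed.
HB.instance Definition _ := GRing.isLinear.Build A {mpoly A[n]} 'M[A]_D _ M M_is_linear.

Lemma M_ideal p : inid H p -> M p = 0.
Proof.
move=> hp; apply/row_matrixP => r; apply/rowP => j; rewrite !mxE mulrC NP_ideal ?mxE //.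
exact: inidM.
Qed.
End Ring.

Lemma N_map (A B : comNzRingType) (f : {rmorphism A -> B}) (G : 'I_n -> {mpoly A[n]}) b :
  N (fun i => map_mpoly f (G i)) b = map_mx f (N G b).
Proof.
rewrite /N; move: (mdeg b).+1 => k; elim: k b => [|k IH] b /=; first by rewrite map_mx0.
case: (fi b) => [i|]; last by rewrite map_delta_mx.
rewrite map_mxN; congr (- _); apply/rowP => j.
rewrite [RHS]mxE !summxE [RHS]raddf_sum /=.
by apply: eq_bigr => c _; rewrite mcoeff_map_mpoly IH !mxE rmorphM.
Qed.

(** Base change. Applied to evaluation of polynomials in [t], it shows that the entries of the
    multiplication matrices are polynomials in the parameter of a segment. *)
Lemma M_map (A B : comNzRingType) (f : {rmorphism A -> B}) (G : 'I_n -> {mpoly A[n]}) p :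
  M (fun i => map_mpoly f (G i)) (map_mpoly f p) = map_mx f (M G p).
Proof.
have K q : NP (fun i => map_mpoly f (G i)) (map_mpoly f q) = map_mx f (NP G q).
  rewrite {1}(mpolyE q) raddf_sum /= /NP linear_sum /= [in RHS]/lx.
  apply/rowP => j; rewrite [RHS]mxE !summxE [RHS]raddf_sum /=; apply: eq_bigr => b _.
  by rewrite map_mpolyZ map_mpolyX linearZ /= lxX N_map !mxE rmorphM.
apply/matrixP => r j; rewrite !mxE; have := K (p * 'X_[mr (enum_val r)]).
by rewrite rmorphM /= map_mpolyX => ->; rewrite mxE.
Qed.
End Pham.

(** * Order of vanishing at the origin *)

Section Order.
Variables (A : comNzRingType) (n : nat).
Implicit Types p q : {mpoly A[n]}.

Definition ordge k p := forall b, (mdeg b < k)%N -> p@_b = 0.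

Lemma ordge0 p : ordge 0 p. Proof. by move=> b. Qed.
Lemma ordge_le k l p : (k <= l)%N -> ordge l p -> ordge k p.
Proof. by move=> h hp b hb; apply: hp; exact: leq_trans h. Qed.
Lemma ordgeD k p q : ordge k p -> ordge k q -> ordge k (p + q).
Proof. by move=> h1 h2 b hb; rewrite mcoeffD h1 // h2 // addr0. Qed.
Lemma ordgeM k l p q : ordge k p -> ordge l q -> ordge (k + l) (p * q).
Proof.
move=> h1 h2 b hb; rewrite mcoeffM big1 // => -[[b1 hb1] [b2 hb2]] /= /eqP e.
case: (ltnP (mdeg b1) k) => [/h1->|h]; first by rewrite mul0r.
rewrite [q@__]h2 ?mulr0 //; rewrite e mdegD in hb.
by rewrite -(ltn_add2l (mdeg b1)); apply: leq_trans hb _; rewrite leq_add2r.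
Qed.
Lemma ordgeMr k p q : ordge k q -> ordge k (p * q).
Proof. by move=> h; rewrite -[k]add0n; exact: ordgeM (ordge0 p) h. Qed.
Lemma ordgeX k p : ordge 1 p -> ordge k (p ^+ k).
Proof.
move=> h; elim: k => [|k IH]; first exact: ordge0.
by rewrite exprS -add1n; exact: ordgeM.
Qed.
Lemma meval0E p : p.@[fun=> 0] = p@_0%MM.
Proof.
rewrite [in RHS](mpolyE p) mevalE raddf_sum /=; apply: eq_bigr => b _.
rewrite mcoeffZ mcoeffX; case: eqP => [->|/eqP hb].
  by rewrite big1 // => i _; rewrite mnm0E expr0.
have [i hi] : exists i, b i != 0%N.
  apply/existsP; apply: contraNT hb; rewrite negb_exists => /forallP h.
  by apply/eqP/mnmP => i; rewrite mnm0E; apply/eqP; rewrite -[_ == _]negbK.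
by rewrite (bigD1 i) //= expr0n (negPf hi) mul0r.
Qed.
Lemma ordge1 p : p.@[fun=> 0] = 0 -> ordge 1 p.
Proof. by rewrite meval0E => h b; rewrite ltnS leqn0 mdeg_eq0 => /eqP->. Qed.
End Order.

(** * Zeros as joint eigenvalues *)

Section ZeroList.
Variables (F : numClosedFieldType) (n m' : nat) (G : 'I_n -> {mpoly F[n]}).
Local Notation m := m'.+1.
Local Notation rd := {ffun 'I_n -> 'I_m}.
Local Notation D := #|{: rd}|.
Hypothesis hG : forall i, (msize (G i) <= m)%N.
Local Notation M := (M m' G).
Local Notation H := (H m' G).
Local Notation NP := (NP m' G).

Definition zeroH (z : 'I_n -> F) := forall i, (H i).@[z] = 0.
Definition ev (z : 'I_n -> F) : 'cV[F]_D := \col_r ('X_[mr (enum_val r)]).@[z].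

Lemma sec_ev z v : (v *m ev z) 0 0 = (sec v).@[z].
Proof.
rewrite mxE /sec raddf_sum /= (reindex (@enum_rank rd)) /=; last first.
  by exists enum_val => r _; rewrite ?enum_rankK ?enum_valK.
by apply: eq_bigr => r _; rewrite mxE enum_rankK mevalZ.
Qed.

Lemma NP_ev z p : zeroH z -> (NP p *m ev z) 0 0 = p.@[z].
Proof.
move=> hz; rewrite sec_ev; have [q hq] := sec_NP hG p.
apply/eqP; rewrite eq_sym -subr_eq0 -mevalB hq raddf_sum big1 //= => i _.
by rewrite mevalM hz mulr0.
Qed.

Lemma M_ev z p : zeroH z -> M p *m ev z = p.@[z] *: ev z.
Proof.
move=> hz; apply/colP => r; rewrite !mxE -mevalM -(NP_ev _ hz) mxE.
by apply: eq_bigr => j _; rewrite !mxE.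
Qed.

Lemma ev_neq0 z : zeroH z -> ev z != 0.
Proof.
move=> hz; apply/eqP => e; have := NP_ev 1 hz.
by rewrite e mulmx0 mxE meval1 => /eqP; rewrite eq_sym oner_eq0.
Qed.

Lemma comm_M p q : comm_mx (M p) (M q).
Proof. by rewrite /comm_mx !MM // mulrC. Qed.

(** The multiplication matrices commute, so they are triangular in a common basis, and the k-th
    diagonal entries of the coordinates form [xi k]. The diagonal of the matrix of [p] then consists
    of the values of [p]; if these vanish the matrix is strictly triangular, hence nilpotent. *)
Lemma zero_list : exists xi : 'I_D -> 'I_n -> F, [/\ forall p, \tr (M p) = \sum_k p.@[xi k],
  forall k, zeroH (xi k), forall z, zeroH z -> exists k, z = xi k &
  forall p, (forall k, p.@[xi k] = 0) -> forall l, (D <= l)%N -> M (p ^+ l) = 0].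
Proof.
have [|P /unitarymx_unit uP /allP trg] := @cotrigonalization F D [seq M 'X_i | i <- enum 'I_n].
  by move=> _ _ /mapP[i _ ->] /mapP[j _ ->]; exact: comm_M.
pose T p := P *m M p *m invmx P.
have TD p q : T (p + q) = T p + T q by rewrite /T linearD /= mulmxDr mulmxDl.
have TZ c p : T (c *: p) = c *: T p by rewrite /T linearZ /= -scalemxAr -scalemxAl.
have TM p q : T (p * q) = T q *m T p.
  by rewrite /T -MM // !mulmxA; congr (_ *m _ *m _); rewrite mulmxKV.
have T1 : T 1 = 1%:M by rewrite /T M1 mulmx1 mulmxV.
have T0 : T 0 = 0 by rewrite /T linear0 mulmx0 mul0mx.
pose xi k i := T 'X_i k k.
pose good p := (forall i j : 'I_D, (i < j)%N -> T p i j = 0) /\ (forall k, T p k k = p.@[xi k]).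
have gM p q : good p -> good q -> good (p * q).
  move=> [p1 p2] [q1 q2]; split=> [i j ij|k]; rewrite TM mxE.
    rewrite big1 // => l _; case: (ltnP i l) => il; first by rewrite q1 // mul0r.
    by rewrite p1 ?mulr0 //; exact: leq_ltn_trans ij.
  rewrite (bigD1 k) //= big1 ?addr0 => [|l lk]; first by rewrite p2 q2 mevalM mulrC.
  case: (ltngtP k l) => kl; first by rewrite q1 // mul0r.
    by rewrite p1 // mulr0.
  by move: lk; rewrite (val_inj kl) eqxx.
have gX i : good 'X_i.
  split=> [j k jk|k]; last by rewrite mevalXU.
  have := trg (M 'X_i) (map_f (fun i => M 'X_i) (mem_enum _ i)).
  by rewrite /= /similar_to conjumx // => /is_trig_mxP; exact.
have g1 : good 1.
  split=> [i j ij|k]; rewrite T1 mxE ?eqxx ?meval1 //.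
  by rewrite -val_eqE /= ltn_eqF.
have gXn i k : good ('X_i ^+ k) by elim: k => [|k IH] //; rewrite exprS; exact: gM.
have gmon b : good 'X_[b].
  rewrite mpolyXE_id; elim/big_ind: _ => // p q; exact: gM.
have gall p : good p.
  rewrite [p]mpolyE; elim/big_ind: _ => [|p1 p2 [a1 a2] [b1 b2]|b _].
  - by split=> [i j _|k]; rewrite T0 mxE ?meval0.
  - by split=> [i j ij|k]; rewrite TD mxE; [rewrite a1 // b1 // addr0|rewrite a2 b2 mevalD].
  - by have [a1 a2] := gmon b; split=> [i j ij|k]; rewrite TZ mxE; [rewrite a1 // mulr0|rewrite a2 mevalZ].
have trT p : \tr (M p) = \tr (T p) by rewrite /T mxtrace_mulC mulmxA mulVmx // mul1mx.
have nil p : (forall k, p.@[xi k] = 0) -> forall l, (D <= l)%N -> M (p ^+ l) = 0.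
  move=> hp l hl; have [a1 a2] := gall p.
  have K s (i j : 'I_D) : (i < j + s)%N -> T (p ^+ s) i j = 0.
    elim: s i j => [|s IH] i j ij; first by have [] := gall 1 => + _; apply; rewrite addn0 in ij.
    rewrite exprSr TM mxE big1 // => k _.
    case: (ltngtP i k) => ik; first by rewrite a1 // mul0r.
      by rewrite IH ?mulr0 //; move: ij ik; lia.
    by rewrite (val_inj ik) a2 hp mul0r.
  have : T (p ^+ l) = 0.
    by apply/matrixP => i j; rewrite K ?mxE //; apply: leq_trans (ltn_ord i) _; apply: leq_trans hl _; exact: leq_addl.
  move=> e; have := congr1 (fun X => invmx P *m X *m P) e.
  by rewrite mulmx0 mul0mx /T !mulmxA mulVmx // mul1mx mulmxKV.
exists xi; split=> //.
- by move=> p; rewrite trT; apply: eq_bigr => k _; have [_ ->] := gall p.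
- move=> k i; have [_ <-] := gall (H i).
  by rewrite /T M_ideal ?mulmx0 ?mul0mx ?mxE //; exact: inid_gen.
move=> z hz; apply: contrapT => /forallNP nz.
have /choice[ix hix] : forall k, exists i, z i != xi k i.
  move=> k; apply: contrapT => /forallNP h; apply: (nz k); apply: funext => i.
  by have := h i; move/negP; rewrite negbK => /eqP.
(* [p] vanishes at every [xi k], so a power of its matrix is 0, but it does not vanish at [z], where
   its value is an eigenvalue with eigenvector [ev z]. *)
pose p := \prod_k ('X_(ix k) - (xi k (ix k))%:MP_[n]).
have pk k : p.@[xi k] = 0.
  rewrite /p rmorph_prod (bigD1 k) //= mevalB mevalXU mevalC subrr mul0r //.
have := M_ev (p ^+ D) hz; rewrite nil // mul0mx => /esym/eqP; rewrite scaler_eq0 (negPf (ev_neq0 hz)) orbF.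
rewrite rmorphXn expf_eq0 => /andP[_]; rewrite /p rmorph_prod => /prodf_eq0[k _] /=.
by rewrite mevalB mevalXU mevalC subr_eq0 (negPf (hix k)).
Qed.
End ZeroList.

(** * The multiplicity of the origin *)

Section Multiplicity.
Variables (F : numClosedFieldType) (n m' : nat) (G : 'I_n -> {mpoly F[n]}).
Local Notation m := m'.+1.
Local Notation rd := {ffun 'I_n -> 'I_m}.
Local Notation D := #|{: rd}|.
Hypothesis hG : forall i, (msize (G i) <= m)%N.
Hypothesis n0 : (0 < n)%N.
Local Notation M := (M m' G).
Local Notation H := (H m' G).
Local Notation NP := (NP m' G).

(** Membership in the ideal of [h] plus the K-th power of the maximal ideal at the origin. The
    truncation expresses the local algebra through polynomials. *)
Definition idord (k : nat) (h : 'I_k -> {mpoly F[n]}) (K : nat) (p : {mpoly F[n]}) :=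
  exists2 q, inid h q & ordge K (p - q).

Definition indep (J : {mpoly F[n]} -> Prop) (s : nat) := exists e : 'I_s -> {mpoly F[n]},
  forall c : 'I_s -> F, J (\sum_i c i *: e i) -> forall i, c i = 0.

(** In a full rank factorisation of [E] the two factors multiplied in the other order give an
    identity matrix of size the rank, with the same trace. *)
Lemma idempotent_rank (E : 'M[F]_D) : E *m E = E -> \tr E = (\rank E)%:R.
Proof.
move=> e; rewrite -[in LHS](mulmx_base E) mxtrace_mulC.
suff -> : row_base E *m col_base E = 1%:M by rewrite mxtrace1.
apply: (row_free_inj (row_base_free E)); rewrite mul1mx.
apply: (row_full_inj (col_base_full E)).
transitivity ((col_base E *m row_base E) *m (col_base E *m row_base E)); first by rewrite !mulmxA.
by rewrite !mulmx_base.
Qed.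

(* e is the idempotent of F[X]/(H) supported at the origin: it is divisible by x^K and 1 - e has
   order at least K, where x is 1 at the origin and 0 at the other zeros. *)
Lemma multiplicity (xi : 'I_D -> 'I_n -> F) (K : nat) :
  (forall p, \tr (M p) = \sum_k p.@[xi k]) ->
  (forall p, (forall k, p.@[xi k] = 0) -> forall l, (D <= l)%N -> M (p ^+ l) = 0) ->
  (n * D <= K)%N -> (0 < K)%N ->
  let mu := #|[pred k | `[< xi k = (fun=> 0) >]]| in
  indep (idord H K) mu /\ (forall s, indep (idord H K) s -> (s <= mu)%N).
Proof.
move=> htr hnil hK K0 mu.
have DK : (D <= K)%N by apply: leq_trans hK; exact: leq_pmull.
have /choice[ix hix] : forall k, exists i, xi k <> (fun=> 0) -> xi k i != 0.
  move=> k; case: (pselect (xi k = (fun=> 0))) => [h|h]; first by exists (Ordinal n0).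
  apply: contrapT => /forallNP H0; apply: h; apply: funext => i.
  by have := H0 i; case: eqVneq => // _ []; rewrite implyb.
pose x := \prod_(k | `[< xi k <> (fun=> 0) >]) (1 - (xi k (ix k))^-1 *: 'X_(ix k)).
have x0 : x.@[fun=> 0] = 1.
  rewrite /x rmorph_prod big1 //= => k _.
  by rewrite mevalB meval1 mevalZ mevalXU mulr0 subr0.
have xk k : xi k <> (fun=> 0) -> x.@[xi k] = 0.
  move=> hk; rewrite /x rmorph_prod (bigD1 k) /=; last exact/asboolP.
  by rewrite mevalB meval1 mevalZ mevalXU mulVf ?hix // subrr mul0r.
pose e := 1 - (1 - x ^+ K) ^+ K.
have [a ea] : exists a, e = x ^+ K * a.
  rewrite /e -{1}(expr1n _ K) subrXX; rewrite opprB addrC subrK; by eexists.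
have [b eb] : exists b, 1 - e = (1 - x) ^+ K * b.
  rewrite /e opprB addrC subrK -{1}(expr1n _ K) subrXX exprMn; by eexists.
have M0 : M ((x * (1 - x)) ^+ K) = 0.
  apply: hnil => // k; rewrite mevalM mevalB meval1.
  case: (pselect (xi k = (fun=> 0))) => [->|/xk->]; last by rewrite mul0r.
  by rewrite x0 subrr mulr0.
pose E := M e.
have EE : E *m E = E.
  apply/eqP; rewrite -subr_eq0 /E MM // -linearB /= -[X in _ - X]mulr1 -mulrBr -opprB mulrN linearN /= oppr_eq0.
  have -> : e * (1 - e) = (a * b) * (x * (1 - x)) ^+ K by rewrite eb ea exprMn; ring.
  by rewrite -MM // M0 mul0mx.
have oe : ordge K (1 - e).
  rewrite eb mulrC; apply: ordgeMr; apply: ordgeX; apply: ordge1.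
  by rewrite mevalB meval1 x0 subrr.
have rkE : \rank E = mu.
  have := idempotent_rank EE; rewrite /E htr.
  have -> : \sum_k e.@[xi k] = mu%:R.
    pose Z := [pred k | `[< xi k = (fun=> 0) >]].
    have -> : mu = (\sum_(k in Z) 1)%N by rewrite sum1_card.
    rewrite natr_sum [RHS]big_mkcond; apply: eq_bigr => k _ /=.
    rewrite /e mevalB meval1 rmorphXn /= mevalB meval1 rmorphXn /= inE; case: asboolP => [->|/xk->].
      by rewrite x0 expr1n subrr expr0n eqn0Ngt K0 subr0.
    by rewrite expr0n eqn0Ngt K0 subr0 expr1n subrr.
  by move/eqP; rewrite eqr_nat => /eqP.
(* The truncated ideal is the kernel of multiplication by [e]. A monomial of degree at least
   [K >= n * D] is divisible by some [X_i^D]; [e] supplies the factor [x^D], and [X_i * x] vanishes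
   at all zeros, so its D-th power is 0 in the algebra. *)
have Jp p : idord H K p <-> NP p *m E = 0.
  rewrite /E NP_M //; split=> [[q hq hpq]|h].
    have -> : p = q + (p - q) by rewrite addrC subrK.
    rewrite mulrDr /NP linearD /= -!/(NP _) (NP_ideal hG (inidM _ hq)) add0r.
    rewrite [p - q]mpolyE mulr_sumr /NP linear_sum big_seq big1 //= => c hc.
    rewrite -scalerAr linearZ /= -/(NP _).
    have hKc : (K <= mdeg c)%N.
      by rewrite leqNgt; apply: contraTN hc => hc; rewrite mcoeff_msupp hpq // eqxx.
    have [i hi] : exists i, (D <= c i)%N.
      apply/existsP; apply: contraLR hKc; rewrite negb_exists => /forallP h.
      rewrite -ltnNge mdegE; apply: leq_trans hK.
      have : (\sum_(i < n) c i < \sum_(i < n) D)%N.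
        rewrite (bigD1 (Ordinal n0)) //= [X in (_ < X)%N](bigD1 (Ordinal n0)) //= -addSn leq_add //.
          by rewrite ltnNge h.
        by apply: leq_sum => i _; rewrite ltnW // ltnNge h.
      by rewrite sum_nat_const card_ord.
    have -> : e * 'X_[c] = (x ^+ (K - D) * a * 'X_[c - U_(i) *+ D]) * ('X_i * x) ^+ D.
      rewrite ea -{1}(subnK DK) exprD exprMn mpolyXn.
      rewrite -{1}(@submK _ (U_(i) *+ D) c) ?mpolyXD.
        move: (x ^+ D) (x ^+ (K - D)) ('X_[U_(i) *+ D] : {mpoly F[n]}) => x1 x2 x3.
        move: ('X_[c - U_(i) *+ D] : {mpoly F[n]}) a {ea} => x4 x5; ring.
      by apply/mnm_lepP => l; rewrite mulmnE mnm1E; case: eqP => [<-|]; rewrite ?mul1n ?mul0n.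
    rewrite -[X in NP X]mulr1 -NP_M // -MM // hnil ?mul0mx ?mulmx0 ?scaler0 //.
    move=> k; rewrite mevalM mevalXU.
    by case: (pselect (xi k = (fun=> 0))) => [->|/xk->]; rewrite ?mul0r ?mulr0.
  exists (e * p); first by have := sec_NP hG (e * p); rewrite h linear0 subr0.
  by rewrite -{1}[p]mul1r -mulrBl mulrC; exact: ordgeMr.
split.
  rewrite -rkE; exists (fun i => sec (row i (row_base E))) => c /Jp.
  have -> : \sum_i c i *: sec (row i (row_base E)) = sec ((\row_i c i) *m row_base E) :> {mpoly F[n]}.
    rewrite mulmx_sum_row linear_sum /=; apply: eq_bigr => i _; by rewrite linearZ /= mxE.
  rewrite NP_sec // -mulmxA => h; have : (\row_i c i) *m row_base E = 0.
    have [Y hY] : exists Y, row_base E = Y *m E by apply/submxP; rewrite eq_row_base.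
    by rewrite -[RHS]h; congr (_ *m _); rewrite hY -mulmxA EE.
  move/eqP; rewrite mulmx_free_eq0 ?row_base_free // => /eqP/rowP h0 i.
  by have := h0 i; rewrite !mxE.
move=> s [f hf]; rewrite -rkE.
pose Q : 'M[F]_(s, D) := \matrix_i (NP (f i) *m E).
have fr : row_free Q.
  apply/row_freeP; apply/row_freeP; rewrite -kermx_eq0; apply/rowV0P => v /sub_kermxP hv.
  apply/rowP => i; rewrite [RHS]mxE; apply: (hf (fun i => v 0 i)); apply/Jp.
  rewrite /NP linear_sum /= mulmx_suml -[RHS]hv mulmx_sum_row; apply: eq_bigr => j _.
  by rewrite linearZ /= -scalemxAl rowK.
move: fr; rewrite -row_leq_rank => /leq_trans; apply.
by apply: mxrankS; apply/row_subP => i; rewrite rowK submxMl.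
Qed.
End Multiplicity.

(** * Continuous dependence of the zeros on a parameter *)

Section Continuity.
Variable R : realType.
Local Notation C := (R[i]).
Variables (n m' : nat).
Local Notation m := m'.+1.
Local Notation rd := {ffun 'I_n -> 'I_m}.
Local Notation D := #|{: rd}|.

Definition spec (t : C) (P : {mpoly {poly C}[n]}) : {mpoly C[n]} := map_mpoly (horner_eval t) P.
Definition lft (p : {mpoly C[n]}) : {mpoly {poly C}[n]} := map_mpoly (@polyC C) p.

Lemma spec_lft t p : spec t (lft p) = p.
Proof. by apply/mpolyP => b; rewrite !mcoeff_map_mpoly /= /horner_eval hornerC. Qed.

Lemma msize_coef (A : comNzRingType) (p : {mpoly A[n]}) k :
  (forall b, (k <= mdeg b)%N -> p@_b = 0) -> (msize p <= k)%N.
Proof.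
move=> h; rewrite mmeasureE big_seq; elim/big_ind: _ => // [x y|b hb]; first by rewrite geq_max => ->.
by rewrite ltnNge; apply: contraTN hb => /h hb; rewrite mcoeff_msupp hb eqxx.
Qed.

Lemma msize_spec t P : (msize (spec t P) <= msize P)%N.
Proof.
apply: msize_coef => b hb; rewrite mcoeff_map_mpoly memN_msupp_eq0 ?raddf0 //.
exact: msize_mdeg_ge.
Qed.

Lemma M_spec t (P : 'I_n -> {mpoly {poly C}[n]}) p r s :
  M m' (fun j => spec t (P j)) p r s = (M m' P (lft p) r s).[t].
Proof. by rewrite -{1}(spec_lft t p) /spec M_map mxE. Qed.

Lemma polyfun_prod (I J : finType) (F : J -> (I -> C) -> C) :
  (forall j, polyfun (F j)) -> polyfun (fun z => \prod_j F j z).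
Proof.
move=> h; have H (s : seq J) : polyfun (fun z => \prod_(j <- s) F j z).
  elim: s => [|j s IH].
    by rewrite (_ : (fun z => _) = (fun _ => 1)); [exact: polyfun_const|apply: funext => z; rewrite big_nil].
  rewrite (_ : (fun z => _) = (fun z => F j z * \prod_(j <- s) F j z)); last by apply: funext => z; rewrite big_cons.
  exact: polyfun_mul.
exact: H.
Qed.

Lemma polyfun_horner (I : finType) (q : {poly C}) (f : (I -> C) -> C) : polyfun f ->
  polyfun (fun y => q.[f y]).
Proof.
move=> hf; rewrite (_ : (fun y => _) = (fun y => \sum_(i < size q) q`_i * f y ^+ i)); last first.
  by apply: funext => y; rewrite horner_coef.
apply: polyfun_sum => i; apply: polyfun_mul; [exact: polyfun_const|exact: polyfun_exp].
Qed.

Lemma polyfun_meval (I : finType) (p : {mpoly C[n]}) (f : 'I_n -> (I -> C) -> C) :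
  (forall i, polyfun (f i)) -> polyfun (fun y => p.@[fun i => f i y]).
Proof.
move=> hf; rewrite (_ : (fun y => _) = (fun y => \sum_(b : 'X_{1..n < msize p}) p@_b * \prod_i (f i y) ^+ b i)).
  apply: polyfun_sum => b; apply: polyfun_mul; first exact: polyfun_const.
  by apply: polyfun_prod => i; exact: polyfun_exp.
apply: funext => y; rewrite {1}(mpolywE (leqnn (msize p))) raddf_sum /=.
by apply: eq_bigr => b _; rewrite mevalZ mevalX.
Qed.

Lemma polyfun_spec (I : finType) (P : {mpoly {poly C}[n]}) (f0 : (I -> C) -> C) (f : 'I_n -> (I -> C) -> C) :
  polyfun f0 -> (forall i, polyfun (f i)) -> polyfun (fun y => (spec (f0 y) P).@[fun i => f i y]).
Proof.
move=> hf0 hf.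
rewrite (_ : (fun y => _) = (fun y => \sum_(b : 'X_{1..n < msize P}) (P@_b).[f0 y] * \prod_i (f i y) ^+ b i)).
  apply: polyfun_sum => b; apply: polyfun_mul; first exact: polyfun_horner.
  by apply: polyfun_prod => i; exact: polyfun_exp.
apply: funext => y; rewrite {1}(mpolywE (msize_spec (f0 y) P)) raddf_sum /=.
by apply: eq_bigr => b _; rewrite mevalZ mevalX mcoeff_map_mpoly.
Qed.

(** The properties granted by [zero_list]. Such a list is not unique, so counts are stated for all
    lists with these properties. *)
Definition zlist (G : 'I_n -> {mpoly C[n]}) (xi : 'I_D -> 'I_n -> C) :=
  [/\ forall p, \tr (M m' G p) = \sum_k p.@[xi k],
  forall k, zeroH m' G (xi k), forall z, zeroH m' G z -> exists k, z = xi k &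
  forall p, (forall k, p.@[xi k] = 0) -> forall l, (D <= l)%N -> M m' G (p ^+ l) = 0].

Definition cnt (U : ('I_n -> C) -> Prop) (xi : 'I_D -> 'I_n -> C) := #|[pred k | `[< U (xi k) >]]|.

(** Lagrange interpolation. By the trace formula of [zlist] the trace of this polynomial is the
    number of zeros in [U]. *)
Lemma indicator_poly (U : ('I_n -> C) -> Prop) (T : finType) (xi : T -> 'I_n -> C) :
  exists p : {mpoly C[n]}, forall k, p.@[xi k] = `[< U (xi k) >]%:R.
Proof.
have /choice[s hs] : forall kl : T * T, exists s : {mpoly C[n]}, xi kl.1 <> xi kl.2 -> s.@[xi kl.1] = 1 /\ s.@[xi kl.2] = 0.
  move=> [k l] /=; case: (pselect (xi k = xi l)) => [|ne]; first by exists 0.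
  have [i hi] : exists i, xi k i - xi l i != 0.
    apply: contrapT => /forallNP H0; apply: ne; apply: funext => i.
    by have := H0 i => /negP; rewrite negbK subr_eq0 => /eqP.
  exists ((xi k i - xi l i)^-1 *: ('X_i - (xi l i)%:MP)) => _.
  by rewrite !mevalZ !mevalB !mevalXU !mevalC subrr mulr0 mulVf.
pose x k := \prod_(l | ~~ `[< U (xi l) >]) s (k, l).
exists (1 - \prod_(k | `[< U (xi k) >]) (1 - x k)) => k.
rewrite mevalB meval1 rmorph_prod /=; case: asboolP => hk.
  rewrite (bigD1 k) /=; last exact/asboolP.
  rewrite mevalB meval1 /x rmorph_prod big1 /= ?subrr ?mul0r ?subr0 // => l hl.
  have [] // := hs (k, l); move=> /= e; move: hl; rewrite -e; case: asboolP => //.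
rewrite big1 ?subrr // => l hl; rewrite mevalB meval1 /x rmorph_prod (bigD1 k) /=; last by apply/asboolP.
have [|_ ->] := hs (l, k); last by rewrite mul0r subr0.
by move=> /= e; move: hl; rewrite e; case: asboolP.
Qed.

Variable P : 'I_n -> {mpoly {poly C}[n]}.
Hypothesis hP : forall j, (msize (P j) <= m)%N.
Local Notation Gt t := (fun j => spec t (P j)).

Lemma hGt t j : (msize (spec t (P j)) <= m)%N.
Proof. exact: leq_trans (msize_spec _ _) (hP j). Qed.

Lemma zlist_ex t : exists xi, zlist (Gt t) xi.
Proof. by have [xi [a1 a2 a3 a4]] := zero_list (hGt t); exists xi. Qed.

Lemma M_cts p r s t0 : ctsat (fun y : unit -> C => M m' (Gt (y tt)) p r s) (fun _ => t0).
Proof.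
apply: polyfun_cts; rewrite (_ : (fun y => _) = (fun y : unit -> C => (M m' P (lft p) r s).[y tt])).
  by apply: polyfun_horner; exact: polyfun_coord.
by apply: funext => y; rewrite M_spec.
Qed.

Lemma entry0 (k : nat) (A : 'M[C]_k) r s : A = 0 -> A r s = 0.
Proof. by move=> ->; rewrite mxE. Qed.

Lemma ctsat_small (I : finType) (f : (I -> C) -> C) p (kap : R) : ctsat f p -> f p = 0 -> 0 < kap ->
  near p (fun y => nc (f y) < kap).
Proof. by move=> h e k0; apply: near_imp (h _ k0) _ => y; rewrite e subr0. Qed.

Lemma M_small p t0 (kap : R) : M m' (Gt t0) p = 0 -> 0 < kap ->
  near (fun _ : unit => t0) (fun y => forall r s, nc (M m' (Gt (y tt)) p r s) < kap).
Proof.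
move=> p0 k0; apply: near_all => r; apply: near_all => s.
exact: ctsat_small (M_cts p r s t0) (entry0 r s p0) k0.
Qed.

(** The value of [p] at a zero is an eigenvalue of its matrix, and it is read off from the row of
    the largest entry of the eigenvector. *)
Lemma eigen_bound t p z (B : R) : zeroH m' (Gt t) z ->
  (forall r s, nc (M m' (Gt t) p r s) <= B) -> nc p.@[z] <= D%:R * B.
Proof.
move=> hz hB; have e0 := ev_neq0 (hGt t) hz.
have [r0 hr0] : exists r, (ev m' z) r 0 != 0.
  apply: contrapT => /forallNP h; move/eqP: e0; apply; apply/colP => r.
  by have := h r => /negP; rewrite negbK => /eqP ->; rewrite mxE.
pose r := [arg max_(r > r0) nc ((ev m' z) r 0)]%O.
have hr : forall s, nc ((ev m' z) s 0) <= nc ((ev m' z) r 0).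
  by move=> s; rewrite /r; case: arg_maxP => // i _; apply.
have pos : 0 < nc ((ev m' z) r 0) by apply: lt_le_trans (hr r0); exact: nc_gt0.
have := M_ev (hGt t) p hz => /matrixP/(_ r 0); rewrite mxE [RHS]mxE => /(congr1 (@nc R)).
rewrite ncM => E; rewrite -(ler_pM2r pos) -E; apply: le_trans (nc_sum _ _ _) _.
rewrite -mulrA mulr_natl -[D in _ *+ D]card_ord -sumr_const; apply: ler_sum => s _.
by rewrite ncM ler_pM ?nc_ge0.
Qed.

(** The polynomial [q i], which vanishes where the i-th coordinate is that of some zero at [t0], has
    a nilpotent matrix there. Nearby its D-th power has small entries, so each coordinate of a zero
    is close to the same coordinate of some old zero. This confines zeros to neighbourhoods of the
    finite grid of points [w f], and grid points that are not zeros at [t0] are excluded by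
    continuity. *)
Lemma zeros_close t0 xi0 (eta : R) : zlist (Gt t0) xi0 -> 0 < eta ->
  near (fun _ : unit => t0) (fun y => forall z, zeroH m' (Gt (y tt)) z ->
     exists k0, n1 (vsub z (xi0 k0)) < eta).
Proof.
move=> [_ z1 z2 z3] eta0.
pose w (f : {ffun 'I_n -> 'I_D}) i := xi0 (f i) i.
have K1 (f : {ffun 'I_n -> 'I_D}) : exists2 e : R, 0 < e & near (fun _ : unit => t0)
    (fun y => forall z, zeroH m' (Gt (y tt)) z -> n1 (vsub z (w f)) < e -> exists k0, n1 (vsub z (xi0 k0)) < eta).
  case: (pselect (zeroH m' (Gt t0) (w f))) => [/z2[k0 hk0]|/existsNP[j hj]].
    by exists eta => //; apply: near_true => y z _; rewrite hk0 => h; exists k0.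
  pose fn (y : (unit + 'I_n)%type -> C) := (spec (y (inl tt)) (P j)).@[fun i => y (inr i)] + y (inr j) ^+ m.
  have cf p0 : ctsat fn p0.
    apply: polyfun_cts; apply: polyfun_add.
      by apply: polyfun_spec => [|i]; exact: polyfun_coord.
    by apply: polyfun_exp; exact: polyfun_coord.
  pose p0 (o : (unit + 'I_n)%type) := if o is inr i then w f i else t0.
  have fE t z : (H m' (Gt t) j).@[z] = fn (fun o => if o is inr i then z i else t).
    by rewrite /H mevalD rmorphXn /= mevalXU addrC.
  have f0 : fn p0 != 0 by apply/eqP => e; apply: hj; rewrite fE.
  have [e e0 he] := ctsat_neq0 (cf p0) f0.
  exists (e / 2); first by rewrite divr_gt0.
  exists (e / 2); first by rewrite divr_gt0.
  move=> y hy z /(_ j); rewrite fE => hz hw; exfalso.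
  have := he (fun o => if o is inr i then z i else y tt); rewrite hz nc0 => H0.
  have : nc (fn p0) / 2 < 0; last by rewrite ltNge divr_ge0 // nc_ge0.
  apply: H0; rewrite /n1 big_sumType /=.
  have -> : \sum_i nc (vsub (fun o => if o is inr i then z i else y tt) p0 (inr i)) = n1 (vsub z (w f)) by [].
  rewrite (bigD1 tt) //= big1 ?addr0; last by case.
  have hy' : nc (y tt - t0) < e / 2.
    by move: hy; rewrite /n1 (bigD1 tt) //= big1 ?addr0 //; case.
  by rewrite [X in _ < X]splitr; exact: ltrD hy' hw.
have [e e0 he] : exists2 e : R, 0 < e & forall f, near (fun _ : unit => t0)
    (fun y => forall z, zeroH m' (Gt (y tt)) z -> n1 (vsub z (w f)) < e -> exists k0, n1 (vsub z (xi0 k0)) < eta).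
  have H0 (s : seq {ffun 'I_n -> 'I_D}) : exists2 e : R, 0 < e & forall f, f \in s -> near (fun _ : unit => t0)
    (fun y => forall z, zeroH m' (Gt (y tt)) z -> n1 (vsub z (w f)) < e -> exists k0, n1 (vsub z (xi0 k0)) < eta).
    elim: s => [|f s [e e0 he]]; first by exists 1.
    have [e' e'0 he'] := K1 f; exists (Num.min e e'); first by rewrite lt_min e0.
    move=> g; rewrite inE => /orP[/eqP->|/he hg].
      by apply: near_imp he' _ => y hy z hz; rewrite lt_min => /andP[_]; exact: hy.
    by apply: near_imp hg _ => y hy z hz; rewrite lt_min => /andP[+ _]; exact: hy.
  have [e e0 he] := H0 (enum {ffun 'I_n -> 'I_D}).
  by exists e => // f; apply: he; exact: mem_enum.
pose et := e / (n%:R + 1).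
have et0 : 0 < et by rewrite divr_gt0 // ltr_wpDl // ler0n.
pose q i := \prod_(k < D) ('X_i - (xi0 k i)%:MP_[n]).
have qk i k : (q i).@[xi0 k] = 0.
  by rewrite /q rmorph_prod (bigD1 k) //= mevalB mevalXU mevalC subrr mul0r.
have M0 i : M m' (Gt t0) (q i ^+ D) = 0 by apply: z3 => // k; exact: qk.
(* If a coordinate of [z] had distance at least [et] from all old ones, then [q i ^+ D] would have
   modulus at least [et^(D*D)] at [z], more than the [D * kap] allowed by [eigen_bound]. *)
pose kap : R := et ^+ (D * D) / (D%:R + 1).
have kap0 : 0 < kap by rewrite divr_gt0 ?exprn_gt0 // ltr_wpDl // ler0n.
have N1 : near (fun _ : unit => t0) (fun y => forall i r s, nc (M m' (Gt (y tt)) (q i ^+ D) r s) < kap).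
  by apply: near_all => i; exact: M_small (M0 i) kap0.
apply: near_imp (near_and N1 (near_all he)) _ => y [h1 h2] z hz.
have K i : exists k, nc (z i - xi0 k i) < et.
  apply: contrapT => /forallNP hk.
  have b1 := eigen_bound hz (fun r s => ltW (h1 i r s)).
  rewrite rmorphXn /= ncX /q rmorph_prod /= in b1.
  have b2 : et ^+ D <= nc (\prod_(k < D) ('X_i - (xi0 k i)%:MP_[n]).@[z]).
    have -> : nc (\prod_(k < D) ('X_i - (xi0 k i)%:MP_[n]).@[z]) = \prod_(k < D) nc (z i - xi0 k i).
      elim/big_rec2: _ => [|k a b _ <-]; first exact: nc1.
      by rewrite ncM mevalB mevalXU mevalC.
    rewrite -[X in _ ^+ X]card_ord -prodr_const; apply: ler_prod => k _.
    by rewrite (ltW et0) /= leNgt; apply/negP; exact: hk.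
  have b3 : et ^+ (D * D) <= D%:R * kap.
    rewrite exprM; apply: le_trans b1; apply: lerXn2r b2; rewrite nnegrE ?nc_ge0 //.
    by apply: exprn_ge0; exact: ltW.
  move: b3; rewrite /kap mulrA ler_pdivlMr ?ltr_wpDl ?ler0n // mulrC.
  by rewrite ler_pM2r ?exprn_gt0 // gerDl leNgt ltr01.
have /choice[f hf] := K; have := h2 [ffun i => f i] z hz; apply.
apply: (@le_lt_trans _ _ (\sum_(i < n) et)).
  by apply: ler_sum => i _; rewrite /vsub /w ffunE; exact: ltW.
rewrite sumr_const card_ord -[X in X < _]mulr_natl /et mulrA ltr_pdivrMr ?ltr_wpDl ?ler0n //.
by rewrite mulrC ltr_pM2l // ltrDl.
Qed.

Lemma nat_close (a b : nat) : nc (a%:R - b%:R : C) < 1 -> a = b.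
Proof.
have -> : (a%:R - b%:R : C) = real_complex R (a%:R - b%:R) by rewrite rmorphB !rmorph_nat.
rewrite nc_real ltr_norml => /andP[l1 l2].
by apply/eqP; rewrite eqn_leq -(ltnS a) -(ltnS b) -!(ltr_nat R) -!natr1; apply/andP; split; lra.
Qed.

(** The trace of the indicator polynomial at [t0] equals the count at [t0] and varies continuously,
    while at nearby zeros the polynomial is nearly 0 or 1. Two integers at distance below 1 are
    equal. Since no zero lies on the sphere, nearby zeros stay on the same side of it. *)
Lemma cnt_locally_constant (rho : R) t0 xi0 : zlist (Gt t0) xi0 ->
  (forall k, n1 (xi0 k) != rho) ->
  near (fun _ : unit => t0) (fun y => forall xi, zlist (Gt (y tt)) xi ->
    cnt (fun z => n1 z < rho) xi = cnt (fun z => n1 z < rho) xi0).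
Proof.
move=> hz0 hrho; have [tr0 z1 _ _] := hz0.
have [p hp] := indicator_poly (fun z => n1 z < rho) xi0.
have D0 : 0 < D%:R + 1 :> R by rewrite ltr_wpDl // ler0n.
have cp k := @polyfun_cts R _ (fun z => p.@[fun i => z i]) (xi0 k) (polyfun_meval p (fun i => polyfun_coord _ i)).
have eD : 0 < (4 * (D%:R + 1))^-1 :> R by rewrite invr_gt0 mulr_gt0.
have [eta eta0 heta] : exists2 eta : R, 0 < eta & forall k z, n1 (vsub z (xi0 k)) < eta ->
    nc (p.@[z] - p.@[xi0 k]) < (4 * (D%:R + 1))^-1 /\ (n1 z < rho <-> n1 (xi0 k) < rho).
  have H0 (s : seq 'I_D) : exists2 eta : R, 0 < eta & forall k, k \in s -> forall z, n1 (vsub z (xi0 k)) < eta ->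
    nc (p.@[z] - p.@[xi0 k]) < (4 * (D%:R + 1))^-1 /\ (n1 z < rho <-> n1 (xi0 k) < rho).
    elim: s => [|k s [e e0 he]]; first by exists 1.
    have [d d0 hd] := cp k _ eD.
    pose g := `|n1 (xi0 k) - rho|; have g0 : 0 < g by rewrite normr_gt0 subr_eq0 hrho.
    exists (Num.min e (Num.min d g)); first by rewrite !lt_min e0 d0.
    move=> l; rewrite inE => /orP[/eqP->|/he hl] z; rewrite !lt_min => /and3P[q1 q2 q3]; last exact: hl.
    split; first exact: (hd z).
    have t1 := n1_tri (xi0 k) z (fun=> 0); have t2 := n1_tri z (xi0 k) (fun=> 0).
    have s0 u : n1 (vsub u (fun=> 0)) = n1 u :> R by apply: eq_bigr => i _; rewrite /vsub subr0.
    rewrite !s0 in t1 t2; rewrite n1_sub_sym in t2; move: q3; rewrite /g.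
    case: (ltP (n1 (xi0 k)) rho) => c1; [rewrite ltr0_norm ?subr_lt0 //|rewrite ger0_norm ?subr_ge0 //] => q3.
      by split=> // _; lra.
    by split=> //; lra.
  have [e e0 he] := H0 (enum 'I_D); exists e => // k; apply: he; exact: mem_enum.
have ctr : ctsat (fun y : unit -> C => \sum_r M m' (Gt (y tt)) p r r) (fun _ => t0).
  by apply: ctsat_sum => r; exact: M_cts.
have e4 : 0 < 1 / 4 :> R by lra.
apply: near_imp (near_and (zeros_close hz0 eta0) (ctr _ e4)) _ => y [h1 h2] xi [tr x1 _ _].
have cntE (x : 'I_D -> 'I_n -> C) : (cnt (fun z => n1 z < rho) x)%:R = \sum_k `[< n1 (x k) < rho >]%:R :> C.
  rewrite /cnt -sum1_card natr_sum [LHS]big_mkcond; apply: eq_bigr => k _ /=.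
  by rewrite inE; case: asboolP.
have E0 : \sum_r M m' (Gt t0) p r r = (cnt (fun z => n1 z < rho) xi0)%:R.
  by rewrite cntE; apply: (etrans (tr0 p)); apply: eq_bigr => k _; exact: hp.
have E1 : \sum_r M m' (Gt (y tt)) p r r = \sum_k p.@[xi k] by exact: (tr p).
have E2 : nc (\sum_k p.@[xi k] - (cnt (fun z => n1 z < rho) xi)%:R) <= 1 / 4.
  rewrite cntE -sumrB; apply: le_trans (nc_sum _ _ _) _.
  apply: (@le_trans _ _ (\sum_(k < D) (4 * (D%:R + 1))^-1)).
    apply: ler_sum => k _; have [k0 hk0] := h1 _ (x1 k); have [a1 a2] := heta k0 _ hk0.
    apply: ltW; move: a1; rewrite hp; congr (nc (_ - _%:R) < _); congr nat_of_bool.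
    by apply/asboolP/asboolP; tauto.
  rewrite sumr_const card_ord -[X in X <= _]mulr_natl; move: (D%:R) D0 => d D0.
  by rewrite ler_pdivrMr ?mulr_gt0 // mulrA -[1 / 4 * 4]mulrAC; lra.
have {}h2 : nc (\sum_k p.@[xi k] - (cnt (fun z => n1 z < rho) xi0)%:R) < 1 / 4 by rewrite -E0 -E1.
apply: nat_close; have := nc_tri (\sum_k p.@[xi k]) (cnt (fun z => n1 z < rho) xi)%:R (cnt (fun z => n1 z < rho) xi0)%:R.
rewrite nc_distC in E2; move: E2 h2; move: (nc _) (nc _) (nc _) => x y' z; lra.
Qed.

(** Cousin's lemma on [0, 1]: constancy of the count passes to the union of two adjacent intervals
    because they share the midpoint. *)
Lemma cnt_path (rho : R) xi0 xi1 : zlist (Gt 0) xi0 -> zlist (Gt 1) xi1 ->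
  (forall t : R, 0 <= t <= 1 -> forall z, zeroH m' (Gt (real_complex R t)) z -> n1 z != rho) ->
  cnt (fun z => n1 z < rho) xi0 = cnt (fun z => n1 z < rho) xi1.
Proof.
move=> hz0 hz1 hrho.
pose Q (x : unit -> R) h := exists N, forall s, x tt <= s <= x tt + h -> forall xi,
   zlist (Gt (real_complex R s)) xi -> cnt (fun z => n1 z < rho) xi = N.
have [N hN] : Q (fun _ => 0) 1; last first.
  have i0 : (0 : R) <= (0 : R) <= 0 + 1 by lra.
  have i1 : (0 : R) <= (1 : R) <= 0 + 1 by lra.
  have e0 : real_complex R 0 = 0 by rewrite rmorph0.
  have e1 : real_complex R 1 = 1 by rewrite rmorph1.
  rewrite -e0 in hz0; rewrite -e1 in hz1.
  exact: (etrans (hN 0 i0 _ hz0) (esym (hN 1 i1 _ hz1))).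
apply: (@cube_ind R unit Q) => // [x h h0 hs|y hy].
  have [N1 h1] := hs (fun _ => false); have [N2 h2] := hs (fun _ => true).
  rewrite addr0 in h1; rewrite -addrA -splitr in h2.
  have [xi hxi] := zlist_ex (real_complex R (x tt + h / 2)).
  have NN : N1 = N2.
    have i1 : x tt <= x tt + h / 2 <= x tt + h / 2 by lra.
    have i2 : x tt + h / 2 <= x tt + h / 2 <= x tt + h by lra.
    exact: (etrans (esym (h1 _ i1 _ hxi)) (h2 _ i2 _ hxi)).
  exists N1 => s hs' xi' hxi'; case: (leP s (x tt + h / 2)) => c1.
    by apply: (h1 s) => //; lra.
  by rewrite NN; apply: (h2 s) => //; lra.
have hy' : 0 <= y tt <= 1 by have := hy tt => /=; lra.
have [xi hxi] := zlist_ex (real_complex R (y tt)).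
have nr k : n1 (xi k) != rho by apply: (hrho _ hy'); case: hxi => _ + _ _; exact.
have [d d0 hd] := cnt_locally_constant hxi nr.
exists d => // x h h0 hh /(_ tt) hx _; exists (cnt (fun z => n1 z < rho) xi) => s hs xi' hxi'.
apply: (hd (fun _ => real_complex R s)) => //.
rewrite /n1 (bigD1 tt) //= big1 => [|[] //]; rewrite addr0 /vsub -rmorphB nc_real.
by rewrite ltr_norml; lra.
Qed.
End Continuity.

(** * Conservation of the number of zeros *)

Section GenInd.
Variables (A : comNzRingType) (n : nat).

Lemma mpoly_gen_ind (P : {mpoly A[n]} -> Prop) :
  (forall c, P c%:MP) -> (forall i, P 'X_i) ->
  (forall p q, P p -> P q -> P (p + q)) -> (forall p q, P p -> P q -> P (p * q)) ->
  forall p, P p.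
Proof.
move=> hC hX hD hM; elim/mpolyind => [|c m p _ _ IH]; first by rewrite -mpolyC0.
apply: hD => //; rewrite -mul_mpolyC; apply: (hM) => //; rewrite mpolyXE_id.
have P1 : P 1 by rewrite -mpolyC1.
apply: (big_ind P P1 hM) => i _.
by elim: (m i) => [|k IHk]; [rewrite expr0 -mpolyC1|rewrite exprS; exact: hM].
Qed.

Lemma hadamard (z : 'I_n -> A) (p : {mpoly A[n]}) : exists h : 'I_n -> {mpoly A[n]},
  p - p.@[z]%:MP = \sum_i ('X_i - (z i)%:MP) * h i.
Proof.
move: p; apply: mpoly_gen_ind => [c|i|p q [h1 e1] [h2 e2]|p q [h1 e1] [h2 e2]].
- by exists (fun=> 0); rewrite mevalC subrr big1 // => i _; rewrite mulr0.
- exists (fun j => (i == j)%:R); rewrite mevalXU (bigD1 i) //= eqxx mulr1 big1 ?addr0 // => j.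
  by rewrite eq_sym => /negPf->; rewrite mulr0.
- exists (fun i => h1 i + h2 i); rewrite mevalD mpolyCD.
  under eq_bigr do rewrite mulrDr; rewrite big_split /= -e1 -e2; ring.
- exists (fun i => h1 i * q + p.@[z]%:MP * h2 i); rewrite mevalM mpolyCM.
  have -> : \sum_i ('X_i - (z i)%:MP) * (h1 i * q + p.@[z]%:MP * h2 i) =
     (\sum_i ('X_i - (z i)%:MP) * h1 i) * q + p.@[z]%:MP * (\sum_i ('X_i - (z i)%:MP) * h2 i).
    rewrite mulr_suml mulr_sumr -big_split; apply: eq_bigr => i _ /=; ring.
  rewrite -e1 -e2; ring.
Qed.

(** Cramer's rule modulo an ideal: the relations are multiplied by the adjugate matrix. *)
Lemma adj_inid (k N : nat) (g : 'I_k -> {mpoly A[n]}) (T : 'I_N -> 'I_N -> {mpoly A[n]}) (y : 'I_N -> {mpoly A[n]}) :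
  (forall j, inid g (\sum_i T j i * y i)) -> forall i, inid g (\det (\matrix_(j, i) T j i) * y i).
Proof.
set T' := \matrix_(j, i) T j i => h i.
have := congr1 (fun B => (B *m \col_i y i) i 0) (mul_adj_mx T').
rewrite -mulmxA mul_scalar_mx [in RHS]mxE [in RHS]mxE => <-; rewrite mxE.
apply: inid_sum => j; apply: inidM; rewrite mxE.
by under eq_bigr do rewrite !mxE; exact: h.
Qed.

(** An algebraic form of simplicity: after inverting [d], which is a unit at [z], the ideal of [g]
    contains the whole maximal ideal of [z]. *)
Definition nondeg (g : 'I_n -> {mpoly A[n]}) (z : 'I_n -> A) :=
  exists2 d : {mpoly A[n]}, d.@[z] != 0 & forall i, inid g (d * ('X_i - (z i)%:MP)).

Lemma nondeg_mx (g : 'I_n -> {mpoly A[n]}) z (T : 'I_n -> 'I_n -> {mpoly A[n]}) :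
  (forall j, inid g (\sum_i T j i * ('X_i - (z i)%:MP))) ->
  \det (\matrix_(j, i) (T j i).@[z]) != 0 -> nondeg g z.
Proof.
move=> h hd; exists (\det (\matrix_(j, i) T j i)); last exact: adj_inid.
rewrite -det_map_mx (_ : map_mx _ _ = \matrix_(j, i) (T j i).@[z]) //.
by apply/matrixP => i j; rewrite !mxE.
Qed.

Lemma msizeM_le1 (p q : {mpoly A[n]}) k l : (msize p <= k)%N -> (msize q <= l)%N ->
  (msize (p * q) <= (k + l).-1)%N.
Proof.
move=> hp hq; apply: msize_coef => b hb; rewrite mcoeffM big1 // => -[[b1 hb1] [b2 hb2]] /= /eqP e.
have {e} e : mdeg b = (mdeg b1 + mdeg b2)%N by rewrite e mdegD.
case: (leqP k (mdeg b1)) => [h|h].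
  by rewrite [p@__]memN_msupp_eq0 ?mul0r // msize_mdeg_ge // (leq_trans hp).
by rewrite [q@__]memN_msupp_eq0 ?mulr0 // msize_mdeg_ge // (leq_trans hq) //; lia.
Qed.

(** The shape of an equation of a Pham system; it is multiplicative, which allows such equations to
    be built with prescribed zeros. *)
Definition mon_like (i : 'I_n) k (p : {mpoly A[n]}) := (msize (p - 'X_i ^+ k) <= k)%N.

Lemma msizeXn_le (i : 'I_n) k : (msize ('X_i ^+ k : {mpoly A[n]}) <= k.+1)%N.
Proof.
rewrite (_ : 'X_i ^+ k = 'X_[(U_(i) *+ k)]) ?mpolyXn //.
by rewrite msizeX mdegMn mdeg1 mul1n.
Qed.

Lemma mon_likeX i k : mon_like i k ('X_i ^+ k).
Proof. by rewrite /mon_like subrr msize0. Qed.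

Lemma mon_like_msize i k p : mon_like i k p -> (msize p <= k.+1)%N.
Proof.
move=> h; rewrite -(subrK ('X_i ^+ k) p); apply: leq_trans (msizeD_le _ _) _.
by rewrite geq_max (leqW h) msizeXn_le.
Qed.

Lemma mon_likeM i k l p q : mon_like i k p -> mon_like i l q -> mon_like i (k + l) (p * q).
Proof.
move=> hp hq; rewrite /mon_like.
have -> : p * q - 'X_i ^+ (k + l) = (p - 'X_i ^+ k) * q + 'X_i ^+ k * (q - 'X_i ^+ l).
  by rewrite exprD; ring.
apply: leq_trans (msizeD_le _ _) _; rewrite geq_max; apply/andP; split.
  by apply: leq_trans (msizeM_le1 hp (mon_like_msize hq)) _; rewrite addnS.
by apply: leq_trans (msizeM_le1 (msizeXn_le i k) hq) _; rewrite addSn.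
Qed.
End GenInd.

(** * Nondegenerate zeros are counted once *)

Section SimpleCount.
Variables (R : realType) (n m' : nat).
Local Notation C := (R[i]).
Variable G : 'I_n -> {mpoly C[n]}.
Hypothesis hG : forall i, (msize (G i) <= m'.+1)%N.

Lemma card_asbool (S : pzSemiRingType) (T : finType) (P : T -> Prop) :
  #|[pred k | `[< P k >]]|%:R = \sum_k `[< P k >]%:R :> S.
Proof.
rewrite -sum1_card natr_sum [LHS]big_mkcond; apply: eq_bigr => k _ /=.
by rewrite inE; case: asboolP.
Qed.

Lemma NP_sub p q : inid (H m' G) (p - q) -> NP m' G p = NP m' G q.
Proof. by move/(NP_ideal hG); rewrite /NP linearB /= => /eqP; rewrite subr_eq0 => /eqP. Qed.

(** Modulo the ideal [d * p] equals [p(z) * d], so multiplication by [d] has trace [d(z)]. The trace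
    formula gives [d(z)] times the number of occurrences of [z]. *)
Lemma simple_count xi z : @zlist R n m' G xi -> zeroH m' G z -> nondeg (H m' G) z ->
  cnt (fun x => x = z) xi = 1%N.
Proof.
move=> [htr hz _ _] z0 [d d0 hd].
have hdp p : inid (H m' G) (d * p - p.@[z] *: d).
  have [h e] := hadamard z p; rewrite -mul_mpolyC [_%:MP * d]mulrC -mulrBr e mulr_sumr.
  by apply: inid_sum => i; rewrite mulrA mulrC; apply: inidM.
have tr : \tr (M m' G d) = d.@[z].
  rewrite -(NP_ev hG d z0) [RHS]mxE; apply: eq_bigr => r _; rewrite [LHS]mxE.
  rewrite (NP_sub (hdp _)) /NP linearZ /= [LHS]mxE mulrC; congr (_ * _).
  by rewrite mxE.
have dk k : d.@[xi k] = d.@[z] * `[< xi k = z >]%:R.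
  case: asboolP => [->|ne]; first by rewrite mulr1.
  have [i hi] : exists i, xi k i - z i != 0.
    apply: contrapT => /forallNP H0; apply: ne; apply: funext => i.
    by have := H0 i => /negP; rewrite negbK subr_eq0 => /eqP.
  have [q hq] := hd i; have := congr1 (fun p => p.@[xi k]) hq.
  rewrite mevalM mevalB mevalXU mevalC raddf_sum /= big1 => [|j _].
    by move/eqP; rewrite mulf_eq0 (negPf hi) orbF => /eqP->; rewrite mulr0.
  by rewrite mevalM hz mulr0.
move: (htr d); rewrite tr; under eq_bigr do rewrite dk; rewrite -mulr_sumr.
rewrite -{1}[d.@[z]]mulr1 => /(mulfI d0) e.
have : (1%N%:R : C) == (cnt (fun x => x = z) xi)%:R; last by rewrite eqr_nat => /eqP.
by apply/eqP; rewrite /cnt card_asbool.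
Qed.
End SimpleCount.

(** * Zeros of dominated perturbations *)

Section Perturbation.
Variables (R : realType) (n : nat).
Local Notation C := (R[i]).
Local Notation zero g z := (forall i : 'I_n, (g i : {mpoly C[n]}).@[z] = 0).

Lemma n1_sub0 (u : 'I_n -> C) : n1 (vsub u (fun=> 0)) = n1 u.
Proof. by apply: eq_bigr => i _; rewrite /vsub subr0. Qed.

Lemma mpoly_cts (p : {mpoly C[n]}) z : ctsat (fun x => p.@[x]) z.
Proof. by apply: polyfun_cts; apply: (polyfun_meval p (fun i => polyfun_coord _ i)). Qed.

Lemma mpoly_bounded (rho : R) (p : {mpoly C[n]}) :
  exists2 B : R, 0 <= B & forall z, n1 z <= rho -> nc p.@[z] <= B.
Proof.
move: p; apply: mpoly_gen_ind => [c|i|p q [B B0 hB] [D D0 hD]|p q [B B0 hB] [D D0 hD]].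
- by exists (nc c); [exact: nc_ge0|move=> z _; rewrite mevalC].
- exists (Num.max 0 rho); first by rewrite le_max lexx.
  by move=> z hz; rewrite mevalXU le_max (le_trans (le_n1 z i) hz) orbT.
- exists (B + D); first exact: addr_ge0.
  by move=> z hz; rewrite mevalD; apply: le_trans (ncD _ _) _; apply: lerD; [exact: hB|exact: hD].
- exists (B * D); first exact: mulr_ge0.
  by move=> z hz; rewrite mevalM ncM ler_pM ?nc_ge0 ?hB ?hD.
Qed.

Lemma mpoly_bounded_all (rho : R) (T : finType) (p : T -> {mpoly C[n]}) :
  exists2 B : R, 0 <= B & forall t z, n1 z <= rho -> nc (p t).@[z] <= B.
Proof.
have /choice[B hB] : forall t, exists B : R, 0 <= B /\ forall z, n1 z <= rho -> nc (p t).@[z] <= B.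
  by move=> t; have [B B0 h] := mpoly_bounded rho (p t); exists B.
exists (\sum_t B t) => [|t z hz]; first by apply: sumr_ge0 => t _; case: (hB t).
apply: le_trans ((hB t).2 z hz) _; rewrite (bigD1 t) //= lerDl.
by apply: sumr_ge0 => u _; case: (hB u).
Qed.

(** Evaluating [d * (X_i - z_i)] as a combination of the [g j] bounds the distance to [z] by the
    size of [g], since [d] stays away from 0 near [z]. *)
Lemma nondeg_lower (g : 'I_n -> {mpoly C[n]}) z : nondeg g z ->
  exists2 K : R, 0 < K & near z (fun x => n1 (vsub x z) <= K * \sum_i nc (g i).@[x]).
Proof.
move=> [d d0 hd]; have /choice[a ha] : forall i, exists a : 'I_n -> {mpoly C[n]},
    d * ('X_i - (z i)%:MP) = \sum_j a j * g j by move=> i; exact: hd.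
have [B B0 hB] := mpoly_bounded_all (n1 z + 1) (fun ij : 'I_n * 'I_n => a ij.1 ij.2).
have dz : 0 < nc d.@[z] by exact: nc_gt0.
pose K := (n%:R * B + 1) / (nc d.@[z] / 2).
have K0 : 0 < K by rewrite divr_gt0 ?divr_gt0 // ltr_wpDl // mulr_ge0 ?ler0n.
exists K => //; apply: near_imp (near_and (ctsat_neq0 (mpoly_cts d z) d0) (near_ball z ltr01)) _ => x [h1 h2].
have hx : n1 x <= n1 z + 1.
  have := n1_tri z x (fun=> 0); rewrite !n1_sub0; lra.
have E i : nc d.@[z] / 2 * nc (x i - z i) <= B * \sum_j nc (g j).@[x].
  have := congr1 (fun p => p.@[x]) (ha i); rewrite /= mevalM mevalB mevalXU mevalC => e.
  apply: (@le_trans _ _ (nc (d.@[x] * (x i - z i)))).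
    by rewrite ncM ler_wpM2r ?nc_ge0 // ltW.
  rewrite e raddf_sum; apply: le_trans (nc_sum _ _ _) _.
  rewrite mulr_sumr; apply: ler_sum => j _; rewrite /= mevalM ncM ler_wpM2r ?nc_ge0 //.
  exact: (hB (i, j)).
have S0 : 0 <= \sum_j nc (g j).@[x] by apply: sumr_ge0 => j _; exact: nc_ge0.
rewrite /K mulrAC ler_pdivlMr ?divr_gt0 // mulrC /n1 mulr_sumr.
apply: (@le_trans _ _ (\sum_(i < n) B * \sum_j nc (g j).@[x])).
  by apply: ler_sum => i _; exact: E.
rewrite sumr_const card_ord -[X in X <= _]mulr_natl mulrA ler_wpM2r //.
by rewrite lerDl.
Qed.

Section Count.
Variables (g : 'I_n -> {mpoly C[n]}) (rho : R).
Hypothesis rho0 : 0 < rho.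
Hypothesis gsh : forall z, n1 z = rho -> exists i, (g i).@[z] != 0.

Lemma far_point (y : 'I_n -> C) : rho < n1 y -> near y (fun z => rho < n1 z).
Proof.
move=> h; exists (n1 y - rho) => [|z hz]; first by rewrite subr_gt0.
by have := n1_tri z y (fun=> 0); rewrite !n1_sub0 n1_sub_sym; lra.
Qed.

Lemma zero_inside z : n1 z <= rho -> zero g z -> n1 z < rho.
Proof.
rewrite le_eqVlt => /orP[/eqP e|//] h; have [i /eqP] := gsh e; by rewrite h.
Qed.

(** By [nondeg_lower] each zero is isolated, and compactness makes the set finite. Points are stored
    as finite functions, for which lists have decidable membership. *)
Lemma finite_zeros : (forall z, n1 z < rho -> zero g z -> nondeg g z) -> exists (s : nat) (e : 'I_s -> 'I_n -> C), injective e /\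
  forall z, (n1 z < rho /\ zero g z) <-> exists k, z = e k.
Proof.
move=> gnd; pose Q (A : ('I_n -> C) -> Prop) := exists l : seq {ffun 'I_n -> C},
  forall z, A z -> n1 z <= rho -> zero g z -> [ffun i => z i] \in l.
have [||||l hl] := @compact_ball R 'I_n Q (fun=> 0) rho rho0.
- by move=> A B h [l hl]; exists l => z /h; exact: hl.
- by exists [::].
- move=> A B [l hl] [k hk]; exists (l ++ k) => z h h1 h2; rewrite mem_cat.
  by case: h => h; [rewrite hl|rewrite hk ?orbT].
- move=> y; case: (ltP rho (n1 y)) => hy.
    by have [d d0 hd] := far_point hy; exists d => //; exists [::] => z /hd; rewrite ltNge => /negP.
  case: (pselect (zero g y)) => [y0|/existsNP[i /eqP hi]].
    have [K K0 [d d0 hd]] := nondeg_lower (gnd y (zero_inside hy y0) y0).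
    exists d => //; exists [:: [ffun i => y i]] => z /hd h _ z0; rewrite inE.
    move: h; rewrite big1 => [|i _]; last by rewrite z0 nc0.
    rewrite mulr0 => h; have /n1_eq0 -> : n1 (vsub z y) = 0 by apply/eqP; rewrite eq_le h n1_ge0.
    by rewrite eqxx.
  have [d d0 hd] := ctsat_neq0 (mpoly_cts (g i) y) hi.
  exists d => //; exists [::] => z /hd h _ z0; move: h.
  by rewrite z0 nc0 ltNge divr_ge0 ?nc_ge0.
pose l' := undup [seq w : {ffun 'I_n -> C} <- l | `[< n1 (fun i => w i) < rho /\ zero g (fun i => w i) >]].
exists (size l'), (fun k i => tnth (in_tuple l') k i); split.
  move=> j k e; apply/(tuple_uniqP (in_tuple l')); first exact: undup_uniq.
  by apply/ffunP => i; exact: (congr1 (fun f => f i) e).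
move=> z; split=> [[h1 h2]|[k ->]].
  have : [ffun i => z i] \in l'.
    rewrite mem_undup mem_filter hl ?n1_sub0 ?(ltW h1) // andbT; apply/asboolP.
    by rewrite (_ : (fun _ => _) = z) //; apply: funext => i; rewrite ffunE.
  move/(tnthP (in_tuple l')) => [k hk]; exists k; apply: funext => i.
  by rewrite -hk ffunE.
have : tnth (in_tuple l') k \in l' by exact: mem_tnth.
by rewrite mem_undup mem_filter => /andP[/asboolP].
Qed.

Section Dominated.
Variable E : 'I_n -> {mpoly C[n]}.
Local Notation pert lam z := (forall i, (E i).@[z] + real_complex R lam * (g i).@[z] = 0).

(** Compactness reduces the claim to small neighbourhoods. Around a point where some [g i] is
    nonzero, [lam * g i] exceeds the bounded [E i]; zeros of [g] are left to the hypothesis. *)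
Lemma no_other_zeros :
  (forall y, n1 y < rho -> zero g y -> exists L : R,
     near y (fun z => forall lam, L < lam -> n1 z <= rho -> pert lam z -> zero g z)) ->
  exists L : R, forall lam : R, L < lam -> forall z, n1 z <= rho -> pert lam z -> zero g z.
Proof.
move=> hloc; pose Q (A : ('I_n -> C) -> Prop) := exists L : R, forall lam : R, L < lam -> forall z,
  A z -> n1 z <= rho -> pert lam z -> zero g z.
have [||||L hL] := @compact_ball R 'I_n Q (fun=> 0) rho rho0; last first.
- by exists L => lam hlam z hz; apply: hL => //; rewrite n1_sub0.
- move=> y; case: (ltP rho (n1 y)) => hy.
    by have [d d0 hd] := far_point hy; exists d => //; exists 0 => lam _ z /hd; rewrite ltNge => /negP.
  case: (pselect (zero g y)) => [y0|/existsNP[i /eqP hi]].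
    have [L [d d0 hd]] := hloc y (zero_inside hy y0) y0.
    by exists d => //; exists L => lam hlam z /hd; exact.
  have [B B0 hB] := mpoly_bounded_all rho E.
  have [d d0 hd] := ctsat_neq0 (mpoly_cts (g i) y) hi.
  have hi' : 0 < nc (g i).@[y] / 2 by rewrite divr_gt0 // nc_gt0.
  exists d => //; exists (B / (nc (g i).@[y] / 2)) => lam hlam z /hd h hz e; exfalso.
  have lam0 : 0 < lam by apply: le_lt_trans hlam; rewrite divr_ge0 // ltW.
  move: hlam; rewrite ltr_pdivrMr // ltNge => /negP; apply.
  apply: le_trans (hB i z hz).
  have -> : (E i).@[z] = - (real_complex R lam * (g i).@[z]).
    by apply/eqP; rewrite -addr_eq0 e.
  by rewrite ncN ncM nc_real (ger0_norm (ltW lam0)); apply: ler_wpM2l; exact: ltW.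
- move=> A B [L1 h1] [L2 h2]; exists (Num.max L1 L2) => lam; rewrite gt_max => /andP[l1 l2] z [h|h].
    exact: h1.
  exact: h2.
- by exists 0.
- by move=> A B h [L hL]; exists L => lam hlam z /h; exact: hL.
Qed.

(* Near a zero y of g both E and g are comparable to |z - y|, with a factor lam in favour of g. *)
Lemma no_other_near y : n1 y < rho -> nondeg g y ->
  (forall i, exists q, E i = ('X_i - (y i)%:MP) * q) -> exists L : R,
  near y (fun z => forall lam, L < lam -> n1 z <= rho -> pert lam z -> zero g z).
Proof.
move=> hy nd /choice[q hq]; have [K K0 nK] := nondeg_lower nd.
have [D D0 hD] := mpoly_bounded_all rho q.
have [d d0 hd] := nK; exists (K * D); exists d => // z /hd h lam hlam hz e.
have lam0 : 0 < lam by apply: le_lt_trans hlam; rewrite mulr_ge0 // ltW.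
have S : lam * \sum_i nc (g i).@[z] <= D * n1 (vsub z y).
  rewrite mulr_sumr /n1 mulr_sumr; apply: ler_sum => i _.
  have -> : lam = nc (real_complex R lam) by rewrite nc_real ger0_norm // ltW.
  rewrite -ncM; have -> : real_complex R lam * (g i).@[z] = - (E i).@[z].
    by apply/eqP; rewrite -addr_eq0 addrC e.
  rewrite ncN hq mevalM mevalB mevalXU mevalC ncM mulrC ler_wpM2r ?nc_ge0 //.
  exact: hD.
have S0 : 0 <= \sum_i nc (g i).@[z] by apply: sumr_ge0 => i _; exact: nc_ge0.
have : \sum_i nc (g i).@[z] = 0.
  apply/eqP; rewrite eq_le S0 andbT leNgt; apply/negP => Spos.
  have : lam * \sum_i nc (g i).@[z] <= D * (K * \sum_i nc (g i).@[z]).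
    by apply: le_trans S _; rewrite ler_wpM2l.
  by rewrite mulrA ler_pM2r // leNgt mulrC hlam.
move=> /eqP; rewrite psumr_eq0 => [/allP h0 i|i _]; last exact: nc_ge0.
by apply: nc_eq0; apply/eqP; apply: (h0 i); rewrite mem_index_enum.
Qed.
End Dominated.
End Count.
End Perturbation.

(** * Ideals truncated at a given order *)

Section OrderLemmas.
Variables (F : numClosedFieldType) (n : nat).
Implicit Types (p q : {mpoly F[n]}) (b : 'X_{1..n}).

Lemma sub_multinom k b : (k <= mdeg b)%N -> exists2 c : 'X_{1..n}, (c <= b)%MM & mdeg c = k.
Proof.
elim: k => [|k IH] h; first by exists 0%MM; rewrite ?mdeg0 //; apply/mnm_lepP => i; rewrite mnm0E.
have [c hc dc] := IH (ltnW h); move/mnm_lepP: (hc) => hc'.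
have [i hi] : exists i, (c i < b i)%N.
  apply: contrapT => /forallNP hn; have e : b = c.
    by apply/mnmP => i; apply/eqP; rewrite eqn_leq hc' andbT leqNgt; apply/negP.
  by rewrite e dc ltnn in h.
exists (c + U_(i))%MM; last by rewrite mdegD mdeg1 dc addn1.
apply/mnm_lepP => j; rewrite mnmDE mnm1E; case: eqP => [<-|_]; first by rewrite addn1.
by rewrite addn0.
Qed.

(** The monomials of degree exactly [k], indexed by the finite type of exponents of degree at most
    [k] and padded with 0. *)
Definition ymon k (b : 'X_{1..n < k.+1}) : {mpoly F[n]} := if mdeg b == k then 'X_[b] else 0.

Lemma ordgeXm b : ordge (mdeg b) ('X_[b] : {mpoly F[n]}).
Proof. by move=> c hc; rewrite mcoeffX; case: eqP => // e; rewrite e ltnn in hc. Qed.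

Lemma ordge_zero k : ordge k (0 : {mpoly F[n]}).
Proof. by move=> b _; rewrite mcoeff0. Qed.

Lemma ordge_ymon k (b : 'X_{1..n < k.+1}) : ordge k (ymon b).
Proof. by rewrite /ymon; case: eqP => [{1}<-|_]; [exact: ordgeXm|exact: ordge_zero]. Qed.

Lemma ordge_ymon_split k l p : ordge (k + l) p ->
  exists2 c : 'X_{1..n < k.+1} -> {mpoly F[n]}, forall x, ordge l (c x) & p = \sum_x ymon x * c x.
Proof.
move=> hp; rewrite (mpolyE p) big_seq.
apply: (big_ind (fun p => exists2 c : 'X_{1..n < k.+1} -> {mpoly F[n]},
   forall x, ordge l (c x) & p = \sum_x ymon x * c x)) => [|q r [c hc ->] [d hd ->]|b hb].
- by exists (fun=> 0) => [b|]; [exact: ordge_zero|rewrite big1 // => b _; rewrite mulr0].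
- exists (fun x => c x + d x) => [x|]; first exact: ordgeD.
  by rewrite -big_split; apply: eq_bigr => b _; rewrite mulrDr.
have db : (k + l <= mdeg b)%N.
  by rewrite leqNgt; apply/negP => /hp; move: hb; rewrite mcoeff_msupp => /eqP.
have [c hc dc] := @sub_multinom k b (leq_trans (leq_addr _ _) db).
have c1 : (mdeg c < k.+1)%N by rewrite dc.
exists (fun x => if x == BMultinom c1 then p@_b *: 'X_[(b - c)] else 0) => [x|].
  case: eqP => _; last exact: ordge_zero.
  rewrite -mul_mpolyC; apply: ordgeMr; have := @ordgeXm (b - c)%MM; apply: ordge_le.
  have : mdeg b = (mdeg (b - c) + mdeg c)%N by rewrite -mdegD submK.
  by rewrite dc; lia.
rewrite (bigD1 (BMultinom c1)) //= eqxx big1 ?addr0 => [|x /negPf->]; last by rewrite mulr0.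
by rewrite /ymon /= dc eqxx -scalerAr -mpolyXD addmC submK.
Qed.

Section Ideal.
Variables (k : nat) (h : 'I_k -> {mpoly F[n]}).

Lemma idordD K p q : idord h K p -> idord h K q -> idord h K (p + q).
Proof.
move=> [a ia oa] [b ib ob]; exists (a + b); first exact: inidD.
by rewrite opprD addrACA; exact: ordgeD.
Qed.
Lemma idordM K p q : idord h K q -> idord h K (p * q).
Proof. by move=> [a ia oa]; exists (p * a); [exact: inidM|rewrite -mulrBr; exact: ordgeMr]. Qed.
Lemma idordZ K c q : idord h K q -> idord h K (c *: q).
Proof. by rewrite -mul_mpolyC; exact: idordM. Qed.
Lemma idordN K q : idord h K q -> idord h K (- q).
Proof. by rewrite -mulN1r; exact: idordM. Qed.
Lemma idord_ordge K p : ordge K p -> idord h K p.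
Proof. by move=> hp; exists 0; [exact: inid0|rewrite subr0]. Qed.
Lemma idord_inid K p : inid h p -> idord h K p.
Proof. by move=> hp; exists p => //; rewrite subrr; exact: ordge_zero. Qed.
Lemma idord0 K : idord h K 0.
Proof. by apply: idord_inid; exact: inid0. Qed.
Lemma idord_le K L p : (K <= L)%N -> idord h L p -> idord h K p.
Proof. by move=> KL [q iq oq]; exists q => //; apply: ordge_le _ oq. Qed.
Lemma idord_sum K (T : Type) (s : seq T) (f : T -> {mpoly F[n]}) :
  (forall t, idord h K (f t)) -> idord h K (\sum_(t <- s) f t).
Proof.
move=> hf; elim: s => [|t s IH]; rewrite ?big_nil ?big_cons; last exact: idordD.
exact: idord0.
Qed.

(** The hypothesis of Nakayama's lemma for the K-th power of the maximal ideal modulo [h]. *)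
Definition stable K := forall p, ordge K p -> idord h K.+1 p.

Lemma stable_all K : stable K -> forall L p, ordge K p -> idord h L p.
Proof.
move=> st; have step s p : ordge (K + s) p -> idord h (K + s).+1 p.
  rewrite addnC => /ordge_ymon_split[c hc ->]; apply: idord_sum => b.
  have [q iq oq] := st _ (hc b); exists (ymon b * q); first exact: inidM.
  by rewrite -mulrBr -addnS; apply: ordgeM oq; exact: ordge_ymon.
move=> L; elim: L => [|L IH] p hp; first by apply: idord_ordge; exact: ordge0.
case: (leqP L.+1 K) => hL; first by apply: idord_ordge; apply: ordge_le _ hp.
have [q iq oq] := IH p hp; rewrite -(subrK q p).
apply: idordD; last exact: idord_inid.
by have := step (L - K)%N (p - q); rewrite subnKC //; apply.
Qed.

(* Otherwise elements p_i of order i outside (h) + m^(i+1) are independent modulo (h) + m^N. *)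
Lemma stable_ex s : (forall K r, indep (idord h K) r -> (r <= s)%N) -> exists K, stable K.
Proof.
move=> hs; apply: contrapT => /forallNP hn.
have /choice[p hp] : forall K, exists p, ordge K p /\ ~ idord h K.+1 p.
  by move=> K; have /existsNP[p /not_implyP[h1 h2]] := hn K; exists p.
suff : (s.+1 <= s)%N by rewrite ltnn.
apply: (hs s.+1); exists (fun i => p i) => c hc i.
have [N] := ubnP (i : nat); elim: N i => // N IH i hi.
apply/eqP; apply: contrapT => /negP ci; apply: (hp i).2.
have -> : p i = (c i)^-1 *: (c i *: p i) by rewrite scalerA mulVf ?scale1r.
apply: idordZ.
have -> : c i *: p i = (\sum_i c i *: p i) - \sum_(j | j != i) c j *: p j.
  by rewrite (bigD1 i) //= addrK.
apply: idordD; first by by apply: idord_le _ hc.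
apply: idordN; rewrite big_mkcond; apply: idord_sum => j.
case: eqP => [_|/eqP ne] /=; first exact: idord0.
case: (ltnP j i) => ji; first by rewrite IH ?scale0r; [exact: idord0|exact: leq_trans ji hi].
apply: idordZ; apply: idord_ordge; apply: ordge_le _ (hp j).1.
by rewrite ltn_neqAle ji andbT eq_sym.
Qed.
End Ideal.

Lemma indep_sub (I J : {mpoly F[n]} -> Prop) s : (forall p, I p -> J p) -> indep J s -> indep I s.
Proof. by move=> h [e he]; exists e => c /h; exact: he. Qed.
End OrderLemmas.

(** * Truncated ideals of Pham systems *)

Section Pham.
Variables (F : numClosedFieldType) (n m' : nat) (g : 'I_n -> {mpoly F[n]}) (lam : F).
Hypothesis lam0 : lam != 0.
Local Notation HH := (H m' (fun i => lam *: g i)).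

(** For [k] at most [m] the added powers [X_i^m] have order at least [k], so modulo that order the
    Pham system and [g] generate the same ideal; [idord_pham_up] is the converse. *)
Lemma idord_pham_down K k p : (k <= m'.+1)%N -> (k <= K)%N -> idord HH K p -> idord g k p.
Proof.
move=> km kK [q [u hu] oq]; rewrite -(subrK q p); apply: idordD.
  by apply: idord_ordge; apply: ordge_le _ oq.
rewrite hu; apply: idord_sum => j; rewrite /H mulrDr; apply: idordD.
  apply: idord_ordge; apply: ordgeMr; apply: ordge_le km _; apply: ordgeX.
  by apply: ordge1; rewrite mevalXU.
by apply: idordM; apply: idord_inid; apply: inidZ; exact: inid_gen.
Qed.

Lemma idord_pham_up k p : (k <= m'.+1)%N -> idord g k p -> idord HH k p.
Proof.
move=> km [q [u hu] oq]; rewrite -(subrK q p); apply: idordD; first exact: idord_ordge.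
rewrite hu; apply: idord_sum => j.
have -> : u j * g j = (lam^-1 *: u j) * HH j + - (lam^-1 *: u j * 'X_j ^+ m'.+1).
  by rewrite /H mulrDr addrC addKr -scalerAr scalerAl scalerA mulfV // scale1r.
apply: idordD; first by apply: idordM; apply: idord_inid; exact: inid_gen.
apply: idordN; apply: idordM; apply: idord_ordge; apply: ordge_le km _; apply: ordgeX.
by apply: ordge1; rewrite mevalXU.
Qed.

Lemma idord_pham_stable K k p : (k < m'.+1)%N -> stable g k -> idord g k p -> idord HH K p.
Proof.
move=> km st hp; have stH : stable HH k by move=> q /st; exact: idord_pham_up.
have [q iq oq] := idord_pham_up (ltnW km) hp; rewrite -(subrK q p).
by apply: idordD; [exact: stable_all oq|exact: idord_inid].
Qed.
End Pham.

Section Segment.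
Variables (R : realType) (n m' : nat).
Local Notation C := (R[i]).
Local Notation m := m'.+1.
Variables (G0 G1 : 'I_n -> {mpoly C[n]}).
Hypotheses (h0 : forall i, (msize (G0 i) <= m)%N) (h1 : forall i, (msize (G1 i) <= m)%N).

Lemma cnt_segment (rho : R) xi0 xi1 : @zlist R n m' G0 xi0 -> @zlist R n m' G1 xi1 ->
  (forall (t : R) z, 0 <= t <= 1 -> n1 z = rho -> exists i,
     (H m' G0 i).@[z] + real_complex R t * ((H m' G1 i).@[z] - (H m' G0 i).@[z]) <> 0) ->
  cnt (fun z => n1 z < rho) xi0 = cnt (fun z => n1 z < rho) xi1.
Proof.
move=> z0 z1 hn; pose P i : {mpoly {poly C}[n]} := lft (G0 i) + 'X%:MP * lft (G1 i - G0 i).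
have PE t i : spec t (P i) = G0 i + t *: (G1 i - G0 i).
  apply/mpolyP => b; rewrite [RHS]mcoeffD mcoeffZ mcoeff_map_mpoly mcoeffD mcoeffCM !mcoeff_map_mpoly.
  by rewrite /= /horner_eval hornerD hornerM hornerX !hornerC.
have hP i : (msize (P i) <= m)%N.
  apply: msize_coef => b hb; rewrite mcoeffD mcoeffCM !mcoeff_map_mpoly mcoeffB.
  have k0 : (G0 i)@_b = 0 by apply: memN_msupp_eq0; apply: msize_mdeg_ge; exact: leq_trans (h0 i) hb.
  have k1 : (G1 i)@_b = 0 by apply: memN_msupp_eq0; apply: msize_mdeg_ge; exact: leq_trans (h1 i) hb.
  by rewrite k0 k1 subrr raddf0 mulr0 addr0.
have e0 : (fun j => spec 0 (P j)) = G0 by apply: funext => j; rewrite PE scale0r addr0.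
have e1 : (fun j => spec 1 (P j)) = G1 by apply: funext => j; rewrite PE scale1r addrC subrK.
rewrite -e0 in z0; rewrite -e1 in z1; apply: (cnt_path hP z0 z1) => t ht z hz.
apply/eqP => e; have [i hi] := hn t z ht e; apply: hi; have := hz i.
rewrite /H PE !mevalD mevalZ mevalB => {1}<-; ring.
Qed.
End Segment.

(** * Deformation between two Pham systems *)

Section Conservation.
Variables (R : realType) (n : nat).
Local Notation C := (R[i]).
Local Notation zero g z := (forall i : 'I_n, (g i : {mpoly C[n]}).@[z] = 0).

Lemma count_simple m' (G : 'I_n -> {mpoly C[n]}) (rho : R) s (e : 'I_s -> 'I_n -> C) xi :
  (forall i, (msize (G i) <= m'.+1)%N) -> @zlist R n m' G xi -> injective e ->
  (forall z, n1 z < rho /\ zeroH m' G z <-> exists k, z = e k) ->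
  (forall k, nondeg (H m' G) (e k)) -> cnt (fun z => n1 z < rho) xi = s.
Proof.
move=> hG hxi inj he nd; apply/eqP; rewrite -(eqr_nat C) /cnt card_asbool.
have E k : `[< n1 (xi k) < rho >]%:R = \sum_l `[< xi k = e l >]%:R :> C.
  case: asboolP => h.
    have [_ z0 _ _] := hxi; have [l hl] := (he (xi k)).1 (conj h (z0 k)).
    rewrite (bigD1 l) //= hl asboolT // big1 ?addr0 // => j ne.
    by rewrite asboolF // => /inj e1; rewrite e1 eqxx in ne.
  rewrite big1 // => l _; rewrite asboolF // => e1; apply: h.
  by have [] := (he (xi k)).2 (ex_intro _ l e1).
rewrite (eq_bigr _ (fun k _ => E k)) exchange_big /=; apply/eqP.
rewrite (eq_bigr (fun=> 1)) => [|l _]; first by rewrite sumr_const card_ord.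
have [_ z0] := (he (e l)).2 (ex_intro _ l erefl).
by rewrite -card_asbool -[#|_|]/(cnt (fun z => z = e l) xi) (simple_count hG hxi z0 (nd l)).
Qed.

Variables (g g' : 'I_n -> {mpoly C[n]}) (rho kap : R).
Hypotheses (rho0 : 0 < rho) (kap0 : 0 < kap).
Hypothesis hsh : forall z, n1 z = rho -> exists i, kap <= nc (g i).@[z].
Hypothesis hcl : forall z, n1 z = rho -> forall i, nc ((g' i).@[z] - (g i).@[z]) <= kap / 2.
Hypothesis gnd : forall z, n1 z < rho -> zero g' z -> nondeg g' z.

Lemma shell_path (t : R) z : 0 <= t <= 1 -> n1 z = rho -> exists i,
  kap / 2 <= nc ((g i).@[z] + real_complex R t * ((g' i).@[z] - (g i).@[z])).
Proof.
move=> ht hz; have [i hi] := hsh hz; exists i; have hc := hcl hz i.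
set a := (g i).@[z] in hi hc *; set b := (g' i).@[z] in hc *.
have := ncD (a + real_complex R t * (b - a)) (- (real_complex R t * (b - a))).
have h1 : t * nc (b - a) <= nc (b - a) by rewrite ler_piMl ?nc_ge0 //; lra.
rewrite addrK ncN ncM nc_real ger0_norm; last by lra.
move: (nc _) (nc _) (nc _) hi hc h1; move=> x y w; lra.
Qed.

Lemma shell_g' z : n1 z = rho -> exists i, (g' i).@[z] != 0.
Proof.
move=> hz; have [|i hi] := @shell_path 1 z _ hz; first by rewrite ler01 lexx.
exists i; apply: contraTneq hi => e; rewrite e rmorph1 mul1r addrC subrK nc0.
by rewrite -ltNge divr_gt0.
Qed.

(** Vanishing to second order at the prescribed values leaves both the position of the zeros of [g']
    and their linear part untouched. The double factors account for the condition [2 * s <= m]. *)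
Lemma square_vanishing s (e : 'I_s -> C) (i : 'I_n) m : (2 * s <= m)%N ->
  exists2 E : {mpoly C[n]}, mon_like i m E & forall k, exists q, E = ('X_i - (e k)%:MP) ^+ 2 * q.
Proof.
move=> hm; exists ('X_i ^+ (m - 2 * s) * \prod_k ('X_i - (e k)%:MP) ^+ 2).
  rewrite -[in mon_like _ _](subnK hm); apply: mon_likeM; first exact: mon_likeX.
  rewrite -[s in mon_like _ (2 * s)]card_ord cardE -[\prod__ _]big_enum /=.
  elim: (enum _) => [|k r IH]; first by rewrite big_nil /mon_like muln0 expr0 subrr msize0.
  rewrite big_cons /= mulnS; apply: mon_likeM => //.
  have m1 : mon_like i 1 ('X_i - (e k)%:MP).
    by rewrite /mon_like expr1 addrAC subrr add0r msizeN msizeC leq_b1.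
  by rewrite expr2; exact: (mon_likeM m1 m1).
by move=> k; exists ('X_i ^+ (m - 2 * s) * \prod_(j | j != k) ('X_i - (e j)%:MP) ^+ 2); rewrite (bigD1 k) //= mulrCA.
Qed.

Lemma nondeg_pert (E : 'I_n -> {mpoly C[n]}) (lam : C) z : lam != 0 ->
  (forall i, exists q, E i = ('X_i - (z i)%:MP) ^+ 2 * q) -> nondeg g' z ->
  nondeg (fun i => E i + lam *: g' i) z.
Proof.
move=> l0 /choice[q hq] [d d0 hd].
have /choice[a ha] : forall i, exists a : 'I_n -> {mpoly C[n]},
    d * ('X_i - (z i)%:MP) = \sum_j a j * g' j by move=> i; exact: hd.
pose T i j := (i == j)%:R * (lam *: d) + a i j * (('X_j - (z j)%:MP) * q j).
apply: (@nondeg_mx _ _ _ _ T) => [i|].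
  exists (a i); rewrite (eq_bigr (fun j => (i == j)%:R * (lam *: (d * ('X_j - (z j)%:MP))) + a i j * E j)); last first.
    by move=> j _; rewrite /T hq -!mul_mpolyC; ring.
  rewrite big_split /= (bigD1 i) //= eqxx mul1r big1 => [|j]; last by rewrite eq_sym => /negPf->; rewrite mul0r.
  rewrite addr0 ha scaler_sumr -big_split; apply: eq_bigr => j _ /=.
  by rewrite mulrDr addrC scalerAr.
rewrite (_ : \matrix_(_, _) _ = (lam * d.@[z])%:M) ?det_scalar ?expf_neq0 ?mulf_neq0 //.
apply/matrixP => i j; rewrite !mxE /T mevalD !mevalM mevalB mevalXU mevalC subrr mul0r mulr0 addr0 mevalZ.
by case: eqP => _; rewrite ?mulr1n ?mulr0n ?meval1 ?meval0 ?mul1r ?mul0r.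
Qed.

(** The system [X_i^m + lam * g_i] is joined by a segment to [E_i + lam * g'_i], where [E_i] comes
    from [square_vanishing]. For large [lam] the latter has in the ball exactly the zeros of [g'],
    all nondegenerate, and on the sphere the terms with [lam] dominate all along the segment. *)
Lemma pham_count : exists (s : nat) (e : 'I_s -> 'I_n -> C), [/\ injective e,
  forall z, (n1 z < rho /\ zero g' z) <-> exists k, z = e k &
  forall m', (forall i, (msize (g i) <= m'.+1)%N) -> (forall i, (msize (g' i) <= m'.+1)%N) ->
    (2 * s <= m'.+1)%N -> exists L : R, forall lam : R, L < lam -> 0 < lam ->
    forall xi, @zlist R n m' (fun i => real_complex R lam *: g i) xi -> cnt (fun z => n1 z < rho) xi = s].
Proof.
have [s [e [inj he]]] := finite_zeros rho0 shell_g' gnd.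
exists s, e; split => // m' hg hg' sm.
have /choice[E hE] : forall i, exists E : {mpoly C[n]}, mon_like i m'.+1 E /\ forall k, exists q, E = ('X_i - (e k i)%:MP) ^+ 2 * q.
  by move=> i; have [E h1 h2] := square_vanishing (fun k => e k i) i sm; exists E.
have hE2 y : n1 y < rho -> zero g' y -> forall i, exists q, E i = ('X_i - (y i)%:MP) ^+ 2 * q.
  by move=> h1 h2 i; have [k ->] := (he y).1 (conj h1 h2); exact: (hE i).2.
have [L hL] := @no_other_zeros R n g' rho rho0 shell_g' E (fun y h1 h2 =>
   no_other_near h1 (gnd h1 h2) (fun i => let: ex_intro q hq := hE2 y h1 h2 i in
     ex_intro _ (('X_i - (y i)%:MP) * q) (etrans hq (esym (mulrA _ _ _))))).
have [B B0 hB] := mpoly_bounded_all rho E.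
have [D D0 hD] := mpoly_bounded_all rho (fun i : 'I_n => 'X_i ^+ m'.+1).
(* Beyond this bound [lam * (kap / 2)] exceeds [B + D], which bounds [E_i] and [X_i^m] on the
   ball. *)
exists (Num.max L ((B + D) / (kap / 2))) => lam; rewrite gt_max => /andP[l1 l2] l0 xi0 hxi0.
have lc : real_complex R lam != 0 by rewrite fmorph_eq0 gt_eqF.
pose G1 i := real_complex R lam *: g' i + (E i - 'X_i ^+ m'.+1).
have hG0 i : (msize (real_complex R lam *: g i) <= m'.+1)%N by apply: leq_trans (msizeZ_le _ _) (hg i).
have hG1 i : (msize (G1 i) <= m'.+1)%N.
  apply: leq_trans (msizeD_le _ _) _; rewrite geq_max; apply/andP; split; last exact: (hE i).1.
  exact: leq_trans (msizeZ_le _ _) (hg' i).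
have HG1 : H m' G1 = (fun i => E i + real_complex R lam *: g' i).
  by apply: funext => i; rewrite /H /G1; ring.
have [xi1 [a1 a2 a3 a4]] := zero_list hG1.
have hxi1 : @zlist R n m' G1 xi1 by [].
rewrite (cnt_segment hG0 hG1 hxi0 hxi1 (rho := rho)).
  apply: (count_simple hG1 hxi1 inj) => [z|k]; last first.
    have [h1 h2] := (he (e k)).2 (ex_intro _ k erefl).
    by rewrite HG1; apply: nondeg_pert lc (hE2 _ h1 h2) (gnd h1 h2).
  rewrite -he /zeroH HG1; split=> -[h1 h2]; split=> // i.
    by apply: (hL lam l1 z (ltW h1)) => j; rewrite -(h2 j) mevalD mevalZ.
  rewrite mevalD mevalZ h2 mulr0 addr0; have [q ->] := hE2 z h1 h2 i.
  by rewrite mevalM rmorphXn /= mevalB mevalXU mevalC subrr expr0n mul0r.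
move=> t z ht hz; have [i hi] := shell_path ht hz; exists i => e0.
have hz' : n1 z <= rho by rewrite hz.
have : lam * (kap / 2) <= B + D; last by rewrite leNgt -ltr_pdivrMr ?divr_gt0 // l2.
apply: (@le_trans _ _ (nc (real_complex R lam * ((g i).@[z] + real_complex R t * ((g' i).@[z] - (g i).@[z]))))).
  by rewrite ncM nc_real ger0_norm ?(ltW l0) // ler_pM2l.
have -> : real_complex R lam * ((g i).@[z] + real_complex R t * ((g' i).@[z] - (g i).@[z])) =
    - (real_complex R t * (E i).@[z] + real_complex R (1 - t) * ('X_i ^+ m'.+1).@[z]).
  apply/eqP; rewrite -addr_eq0 -[X in _ == X]e0 HG1 /H !mevalD !mevalZ rmorphB rmorph1; apply/eqP; ring.
rewrite ncN; apply: le_trans (ncD _ _) _; rewrite !ncM !nc_real !ger0_norm; try lra.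
apply: lerD.
  by apply: le_trans (hB i z hz'); rewrite ler_piMl ?nc_ge0 //; lra.
by apply: le_trans (hD i z hz'); rewrite ler_piMl ?nc_ge0 //; lra.
Qed.
End Conservation.

(** * The number of zeros as a truncated dimension *)

Section ZeroCount.
Variables (R : realType) (n : nat).
Local Notation C := (R[i]).
Local Notation zero g z := (forall i : 'I_n, (g i : {mpoly C[n]}).@[z] = 0).

Lemma meval_monomial_le (z : 'I_n -> C) (b : 'X_{1..n}) : nc ('X_[b] : {mpoly C[n]}).@[z] <= n1 z ^+ mdeg b.
Proof.
rewrite mevalX mdegE expr_sum.
have -> : nc (\prod_(i < n) z i ^+ b i) = \prod_(i < n) nc (z i) ^+ b i.
  by elim/big_rec2: _ => [|i x y _ <-]; [exact: nc1|rewrite ncM ncX].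
apply: ler_prod => i _; rewrite exprn_ge0 ?nc_ge0 //=.
by apply: lerXn2r; rewrite ?nnegrE ?nc_ge0 ?n1_ge0 // le_n1.
Qed.

Lemma meval_ymon_le k (z : 'I_n -> C) (b : 'X_{1..n < k.+1}) : nc (ymon _ b).@[z] <= n1 z ^+ k.
Proof.
rewrite /ymon; case: eqP => [{2}<-|_]; first exact: meval_monomial_le.
by rewrite meval0 nc0 exprn_ge0 ?n1_ge0.
Qed.

Lemma ordge_growth k (p : {mpoly C[n]}) (rho : R) : ordge k p ->
  exists2 B : R, 0 <= B & forall z, n1 z <= rho -> nc p.@[z] <= B * n1 z ^+ k.
Proof.
rewrite -[k]addn0 => /ordge_ymon_split[c _ ->]; rewrite addn0.
have [B B0 hB] := mpoly_bounded_all rho c.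
exists (#|{: 'X_{1..n < k.+1}}|%:R * B) => [|z hz]; first by rewrite mulr_ge0 ?ler0n.
rewrite raddf_sum; apply: le_trans (nc_sum _ _ _) _.
rewrite -mulrA mulr_natl -sumr_const; apply: ler_sum => b _ /=.
by rewrite mevalM ncM mulrC ler_pM ?nc_ge0 ?hB ?meval_ymon_le.
Qed.

Lemma n1_le_max (z : 'I_n -> C) : 0 < n1 z -> exists i, n1 z <= n%:R * nc (z i).
Proof.
move=> h; apply: contrapT => /forallNP H0.
have n0 : (0 < n)%N.
  by case: (n) z h {H0} => // z; rewrite /n1 big_ord0 ltxx.
have : \sum_(i < n) n%:R * nc (z i) < \sum_(i < n) n1 z.
  have i0 : 'I_n by exact: Ordinal n0.
  apply: ltr_sum => [|i _]; last by rewrite ltNge; apply/negP; exact: H0.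
  by apply/hasP; exists i0; rewrite ?mem_index_enum.
by rewrite -mulr_sumr sumr_const card_ord -[X in _ < X]mulr_natl ltxx.
Qed.

Variable g : 'I_n -> {mpoly C[n]}.
Hypothesis g0 : zero g (fun=> 0).

(* A stable g satisfies |z|^k <= W (|g(z)| + |z|^(k+1)), so a zero of z^m + lam g with m > k cannot be small. *)
Lemma no_small_zeros k m (rho : R) : stable g k -> (k < m)%N -> exists L : R,
  near (fun=> 0) (fun z => forall lam, L < lam -> n1 z <= rho ->
   (forall i, ('X_i ^+ m : {mpoly C[n]}).@[z] + real_complex R lam * (g i).@[z] = 0) -> zero g z).
Proof.
move=> st km.
have /choice[q hq] : forall i, exists q : {mpoly C[n]}, inid g q /\ ordge k.+1 ('X_i ^+ k - q).
  move=> i; have [|q h1 h2] := st ('X_i ^+ k); last by exists q.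
  by apply: ordgeX; apply: ordge1; rewrite mevalXU.
have /choice[a ha] : forall i, exists a : 'I_n -> {mpoly C[n]}, q i = \sum_j a j * g j by move=> i; exact: (hq i).1.
have /choice[B hB] : forall i, exists B : R, 0 <= B /\ forall z, n1 z <= 1 -> nc ('X_i ^+ k - q i).@[z] <= B * n1 z ^+ k.+1.
  by move=> i; have [B h1 h2] := ordge_growth 1 (hq i).2; exists B.
have [A A0 hA] := mpoly_bounded_all 1 (fun ij : 'I_n * 'I_n => a ij.1 ij.2).
pose W := n%:R ^+ k * (n%:R * A + \sum_i B i).
have SB0 : 0 <= \sum_i B i by apply: sumr_ge0 => i _; exact: (hB i).1.
have W0 : 0 <= W by rewrite mulr_ge0 ?exprn_ge0 ?ler0n // addr_ge0 // mulr_ge0 ?ler0n.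
exists 1; exists (W + 1)^-1; first by rewrite invr_gt0 ltr_wpDl.
move=> z; rewrite n1_sub0 => hz lam l1 _ hz0.
have lam0 : 0 < lam by apply: lt_trans l1; exact: ltr01.
have z1 : n1 z <= 1 by apply: ltW; apply: lt_le_trans hz _; rewrite invf_le1 ?ltr_wpDl // lerDr.
have [z0|zpos] : n1 z = 0 \/ 0 < n1 z.
  by have := n1_ge0 z; rewrite le_eqVlt => /orP[/eqP<-|]; [left|right].
  have -> : z = fun=> 0 by apply: n1_eq0; rewrite n1_sub0.
  exact: g0.
have [i hi] := n1_le_max zpos; exfalso.
have gj j : nc (g j).@[z] <= n1 z ^+ k.+1.
  have e : nc (real_complex R lam * (g j).@[z]) = nc (z j) ^+ m.
    by have /eqP := hz0 j; rewrite addrC addr_eq0 => /eqP->; rewrite ncN rmorphXn /= mevalXU ncX.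
  rewrite ncM nc_real ger0_norm ?(ltW lam0) // in e.
  apply: (@le_trans _ _ (lam * nc (g j).@[z])); first by rewrite ler_peMl ?nc_ge0 // ltW.
  rewrite e; apply: (@le_trans _ _ (n1 z ^+ m)); last by rewrite ler_wiXn2l ?n1_ge0.
  by apply: lerXn2r; rewrite ?nnegrE ?nc_ge0 ?n1_ge0 // le_n1.
have zi : nc (z i) ^+ k <= (n%:R * A + \sum_i B i) * n1 z ^+ k.+1.
  have -> : nc (z i) ^+ k = nc (('X_i ^+ k - q i).@[z] + (q i).@[z]).
    by rewrite mevalB subrK rmorphXn /= mevalXU ncX.
  apply: le_trans (ncD _ _) _; rewrite addrC mulrDl; apply: lerD.
    rewrite ha raddf_sum; apply: le_trans (nc_sum _ _ _) _.
    rewrite -mulrA mulr_natl -[X in _ *+ X]card_ord -sumr_const; apply: ler_sum => j _ /=.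
    by rewrite mevalM ncM ler_pM ?nc_ge0 // (hA (i, j)).
  apply: le_trans ((hB i).2 z z1) _; rewrite ler_wpM2r ?exprn_ge0 ?n1_ge0 //.
  by rewrite (bigD1 i) //= lerDl; apply: sumr_ge0 => j _; exact: (hB j).1.
have : n1 z ^+ k <= W * n1 z ^+ k.+1.
  apply: (@le_trans _ _ ((n%:R * nc (z i)) ^+ k)).
    by apply: lerXn2r; rewrite ?nnegrE ?mulr_ge0 ?nc_ge0 ?n1_ge0 ?ler0n.
  by rewrite exprMn /W -mulrA ler_wpM2l ?exprn_ge0 ?ler0n.
rewrite exprS mulrA -{1}[n1 z ^+ k]mul1r ler_pM2r ?exprn_gt0 //.
move: hz; rewrite -[_^-1]mul1r ltr_pdivlMr ?ltr_wpDl // mulrDr mulr1 mulrC; lra.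
Qed.

Hypothesis n0 : (0 < n)%N.
Variables (g' : 'I_n -> {mpoly C[n]}) (rho kap : R).
Hypotheses (rho0 : 0 < rho) (kap0 : 0 < kap).
Hypothesis gu : forall z, n1 z < rho -> zero g z -> z = fun=> 0.
Hypothesis hsh : forall z, n1 z = rho -> exists i, kap <= nc (g i).@[z].
Hypothesis hcl : forall z, n1 z = rho -> forall i, nc ((g' i).@[z] - (g i).@[z]) <= kap / 2.
Hypothesis gnd : forall z, n1 z < rho -> zero g' z -> nondeg g' z.

(** The multiplicity of the origin is at most the number of zeros in the ball, with equality if the
    origin is the only one; [multiplicity] expresses it through the Pham ideal and the lemmas above
    pass from there to [g]. *)
Lemma pham_multiplicity k s m' (lam : R) xi : (k <= m'.+1)%N -> 0 < lam ->
  (forall i, (msize (real_complex R lam *: g i) <= m'.+1)%N) ->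
  @zlist R n m' (fun i => real_complex R lam *: g i) xi -> cnt (fun z => n1 z < rho) xi = s ->
  (forall r, indep (idord g k) r -> (r <= s)%N) /\
  ((forall l, n1 (xi l) < rho -> xi l = (fun=> 0)) -> (k < m'.+1)%N -> stable g k -> indep (idord g k) s).
Proof.
move=> km l0 hG [tr hz _ nil] hs.
have lc : real_complex R lam != 0 by rewrite fmorph_eq0 gt_eqF.
(* This order is large enough for [multiplicity] and at least [k], as the comparison with [g] modulo
   order [k] requires. *)
have [||i1 i2] := multiplicity hG (K := (n * #|{: {ffun 'I_n -> 'I_m'.+1}}| + k.+1)%N) n0 tr nil.
- exact: leq_addr.
- by rewrite addnS.
split=> [r hr|h1 h2 st].
  apply: (@leq_trans (cnt (fun z => z = fun=> 0) xi)); last first.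
    rewrite -hs; apply: subset_leq_card; apply/fintype.subsetP => l; rewrite !inE => /asboolP->.
    by apply/asboolP; rewrite /n1 big1 // => i _; rewrite nc0.
  apply: i2; apply: indep_sub hr => p; apply: idord_pham_down => //.
  by apply: leq_trans (leqnSn k) (leq_addl _ _).
have <- : cnt (fun z => z = fun=> 0) xi = s.
  rewrite -hs; apply: eq_card => l; rewrite !inE; apply/asboolP/asboolP => [->|/h1 //].
  by rewrite /n1 big1 // => i _; rewrite nc0.
apply: indep_sub i1 => p; exact: idord_pham_stable.
Qed.

(** The last two clauses mention only [g]. They determine [s] as soon as some [k] is stable, so all
    admissible perturbations have the same number of zeros. *)
Theorem zero_count : exists (s : nat) (e : 'I_s -> 'I_n -> C), [/\ injective e,
  forall z, (n1 z < rho /\ zero g' z) <-> exists k, z = e k,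
  forall k r, indep (idord g k) r -> (r <= s)%N &
  forall k, stable g k -> indep (idord g k) s].
Proof.
have [s [e [inj he hc]]] := pham_count rho0 kap0 hsh hcl gnd.
(* The exponent [(m0 k).+1] exceeds the degrees of [g] and [g'], the number [2 * s] needed for
   double vanishing, and [k]. *)
pose m0 k := ((\max_i msize (g i)) + (\max_i msize (g' i)) + 2 * s + k)%N.
have [b1 [b2 [b3 b4]]] : (forall k i, msize (g i) <= (m0 k).+1)%N /\ (forall k i, msize (g' i) <= (m0 k).+1)%N /\
    (forall k, 2 * s <= (m0 k).+1)%N /\ (forall k, k < (m0 k).+1)%N.
  have u1 i := leq_bigmax (F := fun i => msize (g i)) i; have u2 i := leq_bigmax (F := fun i => msize (g' i)) i.
  rewrite /m0; split=> [k i|]; first by have := u1 i; lia.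
  by split=> [k i|]; [have := u2 i; lia|split=> k; lia].
have hG k lam i : (msize (lam *: g i) <= (m0 k).+1)%N by apply: leq_trans (msizeZ_le _ _) (b1 k i).
exists s, e; split=> // k.
  have [L hL] := hc (m0 k) (b1 k) (b2 k) (b3 k).
  pose lam := Num.max L 0 + 1.
  have l1 : L < lam by rewrite ltr_pwDr // le_max lexx.
  have l2 : 0 < lam by rewrite ltr_pwDr // le_max lexx orbT.
  have [xi [a1 a2 a3 a4]] := zero_list (hG k (real_complex R lam)).
  have hxi : @zlist R n (m0 k) (fun i => real_complex R lam *: g i) xi by [].
  exact: (pham_multiplicity (ltnW (b4 k)) l2 (hG k _) hxi (hL _ l1 l2 _ hxi)).1.
move=> st; have [L hL] := hc (m0 k) (b1 k) (b2 k) (b3 k).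
have gsh z : n1 z = rho -> exists i, (g i).@[z] != 0.
  move=> hz; have [i hi] := hsh hz; exists i; apply: contraTneq hi => ->.
  by rewrite nc0 -ltNge.
have [|L2 hL2] := @no_other_zeros R n g rho rho0 gsh (fun i => 'X_i ^+ (m0 k).+1).
  move=> y h1 /(gu h1) ->; exact: no_small_zeros st (b4 k).
pose lam := Num.max (Num.max L L2) 0 + 1.
have l1 : L < lam by rewrite ltr_pwDr // !le_max lexx.
have l3 : L2 < lam by rewrite ltr_pwDr // !le_max lexx orbT.
have l2 : 0 < lam by rewrite ltr_pwDr // !le_max lexx !orbT.
have [xi [a1 a2 a3 a4]] := zero_list (hG k (real_complex R lam)).
have hxi : @zlist R n (m0 k) (fun i => real_complex R lam *: g i) xi by [].
have [_] := pham_multiplicity (ltnW (b4 k)) l2 (hG k _) hxi (hL _ l1 l2 _ hxi).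
apply=> // l hl; apply: gu => //; apply: (hL2 lam l3 _ (ltW hl)) => i.
by rewrite -(a2 l i) /H mevalD mevalZ.
Qed.
End ZeroCount.

(** * The local algebra *)

Section Growth.
Variables (R : realType) (n : nat).
Local Notation C := (R[i]).

Lemma hat_mpoly (p : {mpoly C[n]}) z : hat (fun x => p.@[x]) z (fun i => p^`M(i).@[z]).
Proof.
move: p; apply: mpoly_gen_ind => [c|j|p q hp hq|p q hp hq].
- have := hat_const c z; congr hat; apply: funext => x; first by rewrite mevalC.
  by rewrite mderivC meval0.
- have := hat_coord j z; congr hat; apply: funext => x; first by rewrite mevalXU.
  rewrite mderivX mnm1E eq_sym mevalZ; case: eqP => [->|_]; last by rewrite mul0r.
  by rewrite mul1r (_ : (_ - _)%MM = 0%MM) ?mpolyX0 ?meval1 //; apply/mnmP => k; rewrite mnmBE subnn mnm0E.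
- have := hat_add hp hq; congr hat; apply: funext => x; first by rewrite mevalD.
  by rewrite mderivD mevalD.
- have := hat_mul hp hq; congr hat; apply: funext => x; first by rewrite mevalM.
  by rewrite mderivM mevalD !mevalM mulrC.
Qed.

Lemma hnear_mpoly (p : {mpoly C[n]}) z : hnear (fun x => p.@[x]) z.
Proof. by apply: near_true => x; eexists; exact: hat_mpoly. Qed.

Lemma deriv_bound (I : finType) (h : (I -> C) -> C) p (r B : R) L i : 0 < r -> 0 <= B ->
  (forall z, n1 (vsub z p) < r -> (exists L, hat h z L) /\ nc (h z) <= B) ->
  hat h p L -> nc (L i) <= 192 * B / r.
Proof.
move=> r0 B0 hB hL; apply/ler_addgt0Pr => e e0; have [d d0 hd] := hL e e0.
have [t t0 [td tr]] : exists2 t : R, 0 < t & t < d /\ t <= r / 96.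
  exists (Num.min (d / 2) (r / 96)); first by rewrite lt_min !divr_gt0.
  by rewrite gt_min ge_min lexx orbT; split=> //; apply/orP; left; lra.
pose y k := p k + (if k == i then real_complex R t else 0).
have ny : n1 (vsub y p) = t.
  rewrite /n1 (bigD1 i) //= big1 => [|k /negPf hk]; rewrite /vsub /y.
    by rewrite eqxx addr0 addrC addKr nc_real gtr0_norm.
  by rewrite hk addr0 subrr nc0.
have sy : \sum_k L k * (y k - p k) = L i * real_complex R t.
  rewrite (bigD1 i) //= big1 => [|k /negPf hk]; rewrite /y.
    by rewrite eqxx addr0 addrC addKr.
  by rewrite hk addr0 subrr mulr0.
have k1 := hd y; rewrite ny sy in k1; have {}k1 := k1 td.
have k2 := holo_est1 r0 hB (x := y); rewrite ny in k2; have {}k2 := k2 tr.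
rewrite -(ler_pM2r t0) mulrDl.
have -> : nc (L i) * t = nc (L i * real_complex R t) by rewrite ncM nc_real gtr0_norm.
have -> : L i * real_complex R t = (h y - h p) - (h y - h p - L i * real_complex R t) by ring.
by apply: le_trans (ncB _ _) _; exact: lerD.
Qed.

Definition growth k (f : ('I_n -> C) -> C) := exists2 B : R, 0 <= B &
  near (fun=> 0) (fun z => nc (f z) <= B * n1 z ^+ k).

(** Cauchy's estimate on the ball of radius [n1 z] around [z]. At the origin the radius is free, and
    the bound is obtained by letting it shrink. *)
Lemma growth_deriv k (p : {mpoly C[n]}) i : growth k.+1 (fun z => p.@[z]) -> growth k (fun z => p^`M(i).@[z]).
Proof.
move=> [B B0 [r r0 hr]].
have key z (s : R) : 0 < s -> n1 z + s < r -> nc p^`M(i).@[z] <= 192 * (B * (n1 z + s) ^+ k.+1) / s.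
  move=> s0 hs; apply: (@deriv_bound _ _ z s _ (fun i => p^`M(i).@[z]) i s0 _ _ (hat_mpoly p z)).
    by rewrite mulr_ge0 // exprn_ge0 // addr_ge0 ?n1_ge0 // ltW.
  move=> x hx; split; first by eexists; exact: hat_mpoly.
  have nx : n1 x <= n1 z + s by have := n1_tri z x (fun=> 0); rewrite !n1_sub0; lra.
  apply: (@le_trans _ _ (B * n1 x ^+ k.+1)); first by apply: hr; rewrite n1_sub0; lra.
  by rewrite ler_wpM2l //; apply: lerXn2r; rewrite ?nnegrE ?n1_ge0 // addr_ge0 ?n1_ge0 // ltW.
exists (192 * B * 2 ^+ k.+1); first by rewrite !mulr_ge0 ?exprn_ge0.
exists (r / 2); first by rewrite divr_gt0.
move=> z; rewrite n1_sub0 => hz.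
have [z0|zpos] : n1 z = 0 \/ 0 < n1 z.
  by have := n1_ge0 z; rewrite le_eqVlt => /orP[/eqP<-|]; [left|right].
  rewrite z0; have [s s0 hs] : exists2 s : R, 0 < s & s < r by exists (r / 2); lra.
  have key0 (t : R) : 0 < t -> t < r -> nc p^`M(i).@[z] <= 192 * B * t ^+ k.
    by move=> t0 ht; have := key z t t0; rewrite z0 add0r exprS => /(_ ht) h; rewrite mulrA mulrA mulrAC mulfK ?gt_eqF // in h.
  case: (k) key0 => [|k'] key0.
    rewrite expr0 mulr1; have := key0 s s0 hs; rewrite expr0 mulr1 => /le_trans; apply.
    by rewrite ler_peMr ?mulr_ge0 // expr1 ler1n.
  rewrite expr0n mulr0; apply/ler_addgt0Pr => e e0; rewrite add0r.
  pose t := Num.min (r / 2) (Num.min 1 (e / (192 * B + 1))).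
  have c0 : 0 < 192 * B + 1 by rewrite ltr_wpDl // mulr_ge0.
  have t0 : 0 < t by rewrite !lt_min ltr01 !divr_gt0.
  have [t1 t2 t3] : [/\ t <= r / 2, t <= 1 & t <= e / (192 * B + 1)] by split; rewrite !ge_min lexx ?orbT.
  have tr : t < r by apply: le_lt_trans t1 _; lra.
  apply: le_trans (key0 t t0 tr) _.
  apply: (@le_trans _ _ ((192 * B + 1) * t)); last by rewrite mulrC -ler_pdivlMr.
  apply: ler_pM; rewrite ?mulr_ge0 ?exprn_ge0 ?(ltW t0) //; first by rewrite lerDl.
  by rewrite exprS ler_piMr ?(ltW t0) // exprn_ile1 // ltW.
have := key z (n1 z) zpos; have -> : n1 z + n1 z = 2 * n1 z by rewrite mulr2n mulrDl mul1r.
move=> h; have {}h := h ltac:(lra); apply: le_trans h _; rewrite exprMn.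
rewrite [n1 z ^+ k.+1]exprSr !mulrA mulfK ?gt_eqF //.
Qed.

(** This converts analytic smallness back into algebra: differentiation lowers both the growth and
    the exponents by one, until the constant term is reached. *)
Lemma growth_ordge k (p : {mpoly C[n]}) : growth k (fun z => p.@[z]) -> ordge k p.
Proof.
elim: k p => [|k IH] p hp; first exact: ordge0.
have p0 : p.@[fun=> 0] = 0.
  have [B B0 [r r0 hr]] := hp; apply: nc_eq0; apply/eqP; rewrite eq_le nc_ge0 andbT.
  have z0 : n1 (fun _ : 'I_n => 0 : C) = 0 by rewrite /n1 big1 // => i _; rewrite nc0.
  have := hr (fun=> 0); rewrite n1_sub0 z0 => /(_ r0); by rewrite exprS mul0r mulr0.
move=> b hb; have [->|hb0] := eqVneq b 0%MM; first by rewrite -meval0E.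
have [i hi] : exists i, b i != 0%N.
  apply/existsP; apply: contraNT hb0; rewrite negb_exists => /forallP h.
  by apply/eqP/mnmP => i; have := h i; rewrite negbK mnm0E => /eqP.
have le : (U_(i) <= b)%MM by apply/mnm_lepP => j; rewrite mnm1E; case: eqP => // <-; rewrite lt0n.
have := IH _ (growth_deriv i hp) (b - U_(i))%MM.
have := mcoeff_mderiv i p (b - U_(i))%MM; rewrite submK // => -> h.
have /eqP : p@_b *+ ((b - U_(i))%MM i).+1 = 0.
  by apply: h; move: hb; rewrite -{1}(submK le) mdegD mdeg1 addn1.
by rewrite -mulr_natr mulf_eq0 pnatr_eq0 orbF => /eqP.
Qed.

Lemma mpoly_nonvanish (p : {mpoly C[n]}) : p != 0 -> exists v, p.@[v] != 0.
Proof.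
move=> p0; apply: contrapT => /forallNP h; move/eqP: p0; apply; apply/mpolyP => b; rewrite mcoeff0.
have hg : growth (mdeg b).+1 (fun z => p.@[z]).
  exists 0 => //; apply: near_true => z; rewrite mul0r.
  by have := h z => /negP; rewrite negbK => /eqP->; rewrite nc0.
exact: (growth_ordge hg).
Qed.
End Growth.

(** * Taylor expansion of germs and Nakayama's lemma *)

Section LocalAlgebra.
Variables (R : realType) (n : nat).
Local Notation C := (R[i]).
Local Notation fn := (('I_n -> C) -> C).
Local Notation o := (fun _ : 'I_n => 0 : C).

(** The coordinates are set to 0 one after the other, each time by the division lemma. *)
Lemma hadamard_germ (psi : fn) : hnear psi o -> exists k : 'I_n -> fn,
  (forall i, hnear (k i) o) /\ near o (fun z => psi z = psi o + \sum_i z i * k i z).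
Proof.
move=> hpsi.
pose zr (r : seq 'I_n) (z : 'I_n -> C) : 'I_n -> C := fun i => if i \in r then 0 else z i.
have K (r : seq 'I_n) : uniq r -> hnear (fun z => psi (zr r z)) o /\ exists k : 'I_n -> fn,
    (forall i, hnear (k i) o) /\ near o (fun z => psi z = psi (zr r z) + \sum_(i <- r) z i * k i z).
  elim: r => [|i r IH] /=.
    move=> _; have e z : zr [::] z = z by [].
    split=> //; exists (fun _ _ => 0); split=> [i|]; first exact: hnear_const.
    by apply: near_true => z; rewrite e big_nil addr0.
  move=> /andP[ir /IH[h1 [k [hk h2]]]].
  have [k0 hk0 nk0] := division i h1.
  have ze z : zr r (upd z i 0) = zr (i :: r) z.
    by apply: funext => j; rewrite /zr /upd inE; case: eqP => [->|] //=; case: ifP.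
  split.
    apply: (@hnear_ext R _ (fun z => psi (zr r z) - (z i - 0) * k0 z)).
      by apply: near_imp nk0 _ => z; rewrite ze => ->; rewrite addrK.
    by apply: hnear_sub => //; apply: hnear_mul => //; apply: hnear_sub; [exact: hnear_coord|exact: hnear_const].
  exists (fun j => if j == i then k0 else k j); split=> [j|]; first by case: ifP.
  apply: near_imp (near_and h2 nk0) _ => z [e1 e2].
  rewrite e1 e2 ze big_cons eqxx subr0 -addrA; congr (_ + (_ + _)).
  rewrite big_seq [RHS]big_seq; apply: eq_bigr => j hj; case: eqP => // ji.
  by rewrite -ji hj in ir.
have [_ [k [hk h]]] := K _ (enum_uniq 'I_n); exists k; split=> //.
apply: near_imp h _ => z e; rewrite {1}e; congr (psi _ + _).
  by apply: funext => i; rewrite /zr mem_enum.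
by rewrite big_enum.
Qed.

(* Finite Taylor expansion: modulo a class of functions that contains the multiples of all
   monomials of degree K, every germ is a polynomial. *)
Lemma taylor_ind K (S : fn -> Prop) :
  (forall f h, S f -> S h -> S (fun z => f z + h z)) ->
  (forall f h, near o (fun z => f z = h z) -> S f -> S h) -> S (fun=> 0) ->
  (forall (b : 'X_{1..n}) psi, mdeg b = K -> hnear psi o -> S (fun z => ('X_[b] : {mpoly C[n]}).@[z] * psi z)) ->
  forall psi, hnear psi o -> exists p : {mpoly C[n]}, S (fun z => psi z - p.@[z]).
Proof.
move=> SD Sext S0 SK.
have key s : (s <= K)%N -> forall (b : 'X_{1..n}) psi, (mdeg b + s)%N = K -> hnear psi o ->
    exists p : {mpoly C[n]}, S (fun z => ('X_[b] : {mpoly C[n]}).@[z] * psi z - p.@[z]).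
  elim: s => [|s IH] sK b psi hb hpsi.
    exists 0; apply: Sext (SK b psi _ hpsi); last by rewrite -hb addn0.
    by apply: near_true => z; rewrite meval0 subr0.
  have [k [hk hn]] := hadamard_germ hpsi.
  have /choice[p hp] : forall i, exists p : {mpoly C[n]},
      S (fun z => ('X_[(b + U_(i))] : {mpoly C[n]}).@[z] * k i z - p.@[z]).
    by move=> i; apply: (IH (ltnW sK)) => //; rewrite mdegD mdeg1 addn1 addSnnS.
  exists (psi o *: 'X_[b] + \sum_i p i).
  apply: (@Sext (fun z => \sum_i (('X_[(b + U_(i))] : {mpoly C[n]}).@[z] * k i z - (p i).@[z]))).
    apply: near_imp hn _ => z e; rewrite e mevalD mevalZ.
    have -> : (\sum_i p i).@[z] = \sum_i (p i).@[z] by rewrite raddf_sum.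
    rewrite sumrB.
    have -> : \sum_i ('X_[(b + U_(i))] : {mpoly C[n]}).@[z] * k i z =
        ('X_[b] : {mpoly C[n]}).@[z] * \sum_i z i * k i z.
      by rewrite mulr_sumr; apply: eq_bigr => i _; rewrite mpolyXD mevalM mevalXU mulrA.
    by ring.
  elim: (index_enum _) => [|i r IHr].
    by apply: Sext S0; apply: near_true => z; rewrite big_nil.
  by apply: Sext (SD _ _ (hp i) IHr); apply: near_true => z; rewrite big_cons.
move=> psi hpsi; have [|p hp] := key K (leqnn K) 0%MM psi _ hpsi; first by rewrite mdeg0.
by exists p; apply: Sext hp; apply: near_true => z; rewrite mpolyX0 meval1 mul1r.
Qed.

Lemma taylor_growth K psi : hnear psi o -> exists p : {mpoly C[n]}, growth K (fun z => psi z - p.@[z]).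
Proof.
apply: (@taylor_ind K (growth K)) => [f h [A A0 hA] [B B0 hB]|f h e [A A0 hA]||b phi db hphi].
- exists (A + B); first exact: addr_ge0.
  apply: near_imp (near_and hA hB) _ => z [h1 h2]; rewrite mulrDl.
  by apply: le_trans (ncD _ _) _; exact: lerD.
- by exists A => //; apply: near_imp (near_and e hA) _ => z [<-].
- by exists 0 => //; apply: near_true => z; rewrite nc0 mul0r.
have [r [B [r0 B0 hB]]] := holo_bnd hphi; exists B => //.
exists r => // z /hB[_ hz]; rewrite ncM mulrC -db.
by apply: ler_pM => //; rewrite ?nc_ge0 // meval_monomial_le.
Qed.

Variables (m : nat) (g : 'I_m -> {mpoly C[n]}).

Definition anid (phi : fn) := exists u : 'I_m -> fn, (forall j, hnear (u j) o) /\
  near o (fun z => phi z = \sum_j u j z * (g j).@[z]).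

Lemma anid_ext f h : near o (fun z => f z = h z) -> anid f -> anid h.
Proof. by move=> e [u [hu k]]; exists u; split=> //; apply: near_imp (near_and e k) _ => z [<-]. Qed.

Lemma anidD f h : anid f -> anid h -> anid (fun z => f z + h z).
Proof.
move=> [u [hu ku]] [v [hv kv]]; exists (fun j z => u j z + v j z); split=> [j|]; first exact: hnear_add.
apply: near_imp (near_and ku kv) _ => z [-> ->]; rewrite -big_split; apply: eq_bigr => j _.
by rewrite mulrDl.
Qed.

Lemma anidM f h : hnear f o -> anid h -> anid (fun z => f z * h z).
Proof.
move=> hf [u [hu ku]]; exists (fun j z => f z * u j z); split=> [j|]; first exact: hnear_mul.
by apply: near_imp ku _ => z ->; rewrite mulr_sumr; apply: eq_bigr => j _; rewrite mulrA.
Qed.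

Lemma anid_inid p : inid g p -> anid (fun z => p.@[z]).
Proof.
move=> [q ->]; exists (fun j z => (q j).@[z]); split=> [j|]; first exact: hnear_mpoly.
by apply: near_true => z; rewrite raddf_sum; apply: eq_bigr => j _; rewrite /= mevalM.
Qed.

Lemma anid0 : anid (fun=> 0).
Proof. by apply: anid_ext (anid_inid (inid0 g)); apply: near_true => z; rewrite meval0. Qed.

(** By stability the vector [y] of monomials of degree [K] satisfies [(1 - c) * y] in the ideal,
    with entries of [c] vanishing at the origin. The determinant of [1 - c] is 1 at the origin, so
    it can be divided out as a holomorphic germ. *)
Lemma nakayama K (b : 'X_{1..n < K.+1}) : stable g K -> anid (fun z => (ymon _ b).@[z]).
Proof.
move=> st; pose y (i : 'I_#|{: 'X_{1..n < K.+1}}|) : {mpoly C[n]} := ymon _ (enum_val i).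
have /choice[c hc] : forall i, exists c : 'X_{1..n < K.+1} -> {mpoly C[n]},
    (forall x, ordge 1 (c x)) /\ inid g (y i - \sum_x ymon _ x * c x).
  move=> i; have [q iq oq] := st _ (@ordge_ymon _ _ _ (enum_val i)).
  have oq' : ordge (K + 1) (y i - q) by rewrite addn1.
  have [c h1 h2] := ordge_ymon_split oq'.
  by exists c; split=> //; rewrite -h2 opprB addrC subrK.
pose T i j : {mpoly C[n]} := (i == j)%:R - c i (enum_val j).
have hT i : inid g (\sum_j T i j * y j).
  rewrite (_ : \sum_j _ = y i - \sum_x ymon _ x * c i x); first exact: (hc i).2.
  rewrite (eq_bigr (fun j => (i == j)%:R * y j - y j * c i (enum_val j))); last by move=> j _; rewrite /T; ring.
  rewrite sumrB (bigD1 i) //= eqxx mul1r big1 => [|j]; last by rewrite eq_sym => /negPf->; rewrite mul0r.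
  rewrite addr0; congr (_ - _); rewrite [LHS](reindex (@enum_rank 'X_{1..n < K.+1})) /=; last first.
    by exists enum_val => x _; rewrite ?enum_valK ?enum_rankK.
  by apply: eq_bigr => x _; rewrite /y enum_rankK.
have := anid_inid (adj_inid hT (enum_rank b)); set d := \det _ => hd.
have d0 : d.@[o] != 0.
  rewrite /d -det_map_mx (_ : map_mx _ _ = 1%:M) ?det1 ?oner_eq0 //.
  apply/matrixP => i j; rewrite !mxE /= /T mevalB (_ : (c i (enum_val j)).@[o] = 0) ?subr0.
    by case: eqP => _; rewrite ?meval1 ?meval0.
  by rewrite meval0E; apply: ((hc i).1 (enum_val j)); rewrite mdeg0.
have nd := ctsat_neq0 (mpoly_cts d o) d0.
have nd0 z : nc d.@[o] / 2 < nc d.@[z] -> d.@[z] != 0.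
  move=> h; apply: contraTneq h => ->; rewrite nc0 -leNgt divr_ge0 ?nc_ge0 //.
have hi : hnear (fun z => (d.@[z])^-1) o.
  apply: near_imp nd _ => z h; eexists; apply: hat_inv (hat_mpoly d z) _; exact: nd0.
apply: anid_ext (anidM hi hd); apply: near_imp nd _ => z h.
by rewrite mevalM /y enum_rankK mulKf // nd0.
Qed.

Lemma anid_ordge K p : stable g K -> ordge K p -> anid (fun z => p.@[z]).
Proof.
rewrite -[K in ordge K]addn0 => st /ordge_ymon_split[c _ ->].
elim: (index_enum _) => [|b r IH]; first by apply: anid_ext anid0; apply: near_true => z; rewrite big_nil meval0.
apply: anid_ext (anidD (anidM (hnear_mpoly (c b) o) (nakayama b st)) IH).
by apply: near_true => z; rewrite big_cons mevalD mevalM mulrC.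
Qed.

Lemma span_of_max K s (e : 'I_s -> {mpoly C[n]}) :
  (forall c : 'I_s -> C, idord g K (\sum_i c i *: e i) -> forall i, c i = 0) ->
  (forall r, indep (idord g K) r -> (r <= s)%N) ->
  forall p, exists c : 'I_s -> C, idord g K (p - \sum_i c i *: e i).
Proof.
move=> he hmax p; apply: contrapT => /forallNP hn.
suff : (s.+1 <= s)%N by rewrite ltnn.
apply: hmax; exists (fun i => if unlift ord0 i is Some j then e j else p) => c hc.
rewrite big_ord_recl unlift_none in hc.
have hc' : idord g K (c ord0 *: p + \sum_(i < s) c (lift ord0 i) *: e i).
  by move: hc; congr (idord g K (_ + _)); apply: eq_bigr => i _; rewrite liftK.
have c0 : c ord0 = 0.
  apply/eqP; apply: contrapT => /negP c0; apply: (hn (fun i => - (c ord0)^-1 * c (lift ord0 i))).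
  move: (idordZ (c ord0)^-1 hc'); rewrite scalerDr scalerA mulVf // scale1r scaler_sumr.
  congr idord; congr (_ + _); rewrite -sumrN; apply: eq_bigr => i _.
  by rewrite scalerA mulNr scaleNr opprK.
rewrite c0 scale0r add0r in hc'; move=> i; case: (unliftP ord0 i) => [j ->|-> //].
exact: (he (fun j => c (lift ord0 j)) hc').
Qed.

(** Polynomials that form a basis modulo order [K] also form one of the analytic quotient. They span
    because a germ is its Taylor polynomial up to elements of the ideal. They are independent
    because the coefficients of an analytic relation may be replaced by Taylor polynomials at the
    cost of a remainder of order [K]. *)
Theorem local_basis K s : stable g K -> indep (idord g K) s ->
  (forall r, indep (idord g K) r -> (r <= s)%N) -> exists e : 'I_s -> {mpoly C[n]},
  (forall phi, hnear phi o -> exists c : 'I_s -> C, anid (fun z => phi z - \sum_i c i * (e i).@[z])) /\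
  (forall c : 'I_s -> C, anid (fun z => \sum_i c i * (e i).@[z]) -> forall i, c i = 0).
Proof.
move=> st [e he] hmax.
have E c z : (\sum_i c i *: e i).@[z] = \sum_i c i * (e i).@[z].
  by rewrite raddf_sum; apply: eq_bigr => i _; rewrite /= mevalZ.
exists e; split=> [phi hphi|c [u [hu nu]]].
  have [|||b psi db hpsi|p hp] := @taylor_ind K anid _ _ _ _ phi hphi.
  - by move=> f h; exact: anidD.
  - exact: anid_ext.
  - exact: anid0.
  - have b1 : (mdeg b < K.+1)%N by rewrite db.
    apply: anid_ext (anidM hpsi (nakayama (BMultinom b1) st)).
    by apply: near_true => z; rewrite /ymon /= db eqxx mulrC.
  have [c [q iq oq]] := span_of_max he hmax p; exists c.
  apply: anid_ext (anidD hp (anidD (anid_inid iq) (anid_ordge st oq))).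
  by apply: near_true => z; rewrite !mevalB E; ring.
apply: he; have /choice[p hp] : forall j, exists p : {mpoly C[n]}, growth K (fun z => u j z - p.@[z]).
  by move=> j; exact: taylor_growth.
exists (\sum_j p j * g j); first by exists p.
apply: growth_ordge.
have /choice[B hB] : forall j, exists B : R, 0 <= B /\ near o (fun z => nc (u j z - (p j).@[z]) <= B * n1 z ^+ K).
  by move=> j; have [B B0 h] := hp j; exists B.
have [A A0 hA] := mpoly_bounded_all 1 g.
exists (\sum_j B j * A); first by apply: sumr_ge0 => j _; rewrite mulr_ge0 // (hB j).1.
apply: near_imp (near_and nu (near_and (near_all (fun j => (hB j).2)) (near_ball o ltr01))) _ => z [e1 [e2 e3]].
have E2 : (\sum_j p j * g j).@[z] = \sum_j (p j).@[z] * (g j).@[z].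
  by rewrite raddf_sum; apply: eq_bigr => j _; rewrite /= mevalM.
rewrite mevalB E E2 e1 -sumrB mulr_suml; apply: le_trans (nc_sum _ _ _) _; apply: ler_sum => j _.
rewrite -mulrBl ncM mulrAC; apply: ler_pM; rewrite ?nc_ge0 //.
by apply: hA; rewrite n1_sub0 in e3; exact: ltW.
Qed.
End LocalAlgebra.

(** * Thin sets of coefficients *)

Section Thin.
Variable R : realType.
Local Notation C := (R[i]).

Definition ev_fin (I : finType) (P : {mpoly C[#|I|]}) (c : I -> C) : C := P.@[fun k => c (enum_val k)].

Lemma ev_finM (I : finType) (P Q : {mpoly C[#|I|]}) (c : I -> C) : ev_fin (P * Q) c = ev_fin P c * ev_fin Q c.
Proof. exact: mevalM. Qed.
Lemma ev_finD (I : finType) (P Q : {mpoly C[#|I|]}) (c : I -> C) : ev_fin (P + Q) c = ev_fin P c + ev_fin Q c.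
Proof. exact: mevalD. Qed.

Definition thin (I : finType) (B : (I -> C) -> Prop) :=
  exists2 P : {mpoly C[#|I|]}, P != 0 & forall c, B c -> ev_fin P c = 0.

Lemma thin_sub (I : finType) (A B : (I -> C) -> Prop) : (forall c, A c -> B c) -> thin B -> thin A.
Proof. by move=> h [P P0 hP]; exists P => // c /h; exact: hP. Qed.

Lemma thin_or (I : finType) (A B : (I -> C) -> Prop) : thin A -> thin B -> thin (fun c => A c \/ B c).
Proof.
move=> [P P0 hP] [Q Q0 hQ]; exists (P * Q); first exact: mulf_neq0.
by move=> c [/hP|/hQ] h; rewrite ev_finM h ?mul0r ?mulr0.
Qed.

Lemma thin_bool (I : finType) (A : bool -> (I -> C) -> Prop) : (forall t, thin (A t)) -> thin (fun c => exists t, A t c).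
Proof. by move=> h; apply: thin_sub (thin_or (h true) (h false)) => c [[]]; [left|right]. Qed.

Lemma polyfun_mpoly (I : finType) (D : (I -> C) -> C) : polyfun D -> exists P, forall c, D c = ev_fin P c.
Proof.
elim=> [a|i|p q _ [P hP] _ [Q hQ]|p q _ [P hP] _ [Q hQ]].
- by exists a%:MP => c; rewrite /ev_fin mevalC.
- by exists 'X_(enum_rank i) => c; rewrite /ev_fin mevalXU enum_rankK.
- by exists (P + Q) => c; rewrite hP hQ /ev_fin mevalD.
- by exists (P * Q) => c; rewrite hP hQ /ev_fin mevalM.
Qed.

Lemma polyfun_ev_fin (I : finType) (P : {mpoly C[#|I|]}) : polyfun (ev_fin P).
Proof. exact: (polyfun_meval P (fun k => polyfun_coord _ (enum_val k))). Qed.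

Lemma ev_fin_nonvanish (I : finType) (P : {mpoly C[#|I|]}) : P != 0 -> exists c, ev_fin P c != 0.
Proof.
move=> /mpoly_nonvanish[v hv]; exists (fun i => v (enum_rank i)).
by rewrite /ev_fin (_ : (fun k => _) = v) //; apply: funext => k; rewrite enum_valK.
Qed.

Lemma complement_open (I : finType) (P : {mpoly C[#|I|]}) : zariski_open (fun c : I -> C => ev_fin P c <> 0).
Proof.
exists (fun D => D = ev_fin P); split=> [_ ->|z]; first exact: polyfun_ev_fin.
by split=> [h|[_ ->]//]; exists (ev_fin P).
Qed.

Lemma complement_dense (I : finType) (P : {mpoly C[#|I|]}) : P != 0 ->
  zariski_dense (fun c : I -> C => ev_fin P c <> 0).
Proof.
move=> P0 V [S [hS hV]] [z /hV[p Sp pz]]; have [Q hQ] := polyfun_mpoly (hS p Sp).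
have Q0 : Q != 0 by apply/eqP => e; apply: pz; rewrite hQ e /ev_fin meval0.
have [c hc] := ev_fin_nonvanish (mulf_neq0 P0 Q0).
rewrite ev_finM mulf_eq0 negb_or in hc; case/andP: hc => /eqP h1 /eqP h2.
by exists c; split=> //; apply/hV; exists p => //; rewrite hQ.
Qed.

Lemma complement_near (I : finType) (P : {mpoly C[#|I|]}) (c : I -> C) (r : R) : P != 0 -> 0 < r ->
  exists2 c', n1 (vsub c' c) < r & ev_fin P c' <> 0.
Proof.
move=> P0 r0; apply: contrapT => H0.
have hn z : n1 (vsub z c) < r -> ev_fin P z = 0.
  by move=> hz; apply: contrapT => h; apply: H0; exists z.
have [Q hQ] : exists Q : {mpoly C[#|I|]}, forall v, Q.@[v] = P.@[fun k => c (enum_val k) + v k].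
  exists (P \mPo [tuple (c (enum_val k))%:MP + 'X_k | k < #|I|]) => v.
  rewrite comp_mpoly_meval; apply: meval_eq => k.
  by rewrite tnth_mktuple mevalD mevalC mevalXU.
have Q0 : Q != 0.
  have [v hv] := ev_fin_nonvanish P0; apply: contraNneq hv => e.
  have := hQ (fun k => v (enum_val k) - c (enum_val k)); rewrite e meval0 => ->.
  by apply/eqP; rewrite /ev_fin; apply: meval_eq => k; rewrite subrKC.
move/eqP: Q0; apply; apply/mpolyP => b; rewrite mcoeff0.
have hg : growth (mdeg b).+1 (fun z => Q.@[z]); last exact: (growth_ordge hg).
exists 0 => //; exists r => // z; rewrite n1_sub0 mul0r hQ => hz.
have := hn (fun i => c i + z (enum_rank i)); rewrite /ev_fin => h.
rewrite (_ : P.@[_] = 0) ?nc0 // -h; first by apply: meval_eq => k; rewrite enum_valK.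
apply: le_lt_trans hz; rewrite /n1 (reindex (@enum_rank I)) /=; last first.
  by exists enum_val => x _; rewrite ?enum_valK ?enum_rankK.
by apply: ler_sum => i _; rewrite /vsub addrC addKr.
Qed.

Section Gen.
Variables (S : Type) (T : finType) (b : T -> S -> C).

(** The functions on [S] that are rational in the parameters [b]. Inversion is restricted to
    functions without zeros on [S], so denominators never vanish. *)
Inductive gen : (S -> C) -> Prop :=
  | gen_const a : gen (fun=> a)
  | gen_base t : gen (b t)
  | gen_add f g : gen f -> gen g -> gen (fun s => f s + g s)
  | gen_mul f g : gen f -> gen g -> gen (fun s => f s * g s)
  | gen_inv f : gen f -> (forall s, f s != 0) -> gen (fun s => (f s)^-1).

Lemma gen_ext f g : (forall s, f s = g s) -> gen f -> gen g.
Proof. by move=> /funext->. Qed.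
Lemma gen_opp f : gen f -> gen (fun s => - f s).
Proof.
by move=> h; apply: gen_ext (gen_mul (gen_const (-1)) h) => s; rewrite mulN1r.
Qed.
Lemma gen_sub f g : gen f -> gen g -> gen (fun s => f s - g s).
Proof. by move=> hf hg; apply: gen_add => //; exact: gen_opp. Qed.
Lemma gen_sum (J : Type) (r : seq J) (Q : pred J) (F : J -> S -> C) :
  (forall j, Q j -> gen (F j)) -> gen (fun s => \sum_(j <- r | Q j) F j s).
Proof.
move=> h; elim: r => [|j r IH].
  by apply: gen_ext (gen_const 0) => s; rewrite big_nil.
case Qj: (Q j); last by apply: gen_ext IH => s; rewrite big_cons Qj.
by apply: gen_ext (gen_add (h j Qj) IH) => s; rewrite big_cons Qj.
Qed.
Lemma gen_exp f k : gen f -> gen (fun s => f s ^+ k).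
Proof.
move=> hf; elim: k => [|k IH]; first by apply: gen_ext (gen_const 1) => s; rewrite expr0.
by apply: gen_ext (gen_mul hf IH) => s; rewrite exprS.
Qed.
Lemma gen_solve (J : finType) (f : J -> S -> C) (l : J -> C) (v : S -> C) j0 :
  (forall s, \sum_j f j s * l j = v s) -> gen v -> l j0 != 0 ->
  (forall j, j != j0 -> l j != 0 -> gen (f j)) -> gen (f j0).
Proof.
move=> e hv l0 h.
apply: (@gen_ext (fun s => (v s - \sum_(j | (j != j0) && (l j != 0)) f j s * l j) * (l j0)^-1)).
  move=> s; have -> : \sum_(j | (j != j0) && (l j != 0)) f j s * l j = \sum_(j | j != j0) f j s * l j.
    by rewrite big_mkcondr; apply: eq_bigr => j _; case: eqP => // ->; rewrite mulr0.
  by rewrite -e (bigD1 j0) //= addrK mulfK.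
apply: gen_mul; last exact: gen_const.
apply: gen_sub => //; apply: gen_sum => j /andP[h1 h2]; apply: gen_mul; last exact: gen_const.
exact: h.
Qed.

Lemma gen_frac f : gen f -> exists P Q : {mpoly C[#|T|]},
  forall s, ev_fin Q (b^~ s) != 0 /\ f s * ev_fin Q (b^~ s) = ev_fin P (b^~ s).
Proof.
elim=> [a|t|f1 f2 _ [P [Q h]] _ [P' [Q' h']]|f1 f2 _ [P [Q h]] _ [P' [Q' h']]|f1 _ [P [Q h]] h0].
- by exists a%:MP, 1 => s; rewrite /ev_fin meval1 mevalC mulr1 oner_eq0.
- by exists 'X_(enum_rank t), 1 => s; rewrite /ev_fin meval1 mevalXU enum_rankK mulr1 oner_eq0.
- exists (P * Q' + P' * Q), (Q * Q') => s; have [a1 a2] := h s; have [b1 b2] := h' s.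
  rewrite ev_finD !ev_finM; split; first exact: mulf_neq0.
  by rewrite -a2 -b2; ring.
- exists (P * P'), (Q * Q') => s; have [a1 a2] := h s; have [b1 b2] := h' s.
  rewrite !ev_finM; split; first exact: mulf_neq0.
  by rewrite -a2 -b2; ring.
- exists Q, P => s; have [a1 a2] := h s; rewrite -a2; split; first exact: mulf_neq0.
  by rewrite mulKf.
Qed.
End Gen.

Lemma card_multinom_le n M : (#|{: 'X_{1..n < M}}| <= M ^ n)%N.
Proof.
case: M => [|M].
  rewrite (_ : #|{: 'X_{1..n < 0}}| = 0%N) //; apply: eq_card0 => b.
  by have := bmdeg b; rewrite ltn0.
have -> : (M.+1 ^ n)%N = #|{: {ffun 'I_n -> 'I_M.+1}}| by rewrite card_ffun !card_ord.
apply: (@leq_card _ _ (fun b : 'X_{1..n < M.+1} => [ffun i => inord (b i)] : {ffun 'I_n -> 'I_M.+1})) => b c e.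
have le (x : 'X_{1..n < M.+1}) i : (x i < M.+1)%N.
  by apply: leq_ltn_trans (bmdeg x); rewrite mdegE (bigD1 i) //= leq_addr.
apply: val_inj; apply/mnmP => i; move/ffunP: e => /(_ i); rewrite !ffunE => /(congr1 (@nat_of_ord _)).
by rewrite !inordK.
Qed.

(* Clearing denominators, the L^#|I| monomials of degree < L in each phi i become polynomials of
   degree at most #|I| L D in #|T| < #|I| variables, so they are linearly dependent for large L. *)
Lemma thin_gen (S : Type) (T I : finType) (b : T -> S -> C) (phi : I -> S -> C) :
  (#|T| < #|I|)%N -> (forall i, gen b (phi i)) -> thin (fun c => exists s, c = phi^~ s).
Proof.
move=> TI hphi; have /choice[PQ hPQ] : forall i, exists PQ : {mpoly C[#|T|]} * {mpoly C[#|T|]},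
    forall s, ev_fin PQ.2 (b^~ s) != 0 /\ phi i s * ev_fin PQ.2 (b^~ s) = ev_fin PQ.1 (b^~ s).
  by move=> i; have [P [Q h]] := gen_frac (hphi i); exists (P, Q).
pose P i := (PQ i).1; pose Q i := (PQ i).2.
pose D := (\max_i (msize (P i) + msize (Q i)))%N.
have hD i : (msize (P i) <= D.+1)%N /\ (msize (Q i) <= D.+1)%N.
  have := leq_bigmax (F := fun i => (msize (P i) + msize (Q i))%N) i; rewrite -/D; lia.
(* With [n < N] this choice of [L] gives [(L * (N * D + 1))^n < L^(n + 1) <= L^N]: there are more
   products [Fb] than coefficients available to distinguish them. *)
pose N := #|I|; pose n := #|T|; pose L := ((N * D + 1) ^ n).+1.
pose Fb (be : {ffun I -> 'I_L}) := \prod_i (P i ^+ be i * Q i ^+ (L - be i)).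
have sz_exp (A : {mpoly C[#|T|]}) k : (msize A <= D.+1)%N -> (msize (A ^+ k) <= (k * D).+1)%N.
  move=> hA; elim: k => [|k IH]; first by rewrite expr0 msize1.
  by rewrite exprS; apply: leq_trans (msizeM_le1 hA IH) _; rewrite mulSn; lia.
have szF be : (msize (Fb be) <= N * (L * D) + 1)%N.
  have K (r : seq I) : (msize (\prod_(i <- r) (P i ^+ be i * Q i ^+ (L - be i))) <= size r * (L * D) + 1)%N; last first.
    by have := K (enum I); rewrite big_enum -cardT.
  elim: r => [|i r IH]; first by rewrite big_nil msize1.
  rewrite big_cons; have [h1 h2] := hD i.
  have hi : (msize (P i ^+ be i * Q i ^+ (L - be i)) <= (L * D).+1)%N.
    apply: leq_trans (msizeM_le1 (sz_exp _ (be i) h1) (sz_exp _ (L - be i)%N h2)) _.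
    by rewrite addnS addSn /= -mulnDl subnKC // ltnW.
  by apply: leq_trans (msizeM_le1 hi IH) _; rewrite /= mulSn; lia.
pose M := (N * (L * D) + 1)%N.
pose A := \matrix_(r < #|{: {ffun I -> 'I_L}}|, j < #|{: 'X_{1..n < M}}|) (Fb (enum_val r))@_(enum_val j : 'X_{1..n < M}).
have cnt : (#|{: 'X_{1..n < M}}| < #|{: {ffun I -> 'I_L}}|)%N.
  apply: leq_ltn_trans (card_multinom_le _ _) _; rewrite card_ffun card_ord -/N.
  apply: (@leq_ltn_trans ((L * (N * D + 1)) ^ n)%N).
    have le1 : (M <= L * (N * D + 1))%N by rewrite /M mulnDr muln1 (mulnCA L) leq_add2l.
    by case: (n) => [|n1]; rewrite ?expn0 ?leq_exp2r.
  rewrite expnMn; apply: (@leq_trans (L ^ n.+1)%N).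
    by rewrite expnSr ltn_pmul2l // expn_gt0.
  by rewrite leq_pexp2l.
have : kermx A != 0.
  rewrite kermx_eq0 /row_free; apply: contraTneq cnt => <-.
  by rewrite -leqNgt; exact: rank_leq_col.
move=> /rowV0Pn[v /sub_kermxP vA v0].
pose w (be : {ffun I -> 'I_L}) := v 0 (enum_rank be).
have rel : \sum_be w be *: Fb be = 0.
  apply/mpolyP => m; rewrite mcoeff0 raddf_sum /=.
  under eq_bigr do rewrite mcoeffZ.
  case: (ltnP (mdeg m) M) => hm; last first.
    apply: big1 => be _; rewrite [X in _ * X]memN_msupp_eq0 ?mulr0 //.
    by apply: msize_mdeg_ge; exact: leq_trans (szF be) hm.
  have := congr1 (fun B : 'rV_ _ => B 0 (enum_rank (BMultinom hm))) vA; rewrite /= [in RHS]mxE mxE => e.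
  apply: etrans e; rewrite [RHS](reindex (@enum_rank {ffun I -> 'I_L})) /=; last first.
    by exists enum_val => x _; rewrite ?enum_valK ?enum_rankK.
  by apply: eq_bigr => be _; rewrite mxE !enum_rankK.
pose mb (be : {ffun I -> 'I_L}) := [multinom (be (enum_val k) : nat) | k < #|I|].
have mb_inj be ga : mb be = mb ga -> be = ga.
  move=> e; apply/ffunP => i; apply: val_inj; have := congr1 (fun m : 'X_{1..#|I|} => m (enum_rank i)) e.
  by rewrite !mnmE enum_rankK.
exists (\sum_be w be *: 'X_[mb be]).
  have [r hr] : exists r, v 0 r != 0 by apply/rV0Pn.
  apply/eqP => /(congr1 (mcoeff (mb (enum_val r)))); rewrite mcoeff0 raddf_sum /= (bigD1 (enum_val r)) //=.
  rewrite mcoeffZ mcoeffX eqxx mulr1 big1 ?addr0 => [e|be ne].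
    by rewrite /w enum_valK in e; rewrite e eqxx in hr.
  rewrite mcoeffZ mcoeffX; case: eqP => [/mb_inj e|_]; last by rewrite mulr0.
  by rewrite e eqxx in ne.
move=> c [s ->]; have Qs i := (hPQ i s).1; have Ps i := (hPQ i s).2.
pose QQ := \prod_i ev_fin (Q i) (b^~ s) ^+ L.
have QQ0 : QQ != 0 by apply/prodf_neq0 => i _; rewrite expf_neq0 // Qs.
apply: (mulIf QQ0); rewrite mul0r.
have := congr1 (fun p => p.@[fun k => b (enum_val k) s]) rel; rewrite meval0 raddf_sum /= => <-.
rewrite /ev_fin raddf_sum mulr_suml; apply: eq_bigr => be _ /=; rewrite !mevalZ -mulrA; congr (_ * _).
rewrite mevalX /Fb rmorph_prod (reindex (@enum_rank I)) /=; last first.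
  by exists enum_val => x _; rewrite ?enum_valK ?enum_rankK.
rewrite /QQ -big_split; apply: eq_bigr => i _ /=; rewrite mnmE enum_rankK mevalM !rmorphXn /=.
rewrite -/(ev_fin (P i) (b^~ s)) -/(ev_fin (Q i) (b^~ s)) -Ps exprMn -mulrA -exprD subnKC //; exact: ltnW.
Qed.
End Thin.

(** * Families of maps with rational coefficients *)

Section Families.
Variable R : realType.
Local Notation C := (R[i]).
Local Notation pt := ('I_2 -> C).
Local Notation o0 := (@ord0 1).
Local Notation o1 := (@ord_max 1).

Definition mi d (m : mon d) : nat := (val m).1.
Definition mj d (m : mon d) : nat := (val m).2.

Lemma mon_eq d (m m' : mon d) : mi m = mi m' -> mj m = mj m' -> m = m'.
Proof.
by case: m m' => [[i j] h] [[i' j'] h']; rewrite /mi /mj /= => e1 e2; apply: val_inj; congr pair; apply: val_inj.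
Qed.

Lemma mon_deg d (m : mon d) : (mi m + mj m <= d)%N.
Proof. exact: valP m. Qed.

Lemma mkmon_proof d i j : (i + j <= d)%N ->
  (((inord i : 'I_d.+1), (inord j : 'I_d.+1)).1 + ((inord i : 'I_d.+1), (inord j : 'I_d.+1)).2 <= d)%N.
Proof. by move=> h; rewrite /= !inordK // ltnS; lia. Qed.

Definition mkmon d i j (h : (i + j <= d)%N) : mon d :=
  exist (fun m : 'I_d.+1 * 'I_d.+1 => (m.1 + m.2 <= d)%N) (inord i, inord j) (mkmon_proof h).

Lemma mi_mk d i j (h : (i + j <= d)%N) : mi (mkmon h) = i.
Proof. by rewrite /mi /= inordK // ltnS; lia. Qed.
Lemma mj_mk d i j (h : (i + j <= d)%N) : mj (mkmon h) = j.
Proof. by rewrite /mj /= inordK // ltnS; lia. Qed.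

Lemma pevalE d (f : mon d -> C) (x : pt) : peval f x = \sum_m f m * x o0 ^+ mi m * x o1 ^+ mj m.
Proof. by []. Qed.

Lemma peval_inj d (f g : mon d -> C) : (forall x, peval f x = peval g x) -> f = g.
Proof.
move=> h; apply: funext => m0; apply/eqP; rewrite -subr_eq0.
pose mm (m : mon d) : 'X_{1..2} := [multinom (if k == o0 then mi m else mj m) | k < 2].
have mm_inj m m' : mm m = mm m' -> m = m'.
  move=> e; apply: mon_eq; first by have := congr1 (fun b : 'X_{1..2} => b o0) e; rewrite !mnmE.
  by have := congr1 (fun b : 'X_{1..2} => b o1) e; rewrite !mnmE.
pose P : {mpoly C[2]} := \sum_m (f m - g m) *: 'X_[mm m].
have PE x : P.@[x] = 0.
  rewrite /P raddf_sum /= (eq_bigr (fun m => f m * x o0 ^+ mi m * x o1 ^+ mj m - g m * x o0 ^+ mi m * x o1 ^+ mj m)).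
    by rewrite sumrB; apply/eqP; rewrite subr_eq0; apply/eqP; exact: h.
  move=> m _; rewrite mevalZ mevalX big_ord_recr big_ord_recr big_ord0 /= mul1r !mnmE.
  have -> : widen_ord (leqnSn 1) ord_max = o0 by apply: val_inj.
  by rewrite eqxx /= mulrA !mulrBl.
have P0 : P = 0.
  by apply/eqP; apply: contraT => /mpoly_nonvanish[v]; rewrite PE eqxx.
have := congr1 (mcoeff (mm m0)) P0; rewrite mcoeff0 /P raddf_sum /= (bigD1 m0) //= mcoeffZ mcoeffX eqxx mulr1.
rewrite big1 ?addr0 => [->//|m ne]; rewrite mcoeffZ mcoeffX; case: eqP => [/mm_inj e|_]; last by rewrite mulr0.
by rewrite e eqxx in ne.
Qed.

Section Rep.
Variables (S : Type) (T : finType) (b : T -> S -> C).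

(** A family of polynomials in [x] of degree at most [d] whose coefficients are rational in the
    parameters. Composition with a family of affine maps preserves this. *)
Definition Rep d (F : S -> pt -> C) := exists2 f : mon d -> S -> C,
  forall m, gen b (f m) & forall s x, F s x = peval (f^~ s) x.

Lemma Rep_ext d F G : (forall s x, F s x = G s x) -> Rep d F -> Rep d G.
Proof. by move=> h [f h1 h2]; exists f => // s x; rewrite -h h2. Qed.

Lemma Rep_mono d a i j : gen b a -> (i + j <= d)%N -> Rep d (fun s x => a s * x o0 ^+ i * x o1 ^+ j).
Proof.
move=> ha h; exists (fun m s => if m == mkmon h then a s else 0) => [m|s x].
  by case: eqP => _ //; exact: gen_const.
rewrite pevalE (bigD1 (mkmon h)) //= eqxx mi_mk mj_mk big1 ?addr0 // => m /negPf->.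
by rewrite !mul0r.
Qed.

Lemma Rep_add d F G : Rep d F -> Rep d G -> Rep d (fun s x => F s x + G s x).
Proof.
move=> [f h1 h2] [g k1 k2]; exists (fun m s => f m s + g m s) => [m|s x]; first exact: gen_add.
by rewrite h2 k2 !pevalE -big_split; apply: eq_bigr => m _; rewrite !mulrDl.
Qed.

Lemma Rep_sum d (J : finType) (F : J -> S -> pt -> C) : (forall j, Rep d (F j)) ->
  Rep d (fun s x => \sum_j F j s x).
Proof.
move=> h; have K (r : seq J) : Rep d (fun s x => \sum_(j <- r) F j s x); last exact: K.
elim: r => [|j r IH].
  by apply: Rep_ext (@Rep_mono d _ 0 0 (gen_const b 0) (leq0n d)) => s x; rewrite big_nil !mul0r.
by apply: Rep_ext (Rep_add (h j) IH) => s x; rewrite big_cons.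
Qed.

Lemma Rep_mul d e F G : Rep d F -> Rep e G -> Rep (d + e) (fun s x => F s x * G s x).
Proof.
move=> [f h1 h2] [g k1 k2].
apply: (@Rep_ext _ (fun s x => \sum_m \sum_m' (f m s * g m' s) * x o0 ^+ (mi m + mi m') * x o1 ^+ (mj m + mj m'))).
  move=> s x; rewrite h2 k2 !pevalE big_distrl /=; apply: eq_bigr => m _.
  by rewrite big_distrr /=; apply: eq_bigr => m' _; rewrite !exprD; ring.
apply: Rep_sum => m; apply: Rep_sum => m'; apply: Rep_mono; first exact: gen_mul.
by have := mon_deg m; have := mon_deg m'; lia.
Qed.

Lemma Rep_le d e F : (d <= e)%N -> Rep d F -> Rep e F.
Proof.
move=> de [f h1 h2]; apply: (@Rep_ext _ (fun s x => \sum_m f m s * x o0 ^+ mi m * x o1 ^+ mj m)).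
  by move=> s x; rewrite h2 pevalE.
by apply: Rep_sum => m; apply: Rep_mono => //; exact: leq_trans (mon_deg m) de.
Qed.

Lemma Rep_exp F k : Rep 1 F -> Rep k (fun s x => F s x ^+ k).
Proof.
move=> hF; elim: k => [|k IH].
  by apply: Rep_ext (@Rep_mono 0 _ 0 0 (gen_const b 1) (leqnn 0)) => s x; rewrite !expr0 !mulr1.
by apply: Rep_ext (Rep_mul hF IH) => s x; rewrite exprS.
Qed.

Lemma Rep_comp d (f : mon d -> S -> C) (A : S -> pt -> pt) : (forall m, gen b (f m)) ->
  Rep 1 (fun s x => A s x o0) -> Rep 1 (fun s x => A s x o1) -> Rep d (fun s x => peval (f^~ s) (A s x)).
Proof.
move=> hf hX hY; apply: Rep_sum => m.
have hc : Rep 0 (fun s x => f m s).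
  by apply: Rep_ext (@Rep_mono 0 _ 0 0 (hf m) (leqnn 0)) => s x; rewrite !expr0 !mulr1.
exact: Rep_le (mon_deg m) (Rep_mul (Rep_mul hc (Rep_exp _ hX)) (Rep_exp _ hY)).
Qed.

Lemma Rep_affine (u v w : S -> C) : gen b u -> gen b v -> gen b w ->
  Rep 1 (fun s x => u s * x o0 + v s * x o1 + w s).
Proof.
move=> hu hv hw; apply: Rep_ext (Rep_add (Rep_add (@Rep_mono 1 _ 1 0 hu isT)
  (@Rep_mono 1 _ 0 1 hv isT)) (@Rep_mono 1 _ 0 0 hw isT)) => s x.
by rewrite !expr0 !expr1 !mulr1.
Qed.
End Rep.

(** An affine change with four parameters that takes a given pair of points to (0, 0) and (1, 0).
    The flag [tau] exchanges the coordinates for pairs with equal first coordinate. *)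
Definition aff (tau : bool) (e t1 m t2 : C) (x : pt) : pt :=
  if tau then vec2 (e * x o0 + t1) (x o1 - m * x o0 + t2)
  else vec2 (e * x o1 + t1) (x o0 - m * x o1 + t2).

Section Fam.
Variables (d1 d2 k : nat).
Local Notation Om := (Omega d1 d2).
Variables (Lf Lg : seq (nat * nat)) (B : (Om -> C) -> ('I_k -> C) -> Prop).

Definition removed : {set Om} := [set o : Om | match o with
  | inl m => (mi m, mj m) \in Lf | inr m => (mi m, mj m) \in Lg end].
Definition fam := {s : (Om -> C) * ('I_k -> C) | B s.1 s.2}.
(** The parameters of the family: the coefficients kept free and [k] further numbers, such as those
    of the affine change and slopes. *)
Definition fb (t : ({o : Om | o \notin removed} + 'I_k)%type) (s : fam) : C :=
  match t with inl o => (sval s).1 (sval o) | inr j => (sval s).2 j end.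

Lemma gen_free (o : Om) : o \notin removed -> gen fb (fun s => (sval s).1 o).
Proof. move=> h; exact: (gen_base fb (inl (exist _ o h))). Qed.
Lemma gen_f m : (mi m, mj m) \notin Lf -> gen fb (fun s => fco (sval s).1 m).
Proof. by move=> h; apply: gen_free; rewrite inE. Qed.
Lemma gen_g m : (mi m, mj m) \notin Lg -> gen fb (fun s => gco (sval s).1 m).
Proof. by move=> h; apply: gen_free; rewrite inE. Qed.
Lemma gen_e j : gen fb (fun s => (sval s).2 j).
Proof. exact: (gen_base fb (inr j)). Qed.

Hypotheses (uf : uniq Lf) (ug : uniq Lg).
Hypothesis (vf : all (fun ij => ij.1 + ij.2 <= d1)%N Lf).
Hypothesis (vg : all (fun ij => ij.1 + ij.2 <= d2)%N Lg).

Lemma card_removed : (size Lf + size Lg <= #|removed|)%N.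
Proof.
pose mk d (ij : nat * nat) : mon d := insubd (@mkmon d 0 0 (leq0n d)) (inord ij.1 : 'I_d.+1, inord ij.2 : 'I_d.+1).
have mkE d ij : (ij.1 + ij.2 <= d)%N -> (mi (mk d ij), mj (mk d ij)) = ij.
  move=> h; rewrite /mi /mj /mk insubdK; last exact: mkmon_proof.
  by rewrite /= !inordK; [case: ij h|lia|lia].
pose s : seq Om := [seq inl (mk d1 ij) | ij <- Lf] ++ [seq inr (mk d2 ij) | ij <- Lg].
have -> : (size Lf + size Lg)%N = size s by rewrite size_cat !size_map.
have us : uniq s.
  rewrite cat_uniq; apply/and3P; split.
  - rewrite map_inj_in_uniq // => x y /(allP vf) hx /(allP vf) hy [e].
    by rewrite -(mkE _ _ hx) e mkE.
  - by apply/hasPn => _ /mapP[x _ ->]; apply/mapP => -[].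
  - rewrite map_inj_in_uniq // => x y /(allP vg) hx /(allP vg) hy [e].
    by rewrite -(mkE _ _ hx) e mkE.
rewrite -(card_uniqP us); apply: subset_leq_card; apply/fintype.subsetP => o.
rewrite mem_cat => /orP[] /mapP[x hx ->]; rewrite inE mkE //; [exact: (allP vf)|exact: (allP vg)].
Qed.

(** Removing more than [k] coefficients and adding [k] parameters leaves fewer parameters than
    coefficients, so [thin_gen] applies to the family composed with the affine changes. *)
Lemma thin_fam tau (pe p1 pm p2 : fam -> C) : (k < size Lf + size Lg)%N ->
  (forall m, (mi m, mj m) \in Lf -> gen fb (fun s => fco (sval s).1 m)) ->
  (forall m, (mi m, mj m) \in Lg -> gen fb (fun s => gco (sval s).1 m)) ->
  gen fb pe -> gen fb p1 -> gen fb pm -> gen fb p2 ->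
  thin (fun c : Om -> C => exists s : fam, forall x, Fmap c x = Fmap (sval s).1 (aff tau (pe s) (p1 s) (pm s) (p2 s) x)).
Proof.
move=> hk hf hg ge g1 gm g2.
have gf m : gen fb (fun s => fco (sval s).1 m).
  by case: (boolP ((mi m, mj m) \in Lf)) => h; [exact: hf|exact: gen_f].
have gg m : gen fb (fun s => gco (sval s).1 m).
  by case: (boolP ((mi m, mj m) \in Lg)) => h; [exact: hg|exact: gen_g].
pose A s := aff tau (pe s) (p1 s) (pm s) (p2 s).
have zz := gen_const fb 0; have oo := gen_const fb 1.
have A0 : Rep fb 1 (fun s x => A s x o0).
  rewrite /A /aff; case: (tau).
    by apply: Rep_ext (Rep_affine ge zz g1) => s x; rewrite /vec2 /= mul0r addr0.
  by apply: Rep_ext (Rep_affine zz ge g1) => s x; rewrite /vec2 /= mul0r add0r.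
have A1 : Rep fb 1 (fun s x => A s x o1).
  rewrite /A /aff; case: (tau).
    by apply: Rep_ext (Rep_affine (gen_opp gm) oo g2) => s x; rewrite /vec2 /=; ring.
  by apply: Rep_ext (Rep_affine oo (gen_opp gm) g2) => s x; rewrite /vec2 /=; ring.
have [f' f1 f2] := Rep_comp gf A0 A1; have [g' g1' g2'] := Rep_comp gg A0 A1.
pose phi (o : Om) (s : fam) := match o with inl m => f' m s | inr m => g' m s end.
have := @thin_gen R fam _ Om fb phi; rewrite card_sum card_ord card_sig => tg.
apply: (thin_sub _ (tg _ _)) => [c [s hs]||[m|m]]; [|..|exact: f1|exact: g1'].
  exists s; apply: funext => -[m|m].
    suff e : fco c = f'^~ s by exact: (congr1 (fun u => u m) e).
    apply: peval_inj => x; rewrite -f2; exact: (congr1 (fun u => u o0) (hs x)).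
  suff e : gco c = g'^~ s by exact: (congr1 (fun u => u m) e).
  apply: peval_inj => x; rewrite -g2'; exact: (congr1 (fun u => u o1) (hs x)).
have := card_removed; have := cardC removed.
have -> : #|[predC removed]| = #|[pred x | x \notin removed]| by [].
by move: hk; clear; lia.
Qed.
End Fam.

(** Composition with the inverse affine map keeps the degrees. *)
Lemma pullback d1 d2 (c : Omega d1 d2 -> C) tau e t1 m t2 : e != 0 ->
  exists c' : Omega d1 d2 -> C, forall x, Fmap c x = Fmap c' (aff tau e t1 m t2 x).
Proof.
move=> e0; pose b (t : void) (s : unit) : C := 0.
pose A (x : pt) : pt := let u := (x o0 - t1) / e in
  if tau then vec2 u (x o1 + m * u - t2) else vec2 (x o1 + m * u - t2) u.
have AK x : A (aff tau e t1 m t2 x) = x.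
  rewrite /A /aff; case: (tau); apply: funext; apply: I2P; rewrite /vec2 /=; field; exact: e0.
have K1 : Rep b 1 (fun s x => (x o0 - t1) / e).
  apply: Rep_ext (Rep_affine (gen_const b e^-1) (gen_const b 0) (gen_const b (- t1 / e))) => s x; ring.
have K2 : Rep b 1 (fun s x => x o1 + m * ((x o0 - t1) / e) - t2).
  apply: Rep_ext (Rep_affine (gen_const b (m / e)) (gen_const b 1) (gen_const b (- m * t1 / e - t2))) => s x; ring.
have A0 : Rep b 1 (fun s x => A x o0) by rewrite /A; case: (tau).
have A1 : Rep b 1 (fun s x => A x o1) by rewrite /A; case: (tau).
have [f f1 f2] := @Rep_comp _ _ b _ _ (fun _ => A) (fun m => gen_const b (fco c m)) A0 A1.
have [g g1 g2] := @Rep_comp _ _ b _ _ (fun _ => A) (fun m => gen_const b (gco c m)) A0 A1.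
exists (fun o => match o with inl m => f m tt | inr m => g m tt end) => x.
apply: funext; apply: I2P; rewrite /Fmap /=.
  by have := f2 tt (aff tau e t1 m t2 x); rewrite AK.
by have := g2 tt (aff tau e t1 m t2 x); rewrite AK.
Qed.
End Families.

(** * Behaviour of critical pairs under affine changes *)

Section Transport.
Variable R : realType.
Local Notation C := (R[i]).
Local Notation pt := ('I_2 -> C).
Local Notation o0 := (@ord0 1).
Local Notation o1 := (@ord_max 1).

(** The transpose of the linear part of [aff], acting on differentials; [dett] is its
    determinant. *)
Definition covec tau (e m : C) (L : pt) : pt :=
  if tau then vec2 (e * L o0 - m * L o1) (L o1) else vec2 (L o1) (e * L o0 - m * L o1).
Definition dett tau (e : C) : C := if tau then e else - e.

Lemma covec_inj tau e m L M : e != 0 -> covec tau e m L = covec tau e m M -> L = M.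
Proof.
move=> e0 E; have E0 := congr1 (fun u => u o0) E; have E1 := congr1 (fun u => u o1) E.
move: E0 E1; rewrite /covec; case: tau {E}; rewrite /vec2 /= => E0 E1.
  apply: funext; apply: I2P => //; apply: (mulfI e0).
  by apply: (addIr (- (m * L o1))); rewrite E0 E1.
apply: funext; apply: I2P => //; apply: (mulfI e0).
by apply: (addIr (- (m * L o1))); rewrite E1 E0.
Qed.

Lemma covecZ tau e m k L : covec tau e m (fun i => k * L i) = (fun i => k * covec tau e m L i).
Proof. by rewrite /covec; case: tau; apply: funext; apply: I2P; rewrite /vec2 /=; ring. Qed.

Lemma wedge_covec tau e m L M : wedge (covec tau e m L) (covec tau e m M) = dett tau e * wedge L M.
Proof. by rewrite /covec /dett /wedge; case: tau; rewrite /vec2 /=; ring. Qed.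

Lemma hat_lin0 (f : pt -> C) (x L : pt) (w : C) :
  (forall y, f y = \sum_i L i * y i + w) -> hat f x L.
Proof.
move=> h ep e0; exists 1 => // y _; rewrite !h.
rewrite (_ : _ - _ - _ = 0) ?nc0 ?mulr_ge0 ?n1_ge0 ?(ltW e0) //; rewrite !sum2; ring.
Qed.

Lemma hat_aff (h : pt -> C) tau e t1 m t2 x L : hat h (aff tau e t1 m t2 x) L ->
  hat (fun y => h (aff tau e t1 m t2 y)) x (covec tau e m L).
Proof.
move=> hh; pose M (i : 'I_2) : pt := if i == o0 then (if tau then vec2 e 0 else vec2 0 e)
  else (if tau then vec2 (- m) 1 else vec2 1 (- m)).
have hM i : hat (fun y => aff tau e t1 m t2 y i) x (M i).
  move: i; apply: I2P; [apply: (@hat_lin0 _ _ _ t1)|apply: (@hat_lin0 _ _ _ t2)] => y;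
  rewrite sum2 /M /aff; case: (tau); rewrite /vec2 /=; ring.
have := hat_comp hh hM; congr hat; apply: funext; apply: I2P; rewrite sum2 /M /covec; case: (tau); rewrite /vec2 /=; ring.
Qed.

Variables (d1 d2 : nat) (c c' : Omega d1 d2 -> C) (tau : bool) (e t1 m t2 : C).
Hypothesis e0 : e != 0.
Local Notation A := (aff tau e t1 m t2).
Hypothesis hc : forall x, Fmap c x = Fmap c' (A x).

Lemma dett_neq0 : dett tau e != 0.
Proof. by rewrite /dett; case: (tau); rewrite ?oppr_eq0. Qed.

Lemma Df_aff x : Df c x = covec tau e m (Df c' (A x)).
Proof.
have E : (fun y => peval (fco c') (A y)) = peval (fco c).
  by apply: funext => y; exact: (esym (congr1 (fun u => u o0) (hc y))).
have h1 := hat_peval (fco c) x; have h2 := hat_aff (hat_peval (fco c') (A x)); rewrite E in h2.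
exact: (hat_unique h1 h2).
Qed.

Lemma Dg_aff x : Dg c x = covec tau e m (Dg c' (A x)).
Proof.
have E : (fun y => peval (gco c') (A y)) = peval (gco c).
  by apply: funext => y; exact: (esym (congr1 (fun u => u o1) (hc y))).
have h1 := hat_peval (gco c) x; have h2 := hat_aff (hat_peval (gco c') (A x)); rewrite E in h2.
exact: (hat_unique h1 h2).
Qed.

Lemma Jac_aff x : Jac c x = dett tau e * Jac c' (A x).
Proof. by rewrite !JacE Df_aff Dg_aff wedge_covec. Qed.

Lemma DJ_aff x : DJ c x = (fun i => dett tau e * covec tau e m (DJ c' (A x)) i).
Proof.
apply: hat_unique (hat_Jac c x) _; have := hat_scale (dett tau e) (hat_aff (hat_Jac c' (A x))); congr hat.
by apply: funext => y; rewrite Jac_aff.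
Qed.

Lemma U_aff x : wedge (DJ c x) (Df c x) = dett tau e ^+ 2 * wedge (DJ c' (A x)) (Df c' (A x)).
Proof.
rewrite DJ_aff Df_aff (_ : wedge _ _ = dett tau e * wedge (covec tau e m (DJ c' (A x))) (covec tau e m (Df c' (A x)))).
  by rewrite wedge_covec mulrA.
by rewrite /wedge; ring.
Qed.

Lemma zero_pair_aff p q : zero_pair c p q -> zero_pair c' (A p) (A q).
Proof.
move=> [h1 h2 h3]; split; last by rewrite -!hc.
  by move: h1; rewrite Jac_aff => /eqP; rewrite mulf_eq0 (negPf dett_neq0) => /eqP.
by move: h2; rewrite Jac_aff => /eqP; rewrite mulf_eq0 (negPf dett_neq0) => /eqP.
Qed.

Lemma Df_aff0 p : Df c p = (fun=> 0) -> Df c' (A p) = (fun=> 0).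
Proof.
rewrite Df_aff => h; apply: (@covec_inj tau e m) => //; rewrite h.
by rewrite /covec; case: (tau); apply: funext; apply: I2P; rewrite /vec2 /=; ring.
Qed.

Lemma U_aff0 p : wedge (DJ c p) (Df c p) = 0 -> wedge (DJ c' (A p)) (Df c' (A p)) = 0.
Proof. by rewrite U_aff => /eqP; rewrite mulf_eq0 expf_eq0 (negPf dett_neq0) => /eqP. Qed.

Lemma prop_aff k p : Dg c p = (fun i => k * Df c p i) -> Dg c' (A p) = (fun i => k * Df c' (A p) i).
Proof. by rewrite Df_aff Dg_aff -covecZ => /covec_inj; apply. Qed.
End Transport.

(** * Slopes and normal position *)

Section Classification.
Variable R : realType.
Local Notation C := (R[i]).
Local Notation pt := ('I_2 -> C).
Local Notation o0 := (@ord0 1).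
Local Notation o1 := (@ord_max 1).
Variables (d1 d2 : nat) (c : Omega d1 d2 -> C).

Lemma proportional (L M : pt) : wedge L M = 0 -> L <> (fun=> 0) -> exists k, M = (fun i => k * L i).
Proof.
rewrite /wedge => w L0; case: (eqVneq (L o0) 0) => [l0|l0].
  have l1 : L o1 != 0 by apply/eqP => l1; apply: L0; apply: funext; apply: I2P.
  exists (M o1 / L o1); apply: funext; apply: I2P; last by rewrite mulfVK.
  rewrite l0 mulr0; move/eqP: w; rewrite l0 mul0r sub0r oppr_eq0 mulf_eq0 (negPf l1) => /eqP->//.
exists (M o0 / L o0); apply: funext; apply: I2P; first by rewrite mulfVK.
apply: (mulfI l0); move/eqP: w; rewrite subr_eq0 => /eqP->; field; exact: l0.
Qed.

(** At a critical point with [Df] nonzero one has [Dg = k * Df], and [k] is the slope of the image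
    of the critical curve. Transversality means that the two slopes differ. *)
Lemma good_criterion p q : zero_pair c p q -> Df c p <> (fun=> 0) -> Df c q <> (fun=> 0) ->
  wedge (DJ c p) (Df c p) <> 0 -> wedge (DJ c q) (Df c q) <> 0 ->
  ~ (exists k, Dg c p = (fun i => k * Df c p i) /\ Dg c q = (fun i => k * Df c q i)) -> good_pair c p q.
Proof.
move=> [Jp Jq _] fp fq /eqP up /eqP uq hk.
have [k ek] := proportional (etrans (esym (JacE c p)) Jp) fp.
have [l el] := proportional (etrans (esym (JacE c q)) Jq) fq.
split; last by left.
have wk (L M : pt) (a : C) : wedge L (fun i => a * M i) = a * wedge L M by rewrite /wedge; ring.
have E1 := wk (DJ c p) (Df c p) k; have E2 := wk (DJ c q) (Df c q) l.
rewrite /transv ek el E1 E2; move: (wedge _ _) (wedge _ _) up uq => u v up uq.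
rewrite mulrCA -mulrA -subr_eq0 -mulrBl mulf_neq0 ?mulf_neq0 // subr_eq0.
apply/eqP => e; apply: hk; exists k; split; first exact: ek.
by rewrite -e; exact: el.
Qed.

Lemma normalize (p q : pt) : p <> q -> exists tau (e t1 m t2 : C), [/\ e != 0,
  aff tau e t1 m t2 p = (fun=> 0) & aff tau e t1 m t2 q = vec2 1 0].
Proof.
move=> pq; case: (eqVneq (q o0) (p o0)) => [e0|ne].
  have n1 : q o1 - p o1 != 0.
    by rewrite subr_eq0; apply/eqP => e1; apply: pq; apply: funext; apply: I2P.
  exists false, (q o1 - p o1)^-1, (- p o1 / (q o1 - p o1)), 0, (- p o0); split; first by rewrite invr_eq0.
    by apply: funext; apply: I2P; rewrite /aff /vec2 /=; field.
  by apply: funext; apply: I2P; rewrite /aff /vec2 /= ?e0; field.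
have n0 : q o0 - p o0 != 0 by rewrite subr_eq0.
pose m := (q o1 - p o1) / (q o0 - p o0).
exists true, (q o0 - p o0)^-1, (- p o0 / (q o0 - p o0)), m, (m * p o0 - p o1); split; first by rewrite invr_eq0.
  by apply: funext; apply: I2P; rewrite /aff /vec2 /= /m; field.
by apply: funext; apply: I2P; rewrite /aff /vec2 /= /m; field.
Qed.
End Classification.

(** * Solving for coefficients from conditions at (0, 0) and (1, 0) *)

Section Cases.
Variable R : realType.
Local Notation C := (R[i]).
Local Notation pt := ('I_2 -> C).
Local Notation o0 := (@ord0 1).
Local Notation o1 := (@ord_max 1).
Local Notation P := (fun _ : 'I_2 => 0 : C).
Local Notation Q := (vec2 1 0 : pt).

(** Written as a sum with at most one nonzero term, the coefficient makes sense for all exponents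
    and is 0 beyond the degree. *)
Definition co d (h : mon d -> C) i j := \sum_m h m * ((mi m == i) && (mj m == j))%:R.

Section Functionals.
Variables (d : nat) (h : mon d -> C).

Lemma zexp k : (0 : C) ^+ k = (k == 0%N)%:R. Proof. exact: expr0n. Qed.

Lemma val_PQ : peval h Q - peval h P = \sum_m h m * ((mj m == 0%N) && (mi m != 0%N))%:R.
Proof.
rewrite !pevalE -sumrB; apply: eq_bigr => m _; rewrite /vec2 /= expr1n !zexp.
by case: (mi m == 0%N) (mj m == 0%N) => [] []; rewrite /= ?mulr1 ?mulr0 ?subrr ?subr0.
Qed.
Lemma pdx_P : pdx h P = co h 1 0.
Proof.
apply: eq_bigr => m _; rewrite /xc /yc -/(mi m) -/(mj m) !zexp -!mulrA; congr (_ * _).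
by case: (mi m) (mj m == 0%N) => [|[|i]] [] /=; rewrite ?mul0r ?mulr0 ?mulr1.
Qed.
Lemma pdy_P : pdy h P = co h 0 1.
Proof.
apply: eq_bigr => m _; rewrite /xc /yc -/(mi m) -/(mj m) !zexp -!mulrA; congr (_ * _).
by case: (mj m) (mi m == 0%N) => [|[|i]] [] /=; rewrite ?mul0r ?mulr0 ?mul1r ?mulr1.
Qed.
Lemma pdx_Q : pdx h Q = \sum_m h m * ((mi m)%:R * (mj m == 0%N)%:R).
Proof.
by apply: eq_bigr => m _; rewrite /xc /yc -/(mi m) -/(mj m) /vec2 /= expr1n zexp mulr1 mulrA.
Qed.
Lemma pdy_Q : pdy h Q = \sum_m h m * (mj m == 1%N)%:R.
Proof.
apply: eq_bigr => m _; rewrite /xc /yc -/(mi m) -/(mj m) /vec2 /= expr1n zexp mulr1 -mulrA; congr (_ * _).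
by case: (mj m) => [|[|i]] /=; rewrite ?mul0r ?mulr0 ?mulr1.
Qed.
Lemma pdxx_P : pdxx h P = 2 * co h 2 0.
Proof.
rewrite mulr_sumr; apply: eq_bigr => m _; rewrite /xc /yc -/(mi m) -/(mj m) !zexp mulrCA -!mulrA; congr (_ * _).
by case: (mi m) (mj m == 0%N) => [|[|[|i]]] [] /=; rewrite ?mul0r ?mulr0 ?mulr1.
Qed.
Lemma pdxy_P : pdxy h P = co h 1 1.
Proof.
apply: eq_bigr => m _; rewrite /xc /yc -/(mi m) -/(mj m) !zexp -!mulrA; congr (_ * _).
by case: (mi m) (mj m) => [|[|i]] [|[|j]] /=; rewrite ?mul0r ?mulr0 ?mulr1.
Qed.
Lemma pdyy_P : pdyy h P = 2 * co h 0 2.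
Proof.
rewrite mulr_sumr; apply: eq_bigr => m _; rewrite /xc /yc -/(mi m) -/(mj m) !zexp mulrCA -!mulrA; congr (_ * _).
by case: (mj m) (mi m == 0%N) => [|[|[|i]]] [] /=; rewrite ?mul0r ?mulr0 ?mul1r ?mulr1.
Qed.
End Functionals.

Section Solve.
Variables (S : Type) (T : finType) (b : T -> S -> C) (d : nat) (h : S -> mon d -> C).
Local Notation gh m := (gen b (fun s => h s m)).
Local Notation G i j := (forall m, mi m = i -> mj m = j -> gh m).

Lemma gsolve (l : mon d -> C) (v : S -> C) i j : (forall s, \sum_m h s m * l m = v s) -> gen b v ->
  (forall m, mi m = i -> mj m = j -> l m != 0) ->
  (forall m, ~~ ((mi m == i) && (mj m == j)) -> l m != 0 -> gh m) -> G i j.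
Proof.
move=> e hv l0 hm m h1 h2; apply: (gen_solve (f := fun m s => h s m) e hv (l0 m h1 h2)) => m' ne lm'.
apply: hm => //; apply: contra ne => /andP[/eqP a /eqP a']; apply/eqP; apply: mon_eq; congruence.
Qed.

Lemma gen_co i j : G i j -> gen b (fun s => co (h s) i j).
Proof.
move=> H0; apply: gen_sum => m _; case: (boolP ((mi m == i) && (mj m == j))) => [/andP[/eqP a /eqP a']|_].
  by apply: gen_mul; [exact: H0|exact: gen_const].
by apply: gen_ext (gen_const b 0) => s; rewrite mulr0.
Qed.

Lemma solve_co i j (v : S -> C) : (forall s, co (h s) i j = v s) -> gen b v -> G i j.
Proof.
move=> e hv; apply: (gsolve (l := fun m => ((mi m == i) && (mj m == j))%:R) e hv) => [m -> ->|m /negPf->].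
  by rewrite !eqxx oner_eq0.
by rewrite eqxx.
Qed.

Variables (v0 v1 v2 : S -> C).

Lemma solve_val i : (forall s, peval (h s) Q - peval (h s) P = v0 s) -> gen b v0 -> (0 < i)%N ->
  (forall m, mj m = 0%N -> mi m != i -> gh m) -> G i 0%N.
Proof.
move=> e hv i0 H0; apply: (gsolve (l := fun m => ((mj m == 0%N) && (mi m != 0%N))%:R)) hv _ _ => [s|m -> ->|m].
- by rewrite -val_PQ.
- by rewrite eqxx -lt0n i0 oner_eq0.
case: (eqVneq (mj m) 0%N) => [e1|_] /=; last by rewrite eqxx.
by rewrite andbT => h1 _; exact: H0.
Qed.

(* pdx at Q minus k times the increment along [P, Q] does not involve the coefficient of x^k. *)
Lemma solve_xQ k : (forall s, peval (h s) Q - peval (h s) P = v0 s) -> (forall s, pdx (h s) Q = v1 s) ->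
  gen b v0 -> gen b v1 -> (0 < k)%N ->
  (forall m, mj m = 0%N -> mi m != k -> mi m != k.+1 -> gh m) -> G k.+1 0%N.
Proof.
move=> e0 e1 g0 g1 k0 H0.
have gv : gen b (fun s => v1 s - k%:R * v0 s) by apply: gen_sub => //; apply: gen_mul => //; exact: gen_const.
apply: (gsolve (l := fun m => (mi m)%:R * (mj m == 0%N)%:R - k%:R * ((mj m == 0%N) && (mi m != 0%N))%:R)) gv _ _.
- move=> s; rewrite -e0 -e1 pdx_Q val_PQ mulr_sumr -sumrB; apply: eq_bigr => m _; rewrite mulrBr; congr (_ - _); ring.
- by move=> m -> ->; rewrite eqxx /= !mulr1 -natr1 addrAC subrr add0r oner_eq0.
move=> m; case: (eqVneq (mj m) 0%N) => [e2|_] /=; last by rewrite !mulr0 subrr eqxx.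
rewrite mulr1 andbT => h1; case: (eqVneq (mi m) k) => [e3|h2 _]; last exact: H0.
by rewrite e3 -lt0n k0 mulr1 subrr eqxx.
Qed.

Lemma solve_yQ : (forall s, pdy (h s) Q = v2 s) -> gen b v2 ->
  (forall m, mj m = 1%N -> mi m != 1%N -> gh m) -> G 1%N 1%N.
Proof.
move=> e hv H0; apply: (gsolve (l := fun m => (mj m == 1%N)%:R)) hv _ _ => [s|m _ ->|m].
- by rewrite -e pdy_Q.
- by rewrite eqxx oner_eq0.
case: (eqVneq (mj m) 1%N) => [e1|_] /=; last by rewrite eqxx.
by rewrite andbT => h1 _; exact: H0.
Qed.
End Solve.

Section NF.
Variables (d1 d2 : nat).
Local Notation Om := (Omega d1 d2).

(** The mode selects the free parameters of the affine change: all four, or only three with [e = 1],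
    or two with also [t1 = 0]. The smaller modes serve degenerate families that are themselves
    invariant under the omitted changes. *)
Definition af (md : nat) (tau : bool) (w : nat -> C) : pt -> pt :=
  match md with
  | O => aff tau (w 0%N) (w 1%N) (w 2%N) (w 3%N)
  | S O => aff tau 1 (w 0%N) (w 1%N) (w 2%N)
  | _ => aff tau 1 0 (w 0%N) (w 1%N)
  end.

(** Reduces a degenerate case to a list of solved exponents, a count, and the proof that the solved
    coefficients are rational in all other data. *)
Lemma thin_NF md k (Lf Lg : seq (nat * nat)) (B : (Om -> C) -> (nat -> C) -> Prop) :
  uniq Lf -> uniq Lg -> all (fun ij => ij.1 + ij.2 <= d1)%N Lf -> all (fun ij => ij.1 + ij.2 <= d2)%N Lg ->
  (k < size Lf + size Lg)%N ->
  (forall (S : Type) (T : finType) (b : T -> S -> C) (c : S -> Om -> C) (w : S -> nat -> C),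
     (forall s, B (c s) (w s)) ->
     (forall m, (mi m, mj m) \notin Lf -> gen b (fun s => fco (c s) m)) ->
     (forall m, (mi m, mj m) \notin Lg -> gen b (fun s => gco (c s) m)) ->
     (forall i, gen b (fun s => w s i)) ->
     (forall m, gen b (fun s => fco (c s) m)) /\ (forall m, gen b (fun s => gco (c s) m))) ->
  thin (fun c : Om -> C => exists (tau : bool) (c' : Om -> C) (l : seq C), [/\ size l = k, B c' (nth 0 l) &
     forall x, Fmap c x = Fmap c' (af md tau (nth 0 l) x)]).
Proof.
move=> uf ug vf vg hk hgen; apply: thin_bool => tau.
pose rd (w : 'I_k -> C) (i : nat) : C := if insub i is Some j then w j else 0.
pose B' c w := B c (rd w).
have gw i : gen (@fb R d1 d2 k Lf Lg B') (fun s => rd (sval s).2 i).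
  by rewrite /rd; case: (insub i) => [j|]; [exact: gen_e|exact: gen_const].
have [gf gg] := hgen (@fam R d1 d2 k B') _ (@fb R d1 d2 k Lf Lg B') (fun s => (sval s).1) (fun s => rd (sval s).2)
  (fun s => svalP s) (@gen_f _ _ _ _ _ _ _) (@gen_g _ _ _ _ _ _ _) gw.
pose pe (s : @fam R d1 d2 k B') : C := if md is 0%N then rd (sval s).2 0%N else 1.
pose p1 (s : @fam R d1 d2 k B') : C := match md with O => rd (sval s).2 1%N | S O => rd (sval s).2 0%N | _ => 0 end.
pose pm (s : @fam R d1 d2 k B') : C := match md with O => rd (sval s).2 2%N | S O => rd (sval s).2 1%N | _ => rd (sval s).2 0%N end.
pose p2 (s : @fam R d1 d2 k B') : C := match md with O => rd (sval s).2 3%N | S O => rd (sval s).2 2%N | _ => rd (sval s).2 1%N end.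
have [q1 [q2 [q3 q4]]] : gen (@fb R d1 d2 k Lf Lg B') pe /\ gen (@fb R d1 d2 k Lf Lg B') p1 /\
    gen (@fb R d1 d2 k Lf Lg B') pm /\ gen (@fb R d1 d2 k Lf Lg B') p2.
  by rewrite /pe /p1 /pm /p2; case: (md) => [|[|md']]; do ![split]; try exact: gw; exact: gen_const.
apply: thin_sub (thin_fam uf ug vf vg tau hk (fun m _ => gf m) (fun m _ => gg m) q1 q2 q3 q4) => c [c' [l [sl hB hx]]].
have rdE : rd (fun j : 'I_k => nth 0 l j) = nth 0 l.
  apply: funext => i; rewrite /rd; case: insubP => [j _ <- //|]; rewrite -leqNgt => hi.
  by rewrite nth_default // sl.
have hB' : B' c' (fun j => nth 0 l j) by rewrite /B' rdE.
exists (exist _ (c', fun j : 'I_k => nth 0 l j) hB') => x; rewrite hx; congr Fmap.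
by rewrite /pe /p1 /pm /p2 /= rdE; case: (md) => [|[|md']].
Qed.
End NF.
End Cases.

(** * Degenerate pairs for degrees at least (2, 3) *)

Section Generic.
Variable R : realType.
Local Notation C := (R[i]).
Local Notation pt := ('I_2 -> C).
Local Notation o0 := (@ord0 1).
Local Notation o1 := (@ord_max 1).
Local Notation P := (fun _ : 'I_2 => 0 : C).
Local Notation Q := (vec2 1 0 : pt).

Section SolveAll.
Variables (S : Type) (T : finType) (b : T -> S -> C) (d : nat) (h : S -> mon d -> C).
Local Notation gh m := (gen b (fun s => h s m)).
Local Notation G i j := (forall m, mi m = i -> mj m = j -> gh m).

Lemma gen_pd (x : pt) : (forall m, gh m) -> [/\ gen b (fun s => pdx (h s) x), gen b (fun s => pdy (h s) x),
  gen b (fun s => pdxx (h s) x), gen b (fun s => pdxy (h s) x) & gen b (fun s => pdyy (h s) x)].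
Proof.
by move=> H0; split; apply: gen_sum => m _; do ![apply: gen_mul]; try exact: gen_const; exact: H0.
Qed.

Lemma all_gen (L : seq (nat * nat)) : (forall m, (mi m, mj m) \notin L -> gh m) ->
  (forall ij, ij \in L -> G ij.1 ij.2) -> forall m, gh m.
Proof. by move=> h1 h2 m; case: (boolP ((mi m, mj m) \in L)) => [/h2|/h1 //]; exact. Qed.

Variables (v0 v1 v2 u1 u2 : S -> C).
Hypotheses (e0 : forall s, peval (h s) Q - peval (h s) P = v0 s)
  (e1 : forall s, pdx (h s) Q = v1 s) (e2 : forall s, pdy (h s) Q = v2 s).
Hypotheses (g0 : gen b v0) (g1 : gen b v1) (g2 : gen b v2).

Lemma solve_low : (forall m, (mj m <= 1)%N -> (mi m, mj m) \notin [:: (2, 0); (3, 0); (1, 1)]%N -> gh m) ->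
  [/\ G 2%N 0%N, G 3%N 0%N & G 1%N 1%N].
Proof.
move=> hf.
have h30 : G 3%N 0%N.
  by apply: (solve_xQ (k := 2) e0 e1 g0 g1 isT) => m a1 a2 a3; apply: hf; rewrite ?a1 // !inE !xpair_eqE; lia.
have h11 : G 1%N 1%N.
  by apply: (solve_yQ e2 g2) => m a1 a2; apply: hf; rewrite ?a1 // !inE !xpair_eqE; lia.
split=> //; apply: (solve_val (i := 2) e0 g0 isT) => m a1 a2; case: (eqVneq (mi m) 3%N) => a3; first exact: h30.
by apply: hf; rewrite ?a1 // !inE !xpair_eqE; lia.
Qed.

Hypotheses (f1 : forall s, pdx (h s) P = u1 s) (f2 : forall s, pdy (h s) P = u2 s).
Hypotheses (k1 : gen b u1) (k2 : gen b u2).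

Lemma solve_jets : (forall m, (mi m, mj m) \notin [:: (1, 0); (0, 1); (2, 0); (3, 0); (1, 1); (0, 2)]%N -> gh m) ->
  [/\ G 1%N 0%N, G 0%N 1%N, G 2%N 0%N, G 3%N 0%N & G 1%N 1%N].
Proof.
move=> hf.
have h10 : G 1%N 0%N by apply: (solve_co _ k1) => s; rewrite -pdx_P.
have h01 : G 0%N 1%N by apply: (solve_co _ k2) => s; rewrite -pdy_P.
have [] := solve_low; last by split.
move=> m a1 a2; case: (eqVneq (mi m, mj m) (1, 0)%N) => [[] b1 b2|a3]; first exact: h10.
case: (eqVneq (mi m, mj m) (0, 1)%N) => [[] b1 b2|a4]; first exact: h01.
by apply: hf; move: a1 a2 a3 a4; rewrite !inE !xpair_eqE; lia.
Qed.
End SolveAll.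

Variables (d1 d2 : nat).
Local Notation Om := (Omega d1 d2).
Definition NFset md k (B : (Om -> C) -> (nat -> C) -> Prop) (c : Om -> C) :=
  exists (tau : bool) (c' : Om -> C) (l : seq C), [/\ size l = k, B c' (nth 0 l) &
     forall x, Fmap c x = Fmap c' (af md tau (nth 0 l) x)].

Definition vals (c : Om -> C) := peval (fco c) Q - peval (fco c) P = 0 /\ peval (gco c) Q - peval (gco c) P = 0.
Definition pP (c : Om -> C) k := pdx (gco c) P = k * pdx (fco c) P /\ pdy (gco c) P = k * pdy (fco c) P.
Definition pQ (c : Om -> C) k := pdx (gco c) Q = k * pdx (fco c) Q /\ pdy (gco c) Q = k * pdy (fco c) Q.

Lemma ord_all (d e : nat) (L : seq (nat * nat)) : (e <= d)%N -> all (fun ij => ij.1 + ij.2 <= e)%N L ->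
  all (fun ij => ij.1 + ij.2 <= d)%N L.
Proof. by move=> h /allP H0; apply/allP => x /H0 h1; exact: leq_trans h1 h. Qed.

(** Five parameters, the affine change and the common slope, against six solved coefficients: one of
    [f] and one of [g] from the equal values, four more of [g] from the proportional gradients at
    both points. *)
Lemma thin_same_slope : (2 <= d1)%N -> (3 <= d2)%N ->
  thin (NFset 0 5 (fun c w => [/\ vals c, pP c (w 4%N) & pQ c (w 4%N)])).
Proof.
move=> hd1 hd2; apply: (@thin_NF R d1 d2 _ _ [:: (2, 0)]%N [:: (1, 0); (0, 1); (2, 0); (3, 0); (1, 1)]%N) => //;
  [exact: ord_all hd1 _|exact: ord_all hd2 _|].
move=> S T b c w hB gf gg gw; have z := gen_const b 0.
have F : forall m, gen b (fun s => fco (c s) m).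
  apply: (all_gen gf) => ij; rewrite inE => /eqP->; apply: (solve_val (i := 2) (h := fun s => fco (c s)) _ z isT) => [s|m a1 a2].
    by have [[]] := hB s.
  by apply: gf; rewrite !inE xpair_eqE; lia.
have [p1 p2 _ _ _] := gen_pd P F; have [q1 q2 _ _ _] := gen_pd Q F.
have W f : gen b f -> gen b (fun s => w s 4%N * f s) by apply: gen_mul; exact: gw.
split=> //; apply: (all_gen gg).
have [||||||k1 k2 k3 k4 k5] := solve_jets _ _ _ z (W _ q1) (W _ q2) _ _ (W _ p1) (W _ p2) (h := fun s => gco (c s)).
- by move=> s; have [[]] := hB s.
- by move=> s; have [_ _ [a1 a2]] := hB s; rewrite ?a1 ?a2.
- by move=> s; have [_ _ [a1 a2]] := hB s; rewrite ?a1 ?a2.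
- by move=> s; have [_ [a1 a2] _] := hB s; rewrite ?a1 ?a2.
- by move=> s; have [_ [a1 a2] _] := hB s; rewrite ?a1 ?a2.
- by move=> m a; apply: gg; move: a; rewrite !inE; lia.
by move=> ij; rewrite !inE => /or4P[||| /orP[]] /eqP->.
Qed.

(** Two slopes make six parameters; [f_x(P) = 0] raises the number of solved coefficients to seven.
    This is the case in which [thin_cusp] cannot divide by [f_x(P)]. *)
Lemma thin_flat : (2 <= d1)%N -> (3 <= d2)%N ->
  thin (NFset 0 6 (fun c w => [/\ vals c, pP c (w 4%N), pQ c (w 5%N) & pdx (fco c) P = 0])).
Proof.
move=> hd1 hd2; apply: (@thin_NF R d1 d2 _ _ [:: (1, 0); (2, 0)]%N [:: (1, 0); (0, 1); (2, 0); (3, 0); (1, 1)]%N) => //;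
  [exact: ord_all hd1 _|exact: ord_all hd2 _|].
move=> S T b c w hB gf gg gw; have z := gen_const b 0.
have F : forall m, gen b (fun s => fco (c s) m).
  have h10 : forall m, mi m = 1%N -> mj m = 0%N -> gen b (fun s => fco (c s) m).
    by apply: (solve_co (h := fun s => fco (c s)) _ z) => s; rewrite -pdx_P; have [] := hB s.
  apply: (all_gen gf) => ij; rewrite !inE => /orP[] /eqP-> //; apply: (solve_val (i := 2) (h := fun s => fco (c s)) _ z isT) => [s|m a1 a2].
    by have [[]] := hB s.
  case: (eqVneq (mi m) 1%N) => a3; first exact: h10.
  by apply: gf; rewrite !inE !xpair_eqE; lia.
have [p1 p2 _ _ _] := gen_pd P F; have [q1 q2 _ _ _] := gen_pd Q F.
have W i f : gen b f -> gen b (fun s => w s i * f s) by apply: gen_mul; exact: gw.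
split=> //; apply: (all_gen gg).
have [||||||k1 k2 k3 k4 k5] := solve_jets _ _ _ z (W 5%N _ q1) (W 5%N _ q2) _ _ (W 4%N _ p1) (W 4%N _ p2) (h := fun s => gco (c s)).
- by move=> s; have [[]] := hB s.
- by move=> s; have [_ _ [a1 a2] *] := hB s; rewrite ?a1 ?a2.
- by move=> s; have [_ _ [a1 a2] *] := hB s; rewrite ?a1 ?a2.
- by move=> s; have [_ [a1 a2] *] := hB s; rewrite ?a1 ?a2.
- by move=> s; have [_ [a1 a2] *] := hB s; rewrite ?a1 ?a2.
- by move=> m a; apply: gg; move: a; rewrite !inE; lia.
by move=> ij; rewrite !inE => /or4P[||| /orP[]] /eqP->.
Qed.

(** The equation [wedge (DJ P) (Df P) = 0], with [k * Df] substituted for [Dg], arranged as a linear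
    equation for the coefficient of [y^2] in [g]. *)
Definition Ueq (c : Om -> C) k := let f := fco c in let g := gco c in
  2 * co g 0 2 * pdx f P ^+ 2 = k * (pdy f P ^+ 2 * pdxx f P - 2 * pdx f P * pdy f P * pdxy f P + pdx f P ^+ 2 * pdyy f P)
   + 2 * pdx f P * pdy f P * co g 1 1 - pdy f P ^+ 2 * (2 * co g 2 0).

(** A critical curve that fails to fold at [P] imposes [Ueq], which yields the coefficient of [y^2]
    in [g] after division by [2 * f_x(P)^2]: seven solved coefficients against six parameters. *)
Lemma thin_cusp : (2 <= d1)%N -> (3 <= d2)%N ->
  thin (NFset 0 6 (fun c w => [/\ vals c, pP c (w 4%N), pQ c (w 5%N), pdx (fco c) P != 0 & Ueq c (w 4%N)])).
Proof.
move=> hd1 hd2; apply: (@thin_NF R d1 d2 _ _ [:: (2, 0)]%N [:: (1, 0); (0, 1); (2, 0); (3, 0); (1, 1); (0, 2)]%N) => //;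
  [exact: ord_all hd1 _|exact: ord_all hd2 _|].
move=> S T b c w hB gf gg gw; have z := gen_const b 0.
have F : forall m, gen b (fun s => fco (c s) m).
  apply: (all_gen gf) => ij; rewrite inE => /eqP->; apply: (solve_val (i := 2) (h := fun s => fco (c s)) _ z isT) => [s|m a1 a2].
    by have [[]] := hB s.
  by apply: gf; rewrite !inE xpair_eqE; lia.
have [p1 p2 p3 p4 p5] := gen_pd P F; have [q1 q2 _ _ _] := gen_pd Q F.
have W i f : gen b f -> gen b (fun s => w s i * f s) by apply: gen_mul; exact: gw.
split=> //; apply: (all_gen gg).
have [||||||k1 k2 k3 k4 k5] := solve_jets _ _ _ z (W 5%N _ q1) (W 5%N _ q2) _ _ (W 4%N _ p1) (W 4%N _ p2) (h := fun s => gco (c s)).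
- by move=> s; have [[]] := hB s.
- by move=> s; have [_ _ [a1 a2] *] := hB s; rewrite ?a1 ?a2.
- by move=> s; have [_ _ [a1 a2] *] := hB s; rewrite ?a1 ?a2.
- by move=> s; have [_ [a1 a2] *] := hB s; rewrite ?a1 ?a2.
- by move=> s; have [_ [a1 a2] *] := hB s; rewrite ?a1 ?a2.
- by move=> m a; apply: gg; move: a; rewrite !inE; lia.
suff k6 : forall m, mi m = 0%N -> mj m = 2%N -> gen b (fun s => gco (c s) m).
  by move=> ij; rewrite !inE => /or4P[||| /or3P[]] /eqP->.
pose rhs s := (let f := fco (c s) in let g := gco (c s) in
  w s 4%N * (pdy f P ^+ 2 * pdxx f P - 2 * pdx f P * pdy f P * pdxy f P + pdx f P ^+ 2 * pdyy f P)
   + 2 * pdx f P * pdy f P * co g 1 1 - pdy f P ^+ 2 * (2 * co g 2 0)) * (2 * pdx (fco (c s)) P ^+ 2)^-1.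
apply: (solve_co (v := rhs)) => [s|].
  have [_ _ _ a0 e] := hB s; rewrite /rhs /= -e [2 * _ * _]mulrAC mulrC mulKf //.
  by rewrite mulf_neq0 ?expf_neq0 // pnatr_eq0.
have c2 := gen_const b 2; have c11 := gen_co k5; have c20 := gen_co k3.
have E2 f : gen b f -> gen b (fun s => f s ^+ 2) by exact: gen_exp.
have h0 s : 2 * pdx (fco (c s)) P ^+ 2 != 0.
  by have [_ _ _ a0 _] := hB s; rewrite mulf_neq0 ?expf_neq0 // pnatr_eq0.
exact: (gen_mul (gen_sub (gen_add (W 4%N _ (gen_add (gen_sub (gen_mul (E2 _ p2) p3)
  (gen_mul (gen_mul (gen_mul c2 p1) p2) p4)) (gen_mul (E2 _ p1) p5)))
  (gen_mul (gen_mul (gen_mul c2 p1) p2) c11)) (gen_mul (E2 _ p2) (gen_mul c2 c20)))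
  (gen_inv (gen_mul c2 (E2 _ p1)) h0)).
Qed.

(** If [Df] vanishes at [P] there is no slope at [P]. Two derivatives and a value give three
    coefficients of [f], and value and slope at [Q] give three of [g], against five parameters. *)
Lemma thin_singular1 : (2 <= d1)%N -> (3 <= d2)%N ->
  thin (NFset 0 5 (fun c w => [/\ vals c, pdx (fco c) P = 0, pdy (fco c) P = 0 & pQ c (w 4%N)])).
Proof.
move=> hd1 hd2; apply: (@thin_NF R d1 d2 _ _ [:: (1, 0); (0, 1); (2, 0)]%N [:: (2, 0); (3, 0); (1, 1)]%N) => //;
  [exact: ord_all hd1 _|exact: ord_all hd2 _|].
move=> S T b c w hB gf gg gw; have z := gen_const b 0.
have F : forall m, gen b (fun s => fco (c s) m).
  have h10 : forall m, mi m = 1%N -> mj m = 0%N -> gen b (fun s => fco (c s) m).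
    by apply: (solve_co (h := fun s => fco (c s)) _ z) => s; rewrite -pdx_P; have [] := hB s.
  have h01 : forall m, mi m = 0%N -> mj m = 1%N -> gen b (fun s => fco (c s) m).
    by apply: (solve_co (h := fun s => fco (c s)) _ z) => s; rewrite -pdy_P; have [] := hB s.
  apply: (all_gen gf) => ij; rewrite !inE => /or3P[] /eqP-> //; apply: (solve_val (i := 2) (h := fun s => fco (c s)) _ z isT) => [s|m a1 a2].
    by have [[]] := hB s.
  case: (eqVneq (mi m) 1%N) => a3; first exact: h10.
  by apply: gf; rewrite !inE !xpair_eqE; lia.
have [q1 q2 _ _ _] := gen_pd Q F.
have W f : gen b f -> gen b (fun s => w s 4%N * f s) by apply: gen_mul; exact: gw.
split=> //; apply: (all_gen gg).
have [||||k3 k4 k5] := solve_low _ _ _ z (W _ q1) (W _ q2) (h := fun s => gco (c s)).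
- by move=> s; have [[]] := hB s.
- by move=> s; have [_ _ _ [a1 a2]] := hB s; rewrite ?a1 ?a2.
- by move=> s; have [_ _ _ [a1 a2]] := hB s; rewrite ?a1 ?a2.
- by move=> m _; exact: gg.
by move=> ij; rewrite !inE => /or3P[] /eqP->.
Qed.

(** [Df] vanishing at both points gives four coefficients of [f], and the equal values give one of
    [g]; there are no parameters beyond the four of the affine change. *)
Lemma thin_singular2 : (2 <= d1)%N -> (2 <= d2)%N ->
  thin (NFset 0 4 (fun c w => [/\ vals c, pdx (fco c) P = 0, pdy (fco c) P = 0 & pdy (fco c) Q = 0])).
Proof.
move=> hd1 hd2; apply: (@thin_NF R d1 d2 _ _ [:: (1, 0); (0, 1); (2, 0); (1, 1)]%N [:: (2, 0)]%N) => //;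
  [exact: ord_all hd1 _|exact: ord_all hd2 _|].
move=> S T b c w hB gf gg gw; have z := gen_const b 0.
have h10 : forall m, mi m = 1%N -> mj m = 0%N -> gen b (fun s => fco (c s) m).
  by apply: (solve_co (h := fun s => fco (c s)) _ z) => s; rewrite -pdx_P; have [] := hB s.
have h01 : forall m, mi m = 0%N -> mj m = 1%N -> gen b (fun s => fco (c s) m).
  by apply: (solve_co (h := fun s => fco (c s)) _ z) => s; rewrite -pdy_P; have [] := hB s.
split.
  apply: (all_gen gf) => ij; rewrite !inE => /or4P[] /eqP-> //.
    apply: (solve_val (i := 2) (h := fun s => fco (c s)) _ z isT) => [s|m a1 a2]; first by have [[]] := hB s.
    case: (eqVneq (mi m) 1%N) => a3; first exact: h10.
    by apply: gf; rewrite !inE !xpair_eqE; lia.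
  apply: (solve_yQ (h := fun s => fco (c s)) _ z) => [s|m a1 a2]; first by have [] := hB s.
  case: (eqVneq (mi m) 0%N) => a3; first exact: h01.
  by apply: gf; rewrite !inE !xpair_eqE; lia.
apply: (all_gen gg) => ij; rewrite inE => /eqP->; apply: (solve_val (i := 2) (h := fun s => gco (c s)) _ z isT) => [s|m a1 a2].
  by have [[]] := hB s.
by apply: gg; rewrite !inE xpair_eqE; lia.
Qed.
End Generic.

(** * Thinness of the degenerate maps for degrees at least (2, 3) *)

Section BadHigh.
Variable R : realType.
Local Notation C := (R[i]).
Local Notation pt := ('I_2 -> C).
Local Notation o0 := (@ord0 1).
Local Notation o1 := (@ord_max 1).
Local Notation P := (fun _ : 'I_2 => 0 : C).
Local Notation Q := (vec2 1 0 : pt).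

Definition bad d1 d2 (c : Omega d1 d2 -> C) := exists p q : pt, [/\ p <> q, zero_pair c p q & ~ good_pair c p q].

Lemma zero_pair_sym d1 d2 (c : Omega d1 d2 -> C) p q : zero_pair c p q -> zero_pair c q p.
Proof. by case=> h1 h2 h3; split. Qed.

Lemma bad_cases d1 d2 (c : Omega d1 d2 -> C) p q : zero_pair c p q -> ~ good_pair c p q ->
  [\/ Df c p = (fun=> 0), Df c q = (fun=> 0) |
    (Df c p <> (fun=> 0) /\ Df c q <> (fun=> 0)) /\ [\/ wedge (DJ c p) (Df c p) = 0, wedge (DJ c q) (Df c q) = 0 |
     exists k, Dg c p = (fun i => k * Df c p i) /\ Dg c q = (fun i => k * Df c q i)]].
Proof.
move=> zp ng; case: (pselect (Df c p = (fun=> 0))) => h1; first by constructor 1.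
case: (pselect (Df c q = (fun=> 0))) => h2; first by constructor 2.
constructor 3; split=> //; case: (pselect (wedge (DJ c p) (Df c p) = 0)) => h3; first by constructor 1.
case: (pselect (wedge (DJ c q) (Df c q) = 0)) => h4; first by constructor 2.
constructor 3; apply: contrapT => h5; apply: ng; exact: good_criterion.
Qed.

Lemma NF_intro d1 d2 tau e t1 m t2 (c c' : Omega d1 d2 -> C) (l : seq C) (B : (Omega d1 d2 -> C) -> (nat -> C) -> Prop) :
  (forall x, Fmap c x = Fmap c' (aff tau e t1 m t2 x)) -> B c' (nth 0 [:: e, t1, m, t2 & l]) ->
  NFset 0 (size l).+4 B c.
Proof. by move=> hc hB; exists tau, c', [:: e, t1, m, t2 & l]; split; [|exact: hB|exact: hc]. Qed.

Section NormalForm.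
Variables (d1 d2 : nat) (c : Omega d1 d2 -> C) (p q : pt).
Hypothesis zp : zero_pair c p q.

Lemma normal_form : p <> q -> exists tau (e t1 m t2 : C) (c' : Omega d1 d2 -> C),
  [/\ e != 0, aff tau e t1 m t2 p = P, aff tau e t1 m t2 q = Q,
     forall x, Fmap c x = Fmap c' (aff tau e t1 m t2 x) & zero_pair c' P Q].
Proof.
move=> pq; have [tau [e [t1 [m [t2 [e0 h1 h2]]]]]] := normalize pq.
have [c' hc] := pullback c tau t1 m t2 e0; exists tau, e, t1, m, t2, c'.
have zp' := zero_pair_aff e0 hc zp; rewrite h1 h2 in zp'.
by split; [exact: e0|exact: h1|exact: h2|exact: hc|exact: zp'].
Qed.
End NormalForm.

Lemma covec0 tau e m : covec tau e m (fun=> 0) = (fun=> 0) :> pt.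
Proof. by rewrite /covec; case: tau; apply: funext; apply: I2P; rewrite /vec2 /= ?mulr0 ?subr0. Qed.

Lemma vals_zero_pair d1 d2 (c : Omega d1 d2 -> C) : zero_pair c P Q -> vals c.
Proof.
move=> [_ _ e]; split; apply/eqP; rewrite subr_eq0; apply/eqP; apply: esym.
  exact: (congr1 (fun u => u o0) e).
exact: (congr1 (fun u => u o1) e).
Qed.

Lemma prop_P d1 d2 (c : Omega d1 d2 -> C) k : Dg c P = (fun i => k * Df c P i) -> pP c k.
Proof. by move=> e; split; [exact: (congr1 (fun u => u o0) e)|exact: (congr1 (fun u => u o1) e)]. Qed.
Lemma prop_Q d1 d2 (c : Omega d1 d2 -> C) k : Dg c Q = (fun i => k * Df c Q i) -> pQ c k.
Proof. by move=> e; split; [exact: (congr1 (fun u => u o0) e)|exact: (congr1 (fun u => u o1) e)]. Qed.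

Lemma cusp_eq d1 d2 (c : Omega d1 d2 -> C) k : pP c k -> wedge (DJ c P) (Df c P) = 0 -> Ueq c k.
Proof.
move=> [e1 e2] h; rewrite /Ueq /=.
rewrite -[2 * co (gco c) 0 2]pdyy_P -[2 * co (gco c) 2 0]pdxx_P -[co (gco c) 1 1]pdxy_P.
apply/eqP; rewrite -subr_eq0 -oppr_eq0 -[X in _ == X]h /wedge /DJ /Df /vec2 /= e1 e2; apply/eqP.
move: (pdx _ _) (pdy _ _) (pdxx _ _) (pdxy _ _) (pdyy _ _) (pdxx _ _) (pdxy _ _) (pdyy _ _) => *; ring.
Qed.

Lemma bad_high d1 d2 : (2 <= d1)%N -> (3 <= d2)%N -> thin (@bad d1 d2).
Proof.
move=> hd1 hd2.
have T5 := thin_or (thin_or (@thin_same_slope R d1 d2 hd1 hd2) (@thin_flat R d1 d2 hd1 hd2))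
  (thin_or (@thin_cusp R d1 d2 hd1 hd2) (thin_or (@thin_singular1 R d1 d2 hd1 hd2) (@thin_singular2 R d1 d2 hd1 (ltnW hd2)))).
apply: thin_sub T5 => c; set UU := (X in bad c -> X) => -[p0 [q0 [pq0 zp0 ng]]].
(* [K] treats degeneracies located at [p] or at the whole pair; those at [q] follow by exchanging
   the two points. *)
have K p q : p <> q -> zero_pair c p q -> Df c p = (fun=> 0) \/ (Df c p <> (fun=> 0) /\ Df c q <> (fun=> 0)) /\
   (wedge (DJ c p) (Df c p) = 0 \/ exists k, Dg c p = (fun i => k * Df c p i) /\ Dg c q = (fun i => k * Df c q i)) -> UU; last first.
  have [h|h|[h [h1|h1|h1]]] := bad_cases zp0 ng.
  - by apply: (K p0 q0) => //; left.
  - by apply: (K q0 p0) => //; [exact: nesym|exact: zero_pair_sym|left].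
  - by apply: (K p0 q0) => //; right; split=> //; left.
  - by apply: (K q0 p0); [exact: nesym|exact: zero_pair_sym|right; split; [case: h|left]].
  - by apply: (K p0 q0) => //; right; split=> //; right.
move=> pq zp hh; have [tau [e [t1 [m [t2 [c' [e0 Ap Aq hc zp']]]]]]] := normal_form zp pq.
have v := vals_zero_pair zp'; have [JP JQ _] := zp'.
have kQ : Df c' Q <> (fun=> 0) -> exists k, pQ c' k.
  move=> h; have [k ek] := proportional (etrans (esym (JacE c' Q)) JQ) h.
  by exists k; exact: prop_Q.
case: hh => [h0|[[h1 h2] h3]].
  have := Df_aff0 e0 hc h0; rewrite Ap => D0.
  have x0 : pdx (fco c') P = 0 by exact: (congr1 (fun u => u o0) D0).
  have y0 : pdy (fco c') P = 0 by exact: (congr1 (fun u => u o1) D0).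
  right; right; case: (pselect (Df c' Q = (fun=> 0))) => [D1|/kQ[k hk]].
    right; apply: (NF_intro (l := [::]) hc); split; [exact: v|exact: x0|exact: y0|].
    exact: (congr1 (fun u => u o1) D1).
  by left; apply: (NF_intro (l := [:: k]) hc); split; [exact: v|exact: x0|exact: y0|exact: hk].
have D1 : Df c' P <> (fun=> 0).
  by move=> h; apply: h1; rewrite (Df_aff hc) Ap h covec0.
have D2 : Df c' Q <> (fun=> 0).
  by move=> h; apply: h2; rewrite (Df_aff hc) Aq h covec0.
case: h3 => [U0|[k [k1 k2]]]; last first.
  left; left; apply: (NF_intro (l := [:: k]) hc); split; first exact: v.
    by apply: prop_P; have := prop_aff e0 hc k1; rewrite Ap.
  by apply: prop_Q; have := prop_aff e0 hc k2; rewrite Aq.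
have [k ek] := proportional (etrans (esym (JacE c' P)) JP) D1; have {}ek := prop_P ek.
have [l hl] := kQ D2.
have := U_aff0 e0 hc U0; rewrite Ap => {}U0.
have hU := cusp_eq ek U0; case: (eqVneq (pdx (fco c') P) 0) => a0.
  by left; right; apply: (NF_intro (l := [:: k; l]) hc); split; [exact: v|exact: ek|exact: hl|exact: a0].
by right; left; apply: (NF_intro (l := [:: k; l]) hc); split; [exact: v|exact: ek|exact: hl|exact: a0|exact: hU].
Qed.

Lemma thin_polyfun (I : finType) (D : (I -> C) -> C) v : polyfun D -> D v != 0 -> thin (fun c => D c = 0).
Proof.
move=> hD hv; have [F hF] := polyfun_mpoly hD; exists F => [|c]; last by rewrite hF.
by apply: contraNneq hv => e; rewrite hF e /ev_fin meval0.
Qed.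

(** Exchanging [f] and [g] changes the sign of the Jacobian and permutes the clauses of [good_pair],
    which reduces the degrees to [d1 <= d2]. *)
Lemma thin_swap d1 d2 : thin (@bad d2 d1) -> thin (@bad d1 d2).
Proof.
pose sw (c : Omega d1 d2 -> C) : Omega d2 d1 -> C := fun o => match o with inl m => c (inr m) | inr m => c (inl m) end.
move=> [F F0 hF]; have [v hv] := ev_fin_nonvanish F0.
pose ws (c : Omega d2 d1 -> C) : Omega d1 d2 -> C := fun o => match o with inl m => c (inr m) | inr m => c (inl m) end.
have swK : sw (ws v) = v by apply: funext => -[].
have := @thin_polyfun _ (fun c => ev_fin F (sw c)) (ws v); rewrite swK => h.
apply: (thin_sub _ (h _ hv)) => [c [p [q [pq [Jp Jq e] ng]]]|]; last first.
  apply: (polyfun_meval F (f := fun k c => sw c (enum_val k))) => k.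
  by rewrite /sw; case: (enum_val k) => m; exact: polyfun_coord.
apply: hF; have JE x : Jac (sw c) x = - Jac c x by rewrite /Jac /fco /gco /=; ring.
have DE x : DJ (sw c) x = (fun i => - DJ c x i).
  by apply: funext; apply: I2P; rewrite /DJ /vec2 /fco /gco /=; ring.
have wN (A B : pt) : wedge (fun i => - A i) B = - wedge A B by rewrite /wedge; ring.
exists p, q; split; first exact: pq.
  split; [by rewrite JE Jp oppr0|by rewrite JE Jq oppr0|]; apply: funext; apply: I2P.
    exact: (congr1 (fun u => u o1) e).
  exact: (congr1 (fun u => u o0) e).
have W1 x : wedge (DJ (sw c) x) (Df (sw c) x) = - wedge (DJ c x) (Dg c x) by rewrite DE; exact: wN.
have W2 x : wedge (DJ (sw c) x) (Dg (sw c) x) = - wedge (DJ c x) (Df c x) by rewrite DE; exact: wN.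
move=> [t1 t2]; apply: ng; rewrite /transv (W1 p) (W2 q) (W2 p) (W1 q) !mulrNN eq_sym in t1.
by rewrite (W1 p) (W1 q) (W2 p) (W2 q) !oppr_eq0 in t2; split; [exact: t1|case: t2; [right|left]].
Qed.
End BadHigh.

(** * Low degrees: affine maps and one affine component *)

Section LowDegree.
Variable R : realType.
Local Notation C := (R[i]).
Local Notation pt := ('I_2 -> C).
Local Notation o0 := (@ord0 1).
Local Notation o1 := (@ord_max 1).
Local Notation P := (fun _ : 'I_2 => 0 : C).
Local Notation Q := (vec2 1 0 : pt).

Lemma coE d (h : mon d -> C) m : co h (mi m) (mj m) = h m.
Proof.
rewrite /co (bigD1 m) //= !eqxx mulr1 big1 ?addr0 // => m' ne.
case: (boolP (_ && _)) => [/andP[/eqP a /eqP a']|_]; last by rewrite mulr0.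
by rewrite (mon_eq a a') eqxx in ne.
Qed.

Lemma axis_coeff d (h : mon d -> C) a : (forall X, peval h (vec2 X 0) = a) ->
  forall m, mj m = 0%N -> mi m != 0%N -> h m = 0.
Proof.
move=> H0 m0 j0 i0; pose F : {poly C} := (\sum_(m | mj m == 0%N) h m *: 'X^(mi m)) - a%:P.
have FE X : F.[X] = 0.
  rewrite /F hornerD hornerN hornerC horner_sum -(H0 X) pevalE big_mkcond /=; apply/eqP; rewrite subr_eq0; apply/eqP.
  apply: eq_bigr => m _; rewrite /vec2 /= zexp; case: eqP => _; last by rewrite mulr0.
  by rewrite hornerZ hornerXn mulr1.
have F0 : F = 0.
  apply: (@roots_geq_poly_eq0 _ F (mkseq (fun i => i%:R) (size F))); last by rewrite size_mkseq.
    by apply/allP => x _; rewrite /root FE.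
  by apply: mkseq_uniq => i j /eqP; rewrite eqr_nat => /eqP.
have := congr1 (fun p : {poly C} => p`_(mi m0)) F0; rewrite coefB coefC (negPf i0) subr0 coef0 coef_sum.
rewrite (bigD1 m0) ?j0 //= coefZ coefXn eqxx mulr1 big1 ?addr0 // => m /andP[/eqP jm ne].
rewrite coefZ coefXn; case: eqP => [e|_]; last by rewrite mulr0.
by rewrite (@mon_eq _ m m0) ?eqxx // in ne; congruence.
Qed.

Definition on_axis d1 d2 (c : Omega d1 d2 -> C) (w : nat -> C) :=
  (forall m : mon d1, mj m = 0%N -> mi m != 0%N -> fco c m = 0) /\
  (forall m : mon d2, mj m = 0%N -> mi m != 0%N -> gco c m = 0).

(** Maps that are constant on some line. The line has two parameters, and once it is the x-axis,
    three coefficients vanish: that of [x] in [f] and those of [x] and [x^2] in [g]. *)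
Lemma thin_line d1 d2 : (1 <= d1)%N -> (2 <= d2)%N -> thin (NFset 2 2 (@on_axis d1 d2)).
Proof.
move=> hd1 hd2; apply: (@thin_NF R d1 d2 _ _ [:: (1, 0)]%N [:: (1, 0); (2, 0)]%N) => //;
  [exact: ord_all hd1 _|exact: ord_all hd2 _|].
move=> S T b c w hB gf gg gw; split.
  apply: (all_gen gf) => ij; rewrite inE => /eqP-> m a1 a2.
  by apply: gen_ext (gen_const b 0) => s; rewrite (hB s).1 ?a1.
apply: (all_gen gg) => ij; rewrite !inE => /orP[] /eqP-> m a1 a2;
by apply: gen_ext (gen_const b 0) => s; rewrite (hB s).2 ?a1.
Qed.

(** Constancy on the axis survives an affine reparametrisation of the axis, so [e] and [t1] can be
    normalised and only two parameters remain. *)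
Lemma line_memb d1 d2 (c c' : Omega d1 d2 -> C) tau e t1 m t2 :
  (forall x, Fmap c x = Fmap c' (aff tau e t1 m t2 x)) ->
  (forall X, Fmap c' (vec2 X 0) = Fmap c' P) -> NFset 2 2 (@on_axis d1 d2) c.
Proof.
move=> hc hX; have [c2 h2] := pullback c tau 0 m t2 (oner_neq0 _).
have K X : Fmap c2 (vec2 X 0) = Fmap c' P.
  pose x : pt := if tau then vec2 X (m * X - t2) else vec2 (m * X - t2) X.
  have e1 : aff tau 1 0 m t2 x = vec2 X 0.
    by rewrite /aff /x; case: (tau); apply: funext; apply: I2P; rewrite /vec2 /=; ring.
  have e2 : aff tau e t1 m t2 x = vec2 (e * X + t1) 0.
    by rewrite /aff /x; case: (tau); apply: funext; apply: I2P; rewrite /vec2 /=; ring.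
  by rewrite -e1 -h2 hc e2 hX.
exists tau, c2, [:: m; t2]; split; [by []| |exact: h2].
split; [apply: (@axis_coeff _ _ (peval (fco c') P)) => X|apply: (@axis_coeff _ _ (peval (gco c') P)) => X].
  exact: (congr1 (fun u => u o0) (K X)).
exact: (congr1 (fun u => u o1) (K X)).
Qed.

Lemma peval_axis d (h : mon d -> C) X : (forall m, mj m = 0%N -> mi m != 0%N -> h m = 0) ->
  peval h (vec2 X 0) = peval h P.
Proof.
move=> H0; rewrite !pevalE; apply: eq_bigr => m _; rewrite /vec2 /= !zexp.
case: (eqVneq (mj m) 0%N) => j0; last by rewrite !mulr0.
by case: (eqVneq (mi m) 0%N) => i0; [rewrite i0 expr0|rewrite H0 // !mul0r].
Qed.

Lemma axis_memb d1 d2 (c c' : Omega d1 d2 -> C) tau e t1 m t2 :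
  (forall x, Fmap c x = Fmap c' (aff tau e t1 m t2 x)) ->
  on_axis c' (fun=> 0) -> NFset 2 2 (@on_axis d1 d2) c.
Proof.
move=> hc [h1 h2]; apply: (line_memb hc) => X; apply: funext; apply: I2P; exact: peval_axis.
Qed.

Section Linear.
Variable (h : mon 1 -> C).
Lemma lin_pdx x : pdx h x = co h 1 0.
Proof.
apply: eq_bigr => m _; have := mon_deg m; rewrite -/(mi m) -/(mj m) -!mulrA => dm; congr (_ * _).
by move: dm; case: (mi m) (mj m) => [|[|i]] [|j] // _; rewrite /= ?mul0r ?expr0 ?mulr1.
Qed.
Lemma lin_pdy x : pdy h x = co h 0 1.
Proof.
apply: eq_bigr => m _; have := mon_deg m; rewrite -/(mi m) -/(mj m) -!mulrA => dm; congr (_ * _).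
by move: dm; case: (mi m) (mj m) => [|[|i]] [|[|j]] // _; rewrite /= ?mul0r ?expr0 ?mulr1.
Qed.
Lemma lin_val : peval h Q - peval h P = co h 1 0.
Proof.
rewrite val_PQ; apply: eq_bigr => m _; congr (_ * _); have := mon_deg m.
by case: (mi m) (mj m) => [|[|i]] [|j].
Qed.
Lemma lin_pdxx x : pdxx h x = 0.
Proof.
apply: big1 => m _; have := mon_deg m; rewrite -/(mi m) -/(mj m) -!mulrA.
by case: (mi m) => [|[|i]] // _; rewrite /= ?mul0r ?mulr0.
Qed.
End Linear.

(** The Jacobian of an affine map is constant, so a critical point forces the determinant of the
    linear part to vanish. *)
Lemma bad_11 : thin (@bad R 1 1).
Proof.
pose D (c : Omega 1 1 -> C) := co (fco c) 1 0 * co (gco c) 0 1 - co (fco c) 0 1 * co (gco c) 1 0.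
have pf i j : polyfun (fun c : Omega 1 1 -> C => co (fco c) i j).
  by apply: polyfun_sum => m; apply: polyfun_mul; [exact: polyfun_coord|exact: polyfun_const].
have pg i j : polyfun (fun c : Omega 1 1 -> C => co (gco c) i j).
  by apply: polyfun_sum => m; apply: polyfun_mul; [exact: polyfun_coord|exact: polyfun_const].
pose v (o : Omega 1 1) : C := match o with inl m => (mi m == 1%N)%:R | inr m => (mj m == 1%N)%:R end.
have m10 : (1 + 0 <= 1)%N by []. have m01 : (0 + 1 <= 1)%N by [].
have Dp : polyfun D.
  rewrite (_ : D = (fun c => co (fco c) 1 0 * co (gco c) 0 1 + -1 * (co (fco c) 0 1 * co (gco c) 1 0))).
    apply: polyfun_add; first exact: polyfun_mul.
    by apply: polyfun_mul; [exact: polyfun_const|exact: polyfun_mul].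
  by apply: funext => c; rewrite /D mulN1r.
have vE : D v != 0.
  have e1 := coE (fco v) (mkmon m10); have e2 := coE (gco v) (mkmon m01).
  have e3 := coE (fco v) (mkmon m01); rewrite !mi_mk !mj_mk in e1 e2 e3.
  by rewrite /D e1 e2 e3 /fco /gco /v !mi_mk !mj_mk /= mul0r subr0 mulr1 oner_neq0.
apply: (thin_sub _ (thin_polyfun Dp vE)) => c [p [q [_ [Jp _ _] _]]].
by move: Jp; rewrite /Jac !lin_pdx !lin_pdy.
Qed.

Section D1.
Variable d2 : nat.
Local Notation Om := (Omega 1 d2).

(** With [f] affine and equal values at [P] and [Q], the coefficient of [x] in [f] is 0. Criticality
    then means [g_x = 0] at both points, and equal slopes mean equal [g_y]. Five solved coefficients
    stand against four parameters. *)
Lemma thin_1_slope : (3 <= d2)%N -> thin (NFset 0 4 (fun (c : Om -> C) w =>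
  [/\ vals c, pdx (gco c) P = 0, pdx (gco c) Q = 0 & pdy (gco c) Q = pdy (gco c) P])).
Proof.
move=> hd2; apply: (@thin_NF R 1 d2 _ _ [:: (1, 0)]%N [:: (1, 0); (2, 0); (3, 0); (1, 1)]%N) => //; first exact: ord_all hd2 _.
move=> S T b c w hB gf gg gw; have z := gen_const b 0; split.
  apply: (all_gen gf) => ij; rewrite inE => /eqP->.
  by apply: (solve_co (h := fun s => fco (c s)) _ z) => s; have [[e _] _ _ _] := hB s; rewrite -lin_val.
have h10 : forall m, mi m = 1%N -> mj m = 0%N -> gen b (fun s => gco (c s) m).
  by apply: (solve_co (h := fun s => gco (c s)) _ z) => s; rewrite -pdx_P; have [_ e _ _] := hB s.
have h01 : forall m, mi m = 0%N -> mj m = 1%N -> gen b (fun s => gco (c s) m).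
  by move=> m a1 a2; apply: gg; rewrite a1 a2.
have gy : gen b (fun s => pdy (gco (c s)) P).
  by apply: gen_ext (gen_co h01) => s; rewrite pdy_P.
have [||||k1 k2 k3] := solve_low (h := fun s => gco (c s)) _ _ _ z z gy.
- by move=> s; have [[_ e] _ _ _] := hB s.
- by move=> s; have [_ _ e _] := hB s.
- by move=> s; have [_ _ _ e] := hB s.
- move=> m _ a; case: (eqVneq (mi m, mj m) (1, 0)%N) => [[] b1 b2|a3]; first exact: h10.
  by apply: gg; move: a a3; rewrite !inE; lia.
by apply: (all_gen gg) => ij; rewrite !inE => /or4P[] /eqP->.
Qed.

(** The fold condition at [P] fails when [g_xx(P) = 0]. The four conditions concern [g] on the
    x-axis, so all four coefficients of [g] are taken from there, up to that of [x^4]. *)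
Lemma thin_1_cusp : (4 <= d2)%N -> thin (NFset 0 4 (fun (c : Om -> C) w =>
  [/\ vals c, pdx (gco c) P = 0, pdx (gco c) Q = 0 & pdxx (gco c) P = 0])).
Proof.
move=> hd2; apply: (@thin_NF R 1 d2 _ _ [:: (1, 0)]%N [:: (1, 0); (2, 0); (3, 0); (4, 0)]%N) => //; first exact: ord_all hd2 _.
move=> S T b c w hB gf gg gw; have z := gen_const b 0; split.
  apply: (all_gen gf) => ij; rewrite inE => /eqP->.
  by apply: (solve_co (h := fun s => fco (c s)) _ z) => s; have [[e _] _ _ _] := hB s; rewrite -lin_val.
have h10 : forall m, mi m = 1%N -> mj m = 0%N -> gen b (fun s => gco (c s) m).
  by apply: (solve_co (h := fun s => gco (c s)) _ z) => s; rewrite -pdx_P; have [_ e _ _] := hB s.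
have h20 : forall m, mi m = 2%N -> mj m = 0%N -> gen b (fun s => gco (c s) m).
  apply: (solve_co (h := fun s => gco (c s)) _ z) => s; have [_ _ _] := hB s; rewrite pdxx_P => /eqP.
  by rewrite mulf_eq0 pnatr_eq0 => /eqP.
have h40 : forall m, mi m = 4%N -> mj m = 0%N -> gen b (fun s => gco (c s) m).
  apply: (solve_xQ (k := 3) (h := fun s => gco (c s)) _ _ z z isT).
  - by move=> s; have [[_ e] _ _ _] := hB s.
  - by move=> s; have [_ _ e _] := hB s.
  move=> m a1 a2 a3; case: (eqVneq (mi m) 1%N) => b1; first exact: h10.
  case: (eqVneq (mi m) 2%N) => b2; first exact: h20.
  by apply: gg; rewrite !inE !xpair_eqE; lia.
apply: (all_gen gg) => ij; rewrite !inE => /or4P[] /eqP-> //.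
apply: (solve_val (i := 3) (h := fun s => gco (c s)) _ z isT) => [s|m a1 a2]; first by have [[_ e] _ _ _] := hB s.
case: (eqVneq (mi m) 1%N) => b1; first exact: h10.
case: (eqVneq (mi m) 2%N) => b2; first exact: h20.
case: (eqVneq (mi m) 4%N) => b3; first exact: h40.
by apply: gg; rewrite !inE !xpair_eqE; lia.
Qed.

Lemma thin_f10 : thin (fun c : Om -> C => co (fco c) 1 0 = 0).
Proof.
have m10 : (1 + 0 <= 1)%N by [].
apply: (@thin_polyfun R _ (fun c : Om -> C => co (fco c) 1 0) (fun o => if o is inl _ then 1 else 0)).
  by apply: polyfun_sum => m; apply: polyfun_mul; [exact: polyfun_coord|exact: polyfun_const].
by have := coE (fco (fun o : Om => if o is inl _ then 1 else 0 : C)) (mkmon m10); rewrite mi_mk mj_mk => ->; rewrite oner_neq0.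
Qed.

(* Along the x-axis g is a polynomial of degree at most 3 with two equal critical values. *)
Lemma cubic_axis (g : mon d2 -> C) : (d2 <= 3)%N -> peval g Q - peval g P = 0 -> pdx g P = 0 -> pdx g Q = 0 ->
  forall m, mj m = 0%N -> mi m != 0%N -> g m = 0.
Proof.
move=> hd; rewrite val_PQ pdx_P pdx_Q => e0 e1 e2.
have E0 : co g 1 0 + co g 2 0 + co g 3 0 = 0.
  rewrite -[RHS]e0 /co -!big_split; apply: eq_bigr => m _ /=; rewrite -!mulrDr; congr (_ * _).
  have := mon_deg m; case: (mi m) (mj m == 0%N) => [|[|[|[|i]]]] [] /=; rewrite ?addr0 ?add0r //; lia.
have E2 : co g 1 0 + 2 * co g 2 0 + 3 * co g 3 0 = 0.
  rewrite -[RHS]e2 /co !mulr_sumr -!big_split; apply: eq_bigr => m _ /=; rewrite ![_ * (g m * _)]mulrCA -!mulrDr; congr (_ * _).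
  have := mon_deg m; case: (mi m) (mj m == 0%N) => [|[|[|[|i]]]] [] /=; rewrite ?mulr0 ?mulr1 ?addr0 ?add0r //; lia.
have c3 : co g 3 0 = 0.
  have -> : co g 3 0 = (co g 1 0 + 2 * co g 2 0 + 3 * co g 3 0) - 2 * (co g 1 0 + co g 2 0 + co g 3 0) + co g 1 0 by ring.
  by rewrite E0 E2 e1 mulr0 subr0 addr0.
have c2 : co g 2 0 = 0 by move: E0; rewrite e1 c3 add0r addr0.
move=> m j0 i0; rewrite -coE j0; have := mon_deg m; case: (mi m) i0 => [|[|[|[|i]]]] // _ dm; lia.
Qed.

Lemma bad_1 : (2 <= d2)%N -> thin (@bad R 1 d2).
Proof.
move=> hd2.
(* The reduction to conditions on [c'] is common to all [d2]. The thin set [B] differs: two families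
   for [d2 >= 4], maps constant on a line for [d2 <= 3], where [cubic_axis] applies. *)
suff [B TB hB] : exists2 B : (Om -> C) -> Prop, thin B & forall (c c' : Om -> C) tau e t1 m t2, e != 0 ->
    (forall x, Fmap c x = Fmap c' (aff tau e t1 m t2 x)) -> vals c' -> pdx (gco c') P = 0 -> pdx (gco c') Q = 0 ->
    (pdxx (gco c') P = 0 \/ pdy (gco c') Q = pdy (gco c') P) -> B c.
  apply: thin_sub (thin_or thin_f10 TB) => c [p0 [q0 [pq0 zp0 ng]]].
  have Ff x y : Df c x = Df c y by rewrite /Df !lin_pdx !lin_pdy.
  case: (pselect (Df c p0 = (fun=> 0))) => [h0|hn].
    by left; have := congr1 (fun u => u o0) h0; rewrite /Df /vec2 /= lin_pdx.
  right; have K p q : p <> q -> zero_pair c p q -> (wedge (DJ c p) (Df c p) = 0 \/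
     exists k, Dg c p = (fun i => k * Df c p i) /\ Dg c q = (fun i => k * Df c q i)) -> B c; last first.
    have [h|h|[_ [h1|h1|h1]]] := bad_cases zp0 ng; first by case: hn.
    - by case: hn; rewrite (Ff p0 q0).
    - by apply: (K p0 q0 pq0 zp0); left.
    - by apply: (K q0 p0 (nesym pq0) (zero_pair_sym zp0)); left.
    - by apply: (K p0 q0 pq0 zp0); right.
  move=> pq zp hh; have [tau [e [t1 [m [t2 [c' [e0 Ap Aq hc zp']]]]]]] := normal_form zp pq.
  have v := vals_zero_pair zp'; have [JP JQ _] := zp'.
  have f0 : co (fco c') 1 0 = 0 by have [] := v; rewrite lin_val.
  have b0 : co (fco c') 0 1 != 0.
    apply/eqP => b0; apply: hn; rewrite (Ff p0 p) (Df_aff hc) Ap.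
    have -> : Df c' P = (fun=> 0) by apply: funext; apply: I2P; rewrite /Df /vec2 /= ?lin_pdx ?lin_pdy.
    exact: covec0.
  have gP : pdx (gco c') P = 0.
    by move: JP; rewrite /Jac lin_pdx lin_pdy f0 mul0r sub0r => /eqP; rewrite oppr_eq0 mulf_eq0 (negPf b0) => /eqP.
  have gQ : pdx (gco c') Q = 0.
    by move: JQ; rewrite /Jac lin_pdx lin_pdy f0 mul0r sub0r => /eqP; rewrite oppr_eq0 mulf_eq0 (negPf b0) => /eqP.
  apply: (hB c c' tau e t1 m t2 e0 hc v gP gQ); case: hh => [U0|[k [k1 k2]]].
    left; have := U_aff0 e0 hc U0; rewrite Ap /wedge /DJ /Df /vec2 /= lin_pdx lin_pdy lin_pdxx f0 gP.
    rewrite !mul0r !mulr0 !add0r subr0 => /eqP; rewrite mulf_eq0 (negPf b0) orbF oppr_eq0 mulf_eq0 (negPf b0).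
    by move/eqP.
  right; have [_ y1] := prop_P (etrans (congr1 (Dg c') (esym Ap)) (etrans (prop_aff e0 hc k1) (congr1 (fun x i => k * Df c' x i) Ap))).
  have [_ y2] := prop_Q (etrans (congr1 (Dg c') (esym Aq)) (etrans (prop_aff e0 hc k2) (congr1 (fun x i => k * Df c' x i) Aq))).
  by rewrite y1 y2 !lin_pdy.
case: (leqP 4 d2) => hd.
  exists (fun c => NFset 0 4 (fun (c : Om -> C) w => [/\ vals c, pdx (gco c) P = 0, pdx (gco c) Q = 0 & pdy (gco c) Q = pdy (gco c) P]) c \/
     NFset 0 4 (fun (c : Om -> C) w => [/\ vals c, pdx (gco c) P = 0, pdx (gco c) Q = 0 & pdxx (gco c) P = 0]) c).
    exact: thin_or (thin_1_slope (ltnW hd)) (thin_1_cusp hd).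
  move=> c c' tau e t1 m t2 e0 hc v gP gQ [h|h].
    by right; apply: (NF_intro (l := [::]) hc); split; [exact: v|exact: gP|exact: gQ|exact: h].
  by left; apply: (NF_intro (l := [::]) hc); split; [exact: v|exact: gP|exact: gQ|exact: h].
exists (NFset 2 2 (@on_axis 1 d2)); first exact: thin_line.
move=> c c' tau e t1 m t2 e0 hc v gP gQ _; apply: (axis_memb hc); split; last first.
  by apply: cubic_axis gP gQ; [exact: hd|exact: v.2].
move=> m' j0 i0; rewrite -coE j0; have f0 : co (fco c') 1 0 = 0 by have [] := v; rewrite lin_val.
by have := mon_deg m'; case: (mi m') i0 => [|[|i]] // _; lia.
Qed.
End D1.
End LowDegree.

(** * Degrees (2, 2) and the general statement *)

Section BadThin.
Variable R : realType.
Local Notation C := (R[i]).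
Local Notation pt := ('I_2 -> C).
Local Notation o0 := (@ord0 1).
Local Notation o1 := (@ord_max 1).
Local Notation P := (fun _ : 'I_2 => 0 : C).
Local Notation Q := (vec2 1 0 : pt).

Section Quadratic.
Variable (h : mon 2 -> C).
Lemma quad_eval x : peval h (vec2 x 0) = co h 0 0 + co h 1 0 * x + co h 2 0 * x ^+ 2.
Proof.
rewrite pevalE /co !mulr_suml -!big_split; apply: eq_bigr => m _ /=; have := mon_deg m.
by rewrite /vec2 /= zexp; case: (mi m) (mj m) => [|[|[|i]]] [|[|[|j]]] //= _; ring.
Qed.
Lemma quad_pdx x : pdx h (vec2 x 0) = co h 1 0 + 2 * co h 2 0 * x.
Proof.
rewrite /co mulr_sumr !mulr_suml -!big_split; apply: eq_bigr => m _ /=; have := mon_deg m.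
rewrite /xc /yc -/(mi m) -/(mj m) /vec2 /= zexp.
by case: (mi m) (mj m) => [|[|[|i]]] [|[|[|j]]] //= _; ring.
Qed.
Lemma quad_pdy x : pdy h (vec2 x 0) = co h 0 1 + co h 1 1 * x.
Proof.
rewrite /co !mulr_suml -!big_split; apply: eq_bigr => m _ /=; have := mon_deg m.
rewrite /xc /yc -/(mi m) -/(mj m) /vec2 /= zexp.
by case: (mi m) (mj m) => [|[|[|i]]] [|[|[|j]]] //= _; ring.
Qed.
End Quadratic.

Local Notation Om := (Omega 2 2).

(** A member [g - k * f] of the pencil reduces to a constant plus a multiple of [y^2]. Four
    parameters, one of them [k], against five solved coefficients. *)
Lemma thin_22_pencil : thin (NFset 1 4 (fun (c : Om -> C) w => [/\ co (fco c) 1 0 = 0, co (gco c) 1 0 = 0,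
  co (gco c) 2 0 = w 3%N * co (fco c) 2 0, co (gco c) 0 1 = w 3%N * co (fco c) 0 1 & co (gco c) 1 1 = w 3%N * co (fco c) 1 1])).
Proof.
apply: (@thin_NF R 2 2 _ _ [:: (1, 0)]%N [:: (1, 0); (2, 0); (0, 1); (1, 1)]%N) => //.
move=> S T b c w hB gf gg gw; have z := gen_const b 0.
have F : forall m, gen b (fun s => fco (c s) m).
  apply: (all_gen gf) => ij; rewrite inE => /eqP->.
  by apply: (solve_co (h := fun s => fco (c s)) _ z) => s; have [] := hB s.
have W i j : gen b (fun s => w s 3%N * co (fco (c s)) i j).
  by apply: gen_mul; [exact: gw|apply: gen_co => m _ _; exact: F].
split=> //; apply: (all_gen gg) => ij; rewrite !inE => /or4P[] /eqP->.
- by apply: (solve_co (h := fun s => gco (c s)) _ z) => s; have [] := hB s.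
- by apply: (solve_co (h := fun s => gco (c s)) _ (W 2 0)%N) => s; have [] := hB s.
- by apply: (solve_co (h := fun s => gco (c s)) _ (W 0 1)%N) => s; have [] := hB s.
- by apply: (solve_co (h := fun s => gco (c s)) _ (W 1 1)%N) => s; have [] := hB s.
Qed.

(** The limiting member of the pencil, where [f] itself is a constant plus a multiple of [y^2]. *)
Lemma thin_22_square : thin (NFset 1 3 (fun (c : Om -> C) w => [/\ co (fco c) 1 0 = 0, co (gco c) 1 0 = 0,
  co (fco c) 2 0 = 0, co (fco c) 0 1 = 0 & co (fco c) 1 1 = 0])).
Proof.
apply: (@thin_NF R 2 2 _ _ [:: (1, 0); (2, 0); (0, 1); (1, 1)]%N [:: (1, 0)]%N) => //.
move=> S T b c w hB gf gg gw; have z := gen_const b 0; split.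
  by apply: (all_gen gf) => ij; rewrite !inE => /or4P[] /eqP->;
  apply: (solve_co (h := fun s => fco (c s)) _ z) => s; have [] := hB s.
apply: (all_gen gg) => ij; rewrite inE => /eqP->.
by apply: (solve_co (h := fun s => gco (c s)) _ z) => s; have [] := hB s.
Qed.

(** With the two points at opposite positions on the x-axis, equal values remove the terms in [x].
    The sum and the difference of the Jacobian conditions at the two points say that [(A, A')] is
    parallel to [(D, D')] and to [(B, B')]. Either a member of the pencil of [f] and [g] has the
    special form above or the map is constant on the axis. *)
Lemma bad_22 : thin (@bad R 2 2).
Proof.
have T3 := thin_or (@thin_line R 2 2 isT isT) (thin_or thin_22_pencil thin_22_square).
apply: thin_sub T3 => c [p [q [pq zp _]]].
have [tau [e [t1 [m [t2 [e0 Ap Aq]]]]]] := normalize pq.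
(* The midpoint of the pair goes to the origin and the scale stays 1: the resulting conditions do
   not involve the distance [2 * hh] of the points, which saves the parameter [e]. *)
pose s := (t1 - 2^-1) / e; pose hh := (2 * e)^-1.
have n2 : (2 : C) != 0 by rewrite pnatr_eq0.
have hh0 : hh != 0 by rewrite invr_eq0 mulf_neq0.
have AE x : aff tau 1 s m t2 x = vec2 ((aff tau e t1 m t2 x o0 - 2^-1) / e) (aff tau e t1 m t2 x o1).
  by rewrite /aff /s; case: (tau); apply: funext; apply: I2P; rewrite /vec2 /=; field.
have Bp : aff tau 1 s m t2 p = vec2 (- hh) 0.
  by rewrite AE Ap; congr vec2; rewrite /hh; field; exact: e0.
have Bq : aff tau 1 s m t2 q = vec2 hh 0.
  by rewrite AE Aq /=; congr vec2; rewrite /hh /vec2 /=; field; exact: e0.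
have [c' hc] := pullback c tau s m t2 (oner_neq0 _).
have := zero_pair_aff (oner_neq0 _) hc zp; rewrite Bp Bq => -[JP JQ eF].
have odd0 (h : mon 2 -> C) : peval h (vec2 (- hh) 0) = peval h (vec2 hh 0) -> co h 1 0 = 0.
  rewrite !quad_eval => /eqP; rewrite -subr_eq0 => /eqP E.
  have : - (2 * hh) * co h 1 0 = 0 by rewrite -[RHS]E; ring.
  by move/eqP; rewrite mulf_eq0 oppr_eq0 (negPf (mulf_neq0 n2 hh0)) => /eqP.
have f1 : co (fco c') 1 0 = 0 by apply: odd0; exact: (congr1 (fun u => u o0) eF).
have g1 : co (gco c') 1 0 = 0 by apply: odd0; exact: (congr1 (fun u => u o1) eF).
move: JP JQ; rewrite /Jac !quad_pdx !quad_pdy f1 g1 !add0r.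
set A := co (fco c') 2 0; set A' := co (gco c') 2 0; set B := co (fco c') 0 1; set B' := co (gco c') 0 1.
set D := co (fco c') 1 1; set D' := co (gco c') 1 1 => JP JQ.
have E1 : A * B' = A' * B.
  have n4 : 4 * hh != 0 by rewrite mulf_neq0 // pnatr_eq0.
  apply: (mulfI n4); apply/eqP; rewrite -subr_eq0; apply/eqP.
  transitivity ((2 * A * hh * (B' + D' * hh) - (B + D * hh) * (2 * A' * hh)) -
     (2 * A * (- hh) * (B' + D' * (- hh)) - (B + D * (- hh)) * (2 * A' * (- hh)))); first by ring.
  by rewrite JP JQ subrr.
have E2 : A * D' = A' * D.
  have n4 : 4 * hh ^+ 2 != 0 by rewrite mulf_neq0 ?expf_neq0 // pnatr_eq0.
  apply: (mulfI n4); apply/eqP; rewrite -subr_eq0; apply/eqP.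
  transitivity ((2 * A * hh * (B' + D' * hh) - (B + D * hh) * (2 * A' * hh)) +
     (2 * A * (- hh) * (B' + D' * (- hh)) - (B + D * (- hh)) * (2 * A' * (- hh)))); first by ring.
  by rewrite JP JQ addr0.
case: (eqVneq A 0) => A0; last first.
  right; left; exists tau, c', [:: s; m; t2; A' / A]; split; [by []| |exact: hc]; split.
  - exact: f1.
  - exact: g1.
  - by rewrite /= -/A -/A'; field.
  - by apply: (mulfI A0); rewrite /= -/B -/B' E1; field.
  - by apply: (mulfI A0); rewrite /= -/D -/D' E2; field.
case: (eqVneq A' 0) => A'0.
  left; apply: (axis_memb hc); split=> m' j0 i0; rewrite -coE j0; have := mon_deg m';
  by case: (mi m') i0 => [|[|[|i]]] // _ dm; lia.
right; right; exists tau, c', [:: s; m; t2]; split; [by []| |exact: hc]; split.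
- exact: f1.
- exact: g1.
- exact: A0.
- by move/eqP: E1; rewrite A0 mul0r eq_sym mulf_eq0 (negPf A'0) => /eqP.
- by move/eqP: E2; rewrite A0 mul0r eq_sym mulf_eq0 (negPf A'0) => /eqP.
Qed.

Theorem bad_thin d1 d2 : (0 < d1)%N -> (0 < d2)%N -> thin (@bad R d1 d2).
Proof.
have le e1 e2 : (0 < e1)%N -> (e1 <= e2)%N -> thin (@bad R e1 e2).
  case: e1 => [//|[|e1]] _ h.
    by case: e2 h => [//|[|e2]] _; [exact: bad_11|exact: bad_1].
  case: (leqP 3 e2) => h3; first exact: bad_high.
  have e20 : e2 = 2%N by lia.
  have e10 : e1 = 0%N by lia.
  by rewrite e20 e10; exact: bad_22.
by move=> h1 h2; case: (leqP d1 d2) => h; [exact: le|apply: thin_swap; apply: le => //; exact: ltnW].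
Qed.
End BadThin.

(** * Nodes and zeros *)

Section Isolated.
Variable R : realType.
Local Notation C := (R[i]).
Local Notation pt := ('I_2 -> C).
Local Notation o0 := (@ord0 1).
Local Notation o1 := (@ord_max 1).

Lemma polyfun_line (f : pt -> C) (a : pt) : polyfun f -> exists N, forall s, exists2 q : {poly C},
  (size q <= N)%N & forall t, f (fun i => a i + vec2 s t i) = q.[t].
Proof.
elim=> [k|i|p q _ [N hN] _ [M hM]|p q _ [N hN] _ [M hM]].
- by exists 1%N => s; exists k%:P => [|t]; rewrite ?hornerC ?size_polyC ?leq_b1.
- exists 2%N => s; move: i; apply: I2P.
    by exists (a o0 + s)%:P => [|t]; rewrite ?hornerC ?size_polyC //; case: eqP.
  exists ((a o1)%:P + 'X) => [|t]; last by rewrite hornerD hornerC hornerX.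
  by apply: leq_trans (size_polyD _ _) _; rewrite geq_max size_polyX size_polyC; case: eqP.
- exists (maxn N M) => s; have [u u1 u2] := hN s; have [v v1 v2] := hM s.
  exists (u + v) => [|t]; last by rewrite u2 v2 hornerD.
  by apply: leq_trans (size_polyD _ _) _; rewrite geq_max !leq_max u1 v1 orbT.
- exists (N + M)%N => s; have [u u1 u2] := hN s; have [v v1 v2] := hM s.
  exists (u * v) => [|t]; last by rewrite u2 v2 hornerM.
  by apply: leq_trans (size_polyMleq _ _) _; apply: leq_trans (leq_pred _) _; exact: leq_add.
Qed.

(** Factor by factor: if [nc t <= rho <= nc r] then [t - r] has modulus at most [2 * nc r]. *)
Lemma poly_growth (q : {poly C}) (rho : R) t : (forall r, root q r -> rho <= nc r) -> nc t <= rho ->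
  nc q.[t] <= 2 ^+ size q * nc q.[0].
Proof.
move=> hr ht; have [rs e] := closed_field_poly_normal q.
case: (eqVneq q 0) => [->|q0]; first by rewrite !horner0 nc0 mulr0.
have sz : size q = (size rs).+1 by rewrite e size_scale ?lead_coef_eq0 // size_prod_XsubC.
have hrs r : r \in rs -> rho <= nc r.
  by move=> h; apply: hr; rewrite e rootZ ?lead_coef_eq0 // root_prod_XsubC.
rewrite sz e !hornerZ !ncM mulrCA ler_wpM2l ?nc_ge0 //.
have K : nc (\prod_(z <- rs) ('X - z%:P)).[t] <= 2 ^+ size rs * nc (\prod_(z <- rs) ('X - z%:P)).[0].
  elim: rs hrs {sz e} => [|r rs IH] hrs; first by rewrite big_nil !hornerC expr0 mul1r.
  rewrite !big_cons !hornerM !ncM /= exprS [2 * _ * _]mulrACA; apply: ler_pM; rewrite ?nc_ge0 //.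
    rewrite !hornerXsubC sub0r ncN; apply: le_trans (ncB _ _) _.
    have -> : 2 * nc r = nc r + nc r by ring.
    by rewrite lerD2r; exact: le_trans ht (hrs r (mem_head _ _)).
  by apply: IH => z hz; apply: hrs; rewrite inE hz orbT.
apply: le_trans K _; rewrite ler_wpM2r ?nc_ge0 // exprS ler_peMl ?exprn_ge0 //.
by rewrite ler1n.
Qed.

Lemma n1_2 (x : pt) : n1 x = nc (x o0) + nc (x o1).
Proof. exact: sum2. Qed.

(** If [a] were isolated, then on the lines with first offset [s], for small nonzero [s], [f] would
    have no zeros with small [t]. By [poly_growth] its value at a fixed [t = ts] would be bounded by
    [2^N] times its value at [t = 0]. The latter tends to 0 with [s], the former to a nonzero
    number. *)
Lemma nonisolated (f : pt -> C) (a : pt) (r : R) : polyfun f -> f a = 0 -> 0 < r ->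
  exists2 x, x <> a & n1 (vsub x a) < r /\ f x = 0.
Proof.
move=> pf fa r0; apply: contrapT => H0.
have hn x : x <> a -> n1 (vsub x a) < r -> f x <> 0.
  by move=> h1 h2 h3; apply: H0; exists x.
pose pz s t : pt := fun i => a i + vec2 s t i.
have nz s t : n1 (vsub (pz s t) a) = nc s + nc t.
  by rewrite n1_2 /vsub /pz /vec2 /= ![a _ + _]addrC !addrK.
have [N hN] := polyfun_line a pf.
pose ts : C := real_complex R (r / 4).
have nts : nc ts = r / 4 by rewrite nc_real ger0_norm // divr_ge0 // ltW.
have f1 : f (pz 0 ts) != 0.
  apply/eqP; apply: hn; last by rewrite nz nc0 nts; lra.
  by move=> /(congr1 (fun u => u o1)) /eqP; rewrite /pz /vec2 /= -subr_eq0 addrC addKr => /eqP/(congr1 (@nc R)) /eqP; rewrite nts nc0 gt_eqF // divr_gt0.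
have z0 : pz 0 0 = a by apply: funext; apply: I2P; rewrite /pz /vec2 /= addr0.
have c1 := ctsat_neq0 (polyfun_cts (pz 0 ts) pf) f1.
pose eta := nc (f (pz 0 ts)) / 2 / 2 ^+ N.
have eta0 : 0 < eta by rewrite !divr_gt0 ?exprn_gt0 // nc_gt0.
have c0 := @polyfun_cts R _ f a pf _ eta0.
have [d1 d10 h1] := c1; have [d2 d20 h2] := c0.
pose d := Num.min (Num.min d1 d2) (r / 2).
have d0 : 0 < d by rewrite !lt_min d10 d20 divr_gt0.
pose s : C := real_complex R (d / 2).
have ns : nc s = d / 2 by rewrite nc_real ger0_norm // divr_ge0 // ltW.
have [sd1 sd2 sr] : [/\ nc s < d1, nc s < d2 & nc s < r / 2].
  have h : nc s < d by rewrite ns; lra.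
  by split; apply: lt_le_trans h _; rewrite /d !ge_min lexx ?orbT.
have k1 : nc (f (pz 0 ts)) / 2 < nc (f (pz s ts)).
  apply: h1; rewrite n1_2 /vsub /pz /vec2 /= subrr nc0 addr0.
  by rewrite addr0 [a o0 + _]addrC addrK.
have k2 : nc (f (pz s 0)) < eta.
  by have := h2 (pz s 0); rewrite nz nc0 addr0 fa subr0; apply.
have [q q1 q2] := hN s.
have rt x : root q x -> r / 4 <= nc x.
  move=> hx; rewrite leNgt; apply/negP => hlt; have : f (pz s x) = 0 by rewrite q2; exact/eqP.
  apply: hn; last by rewrite nz; lra.
  move=> /(congr1 (fun u => u o0)) /eqP; rewrite /pz /vec2 /= -subr_eq0 addrC addKr => /eqP/(congr1 (@nc R)) /eqP.
  by rewrite ns nc0 gt_eqF // divr_gt0.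
have := poly_growth rt (_ : nc ts <= r / 4); rewrite nts => /(_ (lexx _)).
rewrite -!q2 -/(pz s ts) -/(pz s 0) => k3.
have : nc (f (pz s ts)) <= 2 ^+ N * nc (f (pz s 0)).
  apply: le_trans k3 _; rewrite ler_wpM2r ?nc_ge0 // ler_weXn2l // ler1n.
  by [].
have : 2 ^+ N * nc (f (pz s 0)) < nc (f (pz 0 ts)) / 2.
  by rewrite mulrC -ltr_pdivlMr ?exprn_gt0.
move=> l1 l2; have := lt_trans k1 (le_lt_trans l2 l1); by rewrite ltxx.
Qed.
End Isolated.

(** * The square system of a pair of points *)

Section NodeSystem.
Variable R : realType.
Local Notation C := (R[i]).
Local Notation pt := ('I_2 -> C).
Local Notation o0 := (@ord0 1).
Local Notation o1 := (@ord_max 1).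
Local Notation I4 := 'I_(2 + 2).
Local Notation il i := (lshift 2 i : I4).
Local Notation ir i := (rshift 2 i : I4).

Lemma polyfun_pull n (J : finType) (D : (J -> C) -> C) (L : J -> {mpoly C[n]}) : polyfun D ->
  exists p : {mpoly C[n]}, forall z, p.@[z] = D (fun k => (L k).@[z]).
Proof.
elim=> [k|j|p q _ [P hP] _ [Q hQ]|p q _ [P hP] _ [Q hQ]].
- by exists k%:MP => z; rewrite mevalC.
- by exists (L j).
- by exists (P + Q) => z; rewrite mevalD hP hQ.
- by exists (P * Q) => z; rewrite mevalM hP hQ.
Qed.

Lemma hadamard_hat n (p : {mpoly C[n]}) z (h : 'I_n -> {mpoly C[n]}) :
  p - p.@[z]%:MP = \sum_i ('X_i - (z i)%:MP) * h i -> hat (fun x => p.@[x]) z (fun i => (h i).@[z]).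
Proof.
move=> e; have H0 i := hat_mul (hat_sub (hat_coord i z) (hat_const (z i) z)) (hat_mpoly (h i) z).
have := hat_add (hat_const p.@[z] z) (hat_sum (index_enum _) H0); congr hat.
  apply: funext => x; have e1 := congr1 (fun p => p.@[x]) e; rewrite /= mevalB mevalC in e1.
  have e2 : (\sum_i ('X_i - (z i)%:MP) * h i).@[x] = \sum_i (x i - z i) * (h i).@[x].
    by rewrite raddf_sum; apply: eq_bigr => i _; rewrite /= mevalM mevalB mevalXU mevalC.
  by rewrite -[RHS](subrK p.@[z]) e1 e2 addrC.
apply: funext => k; rewrite add0r (bigD1 k) //= eqxx subrr mul0r addr0 subr0 mulr1 big1 ?addr0 // => i.
by rewrite eq_sym => /negPf->; rewrite subr0 mulr0 subrr mul0r addr0.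
Qed.

Lemma sum_lr (V : nmodType) (F : I4 -> V) : \sum_k F k = F (il o0) + F (il o1) + (F (ir o0) + F (ir o1)).
Proof. by rewrite big_split_ord /= !sum2. Qed.

Variables (a b : pt).
(** Coordinates on C^4 centred at (a, b), so that the results on zeros at the origin apply. *)
Definition p1 (z : I4 -> C) : pt := fun i => a i + z (il i).
Definition p2 (z : I4 -> C) : pt := fun i => b i + z (ir i).

Variables (d1 d2 : nat).
Implicit Type c : Omega d1 d2 -> C.

Definition gens c (j : I4) (z : I4 -> C) : C := node_gens c j (join2 (p1 z) (p2 z)).

Lemma polyfun_Jac c : polyfun (Jac c).
Proof.
have [_ a1 a2 _] := polyfun_peval_at (fco c); have [_ b1 b2 _] := polyfun_peval_at (gco c).
rewrite (_ : Jac c = (fun x => pdx (fco c) x * pdy (gco c) x + -1 * (pdy (fco c) x * pdx (gco c) x))).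
  apply: polyfun_add; first exact: polyfun_mul.
  by apply: polyfun_mul; [exact: polyfun_const|exact: polyfun_mul].
by apply: funext => x; rewrite mulN1r.
Qed.

Lemma I4P (Q : I4 -> Prop) : Q (il o0) -> Q (il o1) -> Q (ir o0) -> Q (ir o1) -> forall j, Q j.
Proof.
move=> h1 h2 h3 h4 j; case: (split_ordP j) => k ->; move: k; exact: I2P.
Qed.

Lemma gensE c z : [/\ gens c (il o0) z = Jac c (p1 z), gens c (il o1) z = Jac c (p2 z),
  gens c (ir o0) z = peval (fco c) (p1 z) - peval (fco c) (p2 z) &
  gens c (ir o1) z = peval (gco c) (p1 z) - peval (gco c) (p2 z)].
Proof. by []. Qed.

Lemma gens_mpoly c : exists G : I4 -> {mpoly C[2 + 2]}, forall j z, (G j).@[z] = gens c j z.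
Proof.
pose L1 i : {mpoly C[2 + 2]} := (a i)%:MP + 'X_(il i); pose L2 i : {mpoly C[2 + 2]} := (b i)%:MP + 'X_(ir i).
have E1 z : (fun k => (L1 k).@[z]) = p1 z by apply: funext => i; rewrite mevalD mevalC mevalXU.
have E2 z : (fun k => (L2 k).@[z]) = p2 z by apply: funext => i; rewrite mevalD mevalC mevalXU.
have K D : polyfun D -> (exists p : {mpoly C[2 + 2]}, forall z, p.@[z] = D (p1 z)) /\
   exists p : {mpoly C[2 + 2]}, forall z, p.@[z] = D (p2 z).
  move=> hD; have [p hp] := polyfun_pull L1 hD; have [q hq] := polyfun_pull L2 hD.
  by split; [exists p => z; rewrite hp E1|exists q => z; rewrite hq E2].
have [[J1 hJ1] [J2 hJ2]] := K _ (polyfun_Jac c).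
have [pf _ _ _] := polyfun_peval_at (fco c); have [pg _ _ _] := polyfun_peval_at (gco c).
have [[F1 hF1] [F2 hF2]] := K _ pf; have [[G1 hG1] [G2 hG2]] := K _ pg.
have : forall j, exists p : {mpoly C[2 + 2]}, forall z, p.@[z] = gens c j z.
  apply: I4P; [exists J1 => z|exists J2 => z|exists (F1 - F2) => z|exists (G1 - G2) => z];
  have [e1 e2 e3 e4] := gensE c z; rewrite ?e1 ?e2 ?e3 ?e4 ?mevalB ?hJ1 ?hJ2 ?hF1 ?hF2 ?hG1 ?hG2 //.
by move=> /choice[G hG]; exists G.
Qed.

Lemma gens_zero c z : (forall j, gens c j z = 0) <-> zero_pair c (p1 z) (p2 z).
Proof.
have [e1 e2 e3 e4] := gensE c z; split=> [h|[h1 h2 h3]].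
  split; [by rewrite -e1|by rewrite -e2|apply: funext; apply: I2P].
    by apply/eqP; rewrite -subr_eq0 -[X in _ == X](h (ir o0)) e3.
  by apply/eqP; rewrite -subr_eq0 -[X in _ == X](h (ir o1)) e4.
apply: I4P; rewrite ?e1 ?e2 ?e3 ?e4 //; apply/eqP; rewrite subr_eq0; apply/eqP.
  exact: (congr1 (fun u => u o0) h3).
exact: (congr1 (fun u => u o1) h3).
Qed.

Definition dl (L : pt) : I4 -> C := fun k => \sum_i L i * (k == il i)%:R.
Definition dr (L : pt) : I4 -> C := fun k => \sum_i L i * (k == ir i)%:R.

Lemma hat_p1 (h : pt -> C) z L : hat h (p1 z) L -> hat (fun z => h (p1 z)) z (dl L).
Proof.
move=> hh; have H0 i : hat (fun z => p1 z i) z (fun k => 0 + (k == il i)%:R) := hat_add (hat_const (a i) z) (hat_coord (il i) z).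
by have := hat_comp hh H0; congr hat; apply: funext => k; apply: eq_bigr => i _; rewrite add0r.
Qed.
Lemma hat_p2 (h : pt -> C) z L : hat h (p2 z) L -> hat (fun z => h (p2 z)) z (dr L).
Proof.
move=> hh; have H0 i : hat (fun z => p2 z i) z (fun k => 0 + (k == ir i)%:R) := hat_add (hat_const (b i) z) (hat_coord (ir i) z).
by have := hat_comp hh H0; congr hat; apply: funext => k; apply: eq_bigr => i _; rewrite add0r.
Qed.

Lemma dl_dot L (v : I4 -> C) : \sum_k v k * dl L k = L o0 * v (il o0) + L o1 * v (il o1).
Proof. by rewrite sum_lr /dl !sum2 /=; ring. Qed.
Lemma dr_dot L (v : I4 -> C) : \sum_k v k * dr L k = L o0 * v (ir o0) + L o1 * v (ir o1).
Proof. by rewrite sum_lr /dr !sum2 /=; ring. Qed.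

Lemma split_il i : split (il i) = inl i. Proof. exact: (unsplitK (inl i)). Qed.
Lemma split_ir i : split (ir i) = inr i. Proof. exact: (unsplitK (inr i)). Qed.

Definition Dgens c z (j : I4) : I4 -> C := match split j with
  | inl i => if i == o0 then dl (DJ c (p1 z)) else dr (DJ c (p2 z))
  | inr i => if i == o0 then (fun k => dl (Df c (p1 z)) k - dr (Df c (p2 z)) k)
             else (fun k => dl (Dg c (p1 z)) k - dr (Dg c (p2 z)) k) end.

Lemma hat_gens c z j : hat (gens c j) z (Dgens c z j).
Proof.
move: j; apply: I4P; rewrite /Dgens ?split_il ?split_ir /=.
- exact: (hat_p1 (hat_Jac c (p1 z)) : hat (gens c (il o0)) z _).
- exact: (hat_p2 (hat_Jac c (p2 z)) : hat (gens c (il o1)) z _).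
- exact: (hat_sub (hat_p1 (hat_peval (fco c) (p1 z))) (hat_p2 (hat_peval (fco c) (p2 z))) : hat (gens c (ir o0)) z _).
- exact: (hat_sub (hat_p1 (hat_peval (gco c) (p1 z))) (hat_p2 (hat_peval (gco c) (p2 z))) : hat (gens c (ir o1)) z _).
Qed.

(** The vectors [u] and [w] are tangent to the two critical branches, so their common image [(X, Y)]
    is parallel to [(U, U2)] and to [(V, V2)]. Transversality makes these independent, hence
    [X = Y = 0]; as [(U, U2)] is nonzero, [u] vanishes. *)
Lemma transv_kernel (J f g J' f' g' : pt) (u0 u1 w0 w1 : C) :
  wedge J f * wedge J' g' != wedge J g * wedge J' f' ->
  J o0 * u0 + J o1 * u1 = 0 -> J' o0 * w0 + J' o1 * w1 = 0 ->
  f o0 * u0 + f o1 * u1 = f' o0 * w0 + f' o1 * w1 ->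
  g o0 * u0 + g o1 * u1 = g' o0 * w0 + g' o1 * w1 -> u0 = 0 /\ u1 = 0.
Proof.
rewrite /wedge; move: (J o0) (J o1) (f o0) (f o1) (g o0) (g o1) (J' o0) (J' o1) (f' o0) (f' o1) (g' o0) (g' o1).
move=> j0 j1 f0 f1 g0 g1 k0 k1 h0 h1 l0 l1; set U := j0 * f1 - j1 * f0; set U2 := j0 * g1 - j1 * g0.
set V := k0 * h1 - k1 * h0; set V2 := k0 * l1 - k1 * l0 => tr e1 e2 e3 e4.
set X := f0 * u0 + f1 * u1 in e3; set Y := g0 * u0 + g1 * u1 in e4.
have a1 : j0 * X = U * u1.
  by apply/eqP; rewrite -subr_eq0 -[X in _ == X](mulr0 f0) -e1 /U /X; apply/eqP; ring.
have a2 : j1 * X = - U * u0.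
  by apply/eqP; rewrite -subr_eq0 -[X in _ == X](mulr0 f1) -e1 /U /X; apply/eqP; ring.
have b1 : j0 * Y = U2 * u1.
  by apply/eqP; rewrite -subr_eq0 -[X in _ == X](mulr0 g0) -e1 /U2 /Y; apply/eqP; ring.
have b2 : j1 * Y = - U2 * u0.
  by apply/eqP; rewrite -subr_eq0 -[X in _ == X](mulr0 g1) -e1 /U2 /Y; apply/eqP; ring.
have c1 : k0 * X = V * w1.
  by apply/eqP; rewrite e3 -subr_eq0 -[X in _ == X](mulr0 h0) -e2 /V; apply/eqP; ring.
have c2 : k1 * X = - V * w0.
  by apply/eqP; rewrite e3 -subr_eq0 -[X in _ == X](mulr0 h1) -e2 /V; apply/eqP; ring.
have d1' : k0 * Y = V2 * w1.
  by apply/eqP; rewrite e4 -subr_eq0 -[X in _ == X](mulr0 l0) -e2 /V2; apply/eqP; ring.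
have d2' : k1 * Y = - V2 * w0.
  by apply/eqP; rewrite e4 -subr_eq0 -[X in _ == X](mulr0 l1) -e2 /V2; apply/eqP; ring.
have r1 : U * Y = U2 * X.
  case: (eqVneq j0 0) => z0; last first.
    by apply: (mulfI z0); rewrite mulrCA b1 [RHS]mulrCA a1; ring.
  case: (eqVneq j1 0) => z1; last first.
    by apply: (mulfI z1); rewrite mulrCA b2 [RHS]mulrCA a2; ring.
  by rewrite /U /U2 z0 z1 !mul0r subrr !mul0r.
have r2 : V * Y = V2 * X.
  case: (eqVneq k0 0) => z0; last first.
    by apply: (mulfI z0); rewrite mulrCA d1' [RHS]mulrCA c1; ring.
  case: (eqVneq k1 0) => z1; last first.
    by apply: (mulfI z1); rewrite mulrCA d2' [RHS]mulrCA c2; ring.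
  by rewrite /V /V2 z0 z1 !mul0r subrr !mul0r.
have tr' : U * V2 - U2 * V != 0 by rewrite subr_eq0.
have X0 : X = 0.
  apply: (mulfI tr'); rewrite mulr0 mulrBl; apply/eqP; rewrite subr_eq0; apply/eqP.
  by rewrite -mulrA -r2 mulrCA r1; ring.
have Y0 : Y = 0.
  apply: (mulfI tr'); rewrite mulr0 mulrBl; apply/eqP; rewrite subr_eq0; apply/eqP.
  by rewrite mulrAC r1 -[RHS]mulrA r2; ring.
rewrite X0 Y0 !mulr0 in a1 a2 b1 b2.
case: (eqVneq U 0) => uz.
  have u2z : U2 != 0 by apply: contraNneq tr' => u2z; rewrite uz u2z !mul0r subrr.
  by split; apply: (mulfI u2z); rewrite mulr0; [move/esym/eqP: b2; rewrite mulNr oppr_eq0 => /eqP|rewrite -b1].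
by split; apply: (mulfI uz); rewrite mulr0; [move/esym/eqP: a2; rewrite mulNr oppr_eq0 => /eqP|rewrite -a1].
Qed.

(** The Hadamard quotients take at [z] the values of the partial derivatives. Two applications of
    [transv_kernel] show that this matrix has trivial kernel. *)
Lemma good_nondeg c (G : I4 -> {mpoly C[2 + 2]}) z : (forall j z, (G j).@[z] = gens c j z) ->
  (forall j, (G j).@[z] = 0) -> transv c (p1 z) (p2 z) -> nondeg G z.
Proof.
move=> hG G0 tr; have /choice[T hT] : forall j, exists h : I4 -> {mpoly C[2 + 2]},
    G j - (G j).@[z]%:MP = \sum_i ('X_i - (z i)%:MP) * h i by move=> j; exact: hadamard.
have TE j : (fun k => (T j k).@[z]) = Dgens c z j.
  apply: hat_unique (hadamard_hat (hT j)) _; have := hat_gens c z j; congr hat.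
  by apply: funext => x; rewrite hG.
apply: (@nondeg_mx _ _ _ _ T) => [j|].
  rewrite (_ : \sum_i _ = G j); first exact: inid_gen.
  have := hT j; rewrite G0 mpolyC0 subr0 => ->; by apply: eq_bigr => i _; rewrite mulrC.
rewrite -det_tr; apply/det0P => -[v v0 hv].
have e j : \sum_k v 0 k * Dgens c z j k = 0.
  have := congr1 (fun A : 'rV_ _ => A 0 j) hv; rewrite /= [in RHS]mxE mxE => e5; apply: etrans e5; apply: eq_bigr => k _.
  by rewrite !mxE -(congr1 (fun u => u k) (TE j)).
have := e (il o0); have := e (il o1); have := e (ir o0); have := e (ir o1).
rewrite /Dgens !split_il !split_ir /= dl_dot dr_dot => e4 e3 e2 e1.
have S (A B : pt) : \sum_k v 0 k * (dl A k - dr B k) = A o0 * v 0 (il o0) + A o1 * v 0 (il o1) - (B o0 * v 0 (ir o0) + B o1 * v 0 (ir o1)).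
  by rewrite -dl_dot -dr_dot -sumrB; apply: eq_bigr => k _; rewrite mulrBr.
rewrite !S in e3 e4; move/eqP: e3; move/eqP: e4; rewrite !subr_eq0 => /eqP e4 /eqP e3.
have [u0 u1] := transv_kernel tr e1 e2 e3 e4.
have tr2 : wedge (DJ c (p2 z)) (Df c (p2 z)) * wedge (DJ c (p1 z)) (Dg c (p1 z)) !=
    wedge (DJ c (p2 z)) (Dg c (p2 z)) * wedge (DJ c (p1 z)) (Df c (p1 z)).
  by move: tr; rewrite /transv eq_sym mulrC [X in _ == X]mulrC.
have [w0 w1] := transv_kernel tr2 e2 e1 (esym e3) (esym e4).
by move/eqP: v0; apply; apply/rowP => k; rewrite mxE; move: k; apply: I4P.
Qed.
End NodeSystem.

(** * Counting nodes of generic perturbations *)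

Section Final.
Variable R : realType.
Local Notation C := (R[i]).
Local Notation pt := ('I_2 -> C).
Local Notation o0 := (@ord0 1).
Local Notation o1 := (@ord_max 1).
Local Notation I4 := 'I_(2 + 2).
Local Notation il i := (lshift 2 i : I4).
Local Notation ir i := (rshift 2 i : I4).
Local Notation o := (fun _ : I4 => 0 : C).

Lemma annulus_lower n (g : 'I_n -> {mpoly C[n]}) (rho r1 : R) : 0 < r1 ->
  (forall z, rho <= n1 z <= r1 -> exists i, (g i).@[z] != 0) ->
  exists2 kap : R, 0 < kap & forall z, rho <= n1 z <= r1 -> exists i, kap <= nc (g i).@[z].
Proof.
move=> r10 gsh; pose Q (A : ('I_n -> C) -> Prop) := exists2 kap : R, 0 < kap &
  forall z, A z -> rho <= n1 z <= r1 -> exists i, kap <= nc (g i).@[z].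
have [||||kap k0 hk] := @compact_ball R 'I_n Q (fun=> 0) r1 r10; last first.
- by exists kap => // z hz; apply: hk => //; rewrite n1_sub0; case/andP: hz.
- move=> y; case: (ltP r1 (n1 y)) => h1.
    have [d d0 hd] := far_point h1; exists d => //; exists 1 => // z /hd h2 /andP[_].
    by rewrite leNgt h2.
  case: (ltP (n1 y) rho) => h2.
    exists (rho - n1 y); first by rewrite subr_gt0.
    exists 1 => // z hz /andP[h3 _]; exfalso.
    have h4 := n1_tri y z (fun=> 0); rewrite !n1_sub0 in h4.
    by have : n1 z < n1 z by [lra]; rewrite ltxx.
  have [|i hi] := gsh y; first by rewrite h1 h2.
  have [d d0 hd] := ctsat_neq0 (mpoly_cts (g i) y) hi.
  exists d => //; exists (nc (g i).@[y] / 2); first by rewrite divr_gt0 // nc_gt0.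
  by move=> z /hd h _; exists i; exact: ltW.
- move=> A B [x x0 hx] [y y0 hy]; exists (Num.min x y); first by rewrite lt_min x0.
  by move=> z [h|h] e; [have [i hi] := hx z h e|have [i hi] := hy z h e]; exists i; rewrite ge_min hi ?orbT.
- by exists 1.
- by move=> A B h [kap k0 hk]; exists kap => // z /h; exact: hk.
Qed.

Variables (d1 d2 : nat) (a b : pt).
Local Notation Om := (Omega d1 d2).
Local Notation gn c := (gens a b c).

Lemma polyfun_sub (I : finType) (f g : (I -> C) -> C) : polyfun f -> polyfun g -> polyfun (fun z => f z - g z).
Proof.
move=> hf hg; rewrite (_ : (fun z => _) = (fun z => f z + -1 * g z)); last by apply: funext => z; rewrite mulN1r.
by apply: polyfun_add => //; apply: polyfun_mul => //; exact: polyfun_const.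
Qed.

Lemma joint_polyfun j : polyfun (fun y : (Om + I4)%type -> C => gn (fun k => y (inl k)) j (fun k => y (inr k))).
Proof.
pose X := (Om + I4)%type.
have K (q : (X -> C) -> pt) d (h : (X -> C) -> mon d -> C) : (forall i, polyfun (fun y => q y i)) -> (forall m, polyfun (fun y => h y m)) ->
    [/\ polyfun (fun y => peval (h y) (q y)), polyfun (fun y => pdx (h y) (q y)) & polyfun (fun y => pdy (h y) (q y))].
  move=> hq hh; split; [apply: (polyfun_monomials (k := fun m y => h y m))|
    apply: (polyfun_monomials (k := fun m y => h y m * ((val m).1 : nat)%:R))|
    apply: (polyfun_monomials (k := fun m y => h y m * ((val m).2 : nat)%:R))]; try exact: hq; move=> m //;
  by apply: polyfun_mul; [exact: hh|exact: polyfun_const].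
have q1 i : polyfun (fun y : X -> C => p1 a (fun k => y (inr k)) i).
  by apply: polyfun_add; [exact: polyfun_const|exact: polyfun_coord].
have q2 i : polyfun (fun y : X -> C => p2 b (fun k => y (inr k)) i).
  by apply: polyfun_add; [exact: polyfun_const|exact: polyfun_coord].
have hf m : polyfun (fun y : X -> C => fco (fun k => y (inl k)) m) by exact: polyfun_coord.
have hg m : polyfun (fun y : X -> C => gco (fun k => y (inl k)) m) by exact: polyfun_coord.
have [f1 f1x f1y] := K _ _ _ q1 hf; have [f2 f2x f2y] := K _ _ _ q2 hf.
have [g1 g1x g1y] := K _ _ _ q1 hg; have [g2 g2x g2y] := K _ _ _ q2 hg.
move: j; apply: I4P.
- exact: polyfun_sub (polyfun_mul f1x g1y) (polyfun_mul f1y g1x).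
- exact: polyfun_sub (polyfun_mul f2x g2y) (polyfun_mul f2y g2x).
- exact: polyfun_sub f1 f2.
- exact: polyfun_sub g1 g2.
Qed.

(** Joint continuity in the coefficients and the point becomes uniform in the point by compactness
    of the ball. *)
Lemma uniform_close (c : Om -> C) (r1 kap : R) : 0 < r1 -> 0 < kap ->
  near c (fun c' => forall z, n1 z <= r1 -> forall j, nc (gn c' j z - gn c j z) <= kap).
Proof.
move=> r10 k0; pose Q (A : (I4 -> C) -> Prop) := near c (fun c' => forall z, A z -> forall j, nc (gn c' j z - gn c j z) <= kap).
suff H0 : Q (fun z => n1 (vsub z (fun=> 0)) <= r1).
  by apply: near_imp H0 _ => c' h z hz; apply: h; rewrite n1_sub0.
apply: compact_ball r10 _ _ _ _; last first.
- move=> y; pose D j (x : (Om + I4)%type -> C) := gn (fun k => x (inl k)) j (fun k => x (inr k)).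
  pose x0 (k : (Om + I4)%type) : C := match k with inl k => c k | inr k => y k end.
  have k20 : 0 < kap / 2 by rewrite divr_gt0.
  have [d d0 hd] := near_all (fun j => @polyfun_cts R _ (D j) x0 (joint_polyfun j) _ k20).
  exists (d / 2); first by rewrite divr_gt0.
  exists (d / 2); first by rewrite divr_gt0.
  have key c' z : n1 (vsub c' c) < d / 2 -> n1 (vsub z y) < d / 2 -> forall j, nc (gn c' j z - gn c j y) < kap / 2.
    move=> h1 h2 j; apply: (hd (fun k => match k with inl k => c' k | inr k => z k end)).
    by rewrite /n1 big_sumType /= [X in _ < X]splitr; exact: ltrD h1 h2.
  move=> c' h1 z h2 j; apply: le_trans (nc_tri (gn c j y) _ _) _; rewrite [X in _ <= X]splitr; apply: lerD.
    by apply: ltW; exact: key.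
  by rewrite nc_distC; apply: ltW; apply: key => //; rewrite n1_subxx divr_gt0.
- move=> A B h1 h2; apply: near_imp (near_and h1 h2) _ => c' [k1 k2] z [h|h]; [exact: k1|exact: k2].
- exact: near_true.
- by move=> A B h h1; apply: near_imp h1 _ => c' k z /h; exact: k.
Qed.

Lemma n1_split (z : I4 -> C) : n1 z = n1 (vsub (p1 a z) a) + n1 (vsub (p2 b z) b).
Proof.
rewrite {1}/n1 big_split_ord /=; congr (_ + _); apply: eq_bigr => i _; rewrite /vsub /p1 /p2 addrC addKr //.
Qed.

Variable c : Om -> C.
Hypothesis ab : a <> b.
Variable r : R.
Hypothesis r0 : 0 < r.
Hypothesis rab : r <= n1 (vsub a b).
Hypothesis gz : forall j, gn c j o = 0.
Hypothesis gu : forall z, n1 z < r -> (forall j, gn c j z = 0) -> z = o.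
Variable G : I4 -> {mpoly C[2 + 2]}.
Hypothesis hG : forall j z, (G j).@[z] = gn c j z.
Local Notation r1 := (r / 2).

Lemma distinct z : n1 z < r -> p1 a z <> p2 b z.
Proof.
move=> hz e; have h : n1 (vsub a b) <= n1 (vsub (p1 a z) a) + n1 (vsub (p2 b z) b).
  by rewrite (n1_sub_sym (p1 a z) a) -e; exact: n1_tri.
by rewrite -n1_split in h; have := le_lt_trans (le_trans rab h) hz; rewrite ltxx.
Qed.

(** The first clause, on a spherical shell, is there because nodes are counted in a product of balls
    with independent radii: such a product lies between two balls of the sum norm, and no zeros lie
    between these. The remaining clauses come from [zero_count], since the zeros of a map that is
    not [bad] are nondegenerate. *)
Lemma perturbed_zeros (rho : R) : 0 < rho -> rho <= r1 -> near c (fun c' => ~ bad c' ->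
  (forall z, rho <= n1 z <= r1 -> ~ (forall j, gn c' j z = 0)) /\
  exists (s : nat) (e : 'I_s -> I4 -> C), [/\ injective e,
    forall z, (n1 z < rho /\ forall j, gn c' j z = 0) <-> exists k, z = e k,
    forall k t, indep (idord G k) t -> (t <= s)%N & forall k, stable G k -> indep (idord G k) s]).
Proof.
move=> rho0 rho1; have r10 : 0 < r1 by rewrite divr_gt0.
have r1r : r1 < r by lra.
have [|kap k0 hk] := @annulus_lower _ G rho r1 r10.
  move=> z /andP[h1 h2]; apply: contrapT => /forallNP hn.
  have z0 : z = o.
    apply: gu; first by apply: le_lt_trans h2 r1r.
    by move=> j; have := hn j => /negP; rewrite negbK hG => /eqP.
  by move: h1; rewrite z0 /n1 big1 ?leNgt ?rho0 // => i _; rewrite nc0.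
have k20 : 0 < kap / 2 by rewrite divr_gt0.
apply: near_imp (uniform_close c r10 k20) _ => c' hc' nb.
have [G' hG'] := gens_mpoly a b c'; split.
  move=> z hz h0; have [j hj] := hk z hz; move: hj; rewrite hG leNgt => /negP; apply.
  have := hc' z _ j; rewrite h0 sub0r ncN => h; apply: le_lt_trans (h _) _; first by case/andP: hz.
  by lra.
have [|||||s [e [h1 h2 h3 h4]]] := @zero_count R _ G _ isT G' rho kap rho0 k0.
- by move=> j; rewrite hG; exact: gz.
- by move=> z hz h; apply: gu => [|j]; [lra|rewrite -hG].
- by move=> z hz; apply: hk; rewrite hz lexx rho1.
- by move=> z hz j; rewrite hG hG'; apply: hc'; rewrite hz.
- move=> z hz h; have h' j : gn c' j z = 0 by rewrite -hG'.
  have zp : zero_pair c' (p1 a z) (p2 b z) by exact/gens_zero.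
  apply: (good_nondeg hG' h); apply: contrapT => ng; apply: nb.
  exists (p1 a z), (p2 b z); split=> //; first by apply: distinct; lra.
  by case.
exists s, e; split=> // z; rewrite -h2; split=> -[k1 k2]; split=> // j; by [rewrite hG'|rewrite -hG'].
Qed.

(** [Wm] and [Zm] pass between the coordinates in which [node_mult] is stated and centred
    coordinates indexed by an ordinal, as [mpoly] requires. *)
Definition Wm (Z : ('I_2 + 'I_2)%type -> C) : I4 -> C := fun k => Z (split k) - join2 a b (split k).
Definition Zm (z : I4 -> C) := join2 (p1 a z) (p2 b z).

Lemma ZmE z k : Zm z k = join2 a b k + z (unsplit k).
Proof. by case: k. Qed.
Lemma WmK Z : Zm (Wm Z) = Z.
Proof. by apply: funext => k; rewrite ZmE /Wm unsplitK subrKC. Qed.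
Lemma ZmK z : Wm (Zm z) = z.
Proof. by apply: funext => k; rewrite /Wm ZmE splitK addrC addKr. Qed.
Lemma Zm0 : Zm o = join2 a b.
Proof. by apply: funext => k; rewrite ZmE addr0. Qed.
Lemma Wm0 : Wm (join2 a b) = o.
Proof. by rewrite -Zm0 ZmK. Qed.

Lemma hnear_Wm k : hnear (fun Z => Wm Z k) (join2 a b).
Proof. by apply: hnear_sub; [exact: hnear_coord|exact: hnear_const]. Qed.
Lemma hnear_Zm k : hnear (fun z => Zm z k) o.
Proof.
apply: (@hnear_ext R _ (fun z => join2 a b k + z (unsplit k))); first by apply: near_true => z; rewrite ZmE.
by apply: hnear_add; [exact: hnear_const|exact: hnear_coord].
Qed.

Lemma hnear_to_W h : hnear h o -> hnear (fun Z => h (Wm Z)) (join2 a b).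
Proof. by move=> hh; apply: hnear_comp hnear_Wm _; rewrite Wm0. Qed.
Lemma hnear_to_Z h : hnear h (join2 a b) -> hnear (fun z => h (Zm z)) o.
Proof. by move=> hh; apply: hnear_comp hnear_Zm _; rewrite Zm0. Qed.
Lemma near_to_W Q : near o Q -> near (join2 a b) (fun Z => Q (Wm Z)).
Proof. by move=> hh; apply: near_comp (fun k => hnear_cts (hnear_Wm k)) _; rewrite Wm0. Qed.
Lemma near_to_Z Q : near (join2 a b) Q -> near o (fun z => Q (Zm z)).
Proof. by move=> hh; apply: near_comp (fun k => hnear_cts (hnear_Zm k)) _; rewrite Zm0. Qed.

Lemma mult_of_basis K s : stable G K -> indep (idord G K) s ->
  (forall t, indep (idord G K) t -> (t <= s)%N) -> node_mult c a b s.
Proof.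
move=> st ind mx; have [e [e1 e2]] := local_basis st ind mx.
exists (fun i Z => (e i).@[Wm Z]); split; last split.
- by move=> i; apply/holo_nearE; apply: (hnear_to_W (h := fun z => (e i).@[z])); exact: hnear_mpoly.
- move=> phi /holo_nearE hphi; have [x [u [hu nu]]] := e1 _ (hnear_to_Z hphi); exists x.
  exists (fun j Z => u j (Wm Z)); split=> [j|]; first by apply/holo_nearE; exact: hnear_to_W.
  apply/eq_nearE; apply: near_imp (near_to_W nu) _ => Z; rewrite WmK => ->; apply: eq_bigr => j _.
  by rewrite hG /gens -/(Zm (Wm Z)) WmK.
move=> x [u [hu /eq_nearE nu]]; apply: e2; exists (fun j z => u j (Zm z)); split=> [j|].
  by apply: hnear_to_Z; exact/holo_nearE.
apply: near_imp (near_to_Z nu) _ => z; rewrite ZmK => ->; apply: eq_bigr => j _.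
by rewrite hG.
Qed.
End Final.

Theorem theorem2p13 (R : realType) (d1 d2 : nat) :
  (0 < d1)%N -> (0 < d2)%N ->
  forall (c : Omega d1 d2 -> R[i]) (a b : 'I_2 -> R[i]),
    proper_map (Fmap c) ->
    gen_node c a b ->
    exists nu : nat, node_mult c a b nu /\
    exists W : (Omega d1 d2 -> R[i]) -> Prop,
      zariski_open W /\ zariski_dense W /\
      exists2 r0 : R, 0 < r0 &
        forall ra rb : R, 0 < ra -> ra < r0 -> 0 < rb -> rb < r0 ->
        exists2 delta : R, 0 < delta &
          forall c' : Omega d1 d2 -> R[i],
            W c' -> cnorm (vsub c' c) < delta ->
            card_pairs (fun p => cnorm (vsub p.1 a) < ra /\ cnorm (vsub p.2 b) < rb /\
                                 is_node (Fmap c') p.1 p.2) nu.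
Proof.
move=> hd1 hd2 c a b _ [Ja [Jb [/peqP eF [r r0 iso]]]].
(* If [a = b], the pairs [(x, x)] with [x] on the critical curve near [a] contradict isolation, as
   zeros of the Jacobian are not isolated. *)
have ab : a <> b.
  move=> eab; have [x xa [xr Jx]] := nonisolated (polyfun_Jac c) Ja r0.
  have xr' : cnorm (vsub x a) < r by apply: le_lt_trans (cnorm_le_n1 _) xr.
  have [|/peqP xa' _] := iso x x xr' _ Jx Jx (fun i => erefl _); first by rewrite -eab.
  exact: xa.
have nab : 0 < n1 (vsub a b).
  by rewrite lt_neqAle n1_ge0 andbT eq_sym; apply/eqP => /n1_eq0.
pose r' := Num.min r (n1 (vsub a b)).
have r'0 : 0 < r' by rewrite lt_min r0.
have [r'r r'ab] : r' <= r /\ r' <= n1 (vsub a b) by rewrite !ge_min !lexx ?orbT.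
clearbody r'.
have zb z : n1 (vsub (p1 a z) a) <= n1 z /\ n1 (vsub (p2 b z) b) <= n1 z.
  by rewrite (n1_split a b z) lerDl lerDr !n1_ge0.
have gz : forall j, gens a b c j (fun=> 0) = 0.
  apply/gens_zero; have -> : p1 a (fun=> 0) = a by apply: funext => i; rewrite /p1 addr0.
  by have -> : p2 b (fun=> 0) = b by apply: funext => i; rewrite /p2 addr0.
have gu z : n1 z < r' -> (forall j, gens a b c j z = 0) -> z = (fun=> 0).
  move=> hz /gens_zero[k1 k2 /peqP k3]; have [z1 z2] := zb z.
  have b1 : cnorm (vsub (p1 a z) a) < r.
    by apply: le_lt_trans (cnorm_le_n1 _) _; apply: le_lt_trans z1 _; apply: lt_le_trans hz r'r.
  have b2 : cnorm (vsub (p2 b z) b) < r.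
    by apply: le_lt_trans (cnorm_le_n1 _) _; apply: le_lt_trans z2 _; apply: lt_le_trans hz r'r.
  have [e1 e2] := iso _ _ b1 b2 k1 k2 k3.
  have sE (x y : R[i]) : x + y = x -> y = 0 by move=> h; apply: (addrI x); rewrite addr0.
  by apply: funext => k; case: (split_ordP k) => i ->; [exact: sE (e1 i)|exact: sE (e2 i)].
have [G hG] := gens_mpoly a b c.
have PZ := perturbed_zeros r'0 r'ab gz gu hG.
have r10 : 0 < r' / 2 by rewrite divr_gt0.
have [D D0 hD] := @bad_thin R d1 d2 hd1 hd2.
have nb c' : ev_fin D c' <> 0 -> ~ bad c' by move=> h /hD.
have [dl0 dl00 hdl] := PZ _ r10 (lexx _).
(* A single generic map near [c] serves to define the number [s]; it also bounds the independent
   families, from which a stable order [K] follows. *)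
have [c0 c01 /nb /(hdl c0 c01) [_ [s [_ [_ _ mx ind]]]]] := complement_near c D0 dl00.
have [K st] := stable_ex mx.
exists s; split; first exact: (mult_of_basis hG st (ind K st) (mx K)).
exists (fun c' => ev_fin D c' <> 0); split; first exact: complement_open.
split; first exact: complement_dense.
(* In each factor the sum norm is at most twice [cnorm], so pairs in the two balls have total sum
   norm below [r' / 2]. *)
exists (r' / 8); first by rewrite divr_gt0.
move=> ra rb ra0 rar rb0 rbr; pose rho := Num.min ra rb.
have rho0 : 0 < rho by rewrite lt_min ra0.
have [rhoa rhob] : rho <= ra /\ rho <= rb by rewrite !ge_min !lexx ?orbT.
clearbody rho; have rho1 : rho <= r' / 2 by lra.
have [dl dlp {}hdl] := PZ rho rho0 rho1.
have N0 : 0 < #|{: Omega d1 d2}|%:R + 1 :> R by rewrite ltr_wpDl ?ler0n.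
exists (dl / (#|{: Omega d1 d2}|%:R + 1)); first by rewrite divr_gt0.
move=> c' /nb nb' hc'.
have hc1 : n1 (vsub c' c) < dl.
  apply: le_lt_trans (n1_le_cnorm _) _; move: hc'; rewrite ltr_pdivlMr // mulrC => hc'.
  by apply: le_lt_trans hc'; rewrite ler_wpM2r ?sqrtr_ge0 // lerDl.
have [noz [s' [e [inj he mx' ind']]]] := hdl c' hc1 nb'.
(* Both numbers are the largest size of a family independent modulo the ideal of [G] truncated at
   [K]. *)
have ss : s = s' by apply/eqP; rewrite eqn_leq (mx' K s (ind K st)) (mx K s' (ind' K st)).
subst s'; exists (fun k => (p1 a (e k), p2 b (e k))); split=> [i j /= /peqP h1 /peqP h2|[x y] /=].
  apply: inj; apply: funext => k; case: (split_ordP k) => t ->.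
    exact: addrI (congr1 (fun u => u t) h1).
  exact: addrI (congr1 (fun u => u t) h2).
split=> [[hx [hy nd]]|[k [/= /peqP <- /peqP <-]]]; last first.
  have [h1 /gens_zero zp] := (he (e k)).2 (ex_intro _ k erefl); have [z1 z2] := zb (e k).
  have pq : p1 a (e k) <> p2 b (e k) by apply: (distinct r'ab); lra.
  split; first by apply: le_lt_trans (cnorm_le_n1 _) _; apply: le_lt_trans z1 _; exact: lt_le_trans h1 rhoa.
  split; first by apply: le_lt_trans (cnorm_le_n1 _) _; apply: le_lt_trans z2 _; exact: lt_le_trans h1 rhob.
  apply: good_node => //; apply: contrapT => ng; apply: nb'.
  by exists (p1 a (e k)), (p2 b (e k)).
pose z := Wm a b (join2 x y).
have [zx zy] : p1 a z = x /\ p2 b z = y.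
  have h := WmK a b (join2 x y).
  by split; apply: funext => i; [exact: (congr1 (fun u => u (inl i)) h)|exact: (congr1 (fun u => u (inr i)) h)].
have z0 : forall j, gens a b c' j z = 0 by apply/gens_zero; rewrite zx zy; exact: node_zero.
have nz : n1 z <= r' / 2.
  have l1 := n1_le_cnorm (vsub x a); have l2 := n1_le_cnorm (vsub y b); rewrite card_ord in l1 l2.
  by rewrite (n1_split a b z) zx zy; lra.
have [|k hk] := (he z).1 _; last by exists k; rewrite /= -hk zx zy.
(* The node lies within [r' / 2], and the shell from [rho] to [r' / 2] contains no zeros, so it lies
   in the ball of radius [rho]. *)
by split=> //; rewrite ltNge; apply/negP => h; apply: (noz z) => //; rewrite h nz.
Qed.
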